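(* Let $1\leq q_1,q_2\leq \infty$ and $0<r<\infty$ with $\frac{1}r =\frac 1 {q_1}+\frac 1 {q_2}$. Suppose that $a\in S^{m}_{\varrho,\delta}(n,2)$ with $0<\varrho\leq 1$, $0\le\delta\leq \varrho$, $\delta<1$, and \[ m<n(\varrho-1)\left[\max\left(\frac{1}{2},\,\frac{1}{q_1},\, \frac{1}{q_2},\, 1-\frac{1}{r}\right)+\frac{1}{2}\max\left(\frac{1}{r}-1,0\right)\right]. \] Then the bilinear pseudodifferential operator $T_{a} (f,g)(x)= \iint a(x,\xi,\eta)\, e^{ i \langle x,\xi+\eta\rangle} \widehat{ f}(\xi) \widehat{g}(\eta)\,d \xi\, d\eta$ satisfies $\|T_a(f,g)\|_{L^r}\lesssim \|f\|_{L^{q_1}}\|g\|_{L^{q_2}}$ for $f,g\in\mathcal{S}$.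
   Context: $S^m_{\varrho,\delta}(n,2)$ (for $\varrho,\delta\in[0,1]$): functions $a\in C^\infty(\mathbb{R}^n\times\mathbb{R}^{2n})$ with $|\partial_x^\beta\partial_{\xi}^{\alpha_1}\partial_{\eta}^{\alpha_2}a(x,\xi,\eta)|\le C_{\alpha_1,\alpha_2,\beta}(1+|\xi|+|\eta|)^{m-\varrho(|\alpha_1|+|\alpha_2|)+\delta|\beta|}$ for all multi-indices. *)

(* Defs.v *)
From mathcomp Require Import all_boot all_order all_algebra.
From mathcomp Require Import all_classical all_reals all_analysis.
Import Order.TTheory GRing.Theory Num.Theory.
Import numFieldNormedType.Exports.

Set Implicit Arguments.
Unset Strict Implicit.
Unset Printing Implicit Defensive.

Local Open Scope ring_scope.

Section Defs.
Variable R : realType.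

Notation vec n := 'rV[R]_n.

Definition cplx := (R * R)%type.
Definition cmul (z w : cplx) : cplx := (z.1 * w.1 - z.2 * w.2, z.1 * w.2 + z.2 * w.1).
Definition cabs (z : cplx) : R := Num.sqrt (z.1 ^+ 2 + z.2 ^+ 2).
Definition cexpi (t : R) : cplx := (cos t, sin t).

Definition dot n (x y : vec n) : R := \sum_(i < n) x 0 i * y 0 i.
Definition enorm n (x : vec n) : R := Num.sqrt (dot x x).

Definition pd1 n (F : vec n -> R) (i : 'I_n) : vec n -> R :=
  fun x => derive (fun t : R => F (x + t *: delta_mx 0 i)) 0 1.
Definition pd1able n (F : vec n -> R) (i : 'I_n) (x : vec n) : Prop :=
  derivable (fun t : R => F (x + t *: delta_mx 0 i)) 0 1.
(* Iterated partial derivative: a finite sequence of coordinate directions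
   (order of differentiation irrelevant for smooth functions). *)
Definition Dseq1 n (ds : seq 'I_n) (F : vec n -> R) : vec n -> R :=
  foldr (fun i G => pd1 G i) F ds.
Definition smooth1 n (F : vec n -> R) : Prop :=
  forall ds : seq 'I_n,
    continuous (Dseq1 ds F) /\ forall i x, pd1able (Dseq1 ds F) i x.

(* Functions of three vector variables (x, xi, eta) in R^n x R^n x R^n.
   A direction is a pair (k, i): k = 0 for x, 1 for xi, 2 for eta. *)
Definition shift3 n (k : 'I_3) (i : 'I_n) (t : R) (x y z : vec n)
  : vec n * vec n * vec n :=
  if val k == 0%N then (x + t *: delta_mx 0 i, y, z)
  else if val k == 1%N then (x, y + t *: delta_mx 0 i, z)
  else (x, y, z + t *: delta_mx 0 i).
Definition uncurry3 n (F : vec n -> vec n -> vec n -> R) (p : vec n * vec n * vec n) :=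
  F p.1.1 p.1.2 p.2.
Definition pd3 n (F : vec n -> vec n -> vec n -> R) (d : 'I_3 * 'I_n)
  : vec n -> vec n -> vec n -> R :=
  fun x y z => derive (fun t : R => uncurry3 F (shift3 d.1 d.2 t x y z)) 0 1.
Definition pd3able n (F : vec n -> vec n -> vec n -> R) (d : 'I_3 * 'I_n) x y z : Prop :=
  derivable (fun t : R => uncurry3 F (shift3 d.1 d.2 t x y z)) 0 1.
Definition Dseq3 n (ds : seq ('I_3 * 'I_n)) (F : vec n -> vec n -> vec n -> R) :=
  foldr (fun d G => pd3 G d) F ds.
Definition smooth3 n (F : vec n -> vec n -> vec n -> R) : Prop :=
  forall ds : seq ('I_3 * 'I_n),
    continuous (uncurry3 (Dseq3 ds F)) /\ forall d x y z, pd3able (Dseq3 ds F) d x y z.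
Definition ord_in n (k : nat) (ds : seq ('I_3 * 'I_n)) : R :=
  (count (fun d => val d.1 == k) ds)%:R.

Definition symbol_class n (m rho delta : R) (a : vec n -> vec n -> vec n -> cplx) : Prop :=
  smooth3 (fun x y z => (a x y z).1) /\ smooth3 (fun x y z => (a x y z).2) /\
  forall ds : seq ('I_3 * 'I_n), exists C : R, forall x xi eta : vec n,
    cabs (Dseq3 ds (fun x y z => (a x y z).1) x xi eta,
          Dseq3 ds (fun x y z => (a x y z).2) x xi eta)
    <= C * powR (1 + enorm xi + enorm eta)
              (m - rho * (ord_in 1 ds + ord_in 2 ds) + delta * ord_in 0 ds).

Definition schwartz n (f : vec n -> cplx) : Prop :=
  smooth1 (fun x => (f x).1) /\ smooth1 (fun x => (f x).2) /\
  forall (ds : seq 'I_n) (N : nat), exists C : R, forall x : vec n,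
    (1 + enorm x) ^+ N *
      cabs (Dseq1 ds (fun y => (f y).1) x, Dseq1 ds (fun y => (f y).2) x) <= C.

Fixpoint RintRn (n : nat) : (vec n -> R) -> R :=
  match n return (vec n -> R) -> R with
  | 0%N => fun F => F 0
  | n'.+1 => fun F =>
      Rintegral (@lebesgue_measure R) setT
        (fun t : R => RintRn (fun v : vec n' => F (row_mx (const_mx t : 'rV[R]_1) v)))
  end.
Definition CintRn n (F : vec n -> cplx) : cplx :=
  (RintRn (fun v => (F v).1), RintRn (fun v => (F v).2)).

Fixpoint EintRn (n : nat) : (vec n -> \bar R) -> \bar R :=
  match n return (vec n -> \bar R) -> \bar R with
  | 0%N => fun F => F 0
  | n'.+1 => fun F =>
      (\int[@lebesgue_measure R]_(t in setT)
         EintRn (fun v : vec n' => F (row_mx (const_mx t : 'rV[R]_1) v)))%E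
  end.

Definition Lpnorm n (p : \bar R) (f : vec n -> cplx) : \bar R :=
  match p with
  | +oo%E => ereal_sup [set (cabs (f x))%:E | x in [set: vec n]]
  | (p'%:E)%E => poweR (EintRn (fun x => (powR (cabs (f x)) p')%:E)) (p'^-1)
  | -oo%E => 0%E
  end.

Definition inv_exp (q : \bar R) : R :=
  match q with
  | (q'%:E)%E => q'^-1
  | _ => 0
  end.

Definition fourier n (f : vec n -> cplx) (xi : vec n) : cplx :=
  CintRn (fun y => cmul (f y) (cexpi (- dot y xi))).

Definition Tbil n (a : vec n -> vec n -> vec n -> cplx) (f g : vec n -> cplx)
  (x : vec n) : cplx :=
  CintRn (fun xi => CintRn (fun eta =>
    cmul (cmul (a x xi eta) (cexpi (dot x (xi + eta))))
         (cmul (fourier f xi) (fourier g eta)))).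

End Defs.

(* Main.v *)
(* Decompose the symbol smoothly into pieces on which 1 + |xi| + |eta| is comparable with 2 ^ j. The dilation x -> 2 ^ (j rho) x
   turns the j-th piece into a symbol all of whose derivatives are bounded by 2 ^ (j m), concentrated on frequencies of size
   mu = 2 ^ (j (1 - rho)). For such a symbol, integration by parts localizes the operator to unit balls in x, where a T T^* argument
   bounds it from L^2 x L^2 to L^2, Bernstein-type inequalities on the inputs and on the output pass from L^2 to the exponents at
   hand, and Hoelder's inequality sums the unit balls. The constants of the pieces decay geometrically exactly because m is below
   the critical value. *)
From HB Require Import structures.
Require Import Defs.
From mathcomp Require Import all_boot all_order all_algebra.
From mathcomp Require Import all_classical all_reals all_analysis.
From mathcomp Require Import measurable_realfun.
From mathcomp Require Import ring lra zify.
Import Order.TTheory GRing.Theory Num.Theory.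
Import numFieldNormedType.Exports.

Set Implicit Arguments.
Unset Strict Implicit.
Unset Printing Implicit Defensive.

(** Everything is done with real integrals: complex exponentials become cosines with a phase, and
    the operator splits into eight real ones. Decay always comes from integration by parts. Cosines
    have a price: a product of two of them gives one term in the difference and one in the sum of
    the arguments, so kernels come with a sign [e] such that [e ^+ 2 = 1]. The cut-offs are
    rational. In frequency they are differences of rational functions of [1 + |xi|^2 + |eta|^2]; in
    space, localization near [c] is multiplication by a power of [wt (x - c)]. All bounds are proved
    for families indexed by the piece [j] and the centre [c], so that the constants are uniform in
    both, and the sum over unit balls becomes an integral over [c]. The output is localized by
    [wt (x - c) ^+ 5]: four powers and [4 * n] derivatives pay for moving the localization onto the
    two inputs, one power and [2 * n] further derivatives for the estimate in [L^2]. Hence the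
    [6 * n] derivatives required of each piece. *)

(** * Sigma-finite product measures *)

Section ProductMeasure.
Local Open Scope classical_set_scope.
Local Open Scope ring_scope.
Local Open Scope ereal_scope.
Context d1 d2 (T1 : measurableType d1) (T2 : measurableType d2) (R : realType).
Variables (m1 : {sigma_finite_measure set T1 -> \bar R}) (m2 : {sigma_finite_measure set T2 -> \bar R}).

(* Product measure under a new name: canonical inference on [m1 \x m2] only finds its sigma-finiteness for subprobabilities. *)
Definition prodm : set (T1 * T2)%type -> \bar R := m1 \x m2.

HB.instance Definition _ := Measure.on prodm.

Lemma prodm_sigma_finite : sigma_finite setT prodm.
Proof.
by case: (lebesgue_integral_fubini.measure_function_Measure_isSigmaFinite__to__measure_function_isSigmaFinite m1 m2).
Qed.

HB.instance Definition _ := Measure_isSigmaFinite.Build _ _ _ prodm prodm_sigma_finite.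
End ProductMeasure.

(** * Measures with an integrable weight: measurability, domination and Fubini *)

Section WeightedSpaces.
Local Open Scope classical_set_scope.
Local Open Scope ring_scope.
Variable R : realType.

(* A measure on [V] carried by a measurable type [ws_T] through the map [ws_phi], with an integrable weight [ws_w].
   [ws_grid] makes continuous functions on [V] measurable although [V] itself has no sigma-algebra. *)
Record wspace (V : topologicalType) := WSpace {
  ws_d : measure_display;
  ws_T : measurableType ws_d;
  ws_mu : {sigma_finite_measure set ws_T -> \bar R};
  ws_phi : ws_T -> V;
  ws_w : V -> R;
  ws_w_gt0 : forall v, 0 < ws_w v;
  ws_w_cont : continuous ws_w;
  ws_w_int : (\int[ws_mu]_t (ws_w (ws_phi t))%:E < +oo)%E;
  ws_grid : exists ph : nat -> ws_T -> V,
    (forall k, exists idx : ws_T -> nat, exists p : nat -> V,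
       (forall i, measurable (idx @^-1` [set i])) /\ (forall t, ph k t = p (idx t))) /\
    (forall t, ph k t @[k --> \oo] --> ws_phi t) }.

Definition meas V (X : wspace V) (F : V -> R) := measurable_fun setT (F \o @ws_phi _ X).
(** Domination by a fixed integrable weight is used in place of integrability because it holds at
    every point: it passes to slices, products and sums with no exceptional null sets, so the
    hypotheses of Fubini are checked pointwise. *)
Definition tame V (X : wspace V) (F : V -> R) :=
  meas X F /\ exists C, forall v, `|F v| <= C * ws_w X v.
Definition Int V (X : wspace V) (F : V -> R) : R :=
  (\int[@ws_mu _ X]_t (F (ws_phi t)))%R.
Definition Eint V (X : wspace V) (F : V -> \bar R) : \bar R :=
  (\int[@ws_mu _ X]_t (F (ws_phi t)))%E.

(** [F] along [ws_phi] is the pointwise limit of [F] along the grid maps, and each grid map takes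
    countably many values, on measurable sets. *)
Lemma cont_meas V (X : wspace V) F : continuous F -> meas X F.
Proof.
move=> cF; have [ph [h1 h2]] := ws_grid X.
apply: (@measurable_fun_cvg _ _ _ setT (fun k t => F (ph k t))) => [k|t _].
  have [idx [p [hi hp]]] := h1 k.
  rewrite (_ : (fun t => F (ph k t)) = (F \o p) \o idx); last first.
    by apply/funext => t /=; rewrite hp.
  apply: measurableT_comp => // _ A _; rewrite setTI.
  rewrite (_ : _ @^-1` A = \bigcup_(i in A) idx @^-1` [set i]); last first.
    by apply/seteqP; split => x /=; [exists (idx x)|move=> [i Ai ->]].
  by apply: bigcup_measurable.
by apply: cvg_comp; [exact: h2|exact: cF].
Qed.

Lemma measC V (X : wspace V) (c : R) : meas X (fun=> c).
Proof. exact: measurable_cst. Qed.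
Lemma measD V (X : wspace V) F G : meas X F -> meas X G -> meas X (fun v => F v + G v).
Proof. by move=> f g; apply: measurable_funD. Qed.
Lemma measB V (X : wspace V) F G : meas X F -> meas X G -> meas X (fun v => F v - G v).
Proof. by move=> f g; apply: measurable_funB. Qed.
Lemma measM V (X : wspace V) F G : meas X F -> meas X G -> meas X (fun v => F v * G v).
Proof. by move=> f g; apply: measurable_funM. Qed.
Lemma meas_norm V (X : wspace V) F : meas X F -> meas X (fun v => `|F v|).
Proof. by move=> f; apply: (measurableT_comp (@normr_measurable _ _) f). Qed.
Lemma meas_powR V (X : wspace V) F (p : R) : meas X F -> meas X (fun v => powR (F v) p).
Proof. by move=> f; apply: (measurableT_comp (measurable_powR p) f). Qed.
Lemma measX V (X : wspace V) F k : meas X F -> meas X (fun v => F v ^+ k).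
Proof. by move=> f; apply: (measurable_funX k f). Qed.
Lemma measE V (X : wspace V) F : meas X F -> measurable_fun setT (fun t => (F (@ws_phi _ X t))%:E).
Proof. by move=> mF; apply/measurable_EFinP. Qed.

Lemma ws_w_ge0 V (X : wspace V) v : 0 <= ws_w X v.
Proof. exact: ltW (ws_w_gt0 X v). Qed.
Hint Resolve ws_w_ge0 : core.

Lemma tame_integrable V (X : wspace V) F : tame X F ->
  (@ws_mu _ X).-integrable setT (fun t => (F (ws_phi t))%:E).
Proof.
move=> [mF [C hC]]; apply: (@le_integrable _ _ _ _ _ measurableT _
   (fun t => (C * ws_w X (ws_phi t))%:E)).
- exact: measE.
- by move=> t _; rewrite /= lee_fin (le_trans (hC _))// ler_norm.
- apply: (@integrableZl _ _ _ _ _ measurableT C (fun t => (ws_w X (ws_phi t))%:E)).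
  apply/integrableP; split; first exact/measE/cont_meas/ws_w_cont.
  by under eq_integral do rewrite gee0_abs ?lee_fin//; exact: ws_w_int.
Qed.

Lemma tame_w V (X : wspace V) : tame X (ws_w X).
Proof.
by split; [exact/cont_meas/ws_w_cont|exists 1 => v; rewrite mul1r ger0_norm].
Qed.

Lemma tame_le V (X : wspace V) F G C : meas X F -> tame X G -> (forall v, `|F v| <= C * G v) -> tame X F.
Proof.
move=> mF [_ [D hD]] h; split=> //; exists (`|C| * D) => v.
rewrite (le_trans (h v))// (le_trans (ler_norm _))// normrM -mulrA ler_wpM2l//.
Qed.

Lemma tame0 V (X : wspace V) : tame X (fun=> 0).
Proof. by split; [exact: measC|exists 0 => v; rewrite normr0 mul0r]. Qed.
Lemma tameD V (X : wspace V) F G : tame X F -> tame X G -> tame X (fun v => F v + G v).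
Proof.
move=> [mF [C hC]] [mG [D hD]]; split; first exact: measD.
by exists (C + D) => v; rewrite (le_trans (ler_normD _ _))// mulrDl lerD.
Qed.
Lemma tameN V (X : wspace V) F : tame X F -> tame X (fun v => - F v).
Proof.
move=> [mF [C hC]]; split; last by exists C => v; rewrite normrN.
exact: measurableT_comp mF.
Qed.
Lemma tameB V (X : wspace V) F G : tame X F -> tame X G -> tame X (fun v => F v - G v).
Proof. by move=> hF hG; apply: tameD hF (tameN hG). Qed.
Lemma tameMb V (X : wspace V) F G C : meas X F -> (forall v, `|F v| <= C) -> tame X G ->
  tame X (fun v => F v * G v).
Proof.
move=> mF hF [mG [D hD]]; split; first exact: measM.
exists (`|C| * D) => v; rewrite normrM -mulrA ler_pM//.
by rewrite (le_trans (hF v)) ?ler_norm.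
Qed.
Lemma tameZ V (X : wspace V) c G : tame X G -> tame X (fun v => c * G v).
Proof. by apply: tameMb; [exact: measC|move=> _; exact: lexx]. Qed.
Lemma tame_norm V (X : wspace V) F : tame X F -> tame X (fun v => `|F v|).
Proof.
by move=> [mF [C hC]]; split; [exact: meas_norm|exists C => v; rewrite normr_id].
Qed.
Lemma tame_sum V (X : wspace V) (I : Type) (s : seq I) (F : I -> V -> R) :
  (forall i, tame X (F i)) -> tame X (fun v => \sum_(i <- s) F i v).
Proof.
move=> h; elim: s => [|i s IH].
  by under eq_fun do rewrite big_nil; exact: tame0.
by under eq_fun do rewrite big_cons; exact: tameD.
Qed.

Lemma IntD V (X : wspace V) F G : tame X F -> tame X G ->
  Int X (fun v => F v + G v) = Int X F + Int X G.
Proof. by move=> hF hG; rewrite /Int RintegralD//; exact: tame_integrable. Qed.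
Lemma IntB V (X : wspace V) F G : tame X F -> tame X G ->
  Int X (fun v => F v - G v) = Int X F - Int X G.
Proof. by move=> hF hG; rewrite /Int RintegralB//; exact: tame_integrable. Qed.
Lemma IntZ V (X : wspace V) c F : tame X F -> Int X (fun v => c * F v) = c * Int X F.
Proof. by move=> hF; rewrite /Int RintegralZl//; exact: tame_integrable. Qed.
Lemma IntZr V (X : wspace V) c F : tame X F -> Int X (fun v => F v * c) = Int X F * c.
Proof. by move=> hF; under eq_fun do rewrite mulrC; rewrite IntZ// mulrC. Qed.
Lemma Int_ge0 V (X : wspace V) F : (forall v, 0 <= F v) -> 0 <= Int X F.
Proof. by move=> h; apply: Rintegral_ge0 => t _; exact: h. Qed.
Lemma le_Int V (X : wspace V) F G : tame X F -> tame X G -> (forall v, F v <= G v) ->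
  Int X F <= Int X G.
Proof.
by move=> hF hG h; apply: le_Rintegral => //; exact: tame_integrable.
Qed.
Lemma norm_Int V (X : wspace V) F G : meas X F -> tame X G -> (forall v, `|F v| <= G v) ->
  `|Int X F| <= Int X G.
Proof.
move=> mF hG h; have hF : tame X F.
  by apply: (tame_le mF hG (C := 1)) => v; rewrite mul1r.
apply: (le_trans (le_normr_Rintegral measurableT (tame_integrable hF))).
by apply: (@le_Int _ X (fun v => `|F v|)) => //; exact: tame_norm.
Qed.
Lemma Int_sum V (X : wspace V) (I : Type) (s : seq I) (F : I -> V -> R) : (forall i, tame X (F i)) ->
  Int X (fun v => \sum_(i <- s) F i v) = \sum_(i <- s) Int X (F i).
Proof.
move=> h; elim: s => [|i s IH].
  by under eq_fun do rewrite big_nil; rewrite big_nil /Int Rintegral_cst// mul0r.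
by under eq_fun do rewrite big_cons; rewrite big_cons IntD// ?IH//; exact: tame_sum.
Qed.
Lemma EintE V (X : wspace V) F : tame X F -> Eint X (fun v => (F v)%:E) = (Int X F)%:E.
Proof.
move=> hF; rewrite /Int /Rintegral /Eint fineK//.
exact: integrable_fin_num (tame_integrable hF).
Qed.
Lemma Int_Eint V (X : wspace V) F : Int X F = fine (Eint X (fun v => (F v)%:E)).
Proof. by []. Qed.
Lemma Int0 V (X : wspace V) : Int X (fun=> 0) = 0.
Proof. by rewrite /Int Rintegral_cst// mul0r. Qed.
Lemma IntN V (X : wspace V) F : tame X F -> Int X (fun v => - F v) = - Int X F.
Proof.
by move=> h; under eq_fun do rewrite -mulN1r; rewrite IntZ// mulN1r.
Qed.

Section Product.
Variables (V1 V2 : topologicalType) (X : wspace V1) (Y : wspace V2).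

Lemma prodw_int : (\int[(@ws_mu _ X \x @ws_mu _ Y)%E]_t
   (ws_w X (@ws_phi _ X t.1) * ws_w Y (@ws_phi _ Y t.2))%:E < +oo)%E.
Proof.
have mX := measE (cont_meas (@ws_w_cont _ X)); have mY := measE (cont_meas (@ws_w_cont _ Y)).
have iX := tame_integrable (tame_w X); have iY := tame_integrable (tame_w Y).
rewrite fubini_tonelli1; last by move=> t; rewrite lee_fin mulr_ge0.
- rewrite /fubini_F.
  under eq_integral => x _.
    under eq_integral do rewrite /= EFinM.
    rewrite ge0_integralZl_EFin//; last by move=> y _; rewrite lee_fin.
    rewrite -(fineK (integrable_fin_num measurableT iY)) muleC.
    over.
  rewrite ge0_integralZl_EFin//; last 2 first.
  + by move=> y _; rewrite lee_fin.
  + by apply: fine_ge0; apply: integral_ge0 => y _; rewrite lee_fin.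
  rewrite -(fineK (integrable_fin_num measurableT iX)) -EFinM; exact: ltry.
- apply/measurable_EFinP; apply: measurable_funM.
  + exact: (measurableT_comp (cont_meas (@ws_w_cont _ X)) measurable_fst).
  + exact: (measurableT_comp (cont_meas (@ws_w_cont _ Y)) measurable_snd).
Qed.

Lemma prodw_grid : exists ph : nat -> ws_T X * ws_T Y -> V1 * V2,
    (forall k, exists idx : ws_T X * ws_T Y -> nat, exists p : nat -> V1 * V2,
       (forall i, measurable (idx @^-1` [set i])) /\ (forall t, ph k t = p (idx t))) /\
    (forall t, ph k t @[k --> \oo] --> (@ws_phi _ X t.1, @ws_phi _ Y t.2)).
Proof.
have [ph1 [h1 c1]] := ws_grid X; have [ph2 [h2 c2]] := ws_grid Y.
exists (fun k t => (ph1 k t.1, ph2 k t.2)); split => [k|t]; last first.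
  by apply: (cvg_pair (c1 t.1) (c2 t.2)).
have [i1 [p1 [m1 e1]]] := h1 k; have [i2 [p2 [m2 e2]]] := h2 k.
exists (fun t => pickle (i1 t.1, i2 t.2)).
(* Every index that occurs is the code of a pair; at other numbers a default is given, which is
   never reached. *)
exists (fun i => if (unpickle i : option (nat * nat)) is Some ij then (p1 ij.1, p2 ij.2)
   else (ph1 k point, ph2 k point)); split => [i|t]; last first.
  by rewrite pickleK e1 e2.
case e : (unpickle i : option (nat * nat)) => [ij|].
  case: (eqVneq (pickle ij) i) => [ei|nei].
    rewrite (_ : _ @^-1` _ = (i1 @^-1` [set ij.1]) `*` (i2 @^-1` [set ij.2])).
      exact: measurableX.
    apply/seteqP; split => t /=.
      by rewrite -ei => /(pcan_inj pickleK) <-.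
    by move=> [-> ->]; rewrite -ei; case: (ij).
  rewrite (_ : _ @^-1` _ = set0)//; apply/seteqP; split => // t /= et.
  by move: e; rewrite -et pickleK => -[ee]; case/eqP: nei; rewrite -ee.
rewrite (_ : _ @^-1` _ = set0)//; apply/seteqP; split => // t /= et.
by move: e; rewrite -et pickleK.
Qed.

Lemma prodw_cont : continuous (fun v : V1 * V2 => ws_w X v.1 * ws_w Y v.2).
Proof.
move=> v; apply: cvgM.
  by apply: continuous_comp; [exact: cvg_fst|exact: ws_w_cont].
by apply: continuous_comp; [exact: cvg_snd|exact: ws_w_cont].
Qed.

Definition prodw : wspace (V1 * V2)%type := @WSpace (V1 * V2)%type _ _
  (prodm (@ws_mu _ X) (@ws_mu _ Y))
  (fun t => (@ws_phi _ X t.1, @ws_phi _ Y t.2))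
  (fun v => ws_w X v.1 * ws_w Y v.2) (fun v => mulr_gt0 (ws_w_gt0 X v.1) (ws_w_gt0 Y v.2))
  prodw_cont prodw_int prodw_grid.

Lemma meas_fst F : meas X F -> meas prodw (fun v => F v.1).
Proof. by move=> mF; apply: (measurableT_comp mF measurable_fst). Qed.
Lemma meas_snd F : meas Y F -> meas prodw (fun v => F v.2).
Proof. by move=> mF; apply: (measurableT_comp mF measurable_snd). Qed.
Lemma meas_slice1 F : meas prodw F -> forall t, meas Y (fun y => F (@ws_phi _ X t, y)).
Proof. by move=> mF t; apply: (measurable_fun_pair2 t mF). Qed.
Lemma meas_slice2 F : meas prodw F -> forall t, meas X (fun x => F (x, @ws_phi _ Y t)).
Proof. by move=> mF t; apply: (measurable_fun_pair1 t mF). Qed.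

(** Tonelli gives measurability of the inner integral for nonnegative functions, so the positive and
    the negative part are treated separately. *)
Lemma emeas_Int1 (F : V1 * V2 -> R) : meas prodw F -> measurable_fun setT
  (fun t => Eint Y (fun y => (F (@ws_phi _ X t, y))%:E)).
Proof.
move=> mF; rewrite /Eint; pose f z := (F (@ws_phi _ X z.1, @ws_phi _ Y z.2))%:E.
have mf : measurable_fun setT f by exact: (measE mF).
have -> : (fun t => \int[@ws_mu _ Y]_y (F (@ws_phi _ X t, @ws_phi _ Y y))%:E)%E = (fun t =>
  (fubini_F (@ws_mu _ Y) (f^\+)%E t - fubini_F (@ws_mu _ Y) (f^\-)%E t)%E).
  apply/funext => t; rewrite [LHS]integralE /fubini_F.
  by congr (_ - _)%E; apply: eq_integral => y _; rewrite ?(funeposE, funenegE).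
apply: emeasurable_funB.
  by apply: measurable_fun_fubini_tonelli_F; [exact: measurable_funepos|move=> x; exact: funepos_ge0].
by apply: measurable_fun_fubini_tonelli_F; [exact: measurable_funeneg|move=> x; exact: funeneg_ge0].
Qed.

Lemma meas_Int1 (F : V1 * V2 -> R) : meas prodw F -> meas X (fun x => Int Y (fun y => F (x, y))).
Proof. by move=> mF; apply: measurableT_comp (emeas_Int1 mF); exact: fine_measurable. Qed.

Lemma tame_slice1 F : tame prodw F -> forall t, tame Y (fun y => F (@ws_phi _ X t, y)).
Proof.
move=> [mF [C hC]] t; split; first exact: meas_slice1.
by exists (C * ws_w X (ws_phi t)) => v; rewrite -mulrA; exact: hC.
Qed.
Lemma tame_slice2 F : tame prodw F -> forall t, tame X (fun x => F (x, @ws_phi _ Y t)).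
Proof.
move=> [mF [C hC]] t; split; first exact: meas_slice2.
exists (C * ws_w Y (ws_phi t)) => v; rewrite -mulrA [ws_w Y _ * _]mulrC; exact: hC.
Qed.
Lemma tame_prod F G : tame X F -> tame Y G -> tame prodw (fun v => F v.1 * G v.2).
Proof.
move=> [mF [C hC]] [mG [D hD]]; split.
  by apply: measM; [exact: meas_fst|exact: meas_snd].
exists (C * D) => v; rewrite normrM/= mulrACA; apply: ler_pM => //.
Qed.
Lemma Int_prod12 F : tame prodw F -> Int prodw F = Int X (fun x => Int Y (fun y => F (x, y))).
Proof.
move=> hF; rewrite {1}/Int /Rintegral -(integral12_prod_meas1 (tame_integrable hF)).
rewrite /Int; congr fine; apply: eq_integral => t _.
by rewrite /fubini_F/= [RHS]fineK//; exact: integrable_fin_num (tame_integrable (tame_slice1 hF t)).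
Qed.
Lemma Int_prod21 F : tame prodw F -> Int prodw F = Int Y (fun y => Int X (fun x => F (x, y))).
Proof.
move=> hF; rewrite {1}/Int /Rintegral -(integral21_prod_meas1 (tame_integrable hF)).
rewrite /Int; congr fine; apply: eq_integral => t _.
by rewrite /fubini_G/= [RHS]fineK//; exact: integrable_fin_num (tame_integrable (tame_slice2 hF t)).
Qed.
Lemma Int_swap (F : V1 -> V2 -> R) : tame prodw (fun v => F v.1 v.2) ->
  Int X (fun x => Int Y (F x)) = Int Y (fun y => Int X (F^~ y)).
Proof. by move=> h; move: (Int_prod12 h); rewrite (Int_prod21 h) => <-. Qed.

Lemma Eint_swap (F : V1 -> V2 -> R) : meas prodw (fun v => F v.1 v.2) -> (forall x y, 0 <= F x y) ->
  Eint X (fun x => Eint Y (fun y => (F x y)%:E)) = Eint Y (fun y => Eint X (fun x => (F x y)%:E)).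
Proof.
move=> mF F0; rewrite /Eint.
apply: (@fubini_tonelli _ _ _ _ _ _ _
  (fun z => (F (@ws_phi _ X z.1) (@ws_phi _ Y z.2))%:E) (measE mF)).
by move=> z; rewrite lee_fin.
Qed.
End Product.

Lemma meas_swap (V1 V2 : topologicalType) (X : wspace V1) (Y : wspace V2) (F : V1 * V2 -> R) :
  meas (prodw X Y) F -> meas (prodw Y X) (fun v => F (v.2, v.1)).
Proof. by move=> mF; apply: (measurableT_comp mF (@measurable_swap _ _ _ _)). Qed.

Lemma meas_Int2 (V1 V2 : topologicalType) (X : wspace V1) (Y : wspace V2) (F : V1 * V2 -> R) :
  meas (prodw X Y) F -> meas Y (fun y => Int X (fun x => F (x, y))).
Proof. by move=> /meas_swap; exact: meas_Int1. Qed.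

Section Image.
Variables (V1 V2 : topologicalType) (X : wspace V1) (h : V1 -> V2) (w : V2 -> R).
Hypotheses (hc : continuous h) (wc : continuous w) (w0 : forall v, 0 < w v)
  (wE : forall v, w (h v) = ws_w X v).

Lemma imw_int : (\int[@ws_mu _ X]_t (w (h (ws_phi t)))%:E < +oo)%E.
Proof. by under eq_integral do rewrite wE; exact: ws_w_int. Qed.

Lemma imw_grid : exists ph : nat -> ws_T X -> V2,
    (forall k, exists idx : ws_T X -> nat, exists p : nat -> V2,
       (forall i, measurable (idx @^-1` [set i])) /\ (forall t, ph k t = p (idx t))) /\
    (forall t, ph k t @[k --> \oo] --> h (ws_phi t)).
Proof.
have [ph [h1 c1]] := ws_grid X; exists (fun k t => h (ph k t)); split => [k|t].
  have [i [p [m e]]] := h1 k; exists i, (h \o p); split => // t.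
  by rewrite e.
by apply: cvg_comp; [exact: c1|exact: hc].
Qed.

(** The measurable type and the measure stay the same and only the map to the space is composed with
    [h]. Thus [R^(n+1)] is literally the product of the line and [R^n], and [Int_rowm] holds by
    computation. *)
Definition imw : wspace V2 := @WSpace V2 _ _ (@ws_mu _ X) (h \o @ws_phi _ X) w w0 wc imw_int imw_grid.

End Image.

End WeightedSpaces.
#[global] Hint Resolve ws_w_ge0 : core.

(** * Continuity of real-valued functions *)

Section Continuity.
Local Open Scope ring_scope.
Variables (R : realType) (T : topologicalType).

Lemma contC (c : R) : continuous (fun _ : T => c).
Proof. by move=> v; exact: cvg_cst. Qed.
Lemma contD (f g : T -> R) : continuous f -> continuous g -> continuous (fun t => f t + g t).
Proof. by move=> cf cg v; apply: cvgD; [exact: cf|exact: cg]. Qed.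
Lemma contN (f : T -> R) : continuous f -> continuous (fun t => - f t).
Proof. by move=> cf v; apply: cvgN; exact: cf. Qed.
Lemma contB (f g : T -> R) : continuous f -> continuous g -> continuous (fun t => f t - g t).
Proof. by move=> cf cg; apply: contD => //; exact: contN. Qed.
Lemma contM (f g : T -> R) : continuous f -> continuous g -> continuous (fun t => f t * g t).
Proof. by move=> cf cg v; apply: cvgM; [exact: cf|exact: cg]. Qed.
Lemma contV (f : T -> R) : continuous f -> (forall t, f t != 0) -> continuous (fun t => (f t)^-1).
Proof. by move=> cf f0 v; apply: cvgV; [exact: f0|exact: cf]. Qed.
Lemma contX (f : T -> R) k : continuous f -> continuous (fun t => f t ^+ k).
Proof.
move=> cf; elim: k => [|k IH]; first by under eq_fun do rewrite expr0; exact: contC.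
by under eq_fun do rewrite exprS; exact: contM.
Qed.
Lemma cont_comp (U V : topologicalType) (f : U -> V) (g : V -> R) :
  continuous f -> continuous g -> continuous (fun t => g (f t)).
Proof. by move=> cf cg v; apply: continuous_comp; [exact: cf|exact: cg]. Qed.
Lemma cont_sum (I : Type) (s : seq I) (f : I -> T -> R) :
  (forall i, continuous (f i)) -> continuous (fun t => \sum_(i <- s) f i t).
Proof.
move=> cf; elim: s => [|i s IH]; first by under eq_fun do rewrite big_nil; exact: contC.
by under eq_fun do rewrite big_cons; exact: contD.
Qed.
Lemma cont_prod (I : Type) (s : seq I) (f : I -> T -> R) :
  (forall i, continuous (f i)) -> continuous (fun t => \prod_(i <- s) f i t).
Proof.
move=> cf; elim: s => [|i s IH]; first by under eq_fun do rewrite big_nil; exact: contC.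
by under eq_fun do rewrite big_cons; exact: contM.
Qed.
End Continuity.

(** * Euclidean space with a polynomial weight, and the iterated integrals of the statement *)

Section EuclideanSpaces.
Local Open Scope classical_set_scope.
Local Open Scope ring_scope.
Variable R : realType.

(** This rational weight has a finite integral over the line, and all its derivatives are bounded by
    multiples of itself. Its products and powers therefore serve both as integrable majorants and as
    smooth cut-offs. *)
Definition w1 (t : R) : R := (1 + t ^+ 2)^-1.
Definition wt n (v : 'rV[R]_n) : R := \prod_(i < n) w1 (v 0 i).

Lemma w1_den (t : R) : 0 < 1 + t ^+ 2.
Proof. by rewrite ltr_pwDl// sqr_ge0. Qed.
Lemma w1_gt0 t : 0 < w1 t. Proof. by rewrite invr_gt0 w1_den. Qed.
Lemma w1_le1 t : w1 t <= 1.
Proof. by rewrite invf_le1 ?w1_den// lerDl sqr_ge0. Qed.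
Lemma wt_gt0 n (v : 'rV_n) : 0 < wt v.
Proof. by apply: prodr_gt0 => i _; exact: w1_gt0. Qed.
Lemma wt_ge0 n (v : 'rV_n) : 0 <= wt v. Proof. exact: ltW (wt_gt0 v). Qed.
Lemma wt_le1 n (v : 'rV_n) : wt v <= 1.
Proof.
by apply: prodr_ile1 => i _; rewrite w1_le1 (ltW (w1_gt0 _)).
Qed.

Lemma w1_cont : continuous w1.
Proof.
apply: contV => [|t]; last by rewrite gt_eqF ?w1_den.
by apply: contD; [exact: contC|exact: exprn_continuous].
Qed.

Lemma coord_cont n (i : 'I_n) : continuous (fun v : 'rV[R]_n => v 0 i).
Proof. by move=> v; exact: coord_continuous. Qed.

Lemma wt_cont n : continuous (@wt n).
Proof.
apply: cont_prod => i; apply: (cont_comp (f := fun u : 'rV[R]_n => u 0 i)); last exact: w1_cont.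
exact: coord_cont.
Qed.

Lemma cont_rV (T : topologicalType) n (f : T -> 'rV[R]_n) :
  (forall j, continuous (fun t => f t 0 j)) -> continuous f.
Proof.
move=> h t A [P nP sPA]; rewrite nbhs_simpl/=.
have H : \forall s \near t, forall j, P 0 j (f s 0 j).
  apply: filter_forall => j.
  exact: (h j t (P 0 j) (nP 0 j)).
by apply: filterS H => s Hs; apply: sPA => i j; rewrite ord1; exact: Hs.
Qed.

Definition rowm n (p : R * 'rV[R]_n) : 'rV[R]_n.+1 :=
  row_mx (const_mx p.1 : 'rV[R]_1) p.2.

Lemma rowm0 n (p : R * 'rV[R]_n) : rowm p 0 ord0 = p.1.
Proof.
have -> : ord0 = lshift n (ord0 : 'I_1) by apply: val_inj.
by apply: (etrans (@row_mxEl _ 1 1 n _ p.2 0 ord0)); rewrite mxE.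
Qed.
Lemma rowmS n (p : R * 'rV[R]_n) i : rowm p 0 (lift ord0 i) = p.2 0 i.
Proof.
have -> : lift ord0 i = rshift 1 i by apply: val_inj.
exact: (@row_mxEr _ 1 1 n _ p.2 0 i).
Qed.

Lemma rowm_cont n : continuous (@rowm n).
Proof.
apply: cont_rV => j; case: (unliftP ord0 j) => [i|] ->.
  under eq_fun do rewrite rowmS.
  apply: (cont_comp (f := snd) (g := fun u : 'rV[R]_n => u 0 i)); last exact: coord_cont.
  by move=> v; exact: cvg_snd.
under eq_fun do rewrite rowm0.
by move=> v; exact: cvg_fst.
Qed.

Lemma wt_rowm n (p : R * 'rV[R]_n) : wt (rowm p) = w1 p.1 * wt p.2.
Proof.
rewrite /wt big_ord_recl rowm0; congr (_ * _).
by apply: eq_bigr => i _; rewrite rowmS.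
Qed.

Lemma rowm_surj n (v : 'rV[R]_n.+1) : exists p, v = rowm p.
Proof.
exists (v 0 ord0, \row_i v 0 (lift ord0 i)); apply/rowP => j.
by case: (unliftP ord0 j) => [i|] ->; rewrite ?rowmS ?rowm0 ?mxE.
Qed.

Lemma w1_int : (\int[@lebesgue_measure R]_(t in setT) (w1 t)%:E < +oo)%E.
Proof.
rewrite ge0_symfun_integralT.
- have := integral0y_oneDsqr R; rewrite (_ : `[0, +oo[%classic = [set x | 0 <= x]); last first.
    by apply/seteqP; split => x /=; rewrite in_itv/= andbT.
  by move=> h; rewrite [X in (2 * X)%E]h -EFinM ltry.
- by move=> x; exact: ltW (w1_gt0 x).
- exact: w1_cont.
- by move=> x; rewrite /w1/= sqrrN.
Qed.

Lemma R_grid : exists ph : nat -> measurableTypeR R -> R,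
    (forall k, exists idx : measurableTypeR R -> nat, exists p : nat -> R,
       (forall i, measurable (idx @^-1` [set i])) /\ (forall t, ph k t = p (idx t))) /\
    (forall t, ph k t @[k --> \oo] --> (t : R)).
Proof.
(* Rounding down to multiples of [1 / k.+1], with an error of at most [1 / k.+1]; the integer is
   coded as a natural number. *)
exists (fun k t => (Num.floor (k.+1%:R * t))%:~R / k.+1%:R); split => [k|t].
  exists (fun t => pickle (Num.floor (k.+1%:R * t))).
  exists (fun i => (odflt 0 (unpickle i : option int))%:~R / k.+1%:R); split => [i|t]; last by rewrite pickleK.
  case e : (pickle_inv i : option int) => [z|].
    rewrite (_ : _ @^-1` _ = `[z%:~R / k.+1%:R, (z + 1)%:~R / k.+1%:R[%classic).
      exact: measurable_itv.
    have k0 : (0 : R) < k.+1%:R by [].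
    apply/seteqP; split => t /=; rewrite in_itv/= ler_pdivrMr// ltr_pdivlMr// [t * _]mulrC.
      move=> et; have /eqP : Num.floor (k.+1%:R * t) = z.
        by have := pickle_invK (T := int) i; rewrite e/= -et => /(pcan_inj pickleK).
      by rewrite floor_eq.
    rewrite -floor_eq => /eqP ->.
    by have := pickle_invK (T := int) i; rewrite e.
  rewrite (_ : _ @^-1` _ = set0)//; apply/seteqP; split => // t /= et.
  by move: e; rewrite -et pickleK_inv.
apply/cvgrPdist_le => e e0; near=> k.
have k0 : (0 : R) < k.+1%:R by [].
have /andP[h1 h2] := floor_itv (k.+1%:R * t).
have -> : t - (Num.floor (k.+1%:R * t))%:~R / k.+1%:R =
  (k.+1%:R * t - (Num.floor (k.+1%:R * t))%:~R) / k.+1%:R by rewrite mulrBl mulrAC divff ?mul1r// gt_eqF.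
rewrite normrM normfV [`|k.+1%:R|]gtr0_norm// ler_pdivrMr//.
have h3 : (Num.floor (k.+1%:R * t) + 1)%:~R = (Num.floor (k.+1%:R * t))%:~R + 1 :> R by rewrite intrD.
rewrite ger0_norm ?subr_ge0//.
have : e^-1 <= k%:R by near: k; exact: nbhs_infty_ger.
rewrite -div1r ler_pdivrMr// [k%:R * e]mulrC => he.
apply: (@le_trans _ _ 1); first by rewrite lerBlDr addrC -h3 ltW.
by apply: (le_trans he); rewrite ler_pM2l// ler_nat.
Unshelve. all: by end_near. Qed.

Definition Rw : wspace R R := @WSpace R R _ (measurableTypeR R) (@lebesgue_measure R) id
  w1 w1_gt0 w1_cont w1_int R_grid.

Lemma unit_int : (\int[\d_ tt]_t (wt (0 : 'rV[R]_0))%:E < +oo)%E.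
Proof. by rewrite integral_cst// /= -EFinM ltry. Qed.

Lemma unit_grid : exists ph : nat -> unit -> 'rV[R]_0,
    (forall k, exists idx : unit -> nat, exists p : nat -> 'rV[R]_0,
       (forall i, measurable (idx @^-1` [set i])) /\ (forall t, ph k t = p (idx t))) /\
    (forall t, ph k t @[k --> \oo] --> (0 : 'rV[R]_0)).
Proof.
exists (fun _ _ => 0); split => [k|t]; last exact: cvg_cst.
by exists (fun=> 0%N), (fun=> 0).
Qed.

Definition unitw : wspace R 'rV[R]_0 := @WSpace R 'rV[R]_0 _ unit
  (\d_ tt : {sigma_finite_measure set unit -> \bar R}) (fun=> 0)
  (@wt 0) (@wt_gt0 0) (@wt_cont 0) unit_int unit_grid.

Lemma wt_rowm_w n (X : {X : wspace R 'rV[R]_n | ws_w X =1 @wt n}) (v : R * 'rV[R]_n) :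
  wt (rowm v) = ws_w (prodw Rw (proj1_sig X)) v.
Proof. by case: X => X hX; rewrite /= wt_rowm hX. Qed.

(** One coordinate is added at a time, as the image of a product. The equality of the weight with
    [wt] is carried along because [imw] asks for it at the next dimension. *)
Fixpoint Vs n : {X : wspace R 'rV[R]_n | ws_w X =1 @wt n} :=
  match n with
  | 0%N => exist _ unitw (fun=> erefl)
  | n'.+1 => exist _ (imw (@rowm_cont n') (@wt_cont n'.+1) (@wt_gt0 n'.+1) (wt_rowm_w (Vs n'))) (fun=> erefl)
  end.
Definition Vw n : wspace R 'rV[R]_n := proj1_sig (Vs n).

Lemma Vw_w n v : ws_w (Vw n) v = wt v.
Proof. exact: (proj2_sig (Vs n)). Qed.

Lemma tame_rowm n (F : 'rV[R]_n.+1 -> R) : tame (Vw n.+1) F -> tame (prodw Rw (Vw n)) (F \o @rowm n).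
Proof.
move=> [mF [C hC]]; split=> //; exists C => v.
by rewrite (le_trans (hC _))// Vw_w wt_rowm /= Vw_w.
Qed.
Lemma Int_rowm n (F : 'rV[R]_n.+1 -> R) : Int (Vw n.+1) F = Int (prodw Rw (Vw n)) (F \o @rowm n).
Proof. by []. Qed.

(** Links the iterated integral of the statement to the product measure, by Tonelli in one
    coordinate at a time. *)
Lemma EintRnE n (F : 'rV[R]_n -> \bar R) :
  measurable_fun setT (F \o @ws_phi _ _ (Vw n)) -> (forall v, (0 <= F v)%E) ->
  EintRn F = Eint (Vw n) F.
Proof.
elim: n F => [|n IH] F mF F0.
  by rewrite /Eint /= integral_cst//= diracT mule1.
have F0' : forall x, (0%E <= (F \o @ws_phi _ _ (Vw n.+1)) x)%E by move=> x; exact: F0.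
apply: etrans (esym (@fubini_tonelli1 _ _ (measurableTypeR R) (ws_T (Vw n)) R
  (@lebesgue_measure R) (@ws_mu _ _ (Vw n)) (F \o @ws_phi _ _ (Vw n.+1)) mF F0')).
apply: eq_integral => t _; apply: (IH (fun v => F (rowm (t, v)))) => [|v]; last exact: F0.
exact: (measurable_fun_pair2 (t : measurableTypeR R) mF).
Qed.

Lemma RintRnE n (F : 'rV[R]_n -> R) : tame (Vw n) F -> RintRn F = Int (Vw n) F.
Proof.
elim: n F => [|n IH] F hF.
  rewrite /Int /= Rintegral_cst// -[LHS]mulr1; congr (_ * _).
  by rewrite -[LHS]/(fine 1%E); congr fine; exact: esym (@diracT _ _ R tt).
rewrite Int_rowm (Int_prod12 (tame_rowm hF)) /=.
rewrite /Int [LHS]/Rintegral [RHS]/Rintegral; congr fine; apply: eq_integral => t _.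
congr EFin; apply: (IH (fun v => F (rowm (t, v)))).
exact: (tame_slice1 (tame_rowm hF) (t : ws_T Rw)).
Qed.

End EuclideanSpaces.

(** * Affine changes of variables *)

Section AffineChange.
Local Open Scope classical_set_scope.
Local Open Scope ring_scope.
Variable R : realType.

(** The image of Lebesgue measure under [t -> l t + c], multiplied by [l], has the right value on
    half-open intervals, and this determines Lebesgue measure. *)
Lemma Eint_affR (l c : R) (f : R -> \bar R) : 0 < l ->
  measurable_fun [set: measurableTypeR R] f -> (forall t, (0 <= f t)%E) ->
  (l%:E * Eint (Rw R) (fun t => f (l * t + c)%R))%E = Eint (Rw R) f.
Proof.
move=> l0 mf f0; pose h (t : measurableTypeR R) : measurableTypeR R := l * t + c.
have mh : measurable_fun setT h.
  by apply: measurable_funD => //; apply: measurable_funM.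
pose mu := @lebesgue_measure R.
pose nu := mscale (NngNum (ltW l0)) (measure_function_pushforward__canonical__measure_function_Measure mu mh).
have E : forall A, measurable A -> mu A = nu A.
  apply: lebesgue_measure_unique => _ [[a b]] _ <-.
  rewrite -[RHS]/(l%:E * mu (h @^-1` `]a, b]%classic))%E.
  have -> : h @^-1` `]a, b]%classic = `](a - c) / l, (b - c) / l]%classic.
    apply/seteqP; split => t /=; rewrite !in_itv/= /h ltr_pdivrMr// ler_pdivlMr// ltrBlDr lerBrDr [t * l]mulrC//.
  rewrite /mu.
  rewrite !lebesgue_measure_itv/= !lte_fin ltr_pM2r ?invr_gt0// ltrD2r.
  case: ifP => _; last by rewrite mule0.
  rewrite -!EFinB -EFinM; congr EFin; rewrite -mulrBl mulrCA divff ?gt_eqF// mulr1; ring.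
transitivity (\int[nu]_x f x)%E; last by apply: eq_measure_integral => A mA _; (exact: E || exact: (esym (E _ _))).
rewrite ge0_integral_mscale//; congr (_ * _)%E.
by rewrite ge0_integral_pushforward// => y _; exact: f0.
Qed.

Definition aff n (l : R) (c v : 'rV[R]_n) : 'rV[R]_n := l *: v + c.

Lemma affE n l (c v : 'rV[R]_n) j : aff l c v 0 j = l * v 0 j + c 0 j.
Proof. by rewrite !mxE. Qed.

Lemma aff_cont n l (c : 'rV[R]_n) : continuous (aff l c).
Proof.
apply: cont_rV => j; under eq_fun do rewrite affE.
by apply: contD; [apply: contM; [exact: contC|exact: coord_cont]|exact: contC].
Qed.

Lemma aff_rowm n l (c : R * 'rV[R]_n) v :
  aff l (rowm c) (rowm v) = rowm (l * v.1 + c.1, aff l c.2 v.2).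
Proof.
by apply/rowP => j; case: (unliftP ord0 j) => [i|] ->; rewrite affE ?rowmS ?rowm0 ?affE.
Qed.

Lemma Eint_rowm n (F : 'rV[R]_n.+1 -> \bar R) :
  measurable_fun setT (F \o @ws_phi _ _ (Vw R n.+1)) -> (forall v, (0 <= F v)%E) ->
  Eint (Vw R n.+1) F = Eint (Rw R) (fun t => Eint (Vw R n) (fun v => F (rowm (t, v)))).
Proof.
move=> mF F0; apply: (@fubini_tonelli1 _ _ (measurableTypeR R) (ws_T (Vw R n)) R
  (@lebesgue_measure R) (@ws_mu _ _ (Vw R n)) (F \o @ws_phi _ _ (Vw R n.+1)) mF).
by move=> x; exact: F0.
Qed.

(** Since vectors carry no sigma-algebra here, the affine map is first lifted, coordinate by
    coordinate, to a measurable map of the underlying measurable type. *)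
Lemma meas_aff n l c (F : 'rV[R]_n -> \bar R) : 0 < l ->
  measurable_fun setT (F \o @ws_phi _ _ (Vw R n)) ->
  measurable_fun setT ((F \o aff l c) \o @ws_phi _ _ (Vw R n)).
Proof.
move=> l0 mF.
have mA m (b : 'rV[R]_m) : exists2 k : ws_T (Vw R m) -> ws_T (Vw R m),
   measurable_fun setT k & forall t, ws_phi (k t) = aff l b (ws_phi t).
  elim: m b => [|m IHm] b.
    by exists id => // t; apply/rowP => -[].
  have [[b0 b1] ->] := rowm_surj b; have [k mk kE] := IHm b1.
  exists (fun t : measurableTypeR R * ws_T (Vw R m) => (l * t.1 + b0, k t.2)) => [|t].
    apply: measurable_fun_pair.
      apply: measurable_funD => //; apply: measurable_funM => //; exact: measurable_fst.
    by apply: (measurableT_comp mk); exact: measurable_snd.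
  by rewrite /= aff_rowm/= kE.
have [k mk kE] := mA n c.
rewrite (_ : _ \o _ = (F \o @ws_phi _ _ (Vw R n)) \o k); first exact: measurableT_comp mF mk.
by apply/funext => t /=; rewrite kE.
Qed.

Lemma Eint_aff n l c (F : 'rV[R]_n -> \bar R) : 0 < l ->
  measurable_fun setT (F \o @ws_phi _ _ (Vw R n)) -> (forall v, (0 <= F v)%E) ->
  ((l ^+ n)%:E * Eint (Vw R n) (F \o aff l c))%E = Eint (Vw R n) F.
Proof.
move=> l0; elim: n c F => [|n IH] c F mF F0.
  rewrite expr0 mul1e /Eint; apply: eq_integral => t _ /=; congr F.
  by apply/rowP => -[].
have [[c0 c1] ->] := rowm_surj c.
rewrite Eint_rowm//; last 2 first.
- exact: meas_aff.
- by move=> v; exact: F0.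
have mS t : measurable_fun setT ((fun v => F (rowm (t, v))) \o @ws_phi _ _ (Vw R n)).
  exact: (measurable_fun_pair2 (t : measurableTypeR R) mF).
have -> : (fun t => Eint (Vw R n) (fun v => (F \o aff l (rowm (c0, c1))) (rowm (t, v)))) =
    fun t => Eint (Vw R n) ((fun v => F (rowm ((l * t + c0)%R, v))) \o aff l c1).
  by apply/funext => t; congr Eint; apply/funext => v /=; rewrite aff_rowm.
rewrite exprSr EFinM -muleA [RHS]Eint_rowm//.
have mI : measurable_fun [set: measurableTypeR R] (fun t => Eint (Vw R n) (fun v => F (rowm (t, v)))).
  apply: (@measurable_fun_fubini_tonelli_F _ _ (measurableTypeR R) (ws_T (Vw R n)) R
    (@ws_mu _ _ (Vw R n)) (F \o @ws_phi _ _ (Vw R n.+1)) mF).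
  by move=> x; exact: F0.
rewrite -(Eint_affR c0 l0 mI); last by move=> t; apply: integral_ge0 => x _; exact: F0.
rewrite muleCA; congr (_ * _)%E.
rewrite /Eint -ge0_integralZl_EFin//.
- apply: eq_integral => t _; apply: (IH c1 (fun v => F (rowm ((l * t + c0)%R, v)))) => [|v]; last exact: F0.
  exact: mS.
- by move=> t _; apply: integral_ge0 => x _; exact: F0.
- have mIa : measurable_fun [set: measurableTypeR R] (fun t : R => ((l ^- n)%:E * Eint (Vw R n) (fun v => F (rowm ((l * t + c0)%R, v))))%E).
    apply: measurable_funeM; apply: (measurableT_comp mI).
    by apply: measurable_funD => //; apply: measurable_funM.
  apply: (eq_measurable_fun _ _ mIa) => t _.
  rewrite -[in LHS](IH c1)//.
  by rewrite muleA -EFinM mulVf ?mul1e// expf_neq0// gt_eqF.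
- by rewrite exprn_ge0// ltW.
Qed.

Lemma Int_aff n l c (F : 'rV[R]_n -> R) : 0 < l -> tame (Vw R n) F ->
  Int (Vw R n) (fun v => F (aff l c v)) = l ^- n * Int (Vw R n) F.
Proof.
move=> l0 hF; have mF := measE hF.1.
have ln0 : l ^+ n != 0 by rewrite expf_neq0// gt_eqF.
have E G : measurable_fun setT (G \o @ws_phi _ _ (Vw R n)) -> (forall v, (0 <= G v)%E) ->
    Eint (Vw R n) (G \o aff l c) = ((l ^- n)%:E * Eint (Vw R n) G)%E.
  move=> mG G0; rewrite -(Eint_aff c l0 mG G0) muleA -EFinM mulVf// mul1e//.
have [i1 i2] := (integrable_pos_fin_num measurableT (tame_integrable hF), integrable_neg_fin_num measurableT (tame_integrable hF)).
rewrite /Int /Rintegral integralE [in RHS]integralE.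
have e1 : (\int[@ws_mu _ _ (Vw R n)]_t (fun x => (F (aff l c (ws_phi x)))%:E)^\+ t)%E =
    ((l ^- n)%:E * (\int[@ws_mu _ _ (Vw R n)]_t (fun x => (F (ws_phi x))%:E)^\+ t))%E.
  apply: etrans (etrans (E (fun v => (maxe (F v)%:E 0)%E) _ _) _) => //.
  - by apply: eq_integral => t _; rewrite funeposE.
  - have := measurable_funepos mF; apply: eq_measurable_fun => t _ /=; rewrite funeposE//.
  - by move=> v; rewrite le_max lexx orbT.
  - by congr (_ * _)%E; apply: eq_integral => t _; rewrite funeposE.
have e2 : (\int[@ws_mu _ _ (Vw R n)]_t (fun x => (F (aff l c (ws_phi x)))%:E)^\- t)%E =
    ((l ^- n)%:E * (\int[@ws_mu _ _ (Vw R n)]_t (fun x => (F (ws_phi x))%:E)^\- t))%E.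
  apply: etrans (etrans (E (fun v => (maxe (- (F v)%:E) 0)%E) _ _) _) => //.
  - by apply: eq_integral => t _; rewrite funenegE.
  - have := measurable_funeneg mF; apply: eq_measurable_fun => t _ /=; rewrite funenegE//.
  - by move=> v; rewrite le_max lexx orbT.
  - by congr (_ * _)%E; apply: eq_integral => t _; rewrite funenegE.
by rewrite e1 e2 -(fineK i1) -(fineK i2) -!EFinM /= -mulrBr.
Qed.

Lemma tame_aff n l (c : 'rV[R]_n) F : 0 < l -> tame (Vw R n) F -> tame (Vw R n) (fun v => F (aff l c v)).
Proof.
move=> l0 [mF [C hC]]; split.
  apply/measurable_EFinP; exact: (@meas_aff n l c (fun v => (F v)%:E) l0 (measE mF)).
have [D hD] : exists D, forall v, wt (aff l c v) <= D * wt v.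
  (* In each coordinate [1 + t^2 <= (1 + u^2)(1 + l^-2)] with [u = l t], and
     [1 + u^2 <= 2 (1 + b^2)(1 + (u + b)^2)]. *)
  exists (\prod_(i < n) (2 * (1 + c 0 i ^+ 2) * (1 + (l^-1) ^+ 2))) => v.
  rewrite /wt -big_split/=; apply: ler_prod => i _.
  rewrite (ltW (w1_gt0 _))/= !mxE /w1.
  set t := v 0 i; set b := c 0 i.
  rewrite ler_pdivlMr ?w1_den// mulrC ler_pdivrMr ?w1_den//.
  have h : t ^+ 2 = (l^-1) ^+ 2 * (l * t) ^+ 2 by rewrite -exprMn mulKf// gt_eqF.
  have k0 : 0 <= (l^-1) ^+ 2 by rewrite sqr_ge0.
  rewrite h; move: ((l^-1) ^+ 2) k0 (l * t) => k k0 u.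
  have : 1 + u ^+ 2 <= 2 * (1 + b ^+ 2) * (1 + (u + b) ^+ 2).
    have := sqr_ge0 (u + b + b); have := mulr_ge0 (sqr_ge0 b) (sqr_ge0 (u + b)); nra.
  move=> h1; apply: (@le_trans _ _ ((1 + u ^+ 2) * (1 + k))).
    have := sqr_ge0 u; nra.
  rewrite [leRHS]mulrAC ler_wpM2r//; lra.
exists (`|C| * D) => v; rewrite (le_trans (hC _))// !Vw_w.
rewrite -mulrA; apply: (@le_trans _ _ (`|C| * wt (aff l c v))).
  by rewrite ler_wpM2r ?wt_ge0// ler_norm.
by rewrite ler_wpM2l.
Qed.

End AffineChange.

(** * Directional derivatives and integration by parts *)

Section DirectionalDerivatives.
Local Open Scope classical_set_scope.
Local Open Scope ring_scope.
Variable R : realType.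

(** [L] carries the line through [x] in direction [d] to the line through [L x] in direction [e], so
    the two difference quotients coincide term by term. *)
Lemma derive_shift (V U : normedModType R) (L : V -> U) (d : V) (e : U) (F : U -> R) x :
  (forall (h : R) x, L (h *: d + x) = h *: e + L x) -> 'D_d (fun v => F (L v)) x = 'D_e F (L x).
Proof.
move=> hL; rewrite /derive (_ : (fun h : R => h^-1 *: ((F \o shift (L x)) (h *: e) - F (L x))) =
  fun h : R => h^-1 *: (((fun v => F (L v)) \o shift x) (h *: d) - F (L x)))//.
by apply/funext => h /=; rewrite hL.
Qed.

Lemma derivable_shift (V U : normedModType R) (L : V -> U) (d : V) (e : U) (F : U -> R) x :
  (forall (h : R) x, L (h *: d + x) = h *: e + L x) -> derivable F (L x) e ->
  derivable (fun v => F (L v)) x d.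
Proof.
move=> hL; rewrite /derivable (_ : (fun h : R => h^-1 *: ((F \o shift (L x)) (h *: e) - F (L x))) =
  fun h : R => h^-1 *: (((fun v => F (L v)) \o shift x) (h *: d) - F (L x)))//.
by apply/funext => h /=; rewrite hL.
Qed.

(** The integral over [[-k, k]] is [g k - g (-k)], at most [2 C / k] by the weight bound on [g];
    dominated convergence passes to the whole line. *)
Lemma ftcR (g : R -> R) : (forall t, derivable g t 1) -> continuous ('D_1 g) ->
  tame (Rw R) g -> tame (Rw R) ('D_1 g) -> Int (Rw R) ('D_1 g) = 0.
Proof.
move=> dg cg [_ [C hC]] tg.
have iG := tame_integrable tg.
have cvg0 : (fun k : nat => g k%:R - g (- k%:R)) @ \oo --> (0 : R).
  apply/cvgrPdist_le => e e0; near=> k.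
  rewrite sub0r normrN.
  have k0 : 0 < k%:R :> R by near: k; exact: nbhs_infty_gtr.
  have b1 : w1 (k%:R : R) <= k%:R^-1.
    rewrite /w1 lef_pV2 ?posrE ?w1_den//.
    have : 1 <= k%:R :> R by rewrite ler1n -(ltr0n R).
    by move=> ?; nra.
  have b2 : w1 (- k%:R : R) <= k%:R^-1 by rewrite /w1 sqrrN.
  have C0 : 0 <= C.
    by rewrite -(pmulr_lge0 _ (w1_gt0 (0:R))); apply: le_trans (hC 0).
  apply: (le_trans (ler_normB _ _)).
  apply: (@le_trans _ _ (C * k%:R^-1 + C * k%:R^-1)).
    by apply: lerD; (apply: le_trans; [exact: hC|exact: ler_wpM2l]).
  rewrite -mulrDl ler_pdivrMr//.
  have : (2 * C) / e <= k%:R by near: k; exact: nbhs_infty_ger.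
  rewrite ler_pdivrMr//; lra.
have E : (fun k : nat => (g k%:R - g (- k%:R))%:E) @ \oo -->
    (\int[@lebesgue_measure R]_t ('D_1 g t)%:E)%E.
  have P k : (0 < k)%N -> (\int[@lebesgue_measure R]_(t in `[(- k%:R)%R, k%:R%R]) ('D_1 g t)%:E)%E =
      (g k%:R - g (- k%:R))%:E.
    move=> k0; rewrite (@continuous_FTC2 R ('D_1 g) g (- k%:R) k%:R)//.
    - by apply: (@lt_trans _ _ 0); rewrite ?oppr_lt0 ltr0n.
    - exact: continuous_subspaceT.
    - have cc t : {for t, continuous g}.
        by apply: differentiable_continuous; apply/derivable1_diffP; exact: dg.
      split => //.
      + exact: cvg_at_right_filter (cc _).
      + exact: cvg_at_left_filter (cc _).
    - by move=> t _; rewrite derive1E.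
  have := @dominated_cvg _ _ R (@lebesgue_measure R) setT measurableT
    (fun k : nat => (fun t => ('D_1 g t)%:E) \_ (`[(- k%:R)%R, k%:R%R]%classic))
    (fun t => ('D_1 g t)%:E) (fun t => `|('D_1 g t)%:E|)%E.
  have -> : (fun k : nat => (g k%:R - g (- k%:R))%:E) =
     (fun k : nat => \int[@lebesgue_measure R]_t ((fun t => ('D_1 g t)%:E) \_ (`[(- k%:R)%R, k%:R%R]%classic)) t)%E.
    apply/funext => k; rewrite -integral_mkcond.
    case: k => [|k]; last by rewrite P.
    by rewrite oppr0 subrr set_itv1 integral_set1.
  apply.
  - move=> k; apply/(measurable_restrictT _ _).1 => //.
    by apply: measurable_funTS; exact: (measE tg.1).
  - move=> t _; apply: cvg_near_cst; near=> k; rewrite patchE ifT// inE/= in_itv/=.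
    by rewrite -ler_norml; near: k; exact: nbhs_infty_ger.
  - by move=> t _.
  - exact: integrable_abse.
  - move=> k t _; rewrite patchE; case: ifP => // _.
    by rewrite abse0.
move: E; rewrite [X in _ --> X](EintE tg) => /fine_cvgP[_ E].
exact: (cvg_unique _ E cvg0).
Unshelve. all: by end_near. Qed.

Lemma cont_pair (T U V : topologicalType) (f : T -> U) (g : T -> V) :
  continuous f -> continuous g -> continuous (fun t => (f t, g t)).
Proof. by move=> cf cg t; exact: (cvg_pair (cf t) (cg t)). Qed.
Lemma cont_compT (T U W : topologicalType) (f : T -> U) (g : U -> W) :
  continuous f -> continuous g -> continuous (fun t => g (f t)).
Proof. by move=> cf cg t; apply: continuous_comp; [exact: cf|exact: cg]. Qed.
Lemma cont_id (T : topologicalType) : continuous (fun t : T => t).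
Proof. by move=> t; exact: cvg_id. Qed.
Lemma cont_cst (T U : topologicalType) (c : U) : continuous (fun t : T => c).
Proof. by move=> t; exact: cvg_cst. Qed.

(** A property of a space and a direction, so that it can be transferred from the line to products,
    and from products to [R^n] along [rowm]. *)
Definition ibp (V : normedModType R) (X : wspace R V) (d : V) := forall F : V -> R,
  (forall v, derivable F v d) -> continuous ('D_d F) -> tame X F -> tame X ('D_d F) ->
  Int X ('D_d F) = 0.

Lemma ibp_R : ibp (Rw R) 1.
Proof. exact: ftcR. Qed.

Lemma ibp_fst (V1 V2 : normedModType R) (X : wspace R V1) (Y : wspace R V2) d :
  ibp X d -> ibp (prodw X Y) (d, 0).
Proof.
move=> h F dF cF tF tDF; rewrite (Int_prod21 tDF) -(Int0 Y); apply: eq_Rintegral => t _.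
pose L (x : V1) := (x, @ws_phi _ _ Y t).
have hL (r : R) x : L (r *: d + x) = r *: (d, 0) + L x.
  by rewrite /L -[RHS]/(r *: d + x, r *: 0 + @ws_phi _ _ Y t) scaler0 add0r.
have E : 'D_d (fun x => F (L x)) = fun x => 'D_(d, 0) F (L x).
  by apply/funext => x; exact: derive_shift.
rewrite -[LHS]/(Int _ (fun x => 'D_(d, 0) F (L x))) -E; apply: h.
- by move=> v; apply: (derivable_shift hL).
- by rewrite E; apply: (fun c => cont_comp c cF); apply: cont_pair; [exact: cont_id|exact: cont_cst].
- exact: (tame_slice2 tF).
- by rewrite E; exact: (tame_slice2 tDF).
Qed.

Lemma ibp_snd (V1 V2 : normedModType R) (X : wspace R V1) (Y : wspace R V2) d :
  ibp Y d -> ibp (prodw X Y) (0, d).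
Proof.
move=> h F dF cF tF tDF; rewrite (Int_prod12 tDF) -(Int0 X); apply: eq_Rintegral => t _.
pose L (x : V2) := (@ws_phi _ _ X t, x).
have hL (r : R) x : L (r *: d + x) = r *: (0, d) + L x.
  by rewrite /L -[RHS]/(r *: 0 + @ws_phi _ _ X t, r *: d + x) scaler0 add0r.
have E : 'D_d (fun x => F (L x)) = fun x => 'D_(0, d) F (L x).
  by apply/funext => x; exact: derive_shift.
rewrite -[LHS]/(Int _ (fun x => 'D_(0, d) F (L x))) -E; apply: h.
- by move=> v; apply: (derivable_shift hL).
- by rewrite E; apply: (fun c => cont_comp c cF); apply: cont_pair; [exact: cont_cst|exact: cont_id].
- exact: (tame_slice1 tF).
- by rewrite E; exact: (tame_slice1 tDF).
Qed.

Lemma shift_coord n (h : R) (k j : 'I_n) (y : 'rV[R]_n) :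
  (h *: delta_mx 0 k + y) 0 j = h * (j == k)%:R + y 0 j.
Proof. by rewrite !mxE. Qed.

Lemma rowm_shift0 n (h : R) (x : R * 'rV[R]_n) :
  rowm (h *: (1, 0) + x) = h *: delta_mx 0 ord0 + rowm x.
Proof.
apply/rowP => j; rewrite shift_coord.
case: (unliftP ord0 j) => [i|] ->; rewrite ?rowmS ?rowm0 ?eqxx/=.
  by rewrite scaler0 add0r mulr0 add0r.
by [].
Qed.
Lemma rowm_shiftS n (h : R) (x : R * 'rV[R]_n) i :
  rowm (h *: (0, delta_mx 0 i) + x) = h *: delta_mx 0 (lift ord0 i) + rowm x.
Proof.
apply/rowP => j; rewrite shift_coord.
case: (unliftP ord0 j) => [k|] ->; rewrite ?rowmS ?rowm0/=.
  by rewrite shift_coord (inj_eq lift_inj).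
by rewrite scaler0 mulr0.
Qed.

Lemma ibp_Vw n i : ibp (Vw R n) (delta_mx 0 i).
Proof.
elim: n i => [[]//|n IH] i F dF cF tF tDF; rewrite Int_rowm.
have key d e : ibp (prodw (Rw R) (Vw R n)) d ->
    (forall (h : R) (x : R * 'rV[R]_n), rowm (h *: d + x) = h *: e + rowm x) ->
    e = delta_mx 0 i -> Int (prodw (Rw R) (Vw R n)) ('D_(delta_mx 0 i) F \o @rowm R n) = 0.
  move=> hib hr ei; rewrite ei in hr.
  have E : 'D_(delta_mx 0 i) F \o @rowm R n = 'D_d (F \o @rowm R n).
    by apply/funext => x /=; rewrite (derive_shift _ _ hr).
  rewrite E; apply: hib.
  - by move=> v; apply: (derivable_shift hr).
  - rewrite -E; apply: cont_comp => //; exact: rowm_cont.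
  - exact: tame_rowm.
  - by rewrite -E; exact: tame_rowm.
case: (unliftP ord0 i) => [k|] ei.
  by apply: (key (0, delta_mx 0 k) (delta_mx 0 (lift ord0 k))); [exact: ibp_snd|move=> h x; exact: rowm_shiftS|rewrite ei].
by apply: (key (1, 0) (delta_mx 0 ord0)); [exact/ibp_fst/ibp_R|exact: rowm_shift0|rewrite ei].
Qed.
End DirectionalDerivatives.

(** * Rules of differentiation and oscillatory integrals *)

Section DerivativeCalculus.
Local Open Scope classical_set_scope.
Local Open Scope ring_scope.
Variable R : realType.

Lemma derivable_dirR (g : R -> R) y c : derivable g y 1 -> derivable g y c.
Proof. by move=> /derivable1_diffP dg; exact: diff_derivable. Qed.

Lemma derive_dirR (g : R -> R) y c : derivable g y 1 -> 'D_c g y = c * 'D_1 g y.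
Proof.
move=> /derivable1_diffP dg; rewrite !deriveE//.
by rewrite -[X in 'd g y X = _](@mulr1 R c) -/(c *: (1 : R)) linearZ.
Qed.

Section Space.
Variable V : normedModType R.

Lemma line_shift (v e : V) c (h t : R) :
  (h *: c + t) *: e + v = h *: (c *: e) + (t *: e + v).
Proof. by rewrite scalerDl scalerA addrA. Qed.

(** On the line through [v] in direction [e], [F] is a differentiable function of one variable,
    whose derivative is linear in the direction. *)
Lemma derive_scale (F : V -> R) v e c : derivable F v e ->
  derivable F v (c *: e) /\ 'D_(c *: e) F v = c * 'D_e F v.
Proof.
move=> dF; pose L (t : R) : V := t *: e + v; have L0 : L 0 = v by rewrite /L scale0r add0r.
have h1 : derivable (F \o L) 0 1.
  apply: (derivable_shift (L := L) (e := e)); last by rewrite L0.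
  by move=> h t; rewrite /L line_shift scale1r.
have e1 : 'D_1 (F \o L) 0 = 'D_e F v.
  rewrite -[in RHS]L0; apply: (derive_shift (L := L)).
  by move=> h t; rewrite /L line_shift scale1r.
split.
  have := @derivable_dirR _ _ c h1; rewrite /derivable.
  rewrite (_ : (fun h : R => h^-1 *: (((F \o L) \o shift 0) (h *: c) - (F \o L) 0)) =
    fun h : R => h^-1 *: ((F \o shift v) (h *: (c *: e)) - F v))//.
  by apply/funext => h /=; rewrite L0 /L addr0 scalerA.
rewrite -e1 -derive_dirR// -[in LHS]L0; apply: esym; apply: (derive_shift (L := L)).
by move=> h t; rewrite /L line_shift.
Qed.

Lemma DD (F G : V -> R) d : (forall v, derivable F v d) -> (forall v, derivable G v d) ->
  'D_d (fun v => F v + G v) = fun v => 'D_d F v + 'D_d G v.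
Proof. by move=> dF dG; apply/funext => v; exact: deriveD. Qed.
Lemma dD (F G : V -> R) d v : derivable F v d -> derivable G v d -> derivable (fun v => F v + G v) v d.
Proof. exact: derivableD. Qed.
Lemma DN (F : V -> R) d : (forall v, derivable F v d) -> 'D_d (fun v => - F v) = fun v => - 'D_d F v.
Proof. by move=> dF; apply/funext => v; exact: deriveN. Qed.
Lemma dN (F : V -> R) d v : derivable F v d -> derivable (fun v => - F v) v d.
Proof. exact: derivableN. Qed.
Lemma DM (F G : V -> R) d : (forall v, derivable F v d) -> (forall v, derivable G v d) ->
  'D_d (fun v => F v * G v) = fun v => F v * 'D_d G v + G v * 'D_d F v.
Proof. by move=> dF dG; apply/funext => v; exact: deriveM. Qed.
Lemma dM (F G : V -> R) d v : derivable F v d -> derivable G v d -> derivable (fun v => F v * G v) v d.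
Proof. exact: derivableM. Qed.
Lemma DC (c : R) (d : V) : 'D_d (fun _ : V => c) = fun=> 0.
Proof. by apply/funext => v; exact: derive_cst. Qed.
Lemma dC (c : R) (v d : V) : derivable (fun _ : V => c) v d.
Proof. exact: derivable_cst. Qed.
Lemma DZ (F : V -> R) c d : (forall v, derivable F v d) -> 'D_d (fun v => c * F v) = fun v => c * 'D_d F v.
Proof.
move=> dF; rewrite (DM (fun v => @dC c v d) dF).
by apply/funext => v; rewrite (derive_cst c) mulr0 addr0.
Qed.
Lemma dZ (F : V -> R) c d v : derivable F v d -> derivable (fun v => c * F v) v d.
Proof. by move=> dF; apply: dM => //; exact: dC. Qed.
Lemma DV (F : V -> R) d : (forall v, F v != 0) -> (forall v, derivable F v d) ->
  'D_d (fun v => (F v)^-1) = fun v => - ('D_d F v * ((F v)^-1 * (F v)^-1)).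
Proof.
move=> F0 dF; apply/funext => v; rewrite deriveV//.
by rewrite scaleNr /GRing.scale/= mulrC -expr2 exprVn.
Qed.
Lemma dV (F : V -> R) d v : F v != 0 -> derivable F v d -> derivable (fun v => (F v)^-1) v d.
Proof. exact: derivableV. Qed.

Section Phase.
Variables (ph : V -> R) (d : V) (s : R).
Hypothesis hph : forall (h : R) v, ph (h *: d + v) = h * s + ph v.

Lemma d_ph (g : R -> R) v : (forall t, derivable g t 1) -> derivable (fun v => g (ph v)) v d.
Proof.
by move=> dg; apply: (derivable_shift (L := ph) (e := s)); [exact: hph|exact: derivable_dirR].
Qed.
Lemma D_ph (g : R -> R) : (forall t, derivable g t 1) -> 'D_d (fun v => g (ph v)) = fun v => s * 'D_1 g (ph v).
Proof.
by move=> dg; apply/funext => v; rewrite (derive_shift (L := ph) _ _ hph) derive_dirR.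
Qed.
Lemma D_ph_id v : derivable ph v d /\ 'D_d ph v = s.
Proof.
split; first by apply: (d_ph (g := id)) => t; exact: derivable_id.
have did (t : R) : derivable (id : R -> R) t 1 by exact: derivable_id.
by have /(congr1 (@^~ v)) := D_ph did; rewrite /= derive_id mulr1.
Qed.
Lemma d_sin v : derivable (fun v => sin (ph v)) v d.
Proof. by apply: d_ph => t; exact: derivable_sin. Qed.
Lemma D_sin : 'D_d (fun v => sin (ph v)) = fun v => s * cos (ph v).
Proof.
rewrite D_ph; last by move=> t; exact: derivable_sin.
by apply/funext => v; rewrite derive_val.
Qed.
End Phase.

Section Osc.
Variable X : wspace R V.

(** A sine is a cosine shifted by a quarter period, so one real integral with a free phase covers
    real and imaginary parts. *)
Definition osc (b ph : V -> R) : R := Int X (fun v => b v * cos (ph v)).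

Lemma cos_le1 (t : R) : `|cos t| <= 1.
Proof. by rewrite ler_norml cos_geN1 cos_le1. Qed.
Lemma sin_le1 (t : R) : `|sin t| <= 1.
Proof. by rewrite ler_norml sin_geN1 sin_le1. Qed.

Lemma cont_cos (T : topologicalType) (ph : T -> R) : continuous ph -> continuous (fun v => cos (ph v)).
Proof. by move=> c; apply: (cont_comp (f := ph)) => //; exact: continuous_cos. Qed.
Lemma cont_sin (T : topologicalType) (ph : T -> R) : continuous ph -> continuous (fun v => sin (ph v)).
Proof. by move=> c; apply: (cont_comp (f := ph)) => //; exact: continuous_sin. Qed.

Lemma tame_cos b ph : continuous ph -> tame X b -> tame X (fun v => b v * cos (ph v)).
Proof.
move=> cp tb; under eq_fun do rewrite mulrC.
apply: (tameMb (C := 1)) => //; last by move=> v; exact: cos_le1.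
exact/cont_meas/cont_cos.
Qed.

Lemma osc_le b ph om C : continuous b -> continuous ph -> tame X om -> (forall v, `|b v| <= C * om v) ->
  `|osc b ph| <= C * Int X om.
Proof.
move=> cb cp tom h; rewrite -IntZ//; apply: norm_Int.
- by apply/cont_meas; apply: contM => //; exact: cont_cos.
- exact: tameZ.
- by move=> v; rewrite normrM (le_trans _ (h v))// ler_piMr// cos_le1.
Qed.

(** The integral of the derivative of [b sin ph] vanishes. That derivative is
    [s b cos ph + b' sin ph], and the sine is minus the cosine of [ph + pi / 2], so the outcome is
    again of the form [osc]. *)
Lemma osc_D b ph d s : ibp X d -> continuous ph ->
  (forall (h : R) v, ph (h *: d + v) = h * s + ph v) ->
  continuous b -> tame X b -> (forall v, derivable b v d) -> continuous ('D_d b) -> tame X ('D_d b) ->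
  s * osc b ph = osc ('D_d b) (fun v => ph v + pi / 2).
Proof.
move=> hi cp hp cb tb db cdb tdb.
have dS v : derivable (fun v => sin (ph v)) v d by exact: d_sin hp v.
have E : 'D_d (fun v => b v * sin (ph v)) = fun v => s * (b v * cos (ph v)) - 'D_d b v * cos (ph v + pi / 2).
  rewrite DM//; apply/funext => v; rewrite (congr1 (@^~ v) (D_sin hp) : 'D_d (fun v => sin (ph v)) v = _) cosD cos_pihalf sin_pihalf mulr0 sub0r mulr1.
  by rewrite mulrN opprK mulrCA [sin _ * _]mulrC.
have cp2 : continuous (fun v => ph v + pi / 2) by apply: contD => //; exact: contC.
have t1 : tame X (fun v => s * (b v * cos (ph v))) by apply: tameZ; exact: tame_cos.
have t2 : tame X (fun v => 'D_d b v * cos (ph v + pi / 2)) by apply: (@tame_cos _ (fun v => ph v + pi / 2)).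
have := hi (fun v => b v * sin (ph v)).
rewrite E (IntB t1 t2) => h; apply/eqP; rewrite -subr_eq0 /osc -IntZ//; last exact: tame_cos.
rewrite h//.
- by move=> v; exact: dM.
- apply: contB; last by apply: contM => //; exact: cont_cos.
  by apply: contM; [exact: contC|apply: contM => //; exact: cont_cos].
- under eq_fun do rewrite mulrC.
  apply: (tameMb (C := 1)) => //; last by move=> v; exact: sin_le1.
  exact/cont_meas/cont_sin.
- exact: tameB.
Qed.
End Osc.
End Space.
End DerivativeCalculus.

(** * Families of functions whose derivatives are bounded by a weight *)

Section SymbolCalculus.
Local Open Scope classical_set_scope.
Local Open Scope ring_scope.
Variables (R : realType) (V : normedModType R) (D : Type) (e : D -> V).

(* [cls K F om]: all derivatives of order at most [K] of the family [F] in the directions [e] are bounded by constant multiples of [om], uniformly in the family. *)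
Fixpoint cls (I : Type) K (F om : I -> V -> R) : Prop :=
  [/\ forall i, continuous (F i), exists2 C, 0 <= C & forall i v, `|F i v| <= C * om i v &
  if K is K'.+1 then forall d, (forall i v, derivable (F i) v (e d)) /\ cls K' (fun i => 'D_(e d) (F i)) om
  else True].

Section Fam.
Variable I : Type.
Implicit Types (F G om : I -> V -> R).

Lemma cls_cont K F om : cls K F om -> forall i, continuous (F i).
Proof. by case: K => [|K] []. Qed.
Lemma cls_bnd K F om : cls K F om -> exists2 C, 0 <= C & forall i v, `|F i v| <= C * om i v.
Proof. by case: K => [|K] []. Qed.
Lemma cls_d K F om : cls K.+1 F om -> forall d i v, derivable (F i) v (e d).
Proof. by move=> [_ _ h] d; have [] := h d. Qed.
Lemma cls_D K F om d : cls K.+1 F om -> cls K (fun i => 'D_(e d) (F i)) om.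
Proof. by move=> [_ _ h]; have [] := h d. Qed.
Lemma cls_low K K' F om : (K' <= K)%N -> cls K F om -> cls K' F om.
Proof.
elim: K' K F => [|K' IH] [|K] F//=.
  by move=> _ [h1 h2 _].
move=> h [h1 h2 h3]; split=> // d; have [h4 h5] := h3 d; split=> //.
exact: IH h h5.
Qed.
Lemma cls_le K F om om' A : 0 <= A -> (forall i v, om i v <= A * om' i v) -> cls K F om -> cls K F om'.
Proof.
move=> A0 h; elim: K F => [|K IH] F [h1 [C C0 hC] h3]; split=> //.
- exists (C * A); first exact: mulr_ge0.
  by move=> i v; rewrite (le_trans (hC i v))// -mulrA ler_wpM2l.
- exists (C * A); first exact: mulr_ge0.
  by move=> i v; rewrite (le_trans (hC i v))// -mulrA ler_wpM2l.
- by move=> d; have [h4 h5] := h3 d; split=> //; exact: IH.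
Qed.
Lemma cls_reindex K F om (J : Type) (r : J -> I) : cls K F om -> cls K (fun j => F (r j)) (fun j => om (r j)).
Proof.
elim: K F => [|K IH] F [h1 [C C0 hC] h3]; split=> //; try by exists C.
by move=> d; have [h4 h5] := h3 d; split=> [j v|]; [exact: h4|exact: (IH (fun i => 'D_(e d) (F i)))].
Qed.
Lemma clsD K F G om : cls K F om -> cls K G om -> cls K (fun i v => F i v + G i v) om.
Proof.
elim: K F G => [|K IH] F G [h1 [C C0 hC] h3] [k1 [C' C'0 hC'] k3].
  split => //; first by move=> i; exact: contD.
  exists (C + C'); first exact: addr_ge0.
  by move=> i v; rewrite (le_trans (ler_normD _ _))// mulrDl lerD.
split => //; first by move=> i; exact: contD.
  exists (C + C'); first exact: addr_ge0.
  by move=> i v; rewrite (le_trans (ler_normD _ _))// mulrDl lerD.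
move=> d; have [h4 h5] := h3 d; have [k4 k5] := k3 d; split => [i v|]; first exact: dD.
by under eq_fun do rewrite DD//; exact: IH.
Qed.
Lemma clsN K F om : cls K F om -> cls K (fun i v => - F i v) om.
Proof.
elim: K F => [|K IH] F [h1 [C C0 hC] h3]; split => //; try by move=> i; exact: contN.
- by exists C => // i v; rewrite normrN.
- by exists C => // i v; rewrite normrN.
move=> d; have [h4 h5] := h3 d; split => [i v|]; first exact: dN.
by under eq_fun do rewrite DN//; exact: IH.
Qed.
Lemma clsB K F G om : cls K F om -> cls K G om -> cls K (fun i v => F i v - G i v) om.
Proof. by move=> h k; apply: clsD => //; exact: clsN. Qed.
Lemma clsM K F G om om' : (forall i v, 0 <= om i v) -> cls K F om -> cls K G om' ->
  cls K (fun i v => F i v * G i v) (fun i v => om i v * om' i v).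
Proof.
move=> o0; elim: K F G om om' o0 => [|K IH] F G om om' o0 hF hG.
  have [h1 [C C0 hC] _] := hF; have [k1 [C' C'0 hC'] _] := hG.
  split => //; first by move=> i; exact: contM.
  exists (C * C'); first exact: mulr_ge0.
  by move=> i v; rewrite normrM mulrACA ler_pM.
have [h1 [C C0 hC] h3] := hF; have [k1 [C' C'0 hC'] k3] := hG.
split => //; first by move=> i; exact: contM.
  exists (C * C'); first exact: mulr_ge0.
  by move=> i v; rewrite normrM mulrACA ler_pM.
move=> d; have [h4 h5] := h3 d; have [k4 k5] := k3 d; split => [i v|]; first exact: dM.
under eq_fun do rewrite DM//.
apply: clsD; first exact: (IH _ _ _ _ _ (cls_low (leqnSn K) hF) k5).
under eq_fun do under eq_fun do rewrite mulrC.
exact: (IH _ _ _ _ _ h5 (cls_low (leqnSn K) hG)).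
Qed.
Lemma cls_cst K (c : I -> R) om : (forall i v, `|c i| <= om i v) -> cls K (fun i _ => c i) om.
Proof.
move=> h; suff H c' : (forall i v, `|c' i| <= om i v) -> cls K (fun i _ => c' i) om by exact: H.
elim: K c' => [|K IH] c' h'; split => //; try (by move=> i; exact: contC).
- by exists 1 => // i v; rewrite mul1r.
- by exists 1 => // i v; rewrite mul1r.
move=> d; split => [i v|]; first exact: dC.
under eq_fun do rewrite DC; apply: (IH (fun=> 0)) => i v.
by rewrite normr0 (le_trans _ (h i v)).
Qed.
(** The derivative [- F' / F ^+ 2] is bounded by [om / om ^+ 2], hence by the same weight [om^-1],
    and the induction on the order closes. *)
Lemma clsV K F om : (forall i v, 0 < om i v) -> cls K F om ->
  (exists2 c, 0 < c & forall i v, c * om i v <= `|F i v|) ->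
  cls K (fun i v => (F i v)^-1) (fun i v => (om i v)^-1).
Proof.
move=> o0 hF [c c0 hc].
have F0 i v : F i v != 0 by rewrite -normr_gt0 (lt_le_trans _ (hc i v))// mulr_gt0.
have bd : exists2 C, 0 <= C & forall i v, `|(F i v)^-1| <= C * (om i v)^-1.
  exists c^-1; first by rewrite invr_ge0 ltW.
  by move=> i v; rewrite normfV -invfM lef_pV2 ?posrE ?mulr_gt0 ?normr_gt0// [om i v * _]mulrC.
elim: K hF => [|K IH] hF.
  by split => // i; apply: contV => //; exact: (cls_cont hF).
split => //; first by move=> i; apply: contV => //; exact: (cls_cont hF).
move=> d; have [_ _ h3] := hF; have [h4 h5] := h3 d; split => [i v|]; first exact: dV.
under eq_fun do rewrite DV//.
apply: clsN; have hV := IH (cls_low (leqnSn K) hF).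
have i0 i v : 0 <= (om i v)^-1 by rewrite invr_ge0 ltW.
have H := clsM (fun i v => ltW (o0 i v)) h5 (clsM i0 hV hV).
apply: (cls_le ler01 _ H) => i v.
by rewrite mul1r mulrA mulfV ?mul1r// gt_eqF.
Qed.
Lemma clsX K F om k : (forall i v, 0 <= om i v) -> cls K F om -> cls K (fun i v => F i v ^+ k) (fun i v => om i v ^+ k).
Proof.
move=> o0 hF; elim: k => [|k IH].
  by under eq_fun do under eq_fun do rewrite expr0; apply: cls_cst => i v; rewrite ?expr0 normr1.
under eq_fun do under eq_fun do rewrite exprS.
under [X in cls _ _ X]eq_fun do under eq_fun do rewrite exprS.
exact: clsM.
Qed.
Lemma cls_prod K (J : Type) (s : seq J) (F om : J -> I -> V -> R) : (forall j i v, 0 <= om j i v) ->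
  (forall j, cls K (F j) (om j)) ->
  cls K (fun i v => \prod_(j <- s) F j i v) (fun i v => \prod_(j <- s) om j i v).
Proof.
move=> o0 h; elim: s => [|j s IH].
  under eq_fun do under eq_fun do rewrite big_nil.
  by apply: cls_cst => i v; rewrite big_nil normr1.
under eq_fun do under eq_fun do rewrite big_cons.
under [X in cls _ _ X]eq_fun do under eq_fun do rewrite big_cons.
exact: clsM.
Qed.
Lemma clsZ K F om (c : I -> R) : cls K F om -> cls K (fun i v => c i * F i v) (fun i v => `|c i| * om i v).
Proof. by move=> hF; apply: (@clsM _ (fun i _ => c i) F (fun i _ => `|c i|)) => //; exact: cls_cst. Qed.

(** Affine along each distinguished direction, with slope [a i d]. Slopes of size at most 1 keep the
    first derivatives below any weight that is at least 1. *)
Definition affine (a : I -> D -> R) (l : I -> V -> R) :=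
  [/\ forall i, continuous (l i), forall i d, `|a i d| <= 1 &
   forall i d (h : R) v, l i (h *: e d + v) = h * a i d + l i v].

Lemma cls_affine K a l om : affine a l -> (forall i v, 1 <= om i v) -> (forall i v, `|l i v| <= om i v) ->
  cls K l om.
Proof.
move=> [cl ha hl] o1 lo.
have bd : exists2 C, 0 <= C & forall i v, `|l i v| <= C * om i v.
  by exists 1 => // i v; rewrite mul1r.
case: K => [|K]; split => // d; split => [i v|].
  by have [] := D_ph_id (hl i d) v.
rewrite (_ : (fun i => 'D_(e d) (l i)) = fun i _ => a i d); last first.
  by apply/funext => i; apply/funext => v; have [] := D_ph_id (hl i d) v.
by apply: cls_cst => i v; rewrite (le_trans (ha i d)).
Qed.

(** A derivative of [l ^+ 2] is [2 a l], and [|l| <= om] follows from [l ^+ 2 <= om] and [1 <= om].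
    A quadratic form that is at least 1 can thus serve as its own weight. *)
Lemma cls_quad K (J : Type) (s : seq J) (a : J -> I -> D -> R) (l : J -> I -> V -> R) (c : I -> R) om :
  (forall j, affine (a j) (l j)) -> (forall i, 0 <= c i) -> (forall i v, 1 <= om i v) ->
  (forall i v, c i + \sum_(j <- s) l j i v ^+ 2 <= om i v) ->
  cls K (fun i v => c i + \sum_(j <- s) l j i v ^+ 2) om.
Proof.
move=> hl c0 o1 ho.
have Q0 i v : 0 <= c i + \sum_(j <- s) l j i v ^+ 2.
  by rewrite addr_ge0// sumr_ge0// => j _; exact: sqr_ge0.
have hs : forall s', (forall i v, \sum_(j <- s') l j i v ^+ 2 <= om i v) ->
    cls K (fun i v => \sum_(j <- s') l j i v ^+ 2) om.
  elim => [|j s' IH] hs'.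
    by under eq_fun do under eq_fun do rewrite big_nil; apply: cls_cst => i v; rewrite normr0 (le_trans _ (o1 i v)).
  under eq_fun do under eq_fun do rewrite big_cons.
  have hj i v : l j i v ^+ 2 <= om i v.
    by apply: le_trans (hs' i v); rewrite big_cons lerDl sumr_ge0// => k _; exact: sqr_ge0.
  apply: clsD; last first.
    apply: IH => i v; apply: le_trans (hs' i v); rewrite big_cons lerDr sqr_ge0//.
  have [cl ha hl'] := hl j.
  have lj i v : `|l j i v| <= om i v.
    have := hj i v; have := o1 i v; rewrite -real_normK ?num_real//.
    have := normr_ge0 (l j i v); nra.
  have bd : exists2 C, 0 <= C & forall i v, `|l j i v ^+ 2| <= C * om i v.
    by exists 1 => // i v; rewrite mul1r ger0_norm ?sqr_ge0.
  have cc i : continuous (fun v => l j i v ^+ 2) by exact: contX.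
  case: (K) => [|K']; split => // d.
  have dl i v : derivable (l j i) v (e d) by have [] := D_ph_id (hl' i d) v.
  have -> : (fun i => 'D_(e d) (fun v => l j i v ^+ 2)) = fun i v => (a j i d + a j i d) * l j i v.
    apply/funext => i; under [X in 'D__ X]eq_fun do rewrite expr2.
    rewrite DM//; apply/funext => v; have [_ ->] := D_ph_id (hl' i d) v.
    by rewrite mulrDl mulrC.
  split => [i v|].
    by under eq_fun do rewrite expr2; exact: dM.
  have := clsZ (fun i => a j i d + a j i d) (cls_affine K' (hl j) o1 lj).
  apply: (@cls_le _ _ _ _ 2) => // i v; rewrite ler_wpM2r//; first by rewrite (le_trans _ (o1 i v)).
  rewrite (le_trans (ler_normD _ _))//; have := ha i d; lra.
apply: clsD.
  apply: cls_cst => i v; rewrite ger0_norm//; apply: le_trans (ho i v).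
  by rewrite lerDl sumr_ge0// => k _; exact: sqr_ge0.
apply: hs => i v; apply: le_trans (ho i v); rewrite lerDr//.
Qed.

Lemma cls_w1 K a l : affine a l -> cls K (fun i v => w1 (l i v)) (fun i v => w1 (l i v)).
Proof.
move=> hl; apply: (@clsV K (fun i v => 1 + l i v ^+ 2) (fun i v => 1 + l i v ^+ 2)).
- by move=> i v; exact: w1_den.
- have E : (fun i v => 1 + \sum_(j <- [:: tt]) l i v ^+ 2) = fun i v => 1 + l i v ^+ 2.
    by apply/funext => i; apply/funext => v; rewrite big_seq1.
  rewrite -[X in cls _ X _]E; apply: (@cls_quad K unit [:: tt] (fun=> a) (fun=> l) (fun=> 1)) => // i v.
    by rewrite lerDl sqr_ge0.
  by rewrite big_seq1.
- by exists 1 => // i v; rewrite mul1r ler_norm.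
Qed.
End Fam.
End SymbolCalculus.
Arguments cls_cont {R V D e I K F om} _ _.
Arguments cls_d {R V D e I K F om} _ _ _ _.

(** * Decay of oscillatory integrals, and operators dual to multiplication of the kernel *)

Section SlicesAndOscillation.
Local Open Scope classical_set_scope.
Local Open Scope ring_scope.
Variables (R : realType) (V U : normedModType R) (D D' : Type) (e : D -> V) (e' : D' -> U) (g : D' -> D).

(** The index of the new family records the slice, which makes the bounds uniform over all slices.
    The map [L j] sends the direction [e' d] to [e (g d)], so derivatives on the slice are
    restrictions of derivatives. *)
Lemma cls_slice (I J : Type) (r : J -> I) (L : J -> U -> V) K (F om : I -> V -> R) :
  (forall j, continuous (L j)) ->
  (forall j d (h : R) u, L j (h *: e' d + u) = h *: e (g d) + L j u) ->
  cls e K F om -> cls e' K (fun j u => F (r j) (L j u)) (fun j u => om (r j) (L j u)).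
Proof.
move=> cL hL; elim: K F => [|K IH] F [h1 [C C0 hC] h3]; split=> //.
- by move=> j; exact: (cont_comp (cL j) (h1 _)).
- by exists C.
- by move=> j; exact: (cont_comp (cL j) (h1 _)).
- by exists C.
move=> d; have [h4 h5] := h3 (g d); split => [j u|].
  exact: (derivable_shift (hL j d)).
rewrite (_ : (fun j => 'D_(e' d) (fun u => F (r j) (L j u))) = fun j u => 'D_(e (g d)) (F (r j)) (L j u)).
  exact: (IH (fun i => 'D_(e (g d)) (F i))).
by apply/funext => j; apply/funext => u; exact: (derive_shift _ _ (hL j d)).
Qed.

Section Decay.
Variables (X : wspace R U) (I : Type) (om : I -> U -> R).
Hypotheses (hibp : forall d, ibp X (e' d)) (tom : forall i, tame X (om i)).

Lemma cls_tame K F : cls e' K F om -> forall i, tame X (F i).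
Proof.
move=> hF i; have [C C0 hC] := cls_bnd hF.
by apply: (tame_le _ (tom i) (hC i)); apply/cont_meas; exact: (cls_cont hF).
Qed.

Lemma osc_shift_pi (b ph : U -> R) : tame X b -> continuous ph ->
  osc X b (fun v => ph v + pi / 2 + pi / 2) = - osc X b ph.
Proof.
move=> tb cp; rewrite /osc -IntN; last exact: tame_cos.
congr Int; apply/funext => v.
by rewrite -addrA -splitr cosDpi mulrN.
Qed.

(** Two integrations by parts shift the phase by half a period, which is the minus sign before the
    second derivative; adding the integral itself gives a factor that never vanishes. *)
Lemma osc_D2 (F : I -> U -> R) i (ph : U -> R) d (s : R) : cls e' 2 F om -> continuous ph ->
  (forall (h : R) v, ph (h *: e' d + v) = h * s + ph v) ->
  (1 + s ^+ 2) * osc X (F i) ph = osc X (fun v => F i v - 'D_(e' d) ('D_(e' d) (F i)) v) ph.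
Proof.
move=> hF cp hp.
have hD := cls_D d hF; have hDD := cls_D d hD.
have cp2 : continuous (fun v => ph v + pi / 2) by apply: contD => //; exact: contC.
have hp2 : forall (h : R) v, ph (h *: e' d + v) + pi / 2 = h * s + (ph v + pi / 2).
  by move=> h v; rewrite hp addrA.
have e1 : s * osc X (F i) ph = osc X ('D_(e' d) (F i)) (fun v => ph v + pi / 2).
  by apply: osc_D => //; [exact: (cls_cont hF)|exact: cls_tame hF i|exact: (cls_d hF)|exact: (cls_cont hD)|exact: cls_tame hD i].
have e2 : s * osc X ('D_(e' d) (F i)) (fun v => ph v + pi / 2) =
    osc X ('D_(e' d) ('D_(e' d) (F i))) (fun v => ph v + pi / 2 + pi / 2).
  by apply: osc_D => //; [exact: (cls_cont hD)|exact: cls_tame hD i|exact: (cls_d hD)|exact: (cls_cont hDD)|exact: cls_tame hDD i].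
rewrite mulrDl mul1r expr2 -mulrA e1 e2 osc_shift_pi//; last exact: cls_tame hDD i.
rewrite /osc -IntB; [|by apply: tame_cos => //; exact: cls_tame hF i|by apply: tame_cos => //; exact: cls_tame hDD i].
by congr Int; apply/funext => v; rewrite mulrBl.
Qed.

(** Each entry of [ds] costs two derivatives and gains one factor. Directions may be repeated, and
    the constant depends neither on the phase nor on the member of the family. *)
Lemma osc_decay (F : I -> U -> R) (ds : seq D') : cls e' (2 * size ds) F om ->
  exists2 C, 0 <= C & forall i (ph : U -> R) (s : D' -> R), continuous ph ->
    (forall d (h : R) v, ph (h *: e' d + v) = h * s d + ph v) ->
    `|osc X (F i) ph| <= C * Int X (om i) * \prod_(d <- ds) (1 + s d ^+ 2)^-1.
Proof.
elim: ds F => [|d ds IH] F hF.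
  have [C C0 hC] := cls_bnd hF; exists C => // i ph s cp _.
  rewrite big_nil mulr1; apply: osc_le => //; exact: (cls_cont hF).
have sz : (2 * size (d :: ds) = (2 * size ds).+2)%N by rewrite /= mulnS.
rewrite sz in hF.
have hD2 := cls_D d (cls_D d hF).
have hG := clsB (cls_low (leq_trans (leqnSn _) (leqnSn _)) hF) hD2.
have [C C0 hC] := IH _ hG; exists C => // i ph s cp hp.
have := hC i ph s cp hp.
rewrite -(osc_D2 i (cls_low _ hF) cp (hp d)) // normrM big_cons (ger0_norm (ltW (w1_den _))).
by move=> h; rewrite [X in _ <= _ * X]mulrC [leRHS]mulrA ler_pdivlMr ?w1_den// mulrC.
Qed.
End Decay.

Section Kernel.
Variables (I : Type) (s : D -> I -> V -> R) (a : D -> I -> D -> R).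
Hypothesis hs : forall d, affine e (a d) (s d).
Implicit Types b : bool -> I -> V -> R.

(* The pair [b] stands for the complex symbol [b false + i b true], and [Mop d] for [i D_d - s d]: this operator is dual to multiplication of the kernel by its phase slope minus [s d]. *)
Definition Mop d b u i v := (if u then 'D_(e d) (b false i) v else - 'D_(e d) (b true i) v) - s d i v * b u i v.
(** The operator [1 + Mop d ^ 2]. It is dual to a factor [1 + (slope - s d) ^ 2], which is at least
    1 and can be divided by. *)
Definition Lop d b u i v := b u i v + Mop d (Mop d b) u i v.
Definition LLop ds b := foldr Lop b ds.

(** The affine function [s d] and its derivatives are bounded by [1 + s d ^+ 2]; this is the factor
    lost at each application of [Mop d]. *)
Lemma cls_Mop K b om d : (forall i v, 0 <= om i v) -> (forall u, cls e K.+1 (b u) om) ->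
  forall u, cls e K (Mop d b u) (fun i v => (1 + s d i v ^+ 2) * om i v).
Proof.
move=> o0 hb u.
have s1 i v : 1 <= 1 + s d i v ^+ 2 by rewrite lerDl sqr_ge0.
have low G : cls e K G om -> cls e K G (fun i v => (1 + s d i v ^+ 2) * om i v).
  by apply: (cls_le ler01) => i v; rewrite mul1r ler_peMl.
apply: clsB.
  case: u; first by apply: low; exact: cls_D.
  by apply: low; apply: clsN; exact: cls_D.
apply: clsM; last exact: (cls_low (leqnSn _) (hb u)).
- by move=> i v; exact: le_trans (s1 i v).
- apply: (cls_affine _ (hs d)) => // i v; rewrite -real_normK ?num_real//.
  have := normr_ge0 (s d i v); have := sqr_ge0 (`|s d i v| - 1); nra.
Qed.

Lemma cls_Lop K b om d : (forall i v, 0 <= om i v) -> (forall u, cls e K.+2 (b u) om) ->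
  forall u, cls e K (Lop d b u) (fun i v => (1 + s d i v ^+ 2) ^+ 2 * om i v).
Proof.
move=> o0 hb u.
have s1 i v : 1 <= 1 + s d i v ^+ 2 by rewrite lerDl sqr_ge0.
apply: clsD.
  apply: (cls_le ler01 _ (cls_low _ (hb u))) => [i v|]; last by rewrite (leq_trans (leqnSn _)).
  by rewrite mul1r ler_peMl// exprn_ege1.
have := cls_Mop d (om := fun i v => (1 + s d i v ^+ 2) * om i v) _ (cls_Mop d o0 hb).
under [X in _ -> forall u, cls _ _ _ X]eq_fun do under eq_fun do rewrite mulrA -expr2.
apply=> i v; rewrite mulr_ge0// (le_trans _ (s1 i v))//.
Qed.

Lemma cls_LLop K b om ds : (forall i v, 0 <= om i v) -> (forall u, cls e (K + 2 * size ds) (b u) om) ->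
  forall u, cls e K (LLop ds b u) (fun i v => (\prod_(d <- ds) (1 + s d i v ^+ 2) ^+ 2) * om i v).
Proof.
move=> o0; elim: ds K => [|d ds IH] K hb u.
  rewrite /= muln0 addn0 in hb.
  by under [X in cls _ _ _ X]eq_fun do under eq_fun do rewrite big_nil mul1r; exact: hb.
under [X in cls _ _ _ X]eq_fun do under eq_fun do rewrite big_cons -mulrA.
apply: cls_Lop => [i v|].
  by rewrite mulr_ge0// prodr_ge0// => k _; rewrite exprn_ge0// ltW// w1_den.
by apply: (IH K.+2) => w; move: (hb w); rewrite /= mulnS addnA addn2.
Qed.

Section AtPoint.
Variables (X : wspace R U) (i : I) (L : U -> V) (s0 : D -> R).
Hypotheses (hibp : forall d, ibp X (e' d)) (cL : continuous L)
  (hL : forall d (h : R) u, L (h *: e' d + u) = h *: e (g d) + L u)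
  (hs0 : forall d u, s d i (L u) = s0 d).

(** Real part of the integral of the complex symbol times [exp (i ph)] over the slice [L]. *)
Definition RK b (ph : U -> R) : R := Int X (fun u => b false i (L u) * cos (ph u) - b true i (L u) * sin (ph u)).

Lemma RKE b ph : continuous ph -> (forall w, tame X (fun u => b w i (L u))) ->
  RK b ph = osc X (fun u => b false i (L u)) ph + osc X (fun u => b true i (L u)) (fun u => ph u + pi / 2).
Proof.
move=> cp tb; rewrite /RK /osc -IntD; last 2 first.
- exact: tame_cos.
- by apply: (@tame_cos _ _ _ _ (fun u => ph u + pi / 2)) => //; apply: contD => //; exact: contC.
congr Int; apply/funext => u; rewrite cosD cos_pihalf sin_pihalf mulr0 sub0r mulr1 mulrN//.
Qed.

(** Integration by parts turns the slope [sg d] of the phase into a derivative of the symbol; [s0]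
    can be subtracted under the integral because [s] is constant along the slice. *)
Lemma RK_M b om d (ph : U -> R) (sg : D' -> R) : continuous ph ->
  (forall d (h : R) v, ph (h *: e' d + v) = h * sg d + ph v) ->
  tame X (fun u => om i (L u)) -> (forall u, cls e 1 (b u) om) ->
  (sg d - s0 (g d)) * RK b ph = RK (Mop (g d) b) ph.
Proof.
move=> cp hp tom hb.
have hbs w := cls_slice (fun _ : unit => i) (L := fun=> L) (fun=> cL) (fun=> hL) (hb w).
have tb w : tame X (fun u => b w i (L u)) by apply: (cls_tame (I := unit) (om := fun _ u => om i (L u)) _ (hbs w) tt).
have E w : 'D_(e' d) (fun u => b w i (L u)) = fun u => 'D_(e (g d)) (b w i) (L u).
  by apply/funext => u; exact: (derive_shift _ _ (hL d)).
have hDs w := cls_D d (hbs w).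
have tDb w : tame X (fun u => 'D_(e (g d)) (b w i) (L u)).
  by rewrite -E; apply: (cls_tame (I := unit) (om := fun _ u => om i (L u)) _ (hDs w) tt).
have cp2 : continuous (fun v => ph v + pi / 2) by apply: contD => //; exact: contC.
have hp2 : forall (h : R) v, ph (h *: e' d + v) + pi / 2 = h * sg d + (ph v + pi / 2).
  by move=> h v; rewrite hp addrA.
have st w (q : U -> R) : continuous q -> (forall (h : R) v, q (h *: e' d + v) = h * sg d + q v) ->
  sg d * osc X (fun u => b w i (L u)) q = osc X (fun u => 'D_(e (g d)) (b w i) (L u)) (fun v => q v + pi / 2).
  move=> cq hq; rewrite -E; have c1 := cls_cont (hbs w) tt; have c2 := cls_cont (hDs w) tt.
  have d1 v : derivable (fun u => b w i (L u)) v (e' d) := cls_d (hbs w) d tt v.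
  have t1 : tame X ('D_(e' d) (fun u => b w i (L u))) by rewrite E.
  exact: (osc_D (@hibp d) cq hq c1 (tb w) d1 c2 t1).
have tM w : tame X (fun u => Mop (g d) b w i (L u)).
  rewrite /Mop; under eq_fun do rewrite hs0; apply: tameB; last exact: tameZ.
  by case: w => //; exact: tameN.
rewrite mulrBl {1}(RKE cp tb) mulrDr (st _ _ cp (hp d)) (st _ _ cp2 hp2).
rewrite osc_shift_pi// /osc /RK.
have t1 : tame X (fun u => 'D_(e (g d)) (b false i) (L u) * cos (ph u + pi / 2)).
  exact: (@tame_cos _ _ _ _ (fun u => ph u + pi / 2)).
have t2 := tame_cos cp (tDb true).
have t3 : tame X (fun u => b false i (L u) * cos (ph u) - b true i (L u) * sin (ph u)).
  apply: tameB; first exact: tame_cos.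
  under eq_fun do rewrite mulrC.
  apply: (tameMb (C := 1)) => //; last by move=> v; exact: sin_le1.
  exact/cont_meas/cont_sin.
rewrite -IntB// -IntZ// -IntB//; [|exact: tameB|exact: tameZ].
congr Int; apply/funext => u; rewrite /Mop hs0 cosD cos_pihalf sin_pihalf mulr0 sub0r mulr1; ring.
Qed.

Lemma RK_L b om d (ph : U -> R) (sg : D' -> R) : continuous ph ->
  (forall d (h : R) v, ph (h *: e' d + v) = h * sg d + ph v) ->
  (forall j v, 0 <= om j v) ->
  tame X (fun u => om i (L u)) -> (forall u, cls e 2 (b u) om) ->
  (1 + (sg d - s0 (g d)) ^+ 2) * RK b ph = RK (Lop (g d) b) ph.
Proof.
move=> cp hp o0 tom hb.
have tom2 : tame X (fun u => (1 + s (g d) i (L u) ^+ 2) * om i (L u)).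
  by under eq_fun do rewrite hs0; exact: tameZ.
have e1 := RK_M d cp hp tom (fun u => cls_low (leqnSn 1) (hb u)).
have e2 := RK_M d cp hp (om := fun i v => (1 + s (g d) i v ^+ 2) * om i v) tom2 (cls_Mop (g d) o0 hb).
rewrite mulrDl mul1r expr2 -mulrA e1 e2.
have tb w : tame X (fun u => b w i (L u)).
  by apply: (cls_tame (I := unit) (om := fun _ u => om i (L u)) _
    (cls_slice (fun _ : unit => i) (L := fun=> L) (fun=> cL) (fun=> hL) (hb w)) tt).
have tom3 : tame X (fun u => (1 + s (g d) i (L u) ^+ 2) * ((1 + s (g d) i (L u) ^+ 2) * om i (L u))).
  by under eq_fun do rewrite hs0; apply: tameZ; exact: tameZ.
have hM2 := cls_Mop (g d) (K := 0) (om := fun i v => (1 + s (g d) i v ^+ 2) * om i v)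
   (fun j v => mulr_ge0 (ltW (w1_den _)) (o0 j v)) (cls_Mop (g d) o0 hb).
have tM w : tame X (fun u => Mop (g d) (Mop (g d) b) w i (L u)).
  by apply: (cls_tame (I := unit) (om := fun _ u => (1 + s (g d) i (L u) ^+ 2) * ((1 + s (g d) i (L u) ^+ 2) * om i (L u))) _
    (cls_slice (fun _ : unit => i) (L := fun=> L) (fun=> cL) (fun=> hL) (hM2 w)) tt).
have T F : (forall w, tame X (F w)) -> tame X (fun u => F false u * cos (ph u) - F true u * sin (ph u)).
  move=> tF; apply: tameB; first exact: tame_cos.
  under eq_fun do rewrite mulrC.
  apply: (tameMb (C := 1)) => //; last by move=> v; exact: sin_le1.
  exact/cont_meas/cont_sin.
rewrite /RK -IntD; [|exact: (T (fun w u => b w i (L u)))|exact: (T (fun w u => Mop (g d) (Mop (g d) b) w i (L u)))].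
by congr Int; apply/funext => u; rewrite /Lop; ring.
Qed.

Lemma RK_LL b om ds (ph : U -> R) (sg : D' -> R) : continuous ph ->
  (forall d (h : R) v, ph (h *: e' d + v) = h * sg d + ph v) ->
  (forall j v, 0 <= om j v) ->
  tame X (fun u => om i (L u)) -> (forall u, cls e (2 * size ds) (b u) om) ->
  (\prod_(d <- ds) (1 + (sg d - s0 (g d)) ^+ 2)) * RK b ph = RK (LLop (map g ds) b) ph.
Proof.
move=> cp hp o0 tom; elim: ds => [|d ds IH] hb; first by rewrite big_nil mul1r.
rewrite [size _]/= mulnS in hb.
rewrite big_cons -mulrA IH => [|u]; last by apply: (cls_low _ (hb u)); rewrite leq_addl.
have hb' := cls_LLop (K := 2) (ds := map g ds) o0.
rewrite size_map in hb'.
apply: (RK_L d cp hp _ _ (hb' _ hb)) => [j v|].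
  by rewrite mulr_ge0// prodr_ge0// => k _; rewrite exprn_ge0// ltW// w1_den.
under eq_fun do under eq_bigr do rewrite hs0.
exact: tameZ.
Qed.
End AtPoint.
End Kernel.
End SlicesAndOscillation.

(** * Inequalities for integrals, and the cosine transform of the weight *)

Section IntegralInequalities.
Local Open Scope classical_set_scope.
Local Open Scope ring_scope.
Variable R : realType.

Lemma meas_pull (V1 V2 : topologicalType) (X1 : wspace R V1) (X2 : wspace R V2)
  (k : ws_T X1 -> ws_T X2) (m : V1 -> V2) F : measurable_fun setT k ->
  (forall t, ws_phi (k t) = m (ws_phi t)) -> meas X2 F -> meas X1 (fun v => F (m v)).
Proof.
move=> mk hk mF; rewrite /meas (_ : _ \o _ = (F \o @ws_phi _ _ X2) \o k).
  exact: measurableT_comp mF mk.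
by apply/funext => t /=; rewrite hk.
Qed.

(** The square of an integral over [y] is a double integral over [(y, y')], and Fubini puts the
    integration in [x] innermost, where cancellation can be exploited. The product bound on [G]
    makes the triple integrand tame. *)
Lemma ttstar (V1 V2 : topologicalType) (X : wspace R V1) (Y : wspace R V2) (G : V1 -> V2 -> R) (A : V1 -> R) :
  meas (prodw X Y) (fun p => G p.1 p.2) -> (forall x y, `|G x y| <= A x * ws_w Y y) ->
  (forall x, 0 <= A x) -> tame X (fun x => A x ^+ 2) ->
  meas (prodw Y Y) (fun p => Int X (fun x => G x p.1 * G x p.2)) /\
  Int X (fun x => (Int Y (G x)) ^+ 2) = Int (prodw Y Y) (fun p => Int X (fun x => G x p.1 * G x p.2)).
Proof.
move=> mG hG A0 tA.
have m1 : meas (prodw X (prodw Y Y)) (fun p => G p.1 p.2.1).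
  apply: (@meas_pull _ _ (prodw X (prodw Y Y)) (prodw X Y) (fun t : ws_T X * (ws_T Y * ws_T Y) => (t.1, t.2.1))
    (fun p : V1 * (V2 * V2) => (p.1, p.2.1)) (fun p : V1 * V2 => G p.1 p.2)) => //.
  apply: measurable_fun_pair; first exact: measurable_fst.
  exact: measurableT_comp measurable_fst measurable_snd.
have m2 : meas (prodw X (prodw Y Y)) (fun p => G p.1 p.2.2).
  apply: (@meas_pull _ _ (prodw X (prodw Y Y)) (prodw X Y) (fun t : ws_T X * (ws_T Y * ws_T Y) => (t.1, t.2.2))
    (fun p : V1 * (V2 * V2) => (p.1, p.2.2)) (fun p : V1 * V2 => G p.1 p.2)) => //.
  apply: measurable_fun_pair; first exact: measurable_fst.
  exact: measurableT_comp measurable_snd measurable_snd.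
have tGG : tame (prodw X (prodw Y Y)) (fun p => G p.1 p.2.1 * G p.1 p.2.2).
  split; first exact: measM.
  have [_ [C hC]] := tA; exists C => p; rewrite normrM.
  apply: (le_trans (ler_pM _ _ (hG _ _) (hG _ _))) => //.
  rewrite /= mulrACA -expr2 [leRHS]mulrA ler_wpM2r ?mulr_ge0 ?ws_w_ge0//.
  by apply: le_trans (ler_norm _) (hC _).
split; first exact: (@meas_Int2 _ _ _ X (prodw Y Y) _ tGG.1).
rewrite -(@Int_swap _ _ _ X (prodw Y Y) (fun x p => G x p.1 * G x p.2) tGG).
apply: eq_Rintegral => t _.
have tG : tame Y (G (ws_phi t)).
  split; first exact: (meas_slice1 mG t).
  by exists (A (ws_phi t)) => v; exact: hG.
rewrite -[RHS]/(Int (prodw Y Y) (fun p => G (ws_phi t) p.1 * G (ws_phi t) p.2)).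
rewrite (Int_prod12 (tame_prod tG tG)) /= expr2.
have -> : (fun x => Int Y (fun y => G (ws_phi t) x * G (ws_phi t) y)) = fun x => G (ws_phi t) x * Int Y (G (ws_phi t)).
  by apply/funext => x; rewrite IntZ.
by rewrite IntZr.
Qed.

Section Hoelder.
Variables (V : topologicalType) (X : wspace R V).

(** Weighted arithmetic-geometric inequality, normalized at [A] and [B]: when these are the
    integrals of [u] and [v], the last factor integrates to 1. *)
Lemma powR_young (u v a A B : R) : 0 <= u -> 0 <= v -> 0 < A -> 0 < B -> 0 < a -> a < 1 ->
  powR u a * powR v (1 - a) <= powR A a * powR B (1 - a) * (a * (u / A) + (1 - a) * (v / B)).
Proof.
move=> u0 v0 A0 B0 a0 a1.
have b0 : 0 < 1 - a by rewrite subr_gt0.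
have hu : powR u a = powR A a * powR (u / A) a.
  by rewrite -(powRM _ (ltW A0) (divr_ge0 u0 (ltW A0))) mulrC divfK// gt_eqF.
have hv : powR v (1 - a) = powR B (1 - a) * powR (v / B) (1 - a).
  by rewrite -(powRM _ (ltW B0) (divr_ge0 v0 (ltW B0))) mulrC divfK// gt_eqF.
rewrite hu hv mulrACA ler_wpM2l ?mulr_ge0 ?powR_ge0//.
have := @conjugate_powR R (powR (u / A) a) (powR (v / B) (1 - a)) a^-1 (1 - a)^-1 (powR_ge0 _ _) (powR_ge0 _ _).
rewrite !invrK !invr_gt0 => /(_ a0 b0); rewrite addrC subrK => /(_ erefl).
have d1 := divr_ge0 u0 (ltW A0); have d2 := divr_ge0 v0 (ltW B0).
by rewrite -!powRrM !mulfV ?gt_eqF// !powRr1// [_ / A * _]mulrC [_ / B * _]mulrC.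
Qed.

Lemma Int_eq0_powR (u : V -> R) (G : V -> R) : tame X u -> (forall v, 0 <= u v) -> Int X u = 0 ->
  meas X G -> (forall v, u v = 0 -> G v = 0) -> Int X G = 0.
Proof.
move=> tu u0 iu mG hG; rewrite Int_Eint.
have E : Eint X (fun v => (u v)%:E) = 0%E by rewrite EintE// iu.
have : (\int[@ws_mu _ _ X]_t `|(u (ws_phi t))%:E|)%E = 0%E.
  by under eq_integral do rewrite gee0_abs ?lee_fin//.
move/(ae_eq_integral_abs _ measurableT (measE tu.1)).1 => ae0.
rewrite /Eint (ae_eq_integral (fun=> 0%E))//.
- by rewrite integral0.
- exact: measE.
- apply: filterS ae0 => t h _; move: (h I) => /= [] h'.
  by rewrite hG.
Qed.

(** The exponents stand on integrals and not on norms, so the inequality can be used for every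
    [r > 0], including [r < 1]. Vanishing integrals are treated apart since the normalization
    divides by them. *)
Lemma hoelderH (a : R) (u v G : V -> R) : 0 <= a -> a <= 1 -> tame X u -> tame X v -> tame X G ->
  (forall x, 0 <= u x) -> (forall x, 0 <= v x) ->
  (forall x, G x <= powR (u x) a * powR (v x) (1 - a)) ->
  Int X G <= powR (Int X u) a * powR (Int X v) (1 - a).
Proof.
move=> a0 a1 tu tv tG u0 v0 hG.
have [ae0|an0] := eqVneq a 0.
  rewrite ae0 powRr0 subr0 mul1r powRr1 ?Int_ge0//; apply: le_Int => // x.
  by rewrite (le_trans (hG x))// ae0 powRr0 subr0 mul1r powRr1.
have [ae1|an1] := eqVneq a 1.
  rewrite ae1 subrr powRr0 mulr1 powRr1 ?Int_ge0//; apply: le_Int => // x.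
  by rewrite (le_trans (hG x))// ae1 subrr powRr0 mulr1 powRr1.
have {an0}a0' : 0 < a by rewrite lt_neqAle eq_sym an0.
have {an1}a1' : a < 1 by rewrite lt_neqAle an1.
have b0 : 0 < 1 - a by rewrite subr_gt0.
pose G' x := powR (u x) a * powR (v x) (1 - a).
have mG' : meas X G' by apply: measM; apply: meas_powR; [exact: tu.1|exact: tv.1].
have G'0 x : 0 <= G' x by rewrite mulr_ge0// powR_ge0.
have tG' : tame X G'.
  apply: (tame_le (C := 1) mG' (tameD tu tv)) => x; rewrite ger0_norm// mul1r.
  apply: le_trans (powR_young (u0 x) (v0 x) ltr01 ltr01 a0' a1') _.
  rewrite !powR1 !mul1r !divr1; have := u0 x; have := v0 x; nra.
apply: (@le_trans _ _ (Int X G')); first exact: le_Int.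
have [u00|un0] := eqVneq (Int X u) 0.
  rewrite u00 (Int_eq0_powR tu u0 u00 mG') ?mulr_ge0 ?powR_ge0// => x ux.
  by rewrite /G' ux powR0 ?mul0r// gt_eqF.
have [v00|vn0] := eqVneq (Int X v) 0.
  rewrite v00 (Int_eq0_powR tv v0 v00 mG') ?mulr_ge0 ?powR_ge0// => x vx.
  by rewrite /G' vx powR0 ?mulr0// gt_eqF.
have A0 : 0 < Int X u by rewrite lt_neqAle eq_sym un0 Int_ge0.
have B0 : 0 < Int X v by rewrite lt_neqAle eq_sym vn0 Int_ge0.
set c := _ * _.
have tuv : tame X (fun x => a / Int X u * u x + (1 - a) / Int X v * v x) by apply: tameD; exact: tameZ.
apply: (@le_trans _ _ (Int X (fun x => c * (a / Int X u * u x + (1 - a) / Int X v * v x)))).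
  apply: le_Int => //; first exact: tameZ.
  move=> x; rewrite (le_trans (powR_young (u0 x) (v0 x) A0 B0 a0' a1'))// /c.
  by rewrite -!mulrA ![_^-1 * _]mulrC.
rewrite IntZ// IntD; [|exact: tameZ|exact: tameZ].
by rewrite !IntZ// !divfK ?gt_eqF// addrC subrK mulr1.
Qed.
End Hoelder.

Definition e1 n (i : 'I_n) : 'rV[R]_n := delta_mx 0 i.

Lemma affine_coord n (I : Type) (c : I -> R) (k : 'I_n) :
  affine (@e1 n) (fun _ d => (k == d)%:R) (fun i v => v 0 k - c i).
Proof.
split.
- by move=> i; apply: contB; [exact: coord_cont|exact: contC].
- by move=> i d; case: eqP => _; rewrite ?normr1 ?normr0.
- by move=> i d h v; rewrite shift_coord addrA.
Qed.

Lemma cls_wt n (I : Type) K p :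
  cls (@e1 n) K (fun (_ : I) v => wt v ^+ p) (fun _ v => wt v ^+ p).
Proof.
apply: clsX => [i v|]; first exact: wt_ge0.
have h1 (j : 'I_n) (i : I) (v : 'rV[R]_n) : 0 <= w1 (v 0 j) by exact: ltW (w1_gt0 _).
have h2 (j : 'I_n) : cls (@e1 n) K (fun (_ : I) v => w1 (v 0 j)) (fun _ v => w1 (v 0 j)).
  have := @cls_w1 _ _ _ _ I K _ _ (@affine_coord n I (fun=> 0) j).
  by rewrite (_ : (fun (i : I) (v : 'rV[R]_n) => w1 (v 0 j - 0)) = fun _ v => w1 (v 0 j))//;
     apply/funext => i; apply/funext => v; rewrite subr0.
exact: (@cls_prod _ _ _ _ I K _ (index_enum _) _ _ h1 h2).
Qed.

(** Two powers of the weight: one pays for a translation through [wt_conv], the other remains for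
    integrability. *)
Definition nice n (F : 'rV[R]_n -> R) := continuous F /\ exists C, forall v, `|F v| <= C * wt v ^+ 2.

Lemma tame_wt n p : tame (Vw R n) (fun v => wt v ^+ p.+1).
Proof.
split; first by apply/cont_meas; apply: contX; exact: wt_cont.
exists 1 => v; rewrite Vw_w mul1r ger0_norm ?exprn_ge0 ?wt_ge0//.
by rewrite exprS ler_piMr ?wt_ge0// exprn_ile1 ?wt_ge0 ?wt_le1.
Qed.

Lemma nice_tame n (F : 'rV[R]_n -> R) : nice F -> tame (Vw R n) F.
Proof. by move=> [cF [C hC]]; apply: (tame_le _ (tame_wt n 1) hC); exact: cont_meas. Qed.

(** If [t] is large, then [s] or [s + t] is large; this is a Peetre-type inequality. *)
Lemma w1_conv (s t : R) : w1 s * w1 (s + t) <= 2 * w1 t.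
Proof.
rewrite /w1 -invfM ler_pdivlMr ?w1_den// ler_pdivrMl ?mulr_gt0 ?w1_den//.
have := sqr_ge0 (s + t + s); have := mulr_ge0 (sqr_ge0 s) (sqr_ge0 (s + t)); nra.
Qed.

Lemma wt_conv n (y y' : 'rV[R]_n) : wt y * wt (y + y') <= 2 ^+ n * wt y'.
Proof.
rewrite /wt -big_split/= -[n in 2 ^+ n]card_ord -prodr_const -big_split/=.
apply: ler_prod => i _; rewrite mulr_ge0 ?(ltW (w1_gt0 _))//= mxE; exact: w1_conv.
Qed.

Lemma wtN n (y : 'rV[R]_n) : wt (- y) = wt y.
Proof. by apply: eq_bigr => i _; rewrite mxE /w1 sqrrN. Qed.

Lemma wt_aff_le n (l : R) (y : 'rV[R]_n) : 1 <= l -> wt (l *: y) <= wt y.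
Proof.
move=> l1; apply: ler_prod => i _; rewrite (ltW (w1_gt0 _))/= mxE /w1 lef_pV2 ?posrE ?w1_den//.
rewrite lerD2l exprMn ler_peMl ?sqr_ge0// exprn_ege1//.
Qed.

Lemma tame_scale n (l : R) (F : 'rV[R]_n -> R) : 0 < l -> tame (Vw R n) F -> tame (Vw R n) (fun v => F (l *: v)).
Proof. by move=> l0 /(tame_aff 0 l0); under eq_fun do rewrite /aff addr0. Qed.

Lemma Int_scale n (l : R) (F : 'rV[R]_n -> R) : 0 < l -> tame (Vw R n) F ->
  Int (Vw R n) (fun v => F (l *: v)) = l ^- n * Int (Vw R n) F.
Proof. by move=> l0 tF; rewrite -(Int_aff 0 l0 tF); congr Int; apply/funext => v; rewrite /aff addr0. Qed.

Lemma Int_trans n c (F : 'rV[R]_n -> R) : tame (Vw R n) F ->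
  Int (Vw R n) (fun v => F (v + c)) = Int (Vw R n) F.
Proof.
move=> tF; have := Int_aff c ltr01 tF; rewrite expr1n invr1 mul1r => <-.
by congr Int; apply/funext => v; rewrite /aff scale1r.
Qed.
Lemma tame_trans n c (F : 'rV[R]_n -> R) : tame (Vw R n) F -> tame (Vw R n) (fun v => F (v + c)).
Proof. by move=> /(tame_aff c ltr01); under eq_fun do rewrite /aff scale1r. Qed.

Lemma dot_shift n (h : R) d (v s : 'rV[R]_n) : dot (h *: e1 d + v) s = h * s 0 d + dot v s.
Proof.
rewrite /dot; under eq_bigr do rewrite shift_coord mulrDl.
rewrite big_split/=; congr (_ + _); rewrite (bigD1 d)//= eqxx mulr1 big1 ?addr0// => i /negPf ->.
by rewrite mulr0 mul0r.
Qed.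
Lemma dotC n (v s : 'rV[R]_n) : dot v s = dot s v.
Proof. by apply: eq_bigr => i _; rewrite mulrC. Qed.
Lemma dotDl n (u v s : 'rV[R]_n) : dot (u + v) s = dot u s + dot v s.
Proof. by rewrite /dot -big_split/=; apply: eq_bigr => i _; rewrite mxE mulrDl. Qed.
Lemma dotDr n (u v s : 'rV[R]_n) : dot s (u + v) = dot s u + dot s v.
Proof. by rewrite dotC dotDl !(dotC s). Qed.
Lemma dotNl n (u s : 'rV[R]_n) : dot (- u) s = - dot u s.
Proof. by rewrite /dot -sumrN; apply: eq_bigr => i _; rewrite mxE mulNr. Qed.
Lemma dotZl n c (u s : 'rV[R]_n) : dot (c *: u) s = c * dot u s.
Proof. by rewrite /dot mulr_sumr; apply: eq_bigr => i _; rewrite mxE mulrA. Qed.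
Lemma dotZr n c (u s : 'rV[R]_n) : dot s (c *: u) = c * dot s u.
Proof. by rewrite dotC dotZl dotC. Qed.

Lemma cont_dot (T : topologicalType) n (f g : T -> 'rV[R]_n) :
  (forall i, continuous (fun t => f t 0 i)) -> (forall i, continuous (fun t => g t 0 i)) ->
  continuous (fun t => dot (f t) (g t)).
Proof. by move=> cf cg; apply: cont_sum => i; exact: contM. Qed.

Lemma cos_mul (a b : R) : cos a * cos b = 2^-1 * cos (a - b) + 2^-1 * cos (a + b).
Proof. by rewrite cosB cosD; lra. Qed.

(** After rescaling to [mu = 1] this is the decay of the cosine transform of a fixed power of [wt],
    obtained by two integrations by parts in every coordinate. *)
Lemma wt_osc n p : exists2 C, 0 <= C & forall (mu : R) (s : 'rV[R]_n) th, 0 < mu ->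
  `|Int (Vw R n) (fun xi => wt (mu^-1 *: xi) ^+ p.+1 * cos (dot xi s + th))| <= C * mu ^+ n * wt (mu *: s).
Proof.
have [C C0 hC] := @osc_decay R _ _ (@e1 n) (Vw R n) unit (fun _ v => wt v ^+ p.+1)
  (fun d => ibp_Vw (i := d)) (fun=> tame_wt n p) (fun _ v => wt v ^+ p.+1) (index_enum 'I_n) (@cls_wt n _ _ _).
have I0 : 0 <= Int (Vw R n) (fun v => wt v ^+ p.+1) by apply: Int_ge0 => v; rewrite exprn_ge0// wt_ge0.
exists (C * Int (Vw R n) (fun v => wt v ^+ p.+1)); first exact: mulr_ge0.
move=> mu s th mu0.
have cph t : continuous (fun v : 'rV[R]_n => dot v t + th).
  by apply: contD; [apply: cont_dot => i; [exact: coord_cont|exact: contC]|exact: contC].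
have tF : tame (Vw R n) (fun xi => wt (mu^-1 *: xi) ^+ p.+1 * cos (dot xi s + th)).
  apply: (tame_cos (cph s)); apply: (@tame_scale n _ (fun v => wt v ^+ p.+1)); last exact: tame_wt.
  by rewrite invr_gt0.
have := Int_scale mu0 tF.
rewrite (_ : (fun v => _) = fun v => wt v ^+ p.+1 * cos (dot v (mu *: s) + th)); last first.
  by apply/funext => v; rewrite scalerA mulVf ?gt_eqF// scale1r dotZl dotZr.
move=> e.
have -> : Int (Vw R n) (fun xi => wt (mu^-1 *: xi) ^+ p.+1 * cos (dot xi s + th)) =
   mu ^+ n * osc (Vw R n) (fun v => wt v ^+ p.+1) (fun v => dot v (mu *: s) + th).
  by rewrite /osc e mulrA mulfV ?mul1r// expf_neq0// gt_eqF.
have m0 : 0 <= mu ^+ n by rewrite exprn_ge0// ltW.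
rewrite normrM (ger0_norm m0) [leRHS]mulrAC [leRHS]mulrC ler_wpM2l//.
have := hC tt (fun v => dot v (mu *: s) + th) (fun i => (mu *: s) 0 i) (cph _).
apply => d h v; first by rewrite dot_shift addrA.
Qed.

End IntegralInequalities.

(** * Bessel and Bernstein inequalities for the input functions *)

Section Bessel.
Local Open Scope classical_set_scope.
Local Open Scope ring_scope.
Variable R : realType.

Lemma powR_ge_id (w b : R) : 0 < w -> w <= 1 -> b <= 1 -> w <= powR w b.
Proof.
move=> w0 w1 b1; rewrite -[leLHS](powRr1 (ltW w0)).
by apply: ger_powR => //; rewrite w0.
Qed.

(** Prepares Hoelder with exponents [2 s - 1] and [2 - 2 s]: the first factor does not see the
    kernel [w], the second integrates it in one variable. The resulting powers of [f * f'] add up to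
    1, and [w <= 1] allows the exponent of [w] to drop to [2 - 2 s]. *)
Lemma young_pointwise (f f' w s : R) : 0 <= f -> 0 <= f' -> 0 < w -> w <= 1 -> 2^-1 <= s -> s <= 1 ->
  f * f' * w <= powR (powR f s^-1 * powR f' s^-1) (2 * s - 1) *
    powR (2^-1 * (powR f s^-1 + powR f' s^-1) * w) (1 - (2 * s - 1)).
Proof.
move=> f0 f'0 w0 w1 s1 s2.
have s0 : 0 < s by apply: lt_le_trans s1; rewrite invr_gt0.
set a := 2 * s - 1; have a0 : 0 <= a by rewrite /a; lra.
have a1 : 0 <= 1 - a by rewrite /a; lra.
have ff0 : 0 <= f * f' by exact: mulr_ge0.
rewrite -powRM// -powRrM.
have e1 : powR (f * f') (s^-1 / 2) <= 2^-1 * (powR f s^-1 + powR f' s^-1).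
  have h x : 0 <= x -> powR x s^-1 = powR x (s^-1 / 2) ^+ 2.
    move=> x0; rewrite expr2 -powRD -?splitr//.
    by rewrite -?splitr gt_eqF// invr_gt0.
  rewrite !h// powRM//; have := sqr_ge0 (powR f (s^-1 / 2) - powR f' (s^-1 / 2)); nra.
have e2 : powR (powR (f * f') (s^-1 / 2) * w) (1 - a) <= powR (2^-1 * (powR f s^-1 + powR f' s^-1) * w) (1 - a).
  have w0' := ltW w0; have p1 := powR_ge0 f s^-1; have p2 := powR_ge0 f' s^-1.
  apply: ge0_ler_powR => //; rewrite ?nnegrE.
  - by rewrite mulr_ge0 ?powR_ge0.
  - by rewrite !mulr_ge0// addr_ge0.
  - by rewrite ler_wpM2r.
apply: le_trans (ler_wpM2l (powR_ge0 _ _) e2).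
rewrite (powRM _ (powR_ge0 _ _) (ltW w0)) -powRrM mulrA -powRD; last first.
  apply/implyP => /eqP h; have : s^-1 * a + s^-1 / 2 * (1 - a) = 1.
    by rewrite /a; field; rewrite gt_eqF.
  by rewrite h => /eqP; rewrite eq_sym oner_eq0.
have -> : s^-1 * a + s^-1 / 2 * (1 - a) = 1 by rewrite /a; field; rewrite gt_eqF.
rewrite powRr1// ler_wpM2l// powR_ge_id// /a; lra.
Qed.


Lemma cont_addsc n e : continuous (fun p : 'rV[R]_n * 'rV[R]_n => p.1 + e *: p.2).
Proof.
apply: cont_rV => j; under eq_fun do rewrite !mxE.
apply: contD; last apply: contM; last 1 first.
- by apply: (cont_comp (f := snd) (g := fun u : 'rV[R]_n => u 0 j)); [move=> v; exact: cvg_snd|exact: coord_cont].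
- by apply: (cont_comp (f := fst) (g := fun u : 'rV[R]_n => u 0 j)); [move=> v; exact: cvg_fst|exact: coord_cont].
- exact: contC.
Qed.

Lemma cont_wtsc n mu e : continuous (fun p : 'rV[R]_n * 'rV[R]_n => wt (mu *: (p.1 + e *: p.2))).
Proof.
apply: (cont_comp (f := fun p : 'rV[R]_n * 'rV[R]_n => p.1 + e *: p.2) (g := fun u => wt (mu *: u))).
  exact: cont_addsc.
have := @aff_cont R n mu 0; rewrite (_ : aff mu 0 = fun u : 'rV[R]_n => mu *: u); last first.
  by apply/funext => u; rewrite /aff addr0.
by move=> h; apply: (cont_comp (f := fun u : 'rV[R]_n => mu *: u)) => //; exact: wt_cont.
Qed.

Lemma wt_sign n (mu e : R) (y y' : 'rV[R]_n) : e ^+ 2 = 1 -> wt (mu *: (y + e *: y')) = wt (mu *: (y' + e *: y)).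
Proof.
move=> /eqP; rewrite sqrf_eq1 => /orP[] /eqP ->; rewrite ?scale1r ?scaleN1r; first by rewrite addrC.
by rewrite -(wtN (mu *: (y' - y))) -scalerN opprB.
Qed.

Section YoungIntegral.
Variables (n : nat) (mu e s : R) (F : 'rV[R]_n -> R).
Hypotheses (mu1 : 1 <= mu) (e1 : e ^+ 2 = 1) (s1 : 2^-1 <= s) (s2 : s <= 1) (nF : nice F).
Let V := Vw R n.
Let N y := powR `|F y| s^-1.
Let w (p : 'rV[R]_n * 'rV[R]_n) := wt (mu *: (p.1 + e *: p.2)).
Let kap := Int V (@wt R n).

Lemma nice_powR : exists2 D, 0 <= D & forall y, N y <= D * wt y ^+ 2.
Proof.
have [_ [C hC]] := nF; exists (powR `|C| s^-1); first exact: powR_ge0.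
have s0 : 0 < s by apply: lt_le_trans s1; rewrite invr_gt0.
move=> y; apply: (@le_trans _ _ (powR (`|C| * wt y ^+ 2) s^-1)).
  apply: ge0_ler_powR; rewrite ?invr_ge0 ?nnegrE ?mulr_ge0 ?exprn_ge0 ?wt_ge0 ?(ltW s0)//.
  by rewrite (le_trans (hC y))// ler_wpM2r ?exprn_ge0 ?wt_ge0// ler_norm.
rewrite powRM ?exprn_ge0 ?wt_ge0// ler_wpM2l ?powR_ge0//.
rewrite -[leRHS](powRr1 (exprn_ge0 2 (wt_ge0 y))).
apply: ger_powR; first by rewrite exprn_gt0 ?wt_gt0// exprn_ile1 ?wt_ge0 ?wt_le1.
by rewrite -invr1 lef_pV2 ?posrE.
Qed.

Lemma meas_N : meas V N.
Proof. by apply: meas_powR; apply: meas_norm; apply: cont_meas nF.1. Qed.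
Lemma N_ge0 y : 0 <= N y. Proof. exact: powR_ge0. Qed.
Lemma tame_N : tame V N.
Proof.
have [D D0 hD] := nice_powR; apply: (tame_le meas_N (tame_wt R n 1) (C := D)) => v.
by rewrite ger0_norm ?N_ge0.
Qed.

Lemma w_gt0 p : 0 < w p. Proof. exact: wt_gt0. Qed.
Lemma w_le1 p : w p <= 1. Proof. exact: wt_le1. Qed.
Lemma wsym p : w p = w (p.2, p.1). Proof. exact: wt_sign. Qed.

Lemma N_w : exists2 D, 0 <= D & forall p, N p.1 * w p <= D * (wt p.1 * wt p.2).
Proof.
have [D D0 hD] := nice_powR; exists (D * 2 ^+ n); first by rewrite mulr_ge0// exprn_ge0.
move=> p; apply: (@le_trans _ _ (D * wt p.1 ^+ 2 * wt (p.1 + e *: p.2))).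
  apply: ler_pM => //; first exact: N_ge0; first exact: ltW (w_gt0 _).
  exact: wt_aff_le.
rewrite expr2 -!mulrA ler_wpM2l// [leRHS]mulrCA ler_wpM2l ?wt_ge0//.
apply: le_trans (wt_conv _ _) _; rewrite ler_wpM2l ?exprn_ge0//.
by move/eqP: e1; rewrite sqrf_eq1 => /orP[] /eqP ->; rewrite ?scale1r ?scaleN1r ?wtN.
Qed.

Lemma meas_w : meas (prodw V V) w.
Proof. by apply: cont_meas; exact: cont_wtsc. Qed.

Lemma tame_Nw1 : tame (prodw V V) (fun p => N p.1 * w p).
Proof.
have [D D0 hD] := N_w; split.
  by apply: measM; [exact: (@meas_fst R _ _ V V N meas_N)|exact: meas_w].
by exists D => p; rewrite ger0_norm ?mulr_ge0 ?N_ge0 ?(ltW (w_gt0 _))// (le_trans (hD p))//= !Vw_w.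
Qed.
Lemma tame_Nw2 : tame (prodw V V) (fun p => N p.2 * w p).
Proof.
have [D D0 hD] := N_w; split.
  by apply: measM; [exact: (@meas_snd R _ _ V V N meas_N)|exact: meas_w].
exists D => p; rewrite ger0_norm ?mulr_ge0 ?N_ge0 ?(ltW (w_gt0 _))//= !Vw_w.
by rewrite wsym mulrC [wt p.1 * _]mulrC mulrC; exact: (hD (p.2, p.1)).
Qed.

Lemma Int_w y : Int V (fun y' => w (y, y')) = mu ^- n * kap.
Proof.
have mu0 : 0 < mu by exact: lt_le_trans ltr01 mu1.
have tw : tame V (@wt R n) by have := tame_wt R n 0; under eq_fun do rewrite expr1.
rewrite (_ : (fun y' => _) = fun y' => (fun v => wt (mu *: v)) (y' + e *: y)); last first.
  by apply/funext => y'; rewrite /w/= wt_sign.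
by rewrite (@Int_trans _ _ _ (fun v => wt (mu *: v))) ?Int_scale//; exact: tame_scale.
Qed.

Lemma Int_Nw1 : Int (prodw V V) (fun p => N p.1 * w p) = Int V N * (mu ^- n * kap).
Proof.
rewrite (Int_prod12 tame_Nw1) -IntZr; last exact: tame_N.
congr Int; apply/funext => y; rewrite [LHS](@IntZ _ _ V (N y) (fun y' => w (y, y'))) ?Int_w//.
split.
  apply: cont_meas; apply: (cont_comp (f := fun y' : 'rV[R]_n => (y, y')) (g := w)); last exact: cont_wtsc.
  by apply: cont_pair; [exact: cont_cst|exact: cont_id].
exists (2 ^+ n / wt y) => y'; rewrite Vw_w ger0_norm ?wt_ge0// mulrAC ler_pdivlMr ?wt_gt0//.
rewrite mulrC; apply: (@le_trans _ _ (wt y * wt (y + e *: y'))).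
  by rewrite ler_wpM2l ?wt_ge0// wt_aff_le.
apply: le_trans (wt_conv _ _) _; rewrite ler_wpM2l ?exprn_ge0//.
by move/eqP: e1; rewrite sqrf_eq1 => /orP[] /eqP ->; rewrite ?scale1r ?scaleN1r ?wtN.
Qed.
Lemma Int_Nw2 : Int (prodw V V) (fun p => N p.2 * w p) = Int V N * (mu ^- n * kap).
Proof.
rewrite -Int_Nw1 (Int_prod21 tame_Nw2) (Int_prod12 tame_Nw1).
by congr Int; apply/funext => y; congr Int; apply/funext => y' /=; rewrite wsym.
Qed.

Lemma tame_FFw : tame (prodw V V) (fun p => `|F p.1| * `|F p.2| * w p).
Proof.
under eq_fun do rewrite mulrC.
apply: (tameMb (C := 1)); first exact: meas_w.
- by move=> v; rewrite ger0_norm ?w_le1// ltW ?w_gt0.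
- have tF := tame_norm (nice_tame nF).
  exact: (@tame_prod _ _ _ V V _ _ tF tF).
Qed.

Lemma kap_ge0 : 0 <= kap. Proof. by apply: Int_ge0 => v; exact: wt_ge0. Qed.

(** Young's inequality for a kernel of height [mu ^+ n] and mass of order 1. At [s = 1/2] this is
    Schur's bound, at [s = 1] the supremum of the kernel, and the power [2 s - 1] interpolates
    between them. *)
Lemma young_int : mu ^+ n * Int (prodw V V) (fun p => `|F p.1| * `|F p.2| * w p) <=
  (1 + kap) * powR (mu ^+ n) (2 * s - 1) * powR (Int V N) (2 * s).
Proof.
have a0 : 0 <= 2 * s - 1 by move: s1; lra.
have a1 : 2 * s - 1 <= 1 by move: s2; lra.
have mu0 : 0 < mu by exact: lt_le_trans ltr01 mu1.
have tu : tame (prodw V V) (fun p => N p.1 * N p.2) by exact: (tame_prod tame_N tame_N).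
have tv : tame (prodw V V) (fun p => 2^-1 * (N p.1 + N p.2) * w p).
  rewrite (_ : (fun p => _) = fun p : 'rV[R]_n * 'rV[R]_n => 2^-1 * (N p.1 * w p) + 2^-1 * (N p.2 * w p)).
    by apply: tameD; apply: tameZ; [exact: tame_Nw1|exact: tame_Nw2].
  by apply/funext => p; rewrite mulrDr mulrDl !mulrA.
have H := hoelderH a0 a1 tu tv tame_FFw.
have {H} : Int (prodw V V) (fun p => `|F p.1| * `|F p.2| * w p) <=
    powR (Int V N * Int V N) (2 * s - 1) * powR (Int V N * (mu ^- n * kap)) (1 - (2 * s - 1)).
  have <- : Int (prodw V V) (fun p => N p.1 * N p.2) = Int V N * Int V N.
    rewrite (Int_prod12 tu) -IntZr; last exact: tame_N.
    by congr Int; apply/funext => y; rewrite /= IntZ//; exact: tame_N.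
  have <- : Int (prodw V V) (fun p => 2^-1 * (N p.1 + N p.2) * w p) = Int V N * (mu ^- n * kap).
    rewrite (_ : (fun p => _) = fun p : 'rV[R]_n * 'rV[R]_n => 2^-1 * (N p.1 * w p) + 2^-1 * (N p.2 * w p)).
      rewrite IntD; [|apply: tameZ; exact: tame_Nw1|apply: tameZ; exact: tame_Nw2].
      rewrite !IntZ; [|exact: tame_Nw2|exact: tame_Nw1].
      by rewrite Int_Nw1 Int_Nw2; lra.
    by apply/funext => p; rewrite mulrDr mulrDl !mulrA.
  apply: H => p.
  - by rewrite mulr_ge0 ?N_ge0.
  - by rewrite !mulr_ge0 ?addr_ge0 ?N_ge0 ?(ltW (w_gt0 _)).
  - by apply: young_pointwise => //; [exact: w_gt0|exact: w_le1].
set I := Int V N; have I0 : 0 <= I by apply: Int_ge0 => v; exact: N_ge0.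
set a := 2 * s - 1; rewrite -/a in a0 a1.
have M0 : 0 < mu ^+ n by rewrite exprn_gt0.
move=> H; apply: (le_trans (ler_wpM2l (ltW M0) H)).
have c0 := kap_ge0.
have b0 : 0 <= 1 - a by rewrite subr_ge0.
rewrite !powRM ?mulr_ge0 ?invr_ge0 ?(ltW M0)//.
have eI : powR I a * powR I a * powR I (1 - a) = powR I (2 * s).
  rewrite -mulrA -powRD; last by rewrite addrC subrK oner_eq0.
  rewrite addrC subrK -powRD; first by congr powR; rewrite /a; ring.
  by rewrite gt_eqF// ltr_pwDr.
have eM : mu ^+ n * powR (mu ^- n) (1 - a) = powR (mu ^+ n) a.
  rewrite -[mu ^- n]powR_inv1 ?(ltW M0)// -powRrM -{1}[mu ^+ n](powRr1 (ltW M0)) -powRD.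
    by congr powR; ring.
  by apply/implyP => _; rewrite gt_eqF.
have ek : powR kap (1 - a) <= 1 + kap.
  have [k1|k1] := leP kap 1.
    apply: (@le_trans _ _ 1); last by rewrite lerDl.
    have e11 : powR (1 : R) (1 - a) = 1 by rewrite powR1.
    by rewrite -[leRHS]e11; apply: ge0_ler_powR; rewrite ?nnegrE.
  apply: (@le_trans _ _ (powR kap 1)); last by rewrite powRr1// lerDr.
  by apply: ler_powR; [exact: ltW|rewrite lerBlDr lerDl].
rewrite -eI -eM.
have P1 := powR_ge0 I a; have P2 := powR_ge0 I (1 - a); have P3 := powR_ge0 (mu ^- n) (1 - a).
rewrite [leLHS](_ : _ = powR kap (1 - a) * (mu ^+ n * powR (mu ^- n) (1 - a) * (powR I a * powR I a * powR I (1 - a)))); last by ring.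
by rewrite -[leRHS]mulrA ler_wpM2r// !mulr_ge0 ?(ltW M0).
Qed.
End YoungIntegral.

Lemma cont_phase n (s : 'rV[R]_n) th : continuous (fun v : 'rV[R]_n => dot v s + th).
Proof. by apply: contD; [apply: cont_dot => i; [exact: coord_cont|exact: contC]|exact: contC]. Qed.

Lemma tame_wtsc n mu p : 0 < mu -> tame (Vw R n) (fun xi => wt (mu *: xi) ^+ p.+1).
Proof. by move=> mu0; apply: (@tame_scale R n _ (fun v => wt v ^+ p.+1)) => //; exact: tame_wt. Qed.

(** The square is opened and integrated in [xi] first, which yields the kernel of [wt_osc] and
    reduces the claim to [young_int]. For [s = 1/2] this is Bessel's inequality; for larger [s] it
    is Bernstein's, with a loss of [mu ^+ n] to the power [2 s - 1]. *)
Lemma bessel n : exists2 C, 0 <= C & forall (mu s : R) (F : 'rV[R]_n -> R) th, 1 <= mu -> 2^-1 <= s -> s <= 1 -> nice F ->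
  Int (Vw R n) (fun xi => wt (mu^-1 *: xi) ^+ 2 * (Int (Vw R n) (fun y => F y * cos (dot y xi + th))) ^+ 2) <=
  C * powR (mu ^+ n) (2 * s - 1) * powR (Int (Vw R n) (fun y => powR `|F y| s^-1)) (2 * s).
Proof.
have [C C0 hC] := wt_osc R n 1; exists (C * (1 + Int (Vw R n) (@wt R n))).
  by rewrite mulr_ge0// addr_ge0// Int_ge0// => v; exact: wt_ge0.
move=> mu s F th mu1 s1 s2 nF.
have mu0 : 0 < mu by exact: lt_le_trans ltr01 mu1.
set V := Vw R n.
have tF := nice_tame nF; have [cF [D hD]] := nF.
pose Wm (xi : 'rV[R]_n) := wt (mu^-1 *: xi).
pose G (xi y : 'rV[R]_n) := Wm xi * (F y * cos (dot y xi + th)).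
have cWm : continuous Wm.
  have := @aff_cont R n mu^-1 0; rewrite (_ : aff mu^-1 0 = fun u : 'rV[R]_n => mu^-1 *: u); last first.
    by apply/funext => u; rewrite /aff addr0.
  by move=> h; apply: (cont_comp (f := fun u : 'rV[R]_n => mu^-1 *: u)) => //; exact: wt_cont.
have cG : continuous (fun p : 'rV[R]_n * 'rV[R]_n => G p.1 p.2).
  have cf1 (g : 'rV[R]_n -> R) : continuous g -> continuous (fun p : 'rV[R]_n * 'rV[R]_n => g p.1).
    by move=> cg; apply: (cont_comp (f := fst)) => //; move=> v; exact: cvg_fst.
  have cf2 (g : 'rV[R]_n -> R) : continuous g -> continuous (fun p : 'rV[R]_n * 'rV[R]_n => g p.2).
    by move=> cg; apply: (cont_comp (f := snd)) => //; move=> v; exact: cvg_snd.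
  apply: contM; first exact: cf1.
  apply: contM; first exact: cf2.
  apply: cont_cos; apply: contD; last exact: contC.
  by apply: cont_dot => i; [exact: (cf2 (fun u => u 0 i) (@coord_cont _ _ i))|exact: (cf1 (fun u => u 0 i) (@coord_cont _ _ i))].
have -> : (fun xi => wt (mu^-1 *: xi) ^+ 2 * Int V (fun y => F y * cos (dot y xi + th)) ^+ 2) =
    fun xi => (Int V (G xi)) ^+ 2.
  apply/funext => xi; rewrite /G IntZ ?exprMn//.
  apply: (@tame_cos _ _ V F (fun y => dot y xi + th)) => //; exact: cont_phase.
have h1 x y : `|G x y| <= `|D| * Wm x * ws_w V y.
  rewrite /G normrM ger0_norm ?wt_ge0// [leRHS]mulrAC [leRHS]mulrC ler_wpM2l ?wt_ge0//.
  rewrite Vw_w normrM; apply: (@le_trans _ _ (`|F y| * 1)); first by rewrite ler_wpM2l// cos_le1.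
  rewrite mulr1 (le_trans (hD y))// expr2 mulrA; apply: (@le_trans _ _ (`|D| * wt y * wt y)).
    by rewrite !ler_wpM2r ?wt_ge0// ler_norm.
  by rewrite ler_piMr ?wt_le1// mulr_ge0// wt_ge0.
have h2 x : 0 <= `|D| * Wm x by rewrite mulr_ge0// wt_ge0.
have h3 : tame V (fun x => (`|D| * Wm x) ^+ 2).
  by under eq_fun do rewrite exprMn; apply: tameZ; apply: (@tame_wtsc n mu^-1 1); rewrite invr_gt0.
have [mk ->] := ttstar (cont_meas (X := prodw V V) cG) h1 h2 h3.
(* The product of cosines gives a term in [y - y'], in which the phases cancel, and a term in
   [y + y'], in which they add. *)
have E (p : 'rV[R]_n * 'rV[R]_n) : Int V (fun x => G x p.1 * G x p.2) = F p.1 * F p.2 *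
    (2^-1 * Int V (fun xi => Wm xi ^+ 2 * cos (dot xi (p.1 + (-1) *: p.2) + 0)) +
     2^-1 * Int V (fun xi => Wm xi ^+ 2 * cos (dot xi (p.1 + 1 *: p.2) + (th + th)))).
  have tW : tame V (fun xi => Wm xi ^+ 2) by apply: (@tame_wtsc n mu^-1 1); rewrite invr_gt0.
  have tc s0 t0 : tame V (fun xi => Wm xi ^+ 2 * cos (dot xi s0 + t0)).
    by apply: (@tame_cos _ _ V _ (fun xi => dot xi s0 + t0)) => //; exact: cont_phase.
  rewrite -!IntZ// -IntD; [|exact: tameZ|exact: tameZ].
  rewrite -IntZ; last by apply: tameD; exact: tameZ.
  congr Int; apply/funext => xi; rewrite /G.
  rewrite (_ : _ * _ = F p.1 * F p.2 * (Wm xi ^+ 2 * (cos (dot p.1 xi + th) * cos (dot p.2 xi + th)))); last by ring.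
  rewrite cos_mul !(dotC xi) !dotDl !dotZl mulN1r mul1r addr0.
  rewrite (_ : dot p.1 xi + th - (dot p.2 xi + th) = dot p.1 xi - dot p.2 xi); last by ring.
  rewrite (_ : dot p.1 xi + th + (dot p.2 xi + th) = dot p.1 xi + dot p.2 xi + (th + th)); last by ring.
  by ring.
have te e : e ^+ 2 = 1 -> tame (prodw V V) (fun p => `|F p.1| * `|F p.2| * wt (mu *: (p.1 + e *: p.2))).
  by move=> e1; exact: tame_FFw.
have m11 : (-1) ^+ 2 = 1 :> R by rewrite sqrrN expr1n.
have p11 : 1 ^+ 2 = 1 :> R by rewrite expr1n.
pose c := 2^-1 * C * mu ^+ n.
have cc0 : 0 <= c by rewrite !mulr_ge0// ?exprn_ge0// ltW.
apply: (@le_trans _ _ (Int (prodw V V) (fun p => c * (`|F p.1| * `|F p.2| * wt (mu *: (p.1 + (-1) *: p.2))) +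
   c * (`|F p.1| * `|F p.2| * wt (mu *: (p.1 + 1 *: p.2)))))).
  apply: (le_trans (ler_norm _)); apply: norm_Int => //.
    by apply: tameD; apply: tameZ; exact: te.
  move=> p; rewrite E normrM normrM.
  rewrite [leRHS](_ : _ = `|F p.1| * `|F p.2| * (c * (wt (mu *: (p.1 + (-1) *: p.2)) + wt (mu *: (p.1 + 1 *: p.2))))); last by ring.
  rewrite ler_wpM2l ?mulr_ge0//.
  have b1 := hC mu (p.1 + (-1) *: p.2) 0 mu0; have b2 := hC mu (p.1 + 1 *: p.2) (th + th) mu0.
  apply: (le_trans (ler_normD _ _)); rewrite !normrM [`|2^-1|]ger0_norm// -mulrDr /c -!mulrA ler_wpM2l//.
  by rewrite mulrDr mulrDr; apply: lerD; rewrite mulrA; [exact: b1|exact: b2].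
rewrite IntD; [|by apply: tameZ; exact: te|by apply: tameZ; exact: te].
rewrite !IntZ; [|exact: te|exact: te].
have y1 := young_int mu1 m11 s1 s2 nF.
have y2 := young_int mu1 p11 s1 s2 nF.
rewrite -/V in y1 y2 *.
set B := (1 + _) * _ * _ in y1; rewrite -/B in y2.
rewrite [leRHS](_ : _ = C * B); last by rewrite /B; ring.
set I1 := Int _ _ in y1 *; set I2 := Int _ _ in y2 *.
rewrite [leLHS](_ : _ = C * (2^-1 * (mu ^+ n * I1 + mu ^+ n * I2))); last by rewrite /c; ring.
by rewrite ler_wpM2l//; lra.
Qed.
End Bessel.

Lemma size_index_enum (T : finType) : size (index_enum T) = #|T|.
Proof. by rewrite -(card_uniqP (index_enum_uniq T)); apply: eq_card => i; rewrite mem_index_enum. Qed.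

(** * The space of [(x, xi, eta)], with square-integral and pointwise estimates for localized
    symbols *)

Section TripleSpace.
Local Open Scope classical_set_scope.
Local Open Scope ring_scope.
Variables (R : realType) (n : nat).
Notation V := ('rV[R]_n).
Notation V3 := ('rV[R]_n * 'rV[R]_n * 'rV[R]_n)%type.
Notation X1 := (Vw R n).
Notation X2 := (prodw (Vw R n) (Vw R n)).

Definition e3 (d : 'I_3 * 'I_n) : V3 :=
  if val d.1 == 0%N then (e1 R d.2, 0, 0) else if val d.1 == 1%N then (0, e1 R d.2, 0) else (0, 0, e1 R d.2).
Definition e2 (d : bool * 'I_n) : V * V := if d.1 then (0, e1 R d.2) else (e1 R d.2, 0).
Definition g1 (i : 'I_n) : 'I_3 * 'I_n := (ord0, i).
Definition g2 (d : bool * 'I_n) : 'I_3 * 'I_n := (if d.1 then inord 2 else inord 1, d.2).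
Definition Lz (z : V * V) (x : V) : V3 := (x, z.1, z.2).

Lemma ibp_e2 d : ibp X2 (e2 d).
Proof. by case: d => [[] i]; [exact/ibp_snd/ibp_Vw|exact/ibp_fst/ibp_Vw]. Qed.

Lemma scale3E (h : R) (v w : V3) : h *: v + w = (h *: v.1.1 + w.1.1, h *: v.1.2 + w.1.2, h *: v.2 + w.2).
Proof. by case: v => [[a b] c]; case: w => [[a' b'] c']. Qed.
Lemma scale2E (h : R) (v w : V * V) : h *: v + w = (h *: v.1 + w.1, h *: v.2 + w.2).
Proof. by case: v => [a b]; case: w => [a' b']. Qed.

Lemma Lz_shift z i (h : R) x : Lz z (h *: e1 R i + x) = h *: e3 (g1 i) + Lz z x.
Proof. by rewrite scale3E /= !scaler0 !add0r. Qed.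
Lemma Lx_shift x d (h : R) u : Lz (h *: e2 d + u) x = h *: e3 (g2 d) + Lz u x.
Proof.
by rewrite scale3E scale2E /g2 /e2; case: d => [[] i]; rewrite /e3/= inordK//= !scaler0 ?add0r.
Qed.

Lemma cont_Lz z : continuous (Lz z).
Proof. by apply: cont_pair; [apply: cont_pair; [exact: cont_id|exact: cont_cst]|exact: cont_cst]. Qed.
Lemma cont_Lx x : continuous (fun z => Lz z x).
Proof.
apply: cont_pair; [apply: cont_pair; [exact: cont_cst|]|]; move=> v; [exact: cvg_fst|exact: cvg_snd].
Qed.
Lemma cont_Lxz : continuous (fun p : V * (V * V) => Lz p.2 p.1).
Proof.
have c1 : continuous (fun p : V * (V * V) => p.1) by move=> v; exact: cvg_fst.
have c2 : continuous (fun p : V * (V * V) => p.2) by move=> v; exact: cvg_snd.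
have f1 : continuous (fun p : V * V => p.1) by move=> v; exact: cvg_fst.
have f2 : continuous (fun p : V * V => p.2) by move=> v; exact: cvg_snd.
apply: cont_pair; [apply: cont_pair; [exact: c1|exact: (cont_compT c2 f1)]|exact: (cont_compT c2 f2)].
Qed.

Definition wm (mu : R) (xi : V) := wt (mu^-1 *: xi).
(** Concentration on frequencies of size at most [mu]; the squares match the weight in [bessel]. *)
Definition W2 (mu : R) (z : V * V) := wm mu z.1 ^+ 2 * wm mu z.2 ^+ 2.

Lemma wm_ge0 mu xi : 0 <= wm mu xi. Proof. exact: wt_ge0. Qed.
Lemma W2_gt0 mu z : 0 < W2 mu z. Proof. by rewrite mulr_gt0// exprn_gt0// wt_gt0. Qed.
Lemma W2_ge0 mu z : 0 <= W2 mu z. Proof. exact: ltW (W2_gt0 mu z). Qed.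
Lemma W2_le1 mu z : W2 mu z <= 1.
Proof. by rewrite mulr_ile1// ?exprn_ge0 ?wm_ge0// exprn_ile1 ?wm_ge0 ?wt_le1. Qed.

Section Core.
Variables (J : Type) (A mu : J -> R).
Hypotheses (A0 : forall j, 0 <= A j) (mu1 : forall j, 1 <= mu j).

(** Amplitude [A], frequencies of size at most [mu], position near the centre [i.2]. The centre
    belongs to the index so that no constant can depend on it. *)
Definition om3 M (i : J * V) (v : V3) := A i.1 * W2 (mu i.1) (v.1.2, v.2) * wt (v.1.1 - i.2) ^+ M.

Lemma om3_ge0 M i v : 0 <= om3 M i v.
Proof. by rewrite mulr_ge0 ?exprn_ge0 ?wt_ge0// mulr_ge0 ?W2_ge0. Qed.

Lemma mu_gt0 j : 0 < mu j. Proof. exact: lt_le_trans ltr01 (mu1 j). Qed.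

Lemma tame_wm j p : tame X1 (fun xi => wm (mu j) xi ^+ p.+1).
Proof. by apply: tame_wtsc; rewrite invr_gt0 mu_gt0. Qed.
Lemma tame_W2 j : tame X2 (W2 (mu j)).
Proof. exact: (tame_prod (tame_wm j 1) (tame_wm j 1)). Qed.

Lemma Int_wm j p : Int X1 (fun xi => wm (mu j) xi ^+ p.+1) = mu j ^+ n * Int X1 (fun v => wt v ^+ p.+1).
Proof.
rewrite (@Int_scale R n (mu j)^-1 (fun v => wt v ^+ p.+1)) ?invr_gt0 ?mu_gt0//; last exact: tame_wt.
by rewrite -exprVn invrK.
Qed.

Let k1 := Int X1 (fun v => wt v ^+ 1).
Let k2 := Int X1 (fun v => wt v ^+ 2).

Lemma k_ge0 p : 0 <= Int X1 (fun v => wt v ^+ p).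
Proof. by apply: Int_ge0 => v; rewrite exprn_ge0 ?wt_ge0. Qed.

Lemma Int_W2 j : Int X2 (W2 (mu j)) = (mu j ^+ n * k2) ^+ 2.
Proof.
have t := tame_wm j 1.
rewrite (Int_prod12 (tame_W2 j)) /W2 expr2 /k2 -(Int_wm j 1) -IntZr//.
by congr Int; apply/funext => x /=; rewrite IntZ.
Qed.

Definition tau (z : V * V) := z.1 + z.2.

Lemma cont_tau : continuous tau.
Proof.
have := @cont_addsc R n 1; rewrite (_ : (fun p => _) = tau)//.
by apply/funext => p; rewrite scale1r.
Qed.

Lemma cont_tau_wt e s : continuous (fun z => wt (s + e *: tau z)).
Proof.
apply: (cont_comp (f := tau) (g := fun t => wt (s + e *: t))); first exact: cont_tau.
have h := @aff_cont R n e s.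
apply: (cont_comp (f := fun t : V => s + e *: t)); last exact: wt_cont.
by move=> t; have := h t; rewrite /aff /= (_ : (fun v => e *: v + s) = fun t => s + e *: t)//; apply/funext => v; rewrite addrC.
Qed.

Lemma tame_W2wt j e s : tame X2 (fun z => wt (s + e *: tau z) * W2 (mu j) z).
Proof.
apply: (tameMb (C := 1)); last exact: tame_W2; last by move=> v; rewrite ger0_norm ?wt_ge0 ?wt_le1.
by apply: cont_meas; exact: cont_tau_wt.
Qed.

(** Only [xi + eta] enters the kernel, so one of the two frequency integrals is bounded and only the
    other contributes [mu ^+ n]. This is the gain over the trivial [mu ^+ (2 * n)]. *)
Lemma Int_W2wt j e s : e ^+ 2 = 1 ->
  Int X2 (fun z => wt (s + e *: tau z) * W2 (mu j) z) <= k1 * k2 * mu j ^+ n.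
Proof.
move=> ee; rewrite (Int_prod12 (tame_W2wt j e s)).
have tw := tame_wt R n 0.
rewrite [leRHS](_ : _ = Int X1 (fun x => wm (mu j) x ^+ 2 * k1)); last first.
  by rewrite IntZr; [rewrite (Int_wm j 1) /k2; ring|exact: tame_wm].
have ew x y : wt (s + e *: tau (x, y)) = wt (y + (x + e *: s)) ^+ 1.
  have := @wt_sign R n 1 e s (tau (x, y)) ee; rewrite !scale1r expr1 => ->.
  by rewrite /tau/= addrA [y + x]addrC.
have tsl x : tame X1 (fun y => wt (s + e *: tau (x, y))).
  by under eq_fun do rewrite ew; exact: (tame_trans (x + e *: s) tw).
have bd x : `|Int X1 (fun y => wt (s + e *: tau (x, y)) * W2 (mu j) (x, y))| <= wm (mu j) x ^+ 2 * k1.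
  have -> : k1 = Int X1 (fun y => wt (s + e *: tau (x, y))).
    rewrite /k1 -(Int_trans (x + e *: s) tw); congr Int; apply/funext => y; exact/esym/ew.
  rewrite -IntZ//; apply: norm_Int.
  - apply: measM; first exact: (tsl x).1.
    by rewrite /W2 /=; apply: measM; [exact: measC|exact: (tame_wm j 1).1].
  - exact: tameZ.
  - move=> y; rewrite normrM !ger0_norm ?wt_ge0 ?W2_ge0// mulrC ler_wpM2r ?wt_ge0//.
    by rewrite /W2/= ler_piMr ?exprn_ge0 ?wm_ge0// exprn_ile1 ?wm_ge0 ?wt_le1.
apply: (le_trans (ler_norm _)); apply: norm_Int; last exact: bd.
  exact: (@meas_Int1 _ _ _ X1 X1 _ (tame_W2wt j e s).1).
by under eq_fun do rewrite mulrC; apply: tameZ; exact: (tame_wm j 1).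
Qed.

Section OneTerm.
Variable F : J * V -> V3 -> R.
Hypothesis hF : cls e3 (2 * n) F (om3 1).

Lemma cls_x_slice : cls (@e1 R n) (2 * n) (fun (k : (J * V) * (V * V)) x => F k.1 (Lz k.2 x))
  (fun k x => om3 1 k.1 (Lz k.2 x)).
Proof.
have cL (k : (J * V) * (V * V)) : continuous (Lz k.2) by exact: cont_Lz.
have hL (k : (J * V) * (V * V)) d (h : R) u : Lz k.2 (h *: e1 R d + u) = h *: e3 (g1 d) + Lz k.2 u by exact: Lz_shift.
exact: (cls_slice (fun k : (J * V) * (V * V) => k.1) cL hL hF).
Qed.

Lemma tame_wtc c p : tame X1 (fun x => wt (x - c) ^+ p.+1).
Proof. exact: (tame_trans (- c) (tame_wt R n p)). Qed.

(** Two integrations by parts in each coordinate of [x]. Both factors carry [wt (x - c)], and the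
    integral of its square does not depend on [c]. *)
Lemma pair_decay : exists2 C, 0 <= C & forall j c z z' s th,
  `|Int X1 (fun x => F (j, c) (Lz z x) * F (j, c) (Lz z' x) * cos (dot x s + th))| <=
   C * (A j ^+ 2 * W2 (mu j) z * W2 (mu j) z') * wt s.
Proof.
have h1 := cls_reindex (fun k : (J * V) * (V * V) * (V * V) => k.1) cls_x_slice.
have h2 := cls_reindex (fun k : (J * V) * (V * V) * (V * V) => (k.1.1, k.2)) cls_x_slice.
have h12 := clsM (fun k x => om3_ge0 1 _ _) h1 h2.
have t12 (k : (J * V) * (V * V) * (V * V)) : tame X1 (fun x => om3 1 k.1.1 (Lz k.1.2 x) * om3 1 k.1.1 (Lz k.2 x)).
  rewrite /om3 /Lz /= (_ : (fun x => _) = fun x => A k.1.1.1 ^+ 2 * W2 (mu k.1.1.1) (k.1.2.1, k.1.2.2) *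
    W2 (mu k.1.1.1) (k.2.1, k.2.2) * wt (x - k.1.1.2) ^+ 2); last by apply/funext => x; ring.
  by apply: tameZ; exact: tame_wtc.
have sz : (2 * size (index_enum 'I_n) <= 2 * n)%N by rewrite size_index_enum card_ord.
have [C C0 hC] := @osc_decay R _ _ (@e1 R n) X1 _ _ (fun d => ibp_Vw (i := d)) t12 _ (index_enum 'I_n)
  (cls_low sz h12).
exists (C * k2); first by rewrite mulr_ge0// k_ge0.
move=> j c z z' s th.
have cph := @cont_phase R n s th.
have := hC ((j, c), z, z') (fun x => dot x s + th) (fun i => s 0 i) cph.
have hph d (h' : R) v : dot (h' *: e1 R d + v) s + th = h' * s 0 d + (dot v s + th).
  by rewrite dot_shift addrA.
move=> /(_ hph) h; apply: (le_trans h).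
rewrite /om3 /Lz /= (_ : (fun x => _) = fun x => A j ^+ 2 * W2 (mu j) z *
    W2 (mu j) z' * wt (x - c) ^+ 2); last by apply/funext => x; case: (z) (z') => ? ? [? ?]; ring.
rewrite IntZ; last exact: tame_wtc.
rewrite (Int_trans (- c) (tame_wt R n 1)) -/k2 -/(wt s).
by rewrite [leRHS](_ : _ = C * (A j ^+ 2 * W2 (mu j) z * W2 (mu j) z' * k2) * wt s)//; ring.
Qed.

(** Once the square is opened, the integral in [x] decays in [tau z - tau z'] or in [tau z + tau z']
    by [pair_decay], and Schur's test with [Int_W2wt] bounds the remaining quadratic form in [h]. *)
Lemma l2core : exists2 C, 0 <= C & forall j c th (h : V * V -> R) H,
  meas X2 h -> (forall z, `|h z| <= H) ->
  Int X1 (fun x => (Int X2 (fun z => F (j, c) (Lz z x) * cos (dot x (tau z) + th) * h z)) ^+ 2) <=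
  C * A j ^+ 2 * mu j ^+ n * Int X2 (fun z => W2 (mu j) z * h z ^+ 2).
Proof.
have [C C0 hC] := pair_decay; have [B B0 hB] := cls_bnd hF.
exists (C * (k1 * k2)).
  by rewrite !mulr_ge0// k_ge0.
move=> j c th h H mh hH.
pose G x z := F (j, c) (Lz z x) * cos (dot x (tau z) + th) * h z.
have H0 : 0 <= H by apply: le_trans (hH (0, 0)).
have cph : continuous (fun p : V * (V * V) => dot p.1 (tau p.2) + th).
  apply: contD; last exact: contC.
  apply: cont_dot => i.
    by apply: (cont_comp (f := fst) (g := fun u : V => u 0 i)); [move=> v; exact: cvg_fst|exact: coord_cont].
  apply: (cont_comp (f := fun p : V * (V * V) => tau p.2) (g := fun u : V => u 0 i)); last exact: coord_cont.
  apply: (cont_compT (f := snd) (g := tau)); [by move=> v; exact: cvg_snd|exact: cont_tau].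
have cF := cls_cont hF (j, c).
have mG : meas (prodw X1 X2) (fun p => G p.1 p.2).
  apply: measM; last exact: (@meas_snd R _ _ X1 X2 _ mh).
  apply: cont_meas; apply: contM; last exact: cont_cos.
  exact: (cont_comp cont_Lxz cF).
have [_ [Dw hDw]] := tame_W2 j.
have Dw0 : 0 <= Dw.
  have := hDw (0, 0); rewrite /= !Vw_w; have := W2_ge0 (mu j) (0, 0).
  have : 0 < wt (0 : V) * wt (0 : V) by rewrite mulr_gt0 ?wt_gt0.
  move=> p0 _ h'; rewrite -(pmulr_lge0 _ p0); exact: le_trans h'.
have hG x z : `|G x z| <= B * A j * H * Dw * wt (x - c) * ws_w X2 z.
  rewrite /G !normrM; apply: (@le_trans _ _ (B * om3 1 (j, c) (Lz z x) * 1 * H)).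
    rewrite ler_pM ?mulr_ge0//; apply: ler_pM => //; exact: cos_le1.
  rewrite mulr1 /om3 /Lz/= expr1.
  have : W2 (mu j) z <= Dw * (wt z.1 * wt z.2) by have := hDw z; rewrite /= !Vw_w ger0_norm ?W2_ge0.
  case: z => z1 z2 /= h1; rewrite !Vw_w.
  rewrite [leLHS](_ : _ = B * A j * H * wt (x - c) * W2 (mu j) (z1, z2)); last by ring.
  rewrite [leRHS](_ : _ = B * A j * H * wt (x - c) * (Dw * (wt z1 * wt z2))); last by ring.
  by rewrite ler_wpM2l// !mulr_ge0// wt_ge0.
have A1 x : 0 <= B * A j * H * Dw * wt (x - c) by rewrite !mulr_ge0// wt_ge0.
have tA : tame X1 (fun x => (B * A j * H * Dw * wt (x - c)) ^+ 2).
  by under eq_fun do rewrite exprMn; apply: tameZ; exact: tame_wtc.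
have [mk ->] := ttstar mG hG A1 tA.
have th2 : tame X2 (fun z => W2 (mu j) z * h z ^+ 2).
  under eq_fun do rewrite mulrC.
  apply: (tameMb (C := H ^+ 2)); [exact: measX|move=> z|exact: tame_W2].
  by rewrite normrX lerXn2r ?nnegrE.
(* [E] carries [h ^+ 2] in the first variable and [E'] in the second: the two halves of Schur's test
   after [|h h'| <= (h ^+ 2 + h' ^+ 2) / 2]. *)
pose E e (p : (V * V) * (V * V)) := W2 (mu j) p.1 * h p.1 ^+ 2 * (wt (tau p.1 + e *: tau p.2) * W2 (mu j) p.2).
pose E' e (p : (V * V) * (V * V)) := W2 (mu j) p.2 * h p.2 ^+ 2 * (wt (tau p.2 + e *: tau p.1) * W2 (mu j) p.1).
have mwt e : meas (prodw X2 X2) (fun p => wt (tau p.1 + e *: tau p.2)).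
  apply: cont_meas; have := @cont_wtsc R n 1 e.
  under eq_fun do rewrite scale1r.
  move=> cc; apply: (cont_comp (f := fun p : (V * V) * (V * V) => (tau p.1, tau p.2)) (g := fun p : V * V => wt (p.1 + e *: p.2))) => //.
  by apply: cont_pair; [apply: (cont_compT (f := fst) (g := tau))|apply: (cont_compT (f := snd) (g := tau))];
    (try exact: cont_tau); move=> v; [exact: cvg_fst|exact: cvg_snd].
have tE e : tame (prodw X2 X2) (E e).
  rewrite /E (_ : (fun p => _) = fun p => wt (tau p.1 + e *: tau p.2) * (W2 (mu j) p.1 * h p.1 ^+ 2 * W2 (mu j) p.2)).
    apply: (tameMb (C := 1)) => //; first by move=> v; rewrite ger0_norm ?wt_ge0 ?wt_le1.
    exact: (tame_prod th2 (tame_W2 j)).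
  by apply/funext => p; ring.
have tE' e : tame (prodw X2 X2) (E' e).
  rewrite /E' (_ : (fun p => _) = fun p => wt (tau p.2 + e *: tau p.1) * (W2 (mu j) p.1 * (W2 (mu j) p.2 * h p.2 ^+ 2))).
    apply: (tameMb (C := 1)); last exact: (tame_prod (tame_W2 j) th2).
      exact: meas_swap (mwt e).
    by move=> v; rewrite ger0_norm ?wt_ge0 ?wt_le1.
  by apply/funext => p; ring.
set Ih := Int X2 (fun z => W2 (mu j) z * h z ^+ 2).
have bE e : e ^+ 2 = 1 -> Int (prodw X2 X2) (E e) <= k1 * k2 * mu j ^+ n * Ih.
  move=> ee; rewrite (Int_prod12 (tE e)) mulrC /Ih -IntZr//.
  apply: (le_trans (ler_norm _)); apply: norm_Int; first exact: (@meas_Int1 _ _ _ X2 X2 _ (tE e).1).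
    by under eq_fun do rewrite mulrC; exact: tameZ.
  move=> z; rewrite /E /= IntZ; last exact: tame_W2wt.
  have w0 : 0 <= W2 (mu j) z * h z ^+ 2 by rewrite mulr_ge0 ?W2_ge0 ?sqr_ge0.
  rewrite normrM (ger0_norm w0) ler_wpM2l//.
  rewrite ger0_norm; first exact: Int_W2wt.
  by apply: Int_ge0 => v; rewrite mulr_ge0 ?wt_ge0 ?W2_ge0.
have bE' e : e ^+ 2 = 1 -> Int (prodw X2 X2) (E' e) <= k1 * k2 * mu j ^+ n * Ih.
  move=> ee; apply: le_trans (bE e ee).
  by rewrite (Int_prod21 (tE' e)) (Int_prod12 (tE e)).
have m11 : (-1) ^+ 2 = 1 :> R by rewrite sqrrN expr1n.
have p11 : 1 ^+ 2 = 1 :> R by rewrite expr1n.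
(* The factor [4^-1] is one half from the product of cosines times one half from the bound on
   [|h h'|]. *)
pose S p := C * A j ^+ 2 * (4^-1 * (E (-1) p + E 1 p + E' (-1) p + E' 1 p)).
have tS : tame (prodw X2 X2) S.
  apply: tameZ; apply: tameZ; apply: tameD => //; apply: tameD => //; exact: tameD.
apply: (@le_trans _ _ (Int (prodw X2 X2) S)).
  apply: (le_trans (ler_norm _)); apply: norm_Int => // p.
  have tFF s t : tame X1 (fun x => F (j, c) (Lz p.1 x) * F (j, c) (Lz p.2 x) * cos (dot x s + t)).
    apply: (@tame_cos _ _ X1 _ (fun x => dot x s + t)); first exact: cont_phase.
    apply: (tame_le (C := (B * A j) ^+ 2) _ (tame_wtc c 1)).
      by apply: cont_meas; apply: contM; exact: (cont_comp (@cont_Lz _) cF).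
    have b1 z x : `|F (j, c) (Lz z x)| <= B * A j * wt (x - c).
      apply: (le_trans (hB _ _)); rewrite -mulrA ler_wpM2l// /om3 /Lz /= expr1.
      by rewrite ler_wpM2r ?wt_ge0// ler_piMr ?W2_le1.
    by move=> x; rewrite normrM expr2 [wt _ ^+ 2]expr2 mulrACA; apply: ler_pM.
  have -> : Int X1 (fun x => G x p.1 * G x p.2) = h p.1 * h p.2 * (2^-1 *
     (Int X1 (fun x => F (j, c) (Lz p.1 x) * F (j, c) (Lz p.2 x) * cos (dot x (tau p.1 + (-1) *: tau p.2) + 0)) +
      Int X1 (fun x => F (j, c) (Lz p.1 x) * F (j, c) (Lz p.2 x) * cos (dot x (tau p.1 + 1 *: tau p.2) + (th + th))))).
    rewrite -IntD// -IntZ; last exact: tameD.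
    rewrite -IntZ; last by apply: tameZ; exact: tameD.
    congr Int; apply/funext => x; rewrite /G.
    rewrite [LHS](_ : _ = h p.1 * h p.2 * (F (j, c) (Lz p.1 x) * F (j, c) (Lz p.2 x) *
      (cos (dot x (tau p.1) + th) * cos (dot x (tau p.2) + th)))); last by ring.
    rewrite cos_mul (dotDr (tau p.1) ((-1) *: tau p.2)) (dotDr (tau p.1) (1 *: tau p.2)) !dotZr mulN1r mul1r addr0.
    rewrite (_ : dot x (tau p.1) + th - (dot x (tau p.2) + th) = dot x (tau p.1) - dot x (tau p.2)); last by ring.
    rewrite (_ : dot x (tau p.1) + th + (dot x (tau p.2) + th) = dot x (tau p.1) + dot x (tau p.2) + (th + th)); last by ring.
    by ring.
  have q1 := hC j c p.1 p.2 (tau p.1 + (-1) *: tau p.2) 0.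
  have q2 := hC j c p.1 p.2 (tau p.1 + 1 *: tau p.2) (th + th).
  rewrite normrM normrM [`|2^-1 * _|]normrM [`|2^-1|]ger0_norm//.
  set Y := C * (A j ^+ 2 * W2 (mu j) p.1 * W2 (mu j) p.2) in q1 q2.
  have Y0 : 0 <= Y.
    have wa0 := W2_ge0 (mu j) p.1; have wb0 := W2_ge0 (mu j) p.2.
    by apply: mulr_ge0 => //; apply: mulr_ge0 => //; apply: mulr_ge0 => //; exact: exprn_ge0.
  set wa := wt _ in q1; set wb := wt _ in q2.
  have hh : `|h p.1 * h p.2| <= 2^-1 * (h p.1 ^+ 2 + h p.2 ^+ 2).
    rewrite normrM -(real_normK (num_real (h p.1))) -(real_normK (num_real (h p.2))).
    have := sqr_ge0 (`|h p.1| - `|h p.2|); nra.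
  have -> : S p = 2^-1 * (h p.1 ^+ 2 + h p.2 ^+ 2) * (2^-1 * (Y * wa + Y * wb)).
    rewrite /S /E /E' /Y /wa /wb.
    have := @wt_sign R n 1 (-1) (tau p.1) (tau p.2) m11; rewrite !scale1r => <-.
    have := @wt_sign R n 1 1 (tau p.1) (tau p.2) p11; rewrite !(@scale1r _ _ (_ + _)) => <-.
    by field.
  apply: ler_pM => //; first by rewrite -normrM.
  by rewrite ler_wpM2l// (le_trans (ler_normD _ _))// lerD.
have t1 : tame (prodw X2 X2) (fun p => E (-1) p + E 1 p) by exact: tameD.
have t2 : tame (prodw X2 X2) (fun p => E (-1) p + E 1 p + E' (-1) p) by exact: tameD.
have t3 : tame (prodw X2 X2) (fun p => E (-1) p + E 1 p + E' (-1) p + E' 1 p) by exact: tameD.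
have -> : Int (prodw X2 X2) S = C * A j ^+ 2 * (4^-1 * (Int (prodw X2 X2) (E (-1)) + Int (prodw X2 X2) (E 1) +
    Int (prodw X2 X2) (E' (-1)) + Int (prodw X2 X2) (E' 1))).
  rewrite -(IntD (tE _) (tE _)) -(IntD t1 (tE' _)) -(IntD t2 (tE' _)) -(IntZ _ t3).
  by rewrite -(IntZ _ (tameZ _ t3)).
have := bE _ m11; have := bE _ p11; have := bE' _ m11; have := bE' _ p11.
set u1 := Int _ (E' 1); set u2 := Int _ (E' (-1)); set u3 := Int _ (E 1); set u4 := Int _ (E (-1)).
move=> v1 v2 v3 v4; rewrite [leRHS](_ : _ = C * A j ^+ 2 * (k1 * k2 * mu j ^+ n * Ih)); last by ring.
rewrite ler_wpM2l ?mulr_ge0 ?exprn_ge0//; lra.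
Qed.

(** Cauchy-Schwarz against the total mass of [W2], which is of order [mu ^+ (2 * n)]. Compared with
    [l2core] another [mu ^+ n] is lost: a Bernstein inequality for the output, used when [r > 2]. *)
Lemma supcore : exists2 C, 0 <= C & forall j c th (h : V * V -> R) H x,
  meas X2 h -> (forall z, `|h z| <= H) ->
  (Int X2 (fun z => F (j, c) (Lz z x) * cos (dot x (tau z) + th) * h z)) ^+ 2 <=
  C * A j ^+ 2 * (mu j ^+ n) ^+ 2 * Int X2 (fun z => W2 (mu j) z * h z ^+ 2) * wt (x - c) ^+ 2.
Proof.
have [B B0 hB] := cls_bnd hF.
exists (B ^+ 2 * k2 ^+ 2); first by rewrite mulr_ge0 ?sqr_ge0.
move=> j c th h H x mh hH.
have H0 : 0 <= H by apply: le_trans (hH (0, 0)).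
have cF := cls_cont hF (j, c).
have th2 : tame X2 (fun z => W2 (mu j) z * h z ^+ 2).
  under eq_fun do rewrite mulrC.
  apply: (tameMb (C := H ^+ 2)); [exact: measX|move=> z|exact: tame_W2].
  by rewrite normrX lerXn2r ?nnegrE.
have th1 : tame X2 (fun z => W2 (mu j) z * `|h z|).
  under eq_fun do rewrite mulrC.
  by apply: (tameMb (C := H)); [exact: meas_norm|move=> z; rewrite normr_id|exact: tame_W2].
set Ih := Int X2 (fun z => W2 (mu j) z * h z ^+ 2).
have Ih0 : 0 <= Ih by apply: Int_ge0 => z; rewrite mulr_ge0 ?W2_ge0 ?sqr_ge0.
have CS : Int X2 (fun z => W2 (mu j) z * `|h z|) ^+ 2 <= Int X2 (W2 (mu j)) * Ih.
  have e2 : 1 - 2^-1 = 2^-1 :> R by field.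
  have := @hoelderH R _ X2 2^-1 (W2 (mu j)) (fun z => W2 (mu j) z * h z ^+ 2) _ _ _ (tame_W2 j) th2 th1 (W2_ge0 _).
  rewrite e2 -/Ih => HH.
  have {}HH : Int X2 (fun z => W2 (mu j) z * `|h z|) <= powR (Int X2 (W2 (mu j))) 2^-1 * powR Ih 2^-1.
    apply: HH => //; first by lra.
      by move=> z'; rewrite mulr_ge0 ?W2_ge0 ?sqr_ge0.
    move=> z; have w0 := W2_ge0 (mu j) z.
    have wh0 : 0 <= W2 (mu j) z * h z ^+ 2 by rewrite mulr_ge0 ?sqr_ge0.
    by rewrite !powR12_sqrt// -sqrtrM// mulrA -expr2 sqrtrM ?sqr_ge0// !sqrtr_sqr (ger0_norm w0).
  have W0 : 0 <= Int X2 (W2 (mu j)) by apply: Int_ge0 => z; exact: W2_ge0.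
  have HH0 : 0 <= Int X2 (fun z => W2 (mu j) z * `|h z|) by apply: Int_ge0 => z; rewrite mulr_ge0 ?W2_ge0.
  apply: (@le_trans _ _ ((powR (Int X2 (W2 (mu j))) 2^-1 * powR Ih 2^-1) ^+ 2)).
    by rewrite lerXn2r ?nnegrE ?mulr_ge0 ?powR_ge0.
  by rewrite exprMn !powR12_sqrt// !sqr_sqrtr.
have : `|Int X2 (fun z => F (j, c) (Lz z x) * cos (dot x (tau z) + th) * h z)| <=
    B * A j * wt (x - c) * Int X2 (fun z => W2 (mu j) z * `|h z|).
  rewrite -IntZ//; apply: norm_Int; last 1 first.
  - move=> z; rewrite !normrM mulrA ler_wpM2r//.
    apply: (@le_trans _ _ (B * om3 1 (j, c) (Lz z x) * 1)).
      by apply: ler_pM => //; exact: cos_le1.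
    rewrite mulr1 /om3 /Lz /= expr1; case: (z) => z1 z2 /=; rewrite le_eqVlt; apply/orP; left; apply/eqP; ring.
  - apply: measM => //; apply: cont_meas; apply: contM; first exact: (cont_comp (@cont_Lx x) cF).
    apply: cont_cos; apply: contD; last exact: contC.
    apply: cont_dot => i; first exact: contC.
    by apply: (cont_comp (f := tau) (g := fun u : V => u 0 i)); [exact: cont_tau|exact: coord_cont].
  - exact: tameZ.
move=> hT; rewrite -real_normK ?num_real//.
apply: (@le_trans _ _ ((B * A j * wt (x - c) * Int X2 (fun z => W2 (mu j) z * `|h z|)) ^+ 2)).
  by rewrite lerXn2r ?nnegrE//; apply: le_trans hT.
rewrite exprMn [leRHS](_ : _ = (B * A j * wt (x - c)) ^+ 2 * ((mu j ^+ n * k2) ^+ 2 * Ih)); last by ring.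
by rewrite ler_wpM2l ?sqr_ge0// -(Int_W2 j).
Qed.
End OneTerm.
End Core.
End TripleSpace.

(** * The operator in kernel form, localization of its inputs, and return to the Fourier side *)

Section KernelOperator.
Local Open Scope classical_set_scope.
Local Open Scope ring_scope.
Variables (R : realType) (n : nat).
Notation V := ('rV[R]_n).
Notation V3 := ('rV[R]_n * 'rV[R]_n * 'rV[R]_n)%type.
Notation X1 := (Vw R n).
Notation X2 := (prodw (Vw R n) (Vw R n)).

Definition phk (x : V) (p u : V * V) : R := dot (x - p.1) u.1 + dot (x - p.2) u.2.

(* Real part of the bilinear operator with complex symbol [b false + i b true] applied to real functions, written with its kernel. *)
Definition Tr (I : Type) (b : bool -> I -> V3 -> R) (i : I) (F G : V -> R) (x : V) : R :=
  Int X2 (fun p => F p.1 * G p.2 * RK X2 i (fun z => Lz z x) b (phk x p)).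

Lemma cont_fst2 (i : 'I_n) : continuous (fun u : V * V => u.1 0 i).
Proof. by apply: (cont_comp (f := fst) (g := fun u : V => u 0 i)); [move=> v; exact: cvg_fst|exact: coord_cont]. Qed.
Lemma cont_snd2 (i : 'I_n) : continuous (fun u : V * V => u.2 0 i).
Proof. by apply: (cont_comp (f := snd) (g := fun u : V => u 0 i)); [move=> v; exact: cvg_snd|exact: coord_cont]. Qed.

Lemma cont_phk x p : continuous (phk x p).
Proof.
apply: contD; apply: cont_dot => i; try exact: contC; [exact: cont_fst2|exact: cont_snd2].
Qed.

Lemma phk_shift x p d (h : R) u :
  phk x p (h *: e2 R d + u) = h * (if d.1 then (x - p.2) 0 d.2 else (x - p.1) 0 d.2) + phk x p u.
Proof.
rewrite /phk scale2E /e2; case: d => [[] i] /=; rewrite scaler0 add0r [in LHS]dotC [X in _ + X = _]dotC.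
  by rewrite dot_shift (dotC u.2) (dotC u.1); ring.
by rewrite dot_shift (dotC u.2) (dotC u.1); ring.
Qed.

Section Localize.
Variables (J : Type) (A mu : J -> R).
Hypotheses (A0 : forall j, 0 <= A j) (mu1 : forall j, 1 <= mu j).

Definition sdir (d : 'I_3 * 'I_n) (i : J * V) (v : V3) : R := v.1.1 0 d.2 - i.2 0 d.2.
(** The phase has slope [x_k - y_k] in direction [xi_k], and [sdir] is [x_k - c_k]. Their difference
    [c_k - y_k] is free of [x], which is what puts the localization on the inputs. *)
Definition LLc (b : bool -> J * V -> V3 -> R) := LLop (@e3 R n) sdir (map (@g2 n) (index_enum _)) b.

Lemma affine_sdir d : affine (@e3 R n) (fun (_ : J * V) d' => (e3 R d').1.1 0 d.2) (sdir d).
Proof.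
split.
- move=> i; apply: contB; last exact: contC.
  apply: (cont_comp (f := fun v : V3 => v.1.1) (g := fun u : V => u 0 d.2)); last exact: coord_cont.
  by apply: (cont_compT (f := fst) (g := fst)); move=> v; exact: cvg_fst.
- move=> i d'; rewrite /e3; case: ifP => _ /=; last by case: ifP => _ /=; rewrite mxE normr0.
  by rewrite mxE eqxx; case: eqP => _; rewrite ?normr1 ?normr0.
- by move=> i d' h v; rewrite /sdir scale3E [X in X - _]mxE [X in X + _ - _]mxE; ring.
Qed.

Lemma prod_dirs (x : V) : \prod_(d : bool * 'I_n) (1 + x 0 d.2 ^+ 2) = (wt x)^-1 ^+ 2.
Proof.
rewrite -(pair_bigA _ (fun (_ : bool) (i : 'I_n) => 1 + x 0 i ^+ 2)) /= big_bool /= -expr2; congr (_ ^+ 2).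
by rewrite /wt -prodfV; apply: eq_bigr => i _; rewrite /w1 invrK.
Qed.

(** Every coordinate is used twice, for [xi] and for [eta], and each use loses
    [(1 + (x_k - c_k) ^+ 2) ^+ 2] and two derivatives: [wt (x - c) ^- 4] and [4 * n] derivatives in
    all. *)
Lemma cls_LLc K M b : (forall u, cls (@e3 R n) (K + 4 * n) (b u) (om3 A mu (M + 4))) ->
  forall u, cls (@e3 R n) K (LLc b u) (om3 A mu M).
Proof.
move=> hb u.
have sz : (2 * size (map (@g2 n) (index_enum (bool * 'I_n)%type)) = 4 * n)%N.
  by rewrite size_map size_index_enum card_prod card_bool card_ord mulnA.
have := cls_LLop affine_sdir (K := K) (ds := map (@g2 n) (index_enum _)) (@om3_ge0 R n J A mu A0 (M + 4)).
rewrite sz => /(_ b hb u); apply: (cls_le ler01) => i v; rewrite mul1r le_eqVlt; apply/orP; left; apply/eqP.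
rewrite big_map (_ : \prod_(_ <- _) _ = (wt (v.1.1 - i.2))^-1 ^+ 4).
  rewrite /om3 exprD; have := wt_gt0 (v.1.1 - i.2); set w := wt _ => w0; field; exact: lt0r_neq0.
transitivity ((\prod_(d : bool * 'I_n) (1 + (v.1.1 - i.2) 0 d.2 ^+ 2)) ^+ 2).
  by rewrite -prodrXl; apply: eq_bigr => d _; rewrite /sdir /g2/= !mxE.
by rewrite prod_dirs -exprM.
Qed.

Lemma tame_om3_slice M i x : tame X2 (fun z => om3 A mu M i (Lz z x)).
Proof.
rewrite /om3 /Lz /= (_ : (fun z => _) = fun z => A i.1 * wt (x - i.2) ^+ M * W2 (mu i.1) z).
  by apply: tameZ; exact: tame_W2.
by apply/funext => -[z1 z2] /=; ring.
Qed.

(** The factors gained by integrating by parts are exactly [wt (y - c)] and [wt (y' - c)]; they are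
    absorbed into [F] and [G]. *)
Lemma Tr_loc M b j c F G x : (forall u, cls (@e3 R n) (4 * n) (b u) (om3 A mu M)) ->
  Tr b (j, c) F G x = Tr (LLc b) (j, c) (fun y => F y * wt (y - c)) (fun y => G y * wt (y - c)) x.
Proof.
move=> hb; rewrite /Tr; congr Int; apply/funext => p.
have sz : (2 * size (index_enum (bool * 'I_n)%type) = 4 * n)%N.
  by rewrite size_index_enum card_prod card_bool card_ord mulnA.
have hb' u : cls (@e3 R n) (2 * size (index_enum (bool * 'I_n)%type)) (b u) (om3 A mu M) by rewrite sz.
have := @RK_LL R _ _ _ _ (@e3 R n) (@e2 R n) (@g2 n) _ sdir _ affine_sdir X2 (j, c) (fun z => Lz z x)
  (fun d => x 0 d.2 - c 0 d.2) (@ibp_e2 R n) (@cont_Lx R n x) (@Lx_shift R n x) (fun d u => erefl) b _ (index_enum _)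
  (phk x p) _ (@cont_phk x p) (phk_shift x p) (@om3_ge0 R n J A mu A0 M) (tame_om3_slice M (j, c) x) hb'.
rewrite -/(LLc b) => <-.
rewrite (_ : \prod_(_ <- _) _ = (wt (p.1 - c) * wt (p.2 - c))^-1).
  have := wt_gt0 (p.1 - c); have := wt_gt0 (p.2 - c); set a := wt _; set a' := wt _ => a0 a'0.
  by field; rewrite !lt0r_neq0.
rewrite -(pair_bigA _ (fun (d : bool) (i : 'I_n) => 1 + ((if d then (x - p.2) 0 i else (x - p.1) 0 i) -
  (x 0 i - c 0 i)) ^+ 2)) /= big_bool /= invfM mulrC; congr (_ * _); rewrite /wt -prodfV;
  apply: eq_bigr => i _; rewrite /w1 invrK !mxE; ring.
Qed.
End Localize.

(** Phase 0 gives the cosine transform and phase [- (pi / 2)] the sine transform. *)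
Definition Ft (F : V -> R) (th : R) (xi : V) : R := Int X1 (fun y => F y * cos (dot y xi + th)).
(** [hh0] is the real part, and [hh1] minus the imaginary part, of the product of the Fourier
    transforms of [F] and [G]. *)
Definition hh0 F G (z : V * V) := Ft F 0 z.1 * Ft G 0 z.2 - Ft F (- (pi / 2)) z.1 * Ft G (- (pi / 2)) z.2.
Definition hh1 F G (z : V * V) := Ft F (- (pi / 2)) z.1 * Ft G 0 z.2 + Ft F 0 z.1 * Ft G (- (pi / 2)) z.2.
Definition Th (f : V3 -> R) th (h : V * V -> R) x := Int X2 (fun z => f (Lz z x) * cos (dot x (tau z) + th) * h z).

Lemma tame_Fcos F th xi : tame X1 F -> tame X1 (fun y => F y * cos (dot y xi + th)).
Proof. by move=> tF; apply: (@tame_cos _ _ X1 F (fun y => dot y xi + th)) => //; exact: cont_phase. Qed.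

Lemma Ft_bnd F th xi : tame X1 F -> `|Ft F th xi| <= Int X1 (fun y => `|F y|).
Proof.
move=> tF; apply: norm_Int; [exact: (tame_Fcos _ _ tF).1|exact: tame_norm|].
by move=> y; rewrite normrM ler_piMr// cos_le1.
Qed.

Lemma meas_Ft F th : tame X1 F -> meas X1 (Ft F th).
Proof.
move=> tF; apply: (@meas_Int1 _ _ _ X1 X1 (fun p => F p.2 * cos (dot p.2 p.1 + th))).
apply: measM; first exact: (@meas_snd _ _ _ X1 X1 F tF.1).
apply: cont_meas; apply: cont_cos; apply: contD; last exact: contC.
by apply: cont_dot => i; [exact: cont_snd2|exact: cont_fst2].
Qed.

Lemma meas_FF F G t t' : tame X1 F -> tame X1 G -> meas X2 (fun z => Ft F t z.1 * Ft G t' z.2).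
Proof.
by move=> tF tG; apply: measM; [exact: (@meas_fst _ _ _ X1 X1 _ (meas_Ft t tF))|exact: (@meas_snd _ _ _ X1 X1 _ (meas_Ft t' tG))].
Qed.

Lemma meas_hh F G : tame X1 F -> tame X1 G -> meas X2 (hh0 F G) /\ meas X2 (hh1 F G).
Proof. by move=> tF tG; split; [apply: measB|apply: measD]; exact: meas_FF. Qed.

Lemma hh_bnd F G : tame X1 F -> tame X1 G -> exists H, forall z, `|hh0 F G z| <= H /\ `|hh1 F G z| <= H.
Proof.
move=> tF tG; exists (2 * (Int X1 (fun y => `|F y|) * Int X1 (fun y => `|G y|))) => z.
have b t t' : `|Ft F t z.1 * Ft G t' z.2| <= Int X1 (fun y => `|F y|) * Int X1 (fun y => `|G y|).
  by rewrite normrM ler_pM// Ft_bnd.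
rewrite mulr_natl mulr2n; split; first by apply: (le_trans (ler_normB _ _)); exact: lerD.
by apply: (le_trans (ler_normD _ _)); exact: lerD.
Qed.

Lemma sin_cos (t : R) : sin t = cos (t + - (pi / 2)).
Proof. by rewrite cosD cosN sinN cos_pihalf sin_pihalf mulr0 add0r mulrN1 opprK. Qed.

Section Fubini.
Variables (I : Type) (b : bool -> I -> V3 -> R) (i : I) (x : V) (F G : V -> R) (C mu : R).
Hypotheses (cb : forall u, continuous (b u i)) (hb : forall u z, `|b u i (Lz z x)| <= C * W2 mu z)
  (mu0 : 0 < mu) (nF : nice F) (nG : nice G).

Lemma tameW2' : tame X2 (W2 mu).
Proof.
by apply: (@tame_prod _ _ _ X1 X1 (fun xi => wm mu xi ^+ 2) (fun xi => wm mu xi ^+ 2)); apply: tame_wtsc; rewrite invr_gt0.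
Qed.
Lemma tame_bL u : tame X2 (fun z => b u i (Lz z x)).
Proof.
apply: (tame_le _ tameW2' (hb u)).
by apply: cont_meas; exact: (cont_comp (@cont_Lx R n x) (@cb u)).
Qed.

Lemma tame_Th u th h H : meas X2 h -> (forall z, `|h z| <= H) ->
  tame X2 (fun z => b u i (Lz z x) * cos (dot x (tau z) + th) * h z).
Proof.
move=> mh hH; under eq_fun do rewrite mulrC; apply: (tameMb (C := H)) => //.
apply: (@tame_cos _ _ X2 _ (fun z => dot x (tau z) + th)); last exact: tame_bL.
apply: contD; last exact: contC.
apply: cont_dot => k; first exact: contC.
by apply: (cont_comp (f := @tau R n) (g := fun u : V => u 0 k)); [exact: cont_tau|exact: coord_cont].
Qed.

(** Fubini between [(y, y')] and [(xi, eta)], then the addition formulas. The four terms pair the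
    real and imaginary parts of the symbol with those of the product of transforms. *)
Lemma TrE : Tr b i F G x = Th (b false i) 0 (hh0 F G) x + Th (b true i) (pi / 2) (hh0 F G) x +
  Th (b false i) (- (pi / 2)) (hh1 F G) x + Th (b true i) 0 (hh1 F G) x.
Proof.
have tF := nice_tame nF; have tG := nice_tame nG.
have tFG : tame X2 (fun p : V * V => F p.1 * G p.2) by exact: (tame_prod tF tG).
pose K (p u : V * V) := F p.1 * G p.2 * (b false i (Lz u x) * cos (phk x p u) - b true i (Lz u x) * sin (phk x p u)).
have cphk : continuous (fun q : (V * V) * (V * V) => phk x q.1 q.2).
  have c1 (T : topologicalType) (f : V * V -> T) : continuous f -> continuous (fun q : (V * V) * (V * V) => f q.1).
    by move=> cf; apply: (cont_compT (f := fst)) => //; move=> v; exact: cvg_fst.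
  have c2 (T : topologicalType) (f : V * V -> T) : continuous f -> continuous (fun q : (V * V) * (V * V) => f q.2).
    by move=> cf; apply: (cont_compT (f := snd)) => //; move=> v; exact: cvg_snd.
  apply: contD; apply: cont_dot => k.
  - under eq_fun do rewrite 2!mxE; apply: contB; first exact: contC.
    exact: (c1 _ (fun p => p.1 0 k) (@cont_fst2 k)).
  - exact: (c2 _ (fun p => p.1 0 k) (@cont_fst2 k)).
  - under eq_fun do rewrite 2!mxE; apply: contB; first exact: contC.
    exact: (c1 _ (fun p => p.2 0 k) (@cont_snd2 k)).
  - exact: (c2 _ (fun p => p.2 0 k) (@cont_snd2 k)).
have tK : tame (prodw X2 X2) (fun q => K q.1 q.2).
  have t0 u : tame (prodw X2 X2) (fun q => F q.1.1 * G q.1.2 * b u i (Lz q.2 x)) by exact: (tame_prod tFG (tame_bL u)).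
  rewrite /K (_ : (fun q => _) = fun q : (V * V) * (V * V) => cos (phk x q.1 q.2) * (F q.1.1 * G q.1.2 * b false i (Lz q.2 x)) -
     sin (phk x q.1 q.2) * (F q.1.1 * G q.1.2 * b true i (Lz q.2 x))); last by apply/funext => q; ring.
  apply: tameB; apply: (tameMb (C := 1)) => //; try (by move=> v; exact: cos_le1); try (by move=> v; exact: sin_le1).
    by apply: cont_meas; exact: cont_cos.
  by apply: cont_meas; exact: cont_sin.
have tbc p : tame X2 (fun u => b false i (Lz u x) * cos (phk x p u) - b true i (Lz u x) * sin (phk x p u)).
  apply: tameB.
    by apply: (@tame_cos _ _ X2 _ (phk x p)); [exact: cont_phk|exact: tame_bL].
  under eq_fun do rewrite mulrC; apply: (tameMb (C := 1)); [|by move=> v; exact: sin_le1|exact: tame_bL].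
  by apply: cont_meas; apply: cont_sin; exact: cont_phk.
have -> : Tr b i F G x = Int X2 (fun p => Int X2 (K p)).
  by congr Int; apply/funext => p; rewrite /RK -IntZ.
rewrite (Int_swap tK).
have [m0 m1] := meas_hh tF tG; have [H hH] := hh_bnd tF tG.
have H0 z := (hH z).1; have H1 z := (hH z).2.
rewrite /Th -IntD; [|exact: (tame_Th _ _ m0 H0)|exact: (tame_Th _ _ m0 H0)].
have t12 := tameD (tame_Th false 0 m0 H0) (tame_Th true (pi / 2) m0 H0).
rewrite -IntD//; last exact: (tame_Th _ _ m1 H1).
rewrite -IntD; [|by apply: tameD => //; exact: (tame_Th _ _ m1 H1)|exact: (tame_Th _ _ m1 H1)].
congr Int; apply/funext => u.
have tc t xi := tame_Fcos t xi tF; have tc' t xi := tame_Fcos t xi tG.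
have E t t' : Int X2 (fun p => F p.1 * cos (dot p.1 u.1 + t) * (G p.2 * cos (dot p.2 u.2 + t'))) = Ft F t u.1 * Ft G t' u.2.
  rewrite (Int_prod12 (tame_prod (tc t u.1) (tc' t' u.2))) /Ft -IntZr//.
  by congr Int; apply/funext => y; rewrite /= IntZ.
pose P t t' (p : V * V) := F p.1 * cos (dot p.1 u.1 + t) * (G p.2 * cos (dot p.2 u.2 + t')).
have tP t t' : tame X2 (P t t') by exact: (tame_prod (tc t u.1) (tc' t' u.2)).
set B0 := b false i (Lz u x); set B1 := b true i (Lz u x).
pose c0 := B0 * cos (dot x (tau u)) - B1 * sin (dot x (tau u)).
pose c1 := B0 * sin (dot x (tau u)) + B1 * cos (dot x (tau u)).
transitivity (c0 * hh0 F G u + c1 * hh1 F G u); last first.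
  rewrite /c0 /c1 -sin_cos addr0 [cos (_ + pi / 2)]cosD cos_pihalf sin_pihalf mulr0 sub0r mulr1; ring.
rewrite /hh0 /hh1 -!E -!/(P _ _).
rewrite -IntB; [|exact: tP|exact: tP]; rewrite -IntD; [|exact: tP|exact: tP].
rewrite -IntZ; last exact: tameB; rewrite -IntZ; last exact: tameD.
rewrite -IntD; [|by apply: tameZ; exact: tameB|by apply: tameZ; exact: tameD].
congr Int; apply/funext => p; rewrite /K -/B0 -/B1 /P -!sin_cos !addr0.
have -> : phk x p u = dot x (tau u) - (dot p.1 u.1 + dot p.2 u.2).
  by rewrite /phk /tau !dotDl !dotNl dotDr; ring.
rewrite cosB sinB cosD sinD /c0 /c1; ring.
Qed.
End Fubini.

Section Core.
Variables (J : Type) (A mu : J -> R).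
Hypotheses (A0 : forall j, 0 <= A j) (mu1 : forall j, 1 <= mu j).
Variable b : bool -> J * V -> V3 -> R.
Hypothesis hb : forall u, cls (@e3 R n) (2 * n) (b u) (om3 A mu 1).

Lemma cls_slice_bnd : exists2 C, 0 <= C & forall u i x z, `|b u i (Lz z x)| <= C * (A i.1 * wt (x - i.2)) * W2 (mu i.1) z.
Proof.
have [C C0 hC] := cls_bnd (hb false); have [C' C'0 hC'] := cls_bnd (hb true).
exists (C + C'); first exact: addr_ge0.
move=> u i x z; rewrite -mulrA (_ : _ * W2 _ _ = om3 A mu 1 i (Lz z x)); last first.
  by rewrite /om3 /Lz /= expr1; case: z => z1 z2 /=; ring.
have o0 := @om3_ge0 R n J A mu A0 1 i (Lz z x).
case: u; [apply: (le_trans (hC' _ _))|apply: (le_trans (hC _ _))]; rewrite ler_wpM2r// ?lerDl ?lerDr//.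
Qed.

Lemma mu_gt0' j : 0 < mu j. Proof. exact: lt_le_trans ltr01 (mu1 j). Qed.

Lemma TrE' i F G x : nice F -> nice G ->
  Tr b i F G x = Th (b false i) 0 (hh0 F G) x + Th (b true i) (pi / 2) (hh0 F G) x +
  Th (b false i) (- (pi / 2)) (hh1 F G) x + Th (b true i) 0 (hh1 F G) x.
Proof.
move=> nF nG; have [C C0 hC] := cls_slice_bnd.
apply: (TrE (C := C * (A i.1 * wt (x - i.2))) (mu := mu i.1)) => //.
- by move=> u; exact: (cls_cont (hb u) i).
- exact: mu_gt0'.
Qed.

Lemma meas_Th u i th h : meas X2 h -> meas X1 (Th (b u i) th h).
Proof.
move=> mh; apply: (@meas_Int1 _ _ _ X1 X2 (fun q => b u i (Lz q.2 q.1) * cos (dot q.1 (tau q.2) + th) * h q.2)).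
apply: measM; last exact: (@meas_snd _ _ _ X1 X2 h mh).
apply: cont_meas; apply: contM; first exact: (cont_comp (@cont_Lxz R n) (cls_cont (hb u) i)).
apply: cont_cos; apply: contD; last exact: contC.
apply: cont_dot => k.
  by apply: (cont_comp (f := fst) (g := fun u : V => u 0 k)); [move=> v; exact: cvg_fst|exact: coord_cont].
apply: (cont_comp (f := fun p : V * (V * V) => tau p.2) (g := fun u : V => u 0 k)); last exact: coord_cont.
by apply: (cont_compT (f := snd) (g := @tau R n)); [by move=> v; exact: cvg_snd|exact: cont_tau].
Qed.


(** The weight [W2] and the products of transforms factor in [xi] and [eta], so [bessel] applies to
    [F] and to [G] with independent exponents [s1] and [s2]. *)
Lemma hh_W2 : exists2 C, 0 <= C & forall j F G s1 s2, nice F -> nice G -> 2^-1 <= s1 -> s1 <= 1 -> 2^-1 <= s2 -> s2 <= 1 ->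
  let Q := powR (mu j ^+ n) (2 * s1 - 1) * powR (Int X1 (fun y => powR `|F y| s1^-1)) (2 * s1) *
    (powR (mu j ^+ n) (2 * s2 - 1) * powR (Int X1 (fun y => powR `|G y| s2^-1)) (2 * s2)) in
  0 <= Q /\ Int X2 (fun z => W2 (mu j) z * hh0 F G z ^+ 2) <= C * Q /\ Int X2 (fun z => W2 (mu j) z * hh1 F G z ^+ 2) <= C * Q.
Proof.
have [B B0 hB] := bessel R n; exists (4 * (B * B)); first by rewrite !mulr_ge0.
move=> j F G s1 s2 nF nG s11 s12 s21 s22 Q.
have tF := nice_tame nF; have tG := nice_tame nG.
have bs t H : tame X1 H -> tame X1 (fun xi => wm (mu j) xi ^+ 2 * Ft H t xi ^+ 2).
  move=> tH; under eq_fun do rewrite mulrC.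
  apply: (tameMb (C := Int X1 (fun y => `|H y|) ^+ 2)); last exact: (tame_wm n mu1 j 1).
    by apply: measX; exact: meas_Ft.
  move=> v; rewrite normrX lerXn2r ?nnegrE ?Ft_bnd//.
  exact: le_trans (normr_ge0 _) (Ft_bnd 0 v tH).
have E t t' : tame X2 (fun z => wm (mu j) z.1 ^+ 2 * Ft F t z.1 ^+ 2 * (wm (mu j) z.2 ^+ 2 * Ft G t' z.2 ^+ 2)) /\
   Int X2 (fun z => wm (mu j) z.1 ^+ 2 * Ft F t z.1 ^+ 2 * (wm (mu j) z.2 ^+ 2 * Ft G t' z.2 ^+ 2)) <= B * B * Q.
  have tp := tame_prod (bs t F tF) (bs t' G tG); split => //.
  rewrite (Int_prod12 tp) (_ : Int X1 _ = Int X1 (fun xi => wm (mu j) xi ^+ 2 * Ft F t xi ^+ 2) *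
      Int X1 (fun xi => wm (mu j) xi ^+ 2 * Ft G t' xi ^+ 2)); last first.
    by rewrite -IntZr; [congr Int; apply/funext => y; rewrite /= IntZ//|]; exact: bs.
  have h1 := hB (mu j) s1 F t (mu1 j) s11 s12 nF; have h2 := hB (mu j) s2 G t' (mu1 j) s21 s22 nG.
  have gen (B' m1 N1 m2 N2 : R) : B' * B' * (m1 * N1 * (m2 * N2)) = (B' * m1 * N1) * (B' * m2 * N2) by ring.
  rewrite /Q gen.
  by apply: (ler_pM _ _ h1 h2); apply: Int_ge0 => v; rewrite mulr_ge0 ?sqr_ge0.
have Q0 : 0 <= Q by rewrite /Q !mulr_ge0 ?powR_ge0.
pose e t t' (z : V * V) := wm (mu j) z.1 ^+ 2 * Ft F t z.1 ^+ 2 * (wm (mu j) z.2 ^+ 2 * Ft G t' z.2 ^+ 2).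
have [m0 m1] := meas_hh tF tG; have [H hH] := hh_bnd tF tG.
have key t t' u u' (h : V * V -> R) : meas X2 h ->
   (forall z, h z ^+ 2 <= 2 * (Ft F t z.1 * Ft G t' z.2) ^+ 2 + 2 * (Ft F u z.1 * Ft G u' z.2) ^+ 2) ->
   Int X2 (fun z => W2 (mu j) z * h z ^+ 2) <= 4 * (B * B) * Q.
  move=> mh hh; have [te1 le1] := E t t'; have [te2 le2] := E u u'.
  have te : tame X2 (fun z => 2 * e t t' z + 2 * e u u' z) by apply: tameD; apply: tameZ.
  apply: (@le_trans _ _ (Int X2 (fun z => 2 * e t t' z + 2 * e u u' z))).
    apply: (le_trans (ler_norm _)); apply: norm_Int => //.
      by apply: measM; [exact: (tame_W2 n mu1 j).1|exact: measX].
    move=> z; rewrite ger0_norm; last by rewrite mulr_ge0 ?sqr_ge0// W2_ge0.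
    rewrite [leRHS](_ : _ = W2 (mu j) z * (2 * (Ft F t z.1 * Ft G t' z.2) ^+ 2 + 2 * (Ft F u z.1 * Ft G u' z.2) ^+ 2)); last first.
      by rewrite /e /W2; ring.
    by rewrite ler_wpM2l ?W2_ge0.
  rewrite IntD; [|exact: tameZ|exact: tameZ]; rewrite !IntZ//.
  rewrite -[4]/(2 * 2)%:R; rewrite /e; nra.
split => //; split.
  apply: (key 0 0 (- (pi / 2)) (- (pi / 2))) => // z; rewrite /hh0.
  by set p := Ft F 0 _ * _; set q := Ft F _ _ * _; have := sqr_ge0 (p + q); nra.
apply: (key (- (pi / 2)) 0 0 (- (pi / 2))) => // z; rewrite /hh1.
by set p := Ft F (- _) _ * _; set q := Ft F 0 _ * _; have := sqr_ge0 (p - q); nra.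
Qed.
End Core.
End KernelOperator.

(** * Estimates near a centre for a family of symbols *)

Section LocalEstimate.
Local Open Scope classical_set_scope.
Local Open Scope ring_scope.
Variables (R : realType) (n : nat).
Notation V := ('rV[R]_n).
Notation V3 := ('rV[R]_n * 'rV[R]_n * 'rV[R]_n)%type.
Notation X1 := (Vw R n).
Notation X2 := (prodw (Vw R n) (Vw R n)).

(* Real part of the bilinear operator, written on the Fourier side. *)
Definition Hf (f : bool -> V3 -> R) (F G : V -> R) (x : V) : R :=
  Th (f false) 0 (hh0 F G) x + Th (f true) (pi / 2) (hh0 F G) x +
  Th (f false) (- (pi / 2)) (hh1 F G) x + Th (f true) 0 (hh1 F G) x.

Lemma cls_chi (J : Type) K p : cls (@e3 R n) K (fun (i : J * V) v => wt (v.1.1 - i.2) ^+ p)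
  (fun i v => wt (v.1.1 - i.2) ^+ p).
Proof.
apply: clsX => [i v|]; first exact: wt_ge0.
have h2 (k : 'I_n) := @cls_w1 R _ _ (@e3 R n) (J * V) K _ _ (@affine_sdir R n J (ord0, k)).
have h1 (k : 'I_n) (i : J * V) (v : V3) : 0 <= w1 (sdir (ord0, k) i v) by exact: ltW (w1_gt0 _).
have := @cls_prod _ _ _ _ _ K _ (index_enum 'I_n) _ _ h1 h2.
rewrite (_ : (fun i v => \prod_(j <- index_enum 'I_n) w1 (sdir (ord0, j) i v)) = fun (i : J * V) v => wt (v.1.1 - i.2))//.
by apply/funext => i; apply/funext => v; apply: eq_bigr => k _; rewrite /sdir !mxE.
Qed.

Lemma nice_wc F c : nice F -> nice (fun y : V => F y * wt (y - c)).
Proof.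
move=> [cF [C hC]]; split.
  apply: contM => //; apply: (cont_comp (f := fun y : V => y - c) (g := @wt R n)); last exact: wt_cont.
  apply: cont_rV => j; under eq_fun do rewrite !mxE.
  by apply: contB; [exact: coord_cont|exact: contC].
exists C => v; rewrite normrM (le_trans _ (hC v))// ler_piMr// ger0_norm ?wt_ge0 ?wt_le1//.
Qed.

Lemma Int_sqr4 (T : topologicalType) (X : wspace R T) (u t1 t2 t3 t4 : T -> R) : meas X u ->
  tame X (fun x => t1 x ^+ 2) -> tame X (fun x => t2 x ^+ 2) -> tame X (fun x => t3 x ^+ 2) -> tame X (fun x => t4 x ^+ 2) ->
  (forall x, u x ^+ 2 <= 4 * (t1 x ^+ 2 + t2 x ^+ 2 + t3 x ^+ 2 + t4 x ^+ 2)) ->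
  Int X (fun x => u x ^+ 2) <= 4 * (Int X (fun x => t1 x ^+ 2) + Int X (fun x => t2 x ^+ 2) + Int X (fun x => t3 x ^+ 2) + Int X (fun x => t4 x ^+ 2)).
Proof.
move=> mu h1 h2 h3 h4 hu; have h12 := tameD h1 h2; have h123 := tameD h12 h3; have h := tameD h123 h4.
rewrite -(IntD h1 h2) -(IntD h12 h3) -(IntD h123 h4) -(IntZ 4 h); apply: (le_trans (ler_norm _)).
apply: norm_Int; [exact: measX|exact: tameZ|] => x.
by rewrite (ger0_norm (sqr_ge0 _)).
Qed.

Section Family.
Variables (J : Type) (A mu : J -> R).
Hypotheses (A0 : forall j, 0 <= A j) (mu1 : forall j, 1 <= mu j).
Variable a : bool -> J -> V3 -> R.
Hypothesis ha : forall u, cls (@e3 R n) (6 * n) (a u) (fun j v => A j * W2 (mu j) (v.1.2, v.2)).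

(** Five powers of the weight: [LLc] consumes four, and the estimates for localized symbols need the
    last. *)
Let b u (i : J * V) v := wt (v.1.1 - i.2) ^+ 5 * a u i.1 v.

Lemma cls_b u : cls (@e3 R n) (6 * n) (b u) (om3 A mu 5).
Proof.
have h1 := @cls_chi J (6 * n) 5; have h2 := cls_reindex (fun i : J * V => i.1) (ha u).
have := clsM (fun i v => exprn_ge0 5 (wt_ge0 _)) h1 h2.
by apply: (cls_le ler01) => i v; rewrite mul1r /om3 mulrC.
Qed.

Lemma mu_gt0'' j : 0 < mu j. Proof. exact: lt_le_trans ltr01 (mu1 j). Qed.

Lemma a_bnd : exists2 C, 0 <= C & forall u j v, `|a u j v| <= C * (A j * W2 (mu j) (v.1.2, v.2)).
Proof.
have [C C0 hC] := cls_bnd (ha false); have [C' C'0 hC'] := cls_bnd (ha true).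
exists (C + C'); first exact: addr_ge0.
move=> u j v; have w0 := W2_ge0 (mu j) (v.1.2, v.2).
have o0 : 0 <= A j * W2 (mu j) (v.1.2, v.2) by exact: mulr_ge0.
case: u; [apply: (le_trans (hC' _ _))|apply: (le_trans (hC _ _))]; rewrite ler_wpM2r// ?lerDl ?lerDr//.
Qed.

(** The cut-off depends on [x] only, so it comes out of the frequency integral. *)
Lemma Hf_b j c F G x : nice F -> nice G -> Tr b (j, c) F G x = wt (x - c) ^+ 5 * Hf (a ^~ j) F G x.
Proof.
move=> nF nG.
have hb1 u : cls (@e3 R n) (2 * n) (b u) (om3 A mu 1).
  have := cls_low (K' := 2 * n) _ (cls_b u); rewrite leq_mul2r orbT => /(_ isT).
  apply: (cls_le ler01) => i v; rewrite mul1r /om3 ler_wpM2l//.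
    by have := W2_ge0 (mu i.1) (v.1.2, v.2); exact: mulr_ge0.
  by rewrite expr1 exprS ler_piMr ?wt_ge0// exprn_ile1 ?wt_ge0 ?wt_le1.
rewrite (TrE' A0 mu1 hb1)// /Hf.
have [C C0 hC] := a_bnd.
have [m0 m1] := meas_hh (nice_tame nF) (nice_tame nG); have [H hH] := hh_bnd (nice_tame nF) (nice_tame nG).
have E u th h : meas X2 h -> (forall z, `|h z| <= H) -> Th (b u (j, c)) th h x = wt (x - c) ^+ 5 * Th (a u j) th h x.
  move=> mh hh; rewrite /Th -IntZ.
    by congr Int; apply/funext => z; rewrite /b /Lz /=; ring.
  have := @tame_Th R n J (fun u => a u) j x (C * A j) (mu j) _ _ (mu_gt0'' j) u th h H mh hh.
  apply; first by move=> w; exact: (cls_cont (ha w) j).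
  by move=> w z; apply: (le_trans (hC _ _ _)); rewrite mulrA /Lz /=; case: z.
rewrite !E//; try (by move=> z; have [] := hH z).
by ring.
Qed.

(** The output near [c] is estimated by the inputs near the same [c]. [S2] is the factor
    [A ^+ 2 * mu ^+ n] of [l2core] times the two input bounds of [bessel]; the pointwise bound is
    larger by [mu ^+ n]. *)
Lemma loc2 : exists2 C, 0 <= C & forall j c F G s1 s2, nice F -> nice G -> 2^-1 <= s1 -> s1 <= 1 -> 2^-1 <= s2 -> s2 <= 1 ->
  let u x := wt (x - c) ^+ 5 * Hf (a ^~ j) F G x in
  let S2 := A j ^+ 2 * mu j ^+ n * (powR (mu j ^+ n) (2 * s1 - 1) * powR (Int X1 (fun y => powR `|F y * wt (y - c)| s1^-1)) (2 * s1) *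
    (powR (mu j ^+ n) (2 * s2 - 1) * powR (Int X1 (fun y => powR `|G y * wt (y - c)| s2^-1)) (2 * s2))) in
  [/\ meas X1 u, Int X1 (fun x => u x ^+ 2) <= C * S2 & forall x, u x ^+ 2 <= C * (mu j ^+ n * S2) * wt (x - c) ^+ 2].
Proof.
have hb u : cls (@e3 R n) (2 * n + 4 * n) (b u) (om3 A mu (1 + 4)) by rewrite -mulnDl; exact: cls_b.
have hB := cls_LLc A0 hb.
have hb4 u : cls (@e3 R n) (4 * n) (b u) (om3 A mu (1 + 4)) by apply: cls_low (hb u); rewrite leq_addl.
set B := LLc b in hB.
have [L0 L00 hL0] := l2core A0 mu1 (hB false); have [L1 L10 hL1] := l2core A0 mu1 (hB true).
have [U0 U00 hU0] := supcore mu1 (hB false); have [U1 U10 hU1] := supcore mu1 (hB true).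
have [D D0 hD] := hh_W2 n mu1.
(* One constant for both conclusions: it adds the constants of the four square-integral and the four
   pointwise bounds. The factor 4 comes from squaring a sum of four terms. *)
pose C := 4 * (L0 + L1 + L0 + L1 + (U0 + U1 + U0 + U1)) * D.
have C0 : 0 <= C by rewrite /C !mulr_ge0 ?addr_ge0.
exists C => // j c F G s1 s2 nF nG s11 s12 s21 s22 u S2.
pose F' y := F y * wt (y - c); pose G' y := G y * wt (y - c).
have nF' : nice F' by exact: nice_wc. have nG' : nice G' by exact: nice_wc.
have [Q0 [q0 q1]] := hD j F' G' s1 s2 nF' nG' s11 s12 s21 s22.
set Q := _ * _ in Q0 q0 q1.
have uE x : u x = Th (B false (j, c)) 0 (hh0 F' G') x + Th (B true (j, c)) (pi / 2) (hh0 F' G') x +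
  Th (B false (j, c)) (- (pi / 2)) (hh1 F' G') x + Th (B true (j, c)) 0 (hh1 F' G') x.
  by rewrite /u -Hf_b// (Tr_loc A0 mu1 j c F G x hb4) (TrE' A0 mu1 hB).
have [m0 m1] := meas_hh (nice_tame nF') (nice_tame nG'); have [H hH] := hh_bnd (nice_tame nF') (nice_tame nG').
have H0 z := (hH z).1; have H1 z := (hH z).2.
have mT u' th h : meas X2 h -> meas X1 (Th (B u' (j, c)) th h) by move=> mh; exact: (@meas_Th R n J A mu B hB).
pose t1 x := Th (B false (j, c)) 0 (hh0 F' G') x; pose t2 x := Th (B true (j, c)) (pi / 2) (hh0 F' G') x.
pose t3 x := Th (B false (j, c)) (- (pi / 2)) (hh1 F' G') x; pose t4 x := Th (B true (j, c)) 0 (hh1 F' G') x.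
have mt1 : meas X1 t1 by exact: mT. have mt2 : meas X1 t2 by exact: mT.
have mt3 : meas X1 t3 by exact: mT. have mt4 : meas X1 t4 by exact: mT.
have mu' : meas X1 u.
  rewrite (_ : u = fun x => t1 x + t2 x + t3 x + t4 x); last by apply/funext => x; exact: uE.
  by apply: measD => //; apply: measD => //; exact: measD.
have sq x : u x ^+ 2 <= 4 * (t1 x ^+ 2 + t2 x ^+ 2 + t3 x ^+ 2 + t4 x ^+ 2).
  rewrite uE -/(t1 x) -/(t2 x) -/(t3 x) -/(t4 x).
  have := sqr_ge0 (t1 x - t2 x); have := sqr_ge0 (t1 x - t3 x); have := sqr_ge0 (t1 x - t4 x).
  by have := sqr_ge0 (t2 x - t3 x); have := sqr_ge0 (t2 x - t4 x); have := sqr_ge0 (t3 x - t4 x); nra.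
have M0 : 0 <= mu j ^+ n by rewrite exprn_ge0// ltW// mu_gt0''.
have AM0 : 0 <= A j ^+ 2 * mu j ^+ n by rewrite mulr_ge0 ?sqr_ge0.
have i1 : Int X1 (fun x => t1 x ^+ 2) <= L0 * (A j ^+ 2 * mu j ^+ n) * (D * Q).
  apply: (le_trans (hL0 j c 0 _ H m0 H0)); rewrite -(mulrA _ (A j ^+ 2)); apply: ler_wpM2l => //; exact: mulr_ge0.
have i2 : Int X1 (fun x => t2 x ^+ 2) <= L1 * (A j ^+ 2 * mu j ^+ n) * (D * Q).
  apply: (le_trans (hL1 j c _ _ H m0 H0)); rewrite -(mulrA _ (A j ^+ 2)); apply: ler_wpM2l => //; exact: mulr_ge0.
have i3 : Int X1 (fun x => t3 x ^+ 2) <= L0 * (A j ^+ 2 * mu j ^+ n) * (D * Q).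
  apply: (le_trans (hL0 j c _ _ H m1 H1)); rewrite -(mulrA _ (A j ^+ 2)); apply: ler_wpM2l => //; exact: mulr_ge0.
have i4 : Int X1 (fun x => t4 x ^+ 2) <= L1 * (A j ^+ 2 * mu j ^+ n) * (D * Q).
  apply: (le_trans (hL1 j c _ _ H m1 H1)); rewrite -(mulrA _ (A j ^+ 2)); apply: ler_wpM2l => //; exact: mulr_ge0.
have sup (Uc : R) T q : 0 <= Uc -> q <= D * Q -> (forall x, T x ^+ 2 <= Uc * A j ^+ 2 * (mu j ^+ n) ^+ 2 * q * wt (x - c) ^+ 2) ->
    forall x, T x ^+ 2 <= Uc * (mu j ^+ n * (A j ^+ 2 * mu j ^+ n)) * (D * Q) * wt (x - c) ^+ 2.
  move=> u0 hq hT x; apply: (le_trans (hT x)); rewrite ler_wpM2r ?sqr_ge0//.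
  rewrite [leLHS](_ : _ = Uc * (mu j ^+ n * (A j ^+ 2 * mu j ^+ n)) * q); last by ring.
  by rewrite ler_wpM2l// mulr_ge0// mulr_ge0.
have p1 := sup U0 t1 _ U00 q0 (fun x => hU0 j c 0 _ H x m0 H0).
have p2 := sup U1 t2 _ U10 q0 (fun x => hU1 j c _ _ H x m0 H0).
have p3 := sup U0 t3 _ U00 q1 (fun x => hU0 j c _ _ H x m1 H1).
have p4 := sup U1 t4 _ U10 q1 (fun x => hU1 j c _ _ H x m1 H1).
have S2E : S2 = A j ^+ 2 * mu j ^+ n * Q by [].
have DQ0 : 0 <= D * Q by exact: mulr_ge0.
have tt T K : meas X1 T -> (forall x, T x ^+ 2 <= K * wt (x - c) ^+ 2) -> tame X1 (fun x => T x ^+ 2).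
  move=> mTT hT; apply: (tame_le (C := K) _ (tame_wtc c 1)); first exact: measX.
  by move=> x; rewrite ger0_norm ?sqr_ge0.
have tt1 := tt _ _ mt1 p1; have tt2 := tt _ _ mt2 p2; have tt3 := tt _ _ mt3 p3; have tt4 := tt _ _ mt4 p4.
split => //.
- apply: (le_trans (Int_sqr4 mu' tt1 tt2 tt3 tt4 sq)).
  apply: (@le_trans _ _ (4 * (L0 * (A j ^+ 2 * mu j ^+ n) * (D * Q) + L1 * (A j ^+ 2 * mu j ^+ n) * (D * Q) +
      L0 * (A j ^+ 2 * mu j ^+ n) * (D * Q) + L1 * (A j ^+ 2 * mu j ^+ n) * (D * Q)))).
    apply: ler_wpM2l; first by [].
    exact: (lerD (lerD (lerD i1 i2) i3) i4).
  rewrite S2E; clearbody Q t1 t2 t3 t4 u.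
  rewrite [leRHS](_ : _ = 4 * (L0 + L1 + L0 + L1) * (A j ^+ 2 * mu j ^+ n * (D * Q)) +
     4 * (U0 + U1 + U0 + U1) * (A j ^+ 2 * mu j ^+ n * (D * Q))); last by rewrite /C; ring.
  apply: (@le_trans _ _ (4 * (L0 + L1 + L0 + L1) * (A j ^+ 2 * mu j ^+ n * (D * Q)))).
    by rewrite le_eqVlt; apply/orP; left; apply/eqP; ring.
  rewrite lerDl; apply: mulr_ge0; last exact: mulr_ge0.
  by apply: mulr_ge0 => //; rewrite !addr_ge0.
- move=> x; apply: (le_trans (sq x)); rewrite S2E.
  set w := wt (x - c) ^+ 2; have w0 : 0 <= w by exact: sqr_ge0.
  set Y := mu j ^+ n * (A j ^+ 2 * mu j ^+ n).
  have Y0 : 0 <= Y by rewrite mulr_ge0.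
  rewrite [leRHS](_ : _ = 4 * (L0 + L1 + L0 + L1) * (Y * (D * Q) * w) +
     4 * (U0 * Y * (D * Q) * w + U1 * Y * (D * Q) * w + U0 * Y * (D * Q) * w + U1 * Y * (D * Q) * w)); last by rewrite /C /Y; ring.
  apply: (@le_trans _ _ (4 * (U0 * Y * (D * Q) * w + U1 * Y * (D * Q) * w + U0 * Y * (D * Q) * w + U1 * Y * (D * Q) * w))).
    rewrite ler_wpM2l//; apply: lerD; last exact: p4.
    by apply: lerD; last exact: p3; apply: lerD; [exact: p1|exact: p2].
  rewrite lerDr; apply: mulr_ge0; last by apply: mulr_ge0 => //; exact: mulr_ge0.
  by apply: mulr_ge0 => //; rewrite !addr_ge0.
Qed.
End Family.
End LocalEstimate.

(** * Passage between [L^2] and the given exponents on unit balls *)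

Section GlobalEstimate.
Local Open Scope classical_set_scope.
Local Open Scope ring_scope.
Variables (R : realType) (n : nat).
Notation V := ('rV[R]_n).
Notation V3 := ('rV[R]_n * 'rV[R]_n * 'rV[R]_n)%type.
Notation X1 := (Vw R n).

(* [v] bounds the [L^q] norm of [F]. *)
Definition nrm (q : \bar R) (F : V -> R) (v : R) : Prop :=
  match q with
  | p%:E%E => Int X1 (fun y => powR `|F y| p) <= powR v p
  | +oo%E => forall x, `|F x| <= v
  | -oo%E => False
  end.

(** Reciprocal of the exponent in which a localized input is measured: [q] itself when [q <= 2], and
    2 when [q > 2], since on a unit ball [L^q] then controls [L^2]. *)
Definition sg (q : \bar R) : R := Num.max 2^-1 (inv_exp q).

Lemma powR_le1D (k b : R) : 0 <= k -> 0 <= b -> b <= 1 -> powR k b <= 1 + k.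
Proof.
move=> k0 b0 b1; have [k1|k1] := leP k 1.
  apply: (@le_trans _ _ 1); last by rewrite lerDl.
  have e11 : powR (1 : R) b = 1 by rewrite powR1.
  by rewrite -[leRHS]e11; apply: ge0_ler_powR; rewrite ?nnegrE.
apply: (@le_trans _ _ (powR k 1)); last by rewrite powRr1// lerDr.
by apply: ler_powR => //; exact: ltW.
Qed.

Lemma powR_mix (u v a : R) : 0 <= u -> 0 <= v -> 0 <= a -> a <= 1 -> powR u a * powR v (1 - a) <= u + v.
Proof.
move=> u0 v0 a0 a1; pose M := Num.max u v.
have M0 : 0 <= M by rewrite le_max u0.
have b0 : 0 <= 1 - a by rewrite subr_ge0.
apply: (@le_trans _ _ (powR M a * powR M (1 - a))).
  apply: ler_pM; rewrite ?powR_ge0//; apply: ge0_ler_powR; rewrite ?nnegrE//.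
    by rewrite /M le_max lexx.
  by rewrite /M le_max lexx orbT.
rewrite -powRD; last by rewrite addrC subrK oner_eq0.
rewrite (_ : a + (1 - a) = 1); last by ring.
by rewrite powRr1// ge_max lerDl lerDr u0 v0.
Qed.

Lemma powR_le_mono (u v a : R) : 0 <= u -> 0 <= a -> u <= v -> powR u a <= powR v a.
Proof. by move=> u0 a0 uv; apply: ge0_ler_powR; rewrite ?nnegrE//; exact: le_trans uv. Qed.

Let kap := Int X1 (@wt R n).

Lemma kap0 : 0 <= kap. Proof. by apply: Int_ge0 => v; exact: wt_ge0. Qed.
Lemma tame_wt1 : tame X1 (@wt R n).
Proof. by have := tame_wt R n 0; under eq_fun do rewrite expr1. Qed.
Lemma tame_wtc1 c : tame X1 (fun x => wt (x - c)).
Proof. exact: (tame_trans (- c) tame_wt1). Qed.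
Lemma Int_wtc c : Int X1 (fun x => wt (x - c)) = kap.
Proof. exact: (Int_trans (- c) tame_wt1). Qed.

Lemma powR_nice p F : 1 <= p -> nice F -> exists2 D, 0 <= D & forall y : V, powR `|F y| p <= D * wt y ^+ 2.
Proof.
move=> p1 [_ [C hC]]; have p0 : 0 <= p by exact: le_trans p1.
exists (powR `|C| p); first exact: powR_ge0.
move=> y; apply: (@le_trans _ _ (powR (`|C| * wt y ^+ 2) p)).
  apply: powR_le_mono => //; rewrite (le_trans (hC y))// ler_wpM2r ?exprn_ge0 ?wt_ge0// ler_norm//.
rewrite powRM ?exprn_ge0 ?wt_ge0// ler_wpM2l ?powR_ge0//.
rewrite -[leRHS](powRr1 (exprn_ge0 2 (wt_ge0 y))).
by apply: ger_powR => //; rewrite (exprn_gt0 2 (wt_gt0 y)) exprn_ile1 ?wt_ge0 ?wt_le1.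
Qed.

Lemma cont_wt_diff : continuous (fun z : V * V => wt (z.1 - z.2)).
Proof.
have := @cont_wtsc R n 1 (-1); rewrite (_ : (fun p => _) = fun z : V * V => wt (z.1 - z.2))//.
by apply/funext => z; rewrite scale1r scaleN1r.
Qed.

Section FiniteExponent.
Variables (p : R) (F : V -> R).
Hypotheses (p1 : 1 <= p) (nF : nice F).
Let N y := powR `|F y| p.
Let U c := Int X1 (fun x => N x * wt (x - c)).

Lemma tame_Np : tame X1 N.
Proof.
have [D D0 hD] := powR_nice p1 nF.
apply: (tame_le (C := D) _ (tame_wt R n 1)) => [|v]; last by rewrite (ger0_norm (powR_ge0 _ _)); exact: hD.
by apply: meas_powR; apply: meas_norm; apply: cont_meas nF.1.
Qed.

Lemma tame_Npw : tame (prodw X1 X1) (fun z : V * V => N z.1 * wt (z.1 - z.2)).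
Proof.
have [D D0 hD] := powR_nice p1 nF; split.
  apply: measM; first exact: (@meas_fst _ _ _ X1 X1 _ tame_Np.1).
  by apply: cont_meas; exact: cont_wt_diff.
exists (D * 2 ^+ n) => z; rewrite /= !Vw_w ger0_norm ?mulr_ge0 ?powR_ge0 ?wt_ge0//.
apply: (@le_trans _ _ (D * wt z.1 ^+ 2 * wt (z.1 - z.2))).
  by rewrite ler_wpM2r ?wt_ge0//; exact: hD.
rewrite expr2 -!mulrA ler_wpM2l// [leRHS]mulrCA ler_wpM2l ?wt_ge0//.
by apply: le_trans (wt_conv _ _) _; rewrite wtN.
Qed.

Lemma tame_sl c : tame X1 (fun x => N x * wt (x - c)).
Proof.
under eq_fun do rewrite mulrC; apply: (tameMb (C := 1)); last exact: tame_Np.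
  exact: (tame_wtc1 c).1.
by move=> v; rewrite ger0_norm ?wt_ge0 ?wt_le1.
Qed.

Lemma U0 c : 0 <= U c.
Proof. by apply: Int_ge0 => x; rewrite mulr_ge0 ?powR_ge0 ?wt_ge0. Qed.

Lemma tame_U : tame X1 U.
Proof.
have [D D0 hD] := powR_nice p1 nF; split; first exact: (@meas_Int2 _ _ _ X1 X1 _ tame_Npw.1).
exists (D * 2 ^+ n * kap) => c; rewrite Vw_w.
rewrite [leRHS](_ : _ = Int X1 (fun x => D * 2 ^+ n * wt c * wt x)); last first.
  by rewrite (IntZ _ tame_wt1) /kap; ring.
apply: norm_Int; [exact: (tame_sl c).1|exact: (tameZ _ tame_wt1)|] => x.
rewrite ger0_norm ?mulr_ge0 ?powR_ge0 ?wt_ge0//.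
apply: (@le_trans _ _ (D * wt x ^+ 2 * wt (x - c))).
  by rewrite ler_wpM2r ?wt_ge0//; exact: hD.
rewrite expr2 -!mulrA ler_wpM2l// [leRHS]mulrA [leRHS]mulrC ler_wpM2l ?wt_ge0//.
by apply: le_trans (wt_conv _ _) _; rewrite wtN.
Qed.

Lemma Int_U : Int X1 U = Int X1 N * kap.
Proof.
rewrite /U -(@Int_swap _ _ _ X1 X1 (fun x c => N x * wt (x - c)) tame_Npw) -IntZr; last exact: tame_Np.
congr Int; apply/funext => x.
have e : (fun c : V => wt (x - c)) = fun c => wt (c - x).
  by apply/funext => c; rewrite -wtN opprB.
by rewrite IntZ e ?Int_wtc//; exact: tame_wtc1.
Qed.

Lemma inp_low c : p <= 2 -> powR (Int X1 (fun y => powR `|F y * wt (y - c)| p)) p^-1 <= powR (U c) p^-1.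
Proof.
move=> p2; have p0 : 0 <= p by exact: le_trans p1.
apply: powR_le_mono; rewrite ?invr_ge0//.
  by apply: Int_ge0 => x; exact: powR_ge0.
apply: (le_trans (ler_norm _)); apply: norm_Int.
- by apply: meas_powR; apply: meas_norm; apply: measM; [apply: cont_meas nF.1|exact: (tame_wtc1 c).1].
- exact: tame_sl.
move=> x; rewrite ger0_norm ?powR_ge0// normrM powRM//.
rewrite [`|wt _|]ger0_norm ?wt_ge0// ler_wpM2l ?powR_ge0//.
rewrite -[leRHS](powRr1 (wt_ge0 _)); apply: ger_powR => //.
by rewrite wt_gt0 wt_le1.
Qed.

(** Hoelder with exponents [2 / p] and [1 - 2 / p], the weight [wt (y - c)] playing the role of a
    finite measure on the ball. *)
Lemma inp_high c : 2 <= p -> powR (Int X1 (fun y => powR `|F y * wt (y - c)| 2)) 2^-1 <=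
  (1 + kap) * powR (U c) p^-1.
Proof.
move=> p2; have p0 : 0 < p by exact: lt_le_trans p1.
have a0 : 0 <= 2 / p by rewrite divr_ge0// ltW.
have a1 : 2 / p <= 1 by rewrite ler_pdivrMr// mul1r.
have m2 : meas X1 (fun y => powR `|F y * wt (y - c)| 2).
  by apply: meas_powR; apply: meas_norm; apply: measM; [apply: cont_meas nF.1|exact: (tame_wtc1 c).1].
have pw x : powR `|F x * wt (x - c)| 2 <= powR (N x * wt (x - c)) (2 / p) * powR (wt (x - c)) (1 - 2 / p).
  have w0 := wt_ge0 (x - c).
  rewrite powRM ?powR_ge0// -powRrM mulrCA mulfV ?gt_eqF// mulr1 -mulrA -powRD; last first.
    by rewrite addrC subrK oner_eq0.
  rewrite [2 / p + _]addrC subrK powRr1// normrM powRM// [`|wt _|]ger0_norm//.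
  by rewrite ler_wpM2l ?powR_ge0// powR_mulrn// expr2 ler_piMr// wt_le1.
have t2 : tame X1 (fun y => powR `|F y * wt (y - c)| 2).
  have tD := tameD (tame_sl c) (tame_wtc1 c).
  apply: (@tame_le _ _ X1 _ _ 1 m2 tD) => x.
  rewrite mul1r (ger0_norm (powR_ge0 _ _)); apply: (le_trans (pw x)); apply: powR_mix => //; last exact: wt_ge0.
  by rewrite mulr_ge0 ?powR_ge0 ?wt_ge0.
have H := hoelderH a0 a1 (tame_sl c) (tame_wtc1 c) t2 (fun x => mulr_ge0 (powR_ge0 _ _) (wt_ge0 _)) (fun x => wt_ge0 _) pw.
rewrite Int_wtc -/(U c) in H.
have h2 : 0 <= 2^-1 :> R by [].
apply: (le_trans (powR_le_mono (Int_ge0 _ (fun x => powR_ge0 _ _)) h2 H)).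
have e2p : 2 / p * 2^-1 = p^-1 by field; rewrite gt_eqF.
have -> : powR (powR (U c) (2 / p) * powR kap (1 - 2 / p)) 2^-1 = powR kap ((1 - 2 / p) * 2^-1) * powR (U c) p^-1.
  by rewrite (powRM _ (powR_ge0 _ _) (powR_ge0 _ _)) -(powRrM (U c)) e2p mulrC -powRrM.
apply: ler_wpM2r; first exact: powR_ge0.
apply: powR_le1D; [exact: kap0|apply: mulr_ge0 => //; rewrite subr_ge0//|].
by rewrite -[leRHS]mul1r; apply: ler_pM; rewrite ?subr_ge0// ?gerBl//; have : (2^-1 <= 1 :> R) by rewrite invf_le1 ?ler1n.
Qed.
End FiniteExponent.

(** [U c] is the local energy at [c], and its integral over [c] is the global one. For [q = +oo] the
    exponent [inv_exp q] is 0, the power is 1, and the constant [v'] carries the whole norm; both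
    cases then fit into one Hoelder inequality. *)
Lemma inp_loc q F v : (1%:E <= q)%E -> nice F -> 0 <= v -> nrm q F v -> exists U v', [/\ tame X1 U, forall c, 0 <= U c, 0 <= v',
    forall c, powR (Int X1 (fun y => powR `|F y * wt (y - c)| (sg q)^-1)) (sg q) <= (1 + kap) * (powR (U c) (inv_exp q) * v') &
    powR (Int X1 U) (inv_exp q) * v' <= (1 + kap) * v].
Proof.
have k0 := kap0.
case: q => [p|//|//] p1 nF v0 hv; last first.
  exists (fun=> 0), v; split => //=; [exact: tame0| |by rewrite powRr0 mul1r mulrDl mul1r lerDl mulr_ge0].
  move=> c; rewrite powRr0 mul1r /sg /= (max_l (_ : 0 <= 2^-1))// invrK.
  have t2 : tame X1 (fun x => v ^+ 2 * wt (x - c)) by apply: tameZ; exact: tame_wtc1.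
  apply: (@le_trans _ _ (powR (v ^+ 2 * kap) 2^-1)).
    apply: powR_le_mono => //; first by apply: Int_ge0 => x; exact: powR_ge0.
    rewrite -(Int_wtc c) -IntZ; last exact: tame_wtc1.
    apply: (le_trans (ler_norm _)); apply: norm_Int => //.
      by apply: meas_powR; apply: meas_norm; apply: measM; [apply: cont_meas nF.1|exact: (tame_wtc1 c).1].
    move=> x; rewrite ger0_norm ?powR_ge0// powR_mulrn// normrM exprMn; apply: ler_pM; rewrite ?sqr_ge0//.
      by rewrite lerXn2r ?nnegrE.
    by rewrite ger0_norm ?wt_ge0// expr2 ler_piMr ?wt_ge0 ?wt_le1.
  rewrite powRM ?sqr_ge0// powR12_sqrt ?sqr_ge0// sqrtr_sqr ger0_norm// mulrC ler_wpM2r//.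
  by apply: powR_le1D => //; lra.
rewrite lee_fin in p1; have p0 : 0 < p by exact: lt_le_trans p1.
exists (fun c => Int X1 (fun x => powR `|F x| p * wt (x - c))), 1; split => //=.
- exact: tame_U.
- by move=> c; exact: U0.
- move=> c; rewrite mulr1 /sg /=; have [p2|p2] := leP p 2.
    rewrite (max_r (_ : 2^-1 <= p^-1)) ?invrK; last by rewrite lef_pV2 ?posrE.
    by apply: (le_trans (inp_low p1 nF c p2)); rewrite mulrDl mul1r lerDl mulr_ge0 ?powR_ge0.
  rewrite (max_l (_ : p^-1 <= 2^-1)) ?invrK; last by rewrite lef_pV2 ?posrE// ltW.
  exact: (inp_high p1 nF c (ltW p2)).
- rewrite mulr1 (Int_U p1 nF) powRM ?k0//; last by apply: Int_ge0 => x; exact: powR_ge0.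
  have p10 : 0 <= p^-1 by rewrite invr_ge0 ltW.
  rewrite mulrC; apply: ler_pM; rewrite ?powR_ge0//.
    by apply: powR_le1D => //; rewrite invf_le1.
  apply: (@le_trans _ _ (powR (powR v p) p^-1)).
    by apply: powR_le_mono => //; apply: Int_ge0 => x; exact: powR_ge0.
  by rewrite -powRrM mulfV ?gt_eqF// powRr1.
Qed.

(** For [r <= 2] this is Hoelder on the ball. For [r > 2] all but two of the [r] powers are
    estimated by the pointwise bound, at the price of [m] to the power [1/2 - 1/r] in the norm. The
    exponent [E] compensates [wt ^+ 5] under the power [r], and the spare 1 supplies the weight that
    Hoelder needs. *)
Lemma local_r (r : R) (E : nat) C0 T m c (H : V -> R) : 0 < r -> 5 * r + 1 <= E%:R -> 0 <= C0 -> 0 <= T -> 1 <= m ->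
  meas X1 (fun x => wt (x - c) ^+ 5 * H x) -> Int X1 (fun x => (wt (x - c) ^+ 5 * H x) ^+ 2) <= C0 * T ^+ 2 ->
  (forall x, (wt (x - c) ^+ 5 * H x) ^+ 2 <= C0 * (m * T ^+ 2) * wt (x - c) ^+ 2) ->
  tame X1 (fun x => wt (x - c) ^+ E * powR `|H x| r) /\
  Int X1 (fun x => wt (x - c) ^+ E * powR `|H x| r) <=
    powR C0 (r / 2) * (1 + kap) * powR (T * powR m (Num.max 0 (2^-1 - r^-1))) r.
Proof.
move=> r0 hE C00 T0 m1 mu iu su; have k0 := kap0.
set u := fun x => wt (x - c) ^+ 5 * H x in mu iu su.
have w0 x := wt_gt0 (x - c).
have m0 : 0 < m by exact: lt_le_trans m1.
have tu : tame X1 (fun x => u x ^+ 2).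
  apply: (tame_le (C := C0 * (m * T ^+ 2)) _ (tame_wtc c 1)); first exact: measX.
  by move=> x; rewrite (ger0_norm (sqr_ge0 _)); exact: su.
have mH : meas X1 H.
  rewrite (_ : H = fun x => (wt (x - c) ^+ 5)^-1 * u x); last first.
    by apply/funext => x; rewrite /u mulrA mulVf ?mul1r// expf_neq0// gt_eqF.
  apply: measM => //; apply: cont_meas; apply: contV => [|x]; last by rewrite expf_neq0// gt_eqF.
  apply: contX; apply: (cont_comp (f := fun y : V => y - c) (g := @wt R n)); last exact: wt_cont.
  by apply: cont_rV => j; under eq_fun do rewrite !mxE; apply: contB; [exact: coord_cont|exact: contC].
have mG : meas X1 (fun x => wt (x - c) ^+ E * powR `|H x| r).
  apply: measM; last by apply: meas_powR; exact: meas_norm.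
  exact: (measX E (tame_wtc1 c).1).
have pu x : powR (u x ^+ 2) (r / 2) = powR (wt (x - c)) (5 * r) * powR `|H x| r.
  rewrite -real_normK ?num_real// -powR_mulrn// -powRrM mulrCA mulfV ?mulr1// /u normrM powRM//.
  by rewrite ger0_norm ?exprn_ge0 ?wt_ge0// -powR_mulrn ?wt_ge0// -powRrM.
have wE x y : 0 <= y -> y <= 1 -> wt (x - c) ^+ E <= powR (wt (x - c)) (5 * r + y).
  move=> y0 y1; rewrite -powR_mulrn ?wt_ge0//; apply: ger_powR; first by rewrite w0 wt_le1.
  lra.
have pH x := powR_ge0 `|H x| r.
have G0 x : 0 <= wt (x - c) ^+ E * powR `|H x| r by rewrite mulr_ge0 ?exprn_ge0 ?wt_ge0.
have [r2|r2] := leP r 2.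
  have a0 : 0 <= r / 2 by lra.
  have a1 : r / 2 <= 1 by lra.
  have pw x : wt (x - c) ^+ E * powR `|H x| r <= powR (u x ^+ 2) (r / 2) * powR (wt (x - c)) (1 - r / 2).
    rewrite pu mulrAC -powRD; last by apply/implyP => _; rewrite gt_eqF.
    by rewrite ler_wpM2r// wE; lra.
  have tG : tame X1 (fun x => wt (x - c) ^+ E * powR `|H x| r).
    apply: (tame_le (C := 1) mG (tameD tu (tame_wtc1 c))) => x; rewrite mul1r ger0_norm//.
    by apply: (le_trans (pw x)); apply: powR_mix; rewrite ?sqr_ge0 ?wt_ge0.
  split => //; apply: (le_trans (hoelderH a0 a1 tu (tame_wtc1 c) tG (fun x => sqr_ge0 _) (fun x => wt_ge0 _) pw)).
  rewrite Int_wtc (max_l (_ : 2^-1 - r^-1 <= 0)); last by rewrite subr_le0 lef_pV2 ?posrE.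
  rewrite powRr0 mulr1 mulrAC; apply: ler_pM; rewrite ?powR_ge0//; last by apply: powR_le1D => //; lra.
  apply: (@le_trans _ _ (powR (C0 * T ^+ 2) (r / 2))).
    by apply: powR_le_mono => //; apply: Int_ge0 => x; exact: sqr_ge0.
  by rewrite powRM ?sqr_ge0// -[T ^+ 2]powR_mulrn// -powRrM [2 * _]mulrC divfK.
have a0 : 0 <= r / 2 - 1 by lra.
have c20 : 0 <= C0 * (m * T ^+ 2) by rewrite mulr_ge0// mulr_ge0 ?sqr_ge0 ?(ltW m0).
have r20 : 0 < r / 2 by lra.
have split_pow (y : R) : 0 <= y -> powR y (r / 2) = powR y (r / 2 - 1) * y.
  move=> y0; rewrite -{3}(powRr1 y0) -powRD; first by rewrite subrK.
  by rewrite subrK gt_eqF.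
have pw x : wt (x - c) ^+ E * powR `|H x| r <= powR (C0 * (m * T ^+ 2)) (r / 2 - 1) * u x ^+ 2.
  apply: (@le_trans _ _ (powR (u x ^+ 2) (r / 2))).
    by rewrite pu ler_wpM2r// -[5 * r]addr0 wE.
  rewrite split_pow ?sqr_ge0// ler_wpM2r ?sqr_ge0//; apply: powR_le_mono; rewrite ?sqr_ge0//.
  by apply: (le_trans (su x)); rewrite ler_piMr// exprn_ile1 ?wt_ge0 ?wt_le1.
split; first by apply: (tame_le mG tu) => x; rewrite ger0_norm//; exact: pw.
apply: (@le_trans _ _ (powR (C0 * (m * T ^+ 2)) (r / 2 - 1) * (C0 * T ^+ 2))).
  apply: (@le_trans _ _ (powR (C0 * (m * T ^+ 2)) (r / 2 - 1) * Int X1 (fun x => u x ^+ 2))); last by rewrite ler_wpM2l ?powR_ge0.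
  rewrite -IntZ//; apply: (le_trans (ler_norm _)); apply: norm_Int => //; first exact: tameZ.
  by move=> x; rewrite ger0_norm.
rewrite (max_r (_ : 0 <= 2^-1 - r^-1)); last by rewrite subr_ge0 lef_pV2 ?posrE// ltW.
have -> : powR (C0 * (m * T ^+ 2)) (r / 2 - 1) * (C0 * T ^+ 2) = powR C0 (r / 2) * (powR m (r / 2 - 1) * powR (T ^+ 2) (r / 2)).
  rewrite (split_pow C0)// (split_pow (T ^+ 2)) ?sqr_ge0// !powRM ?sqr_ge0 ?mulr_ge0 ?sqr_ge0 ?(ltW m0)//; ring.
rewrite -[leRHS]mulrA; apply: ler_wpM2l; first exact: powR_ge0.
have -> : powR (T * powR m (2^-1 - r^-1)) r = powR m (r / 2 - 1) * powR (T ^+ 2) (r / 2).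
  rewrite (powRM _ T0 (powR_ge0 _ _)) -powRrM -(powR_mulrn _ T0) -powRrM [2 * _]mulrC divfK// mulrC.
  by congr (powR m _ * _); field; rewrite gt_eqF.
by rewrite ler_peMl ?mulr_ge0 ?powR_ge0// lerDl.
Qed.
End GlobalEstimate.

(** * Integration over all centres *)

Section GlobalBound.
Local Open Scope classical_set_scope.
Local Open Scope ring_scope.

Lemma le_Eint (R : realType) V (X : wspace R V) (F G : V -> R) : meas X F -> meas X G -> (forall v, 0 <= F v) ->
  (forall v, F v <= G v) -> (Eint X (fun v => (F v)%:E) <= Eint X (fun v => (G v)%:E))%E.
Proof.
move=> mF mG F0 FG; apply: ge0_le_integral => //; try by apply/measurable_EFinP.
- by move=> t _; rewrite lee_fin.
- by move=> t _; rewrite lee_fin.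
Qed.

(** A positive function with integral 0 forces the measure itself to vanish; this settles the
    degenerate case of [global]. *)
Lemma Int_pos_or_null (R : realType) V (X : wspace R V) (w F : V -> R) : tame X w -> (forall v, 0 < w v) -> meas X F ->
  Int X w = 0 -> Eint X (fun v => (F v)%:E) = 0%E.
Proof.
move=> tw w0 mF iw.
have ew : (\int[ws_mu X]_(t in setT) `|(w (ws_phi t))%:E| = 0)%E.
  have := EintE tw; rewrite iw /Eint => ew; rewrite -[RHS]ew; apply: eq_integral => t _.
  by rewrite abse_EFin gtr0_norm.
have mw : measurable_fun setT (EFin \o (w \o ws_phi (w:=X))) by apply/measurable_EFinP; exact: tw.1.
have /(ae_eq_integral_abs (ws_mu X) measurableT mw) [N [mN N0 hN]] := ew.
have NT : N = setT.
  apply/seteqP; split => // t _; apply: hN => /= /(_ I) [] e.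
  by have := w0 (ws_phi t); rewrite e ltxx.
have mF' : measurable_fun setT (EFin \o (F \o ws_phi (w:=X))) by exact/measurable_EFinP.
rewrite /Eint; transitivity (\int[ws_mu X]_(t in setT) (cst 0%E t : \bar R))%E; last exact: integral0.
apply: ae_eq_integral => //; exists N; split => //; by rewrite NT.
Qed.

(** Collects the powers of [m]: [1/2] from the estimate in [L^2] and [s - 1/2] from each input add
    up to [s1 + s2 - 1/2]. *)
Lemma sq_scaling (R : realType) (B m s1 s2 k I1 I2 N1 N2 : R) : 0 < m -> 0 <= B -> 0 <= s1 -> 0 <= s2 ->
  powR I1 s1 <= k * N1 -> powR I2 s2 <= k * N2 ->
  B ^+ 2 * m * (powR m (2 * s1 - 1) * powR I1 (2 * s1) * (powR m (2 * s2 - 1) * powR I2 (2 * s2))) <=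
  (B * powR m (s1 + s2 - 2^-1) * k ^+ 2 * N1 * N2) ^+ 2.
Proof.
move=> m0 B0 s10 s20 l1 l2.
have pm (s : R) : powR m (2 * s - 1) = powR m (s - 2^-1) ^+ 2.
  by rewrite -powR_mulrn ?powR_ge0// -powRrM; congr powR; field.
have p2 (s x : R) : powR x (2 * s) = powR x s ^+ 2.
  by rewrite -powR_mulrn ?powR_ge0// -powRrM mulrC.
rewrite !pm !p2; move: (powR_ge0 I1 s1) (powR_ge0 I2 s2) l1 l2.
move: (powR I1 s1) (powR I2 s2) => x1 x2 x10 x20 l1 l2.
have em : powR m (s1 - 2^-1) * powR m (s2 - 2^-1) * powR m 2^-1 = powR m (s1 + s2 - 2^-1).
  by rewrite -!powRD ?(gt_eqF m0) ?implybT//; congr powR; field.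
have e2 : powR m 2^-1 ^+ 2 = m by rewrite -powR_mulrn ?powR_ge0// -powRrM mulVf// powRr1// ltW.
have -> : B ^+ 2 * m * (powR m (s1 - 2^-1) ^+ 2 * x1 ^+ 2 * (powR m (s2 - 2^-1) ^+ 2 * x2 ^+ 2)) =
    (B * powR m (s1 + s2 - 2^-1) * (x1 * x2)) ^+ 2.
  rewrite -em -{1}e2; move: (powR _ _) (powR _ _) (powR _ _) => y1 y2 y3; ring.
have -> : B * powR m (s1 + s2 - 2^-1) * k ^+ 2 * N1 * N2 = B * powR m (s1 + s2 - 2^-1) * ((k * N1) * (k * N2)).
  by move: (powR _ _) => y; ring.
have P0 : 0 <= B * powR m (s1 + s2 - 2^-1) by rewrite mulr_ge0 ?powR_ge0.
have xx : x1 * x2 <= k * N1 * (k * N2) by exact: ler_pM.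
have x0 : 0 <= x1 * x2 by exact: mulr_ge0.
have px : B * powR m (s1 + s2 - 2^-1) * (x1 * x2) <= B * powR m (s1 + s2 - 2^-1) * (k * N1 * (k * N2)) by exact: ler_wpM2l.
have px0 := mulr_ge0 P0 x0.
by apply: lerXn2r => //; rewrite nnegrE//; exact: le_trans px.
Qed.

Variables (R : realType) (n : nat).
Notation V := ('rV[R]_n).
Notation V3 := ('rV[R]_n * 'rV[R]_n * 'rV[R]_n)%type.
Notation X1 := (Vw R n).
Variables (J : Type) (A mu : J -> R).
Hypotheses (A0 : forall j, 0 <= A j) (mu1 : forall j, 1 <= mu j).
Variable a : bool -> J -> V3 -> R.
Hypothesis ha : forall u, cls (@e3 R n) (6 * n) (a u) (fun j v => A j * W2 (mu j) (v.1.2, v.2)).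
Variables (q1 q2 : \bar R) (r : R).
Hypotheses (q11 : (1%:E <= q1)%E) (q21 : (1%:E <= q2)%E) (r0 : 0 < r) (hr : r^-1 = inv_exp q1 + inv_exp q2).

Lemma inv_exp01 q : (1%:E <= q)%E -> 0 <= inv_exp q /\ inv_exp q <= (1 : R).
Proof.
case: q => [p|//|//] /=.
by rewrite lee_fin => p1; rewrite invr_ge0 invf_le1 ?(le_trans _ p1)// (lt_le_trans _ p1).
Qed.

Lemma sg01 q : (1%:E <= q)%E -> 2^-1 <= sg q /\ sg q <= (1 : R).
Proof.
move=> /inv_exp01 [h0 h1]; rewrite /sg le_max lexx; split => //.
by rewrite ge_max h1 andbT invf_le1 ?ler1n.
Qed.

Lemma meas_Hf j F G : nice F -> nice G -> meas X1 (Hf (a ^~ j) F G).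
Proof.
move=> nF nG; have [C C0 h] := loc2 A0 mu1 ha.
have [g0 g1] := sg01 q11; have [mu' _ _] := h j 0 F G _ _ nF nG g0 g1 g0 g1.
have w0 (x : V) := wt_gt0 (x - 0).
rewrite (_ : Hf _ F G = fun x => (wt (x - 0) ^+ 5)^-1 * (wt (x - 0) ^+ 5 * Hf (a ^~ j) F G x)); last first.
  by apply/funext => x; rewrite mulrA mulVf ?mul1r// expf_neq0// gt_eqF.
apply: measM => //; apply: cont_meas; apply: contV => [|x]; last by rewrite expf_neq0// gt_eqF.
apply: contX; apply: (cont_comp (f := fun y : V => y - 0) (g := @wt R n)); last exact: wt_cont.
by apply: cont_rV => i; under eq_fun do rewrite !mxE; apply: contB; [exact: coord_cont|exact: contC].
Qed.

Let e := sg q1 + sg q2 - 2^-1 + Num.max 0 (2^-1 - r^-1).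
Let kap := Int X1 (@wt R n).
Let k1 : 0 <= 1 + kap.
Proof. by rewrite addr_ge0//; apply: Int_ge0 => v; exact: wt_ge0. Qed.

(** The integral of [wt (x - c) ^+ E] over [c] is the constant [kE], so the [r]-th power of the
    output is the average over [c] of its localizations. Tonelli and the local bounds lead to
    Hoelder in [c] with exponents [r / q1] and [r / q2], which sum to 1 by the relation between the
    exponents. *)
Lemma global : exists2 C, 0 <= C & forall j F G v1 v2, nice F -> nice G -> 0 <= v1 -> 0 <= v2 -> nrm q1 F v1 -> nrm q2 G v2 ->
  (Eint X1 (fun x => (powR `|Hf (a ^~ j) F G x| r)%:E) <= (powR (C * (A j * powR (mu j ^+ n) e) * (v1 * v2)) r)%:E)%E.
Proof.
have [C0 C00 hL] := loc2 A0 mu1 ha.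
have [g10 g11] := sg01 q11; have [g20 g21] := sg01 q21.
have [i10 i11] := inv_exp01 q11; have [i20 i21] := inv_exp01 q21.
set s1 := sg q1 in g10 g11 *; set s2 := sg q2 in g20 g21 *.
pose E' := Num.truncn (5 * r + 1); pose E := E'.+1.
have hE : 5 * r + 1 <= E%:R by apply/ltW; rewrite truncnS_gt.
have tE : tame X1 (fun x => wt x ^+ E) by exact: tame_wt.
pose kE := Int X1 (fun x : V => wt x ^+ E).
have kE0 : 0 <= kE by apply: Int_ge0 => x; rewrite exprn_ge0// wt_ge0.
have [kz|kn] := eqVneq kE 0.
  exists 0 => // j F G v1 v2 nF nG v10 v20 _ _.
  rewrite (Int_pos_or_null tE _ _ kz).
  - by rewrite lee_fin powR_ge0.
  - by move=> v; rewrite exprn_gt0// wt_gt0.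
  - by apply: meas_powR; apply: meas_norm; exact: meas_Hf.
have kp : 0 < kE by rewrite lt_def kn.
pose K := kE^-1 * (powR C0 (r / 2) * (1 + kap)).
have K0 : 0 <= K by rewrite mulr_ge0 ?invr_ge0// mulr_ge0// powR_ge0.
exists (powR K r^-1 * (1 + kap) ^+ 4); first by rewrite mulr_ge0 ?powR_ge0 ?exprn_ge0.
move=> j F G v1 v2 nF nG v10 v20 n1 n2.
have [U1 [w1 [tU1 U10 w10 l1 t1]]] := inp_loc q11 nF v10 n1.
have [U2 [w2 [tU2 U20 w20 l2 t2]]] := inp_loc q21 nG v20 n2.
rewrite -/s1 -/kap in l1; rewrite -/s2 -/kap in l2.
set H := Hf (a ^~ j) F G.
have mH : meas X1 H by exact: meas_Hf.
set m := mu j ^+ n.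
have m1 : 1 <= m by rewrite exprn_ege1.
have m0 : 0 < m by exact: lt_le_trans m1.
pose B c := A j * powR m (s1 + s2 - 2^-1) * (1 + kap) ^+ 2 * (powR (U1 c) (inv_exp q1) * w1) * (powR (U2 c) (inv_exp q2) * w2).
have B0 c : 0 <= B c.
  by rewrite /B; do !apply: mulr_ge0; rewrite ?powR_ge0 ?exprn_ge0.
have s1p : 0 <= s1 by apply: le_trans g10.
have s2p : 0 <= s2 by apply: le_trans g20.
have LR c : tame X1 (fun x => wt (x - c) ^+ E * powR `|H x| r) /\
    Int X1 (fun x => wt (x - c) ^+ E * powR `|H x| r) <= powR C0 (r / 2) * (1 + kap) *
      powR (B c * powR m (Num.max 0 (2^-1 - r^-1))) r.
  have [h1 h2 h3] := hL j c F G s1 s2 nF nG g10 g11 g20 g21.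
  have SB := sq_scaling m0 (A0 j) s1p s2p (l1 c) (l2 c); rewrite -/(B c) in SB.
  apply: (local_r r0 hE C00 (B0 c) m1 h1).
    exact: (le_trans h2 (ler_wpM2l C00 SB)).
  move=> x; apply: (le_trans (h3 x)); apply: ler_wpM2r; first exact: sqr_ge0.
  apply: (ler_wpM2l C00); exact: (ler_wpM2l (ltW m0) SB).
pose g (x c : V) := kE^-1 * (wt (x - c) ^+ E * powR `|H x| r).
have g0 x c : 0 <= g x c by rewrite /g mulr_ge0 ?invr_ge0// mulr_ge0 ?exprn_ge0 ?wt_ge0 ?powR_ge0.
have mg : meas (prodw X1 X1) (fun z : V * V => g z.1 z.2).
  apply: measM; first exact: measC.
  apply: measM; first by apply: measX; apply: cont_meas; exact: cont_wt_diff.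
  by apply: (@meas_fst _ _ _ X1 X1 (fun x => powR `|H x| r)); apply: meas_powR; exact: meas_norm.
have eH : (fun x => (powR `|H x| r)%:E) = fun x => Eint X1 (fun c => (g x c)%:E).
  apply/funext => x.
  have e1 : (fun c : V => (g x c)%:E) = fun c => ((kE^-1 * powR `|H x| r) * (wt (c - x)) ^+ E)%:E.
    by apply/funext => c; congr (_%:E); rewrite /g -wtN opprB; ring.
  have tx : tame X1 (fun c : V => wt (c - x) ^+ E) by exact: (tame_trans (- x) tE).
  rewrite e1 (EintE (tameZ _ tx)).
  rewrite IntZ// (Int_trans (- x) tE) -/kE; congr (_%:E).
  by rewrite mulrAC mulVf ?mul1r.
rewrite eH Eint_swap//.
pose al := r * inv_exp q1.
have al0 : 0 <= al by rewrite mulr_ge0// ltW.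
have eal : 1 - al = r * inv_exp q2.
  have : r * r^-1 = 1 by rewrite mulfV// gt_eqF.
  by rewrite hr mulrDr /al => <-; rewrite addrC addKr.
have al1 : al <= 1 by rewrite -subr_ge0 eal mulr_ge0// ltW.
pose L := A j * powR m (s1 + s2 - 2^-1) * (1 + kap) ^+ 2 * w1 * w2 * powR m (Num.max 0 (2^-1 - r^-1)).
have L0 : 0 <= L by rewrite /L; do !apply: mulr_ge0; rewrite ?powR_ge0 ?exprn_ge0.
pose Q c := powR (U1 c) al * powR (U2 c) (1 - al).
have Q0 c : 0 <= Q c by rewrite mulr_ge0 ?powR_ge0.
have BQ c : powR (B c * powR m (Num.max 0 (2^-1 - r^-1))) r = powR L r * Q c.
  have -> : B c * powR m (Num.max 0 (2^-1 - r^-1)) = L * (powR (U1 c) (inv_exp q1) * powR (U2 c) (inv_exp q2)).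
    by rewrite /B /L; ring.
  rewrite powRM ?mulr_ge0 ?powR_ge0// powRM ?powR_ge0// /Q eal.
  by congr (_ * _); rewrite -!powRrM /al ![_ * r]mulrC.
have tQ : tame X1 Q.
  apply: (tame_le (C := 1) _ (tameD tU1 tU2)) => [|c].
    by apply: measM; apply: meas_powR; [exact: tU1.1|exact: tU2.1].
  by rewrite mul1r ger0_norm//; exact: powR_mix.
have Eg c : Eint X1 (fun x => (g x c)%:E) = (kE^-1 * Int X1 (fun x => wt (x - c) ^+ E * powR `|H x| r))%:E.
  by rewrite EintE ?IntZ//; [exact: (LR c).1|apply: tameZ; exact: (LR c).1].
under [X in Eint _ X]eq_fun do rewrite Eg.
have mI : meas X1 (fun c : V => kE^-1 * Int X1 (fun x => wt (x - c) ^+ E * powR `|H x| r)).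
  have := @meas_Int2 _ _ _ X1 X1 _ mg; rewrite (_ : (fun y => _) = fun c : V => kE^-1 * Int X1 (fun x => wt (x - c) ^+ E * powR `|H x| r))//.
  by apply/funext => c; rewrite -IntZ//; exact: (LR c).1.
have tKQ : tame X1 (fun c => K * powR L r * Q c) by exact: tameZ.
apply: (@le_trans _ _ (Eint X1 (fun c => (K * powR L r * Q c)%:E))).
  apply: le_Eint => // [|c|c]; first exact: tKQ.1.
    by rewrite mulr_ge0 ?invr_ge0//; apply: Int_ge0 => x; rewrite mulr_ge0 ?exprn_ge0 ?wt_ge0 ?powR_ge0.
  rewrite -[leRHS]mulrA -BQ /K -[leRHS]mulrA; apply: ler_wpM2l; first by rewrite invr_ge0.
  exact: (LR c).2.
rewrite EintE// lee_fin IntZ//.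
have HQ := hoelderH al0 al1 tU1 tU2 tQ U10 U20 (fun c => lexx _).
have I10 : 0 <= Int X1 U1 by exact: Int_ge0.
have I20 : 0 <= Int X1 U2 by exact: Int_ge0.
apply: (@le_trans _ _ (K * powR L r * (powR (Int X1 U1) al * powR (Int X1 U2) (1 - al)))).
  by apply: ler_wpM2l HQ; rewrite mulr_ge0 ?powR_ge0.
set y1 := powR (Int X1 U1) (inv_exp q1) in t1; set y2 := powR (Int X1 U2) (inv_exp q2) in t2.
have y10 : 0 <= y1 by exact: powR_ge0.
have y20 : 0 <= y2 by exact: powR_ge0.
have -> : powR (Int X1 U1) al * powR (Int X1 U2) (1 - al) = powR (y1 * y2) r.
  by rewrite (powRM r y10 y20) eal /y1 /y2 -(powRrM (Int X1 U1)) -(powRrM (Int X1 U2)) /al ![r * _]mulrC.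
have kr : K = powR (powR K r^-1) r by rewrite -powRrM mulVf ?powRr1// gt_eqF.
have -> : K * powR L r * powR (y1 * y2) r = powR (powR K r^-1 * L * (y1 * y2)) r.
  have h0 := powR_ge0 K r^-1; have h1 := mulr_ge0 h0 L0; have h2 := mulr_ge0 y10 y20.
  by rewrite (powRM r h1 h2) (powRM r h0 L0) -kr.
have h1 := mulr_ge0 (powR_ge0 K r^-1) L0; have h2 := mulr_ge0 h1 (mulr_ge0 y10 y20).
apply: (powR_le_mono h2 (ltW r0)).
have -> : powR K r^-1 * L * (y1 * y2) = powR K r^-1 * (1 + kap) ^+ 2 * (A j * powR m e) * ((y1 * w1) * (y2 * w2)).
  have -> : powR m e = powR m (s1 + s2 - 2^-1) * powR m (Num.max 0 (2^-1 - r^-1)).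
    by rewrite -powRD// (gt_eqF m0) implybT.
  by rewrite /L; ring.
have -> : powR K r^-1 * (1 + kap) ^+ 4 * (A j * powR m e) * (v1 * v2) =
   powR K r^-1 * (1 + kap) ^+ 2 * (A j * powR m e) * (((1 + kap) * v1) * ((1 + kap) * v2)) by ring.
apply: ler_wpM2l; first by do !apply: mulr_ge0; rewrite ?powR_ge0 ?exprn_ge0.
by apply: ler_pM; rewrite ?mulr_ge0.
Qed.
End GlobalBound.

(** * Dyadic scales and rational cut-offs *)

Section FrequencyPieces.
Local Open Scope classical_set_scope.
Local Open Scope ring_scope.
Variable R : realType.

Section Powers.
Variables (V : normedModType R) (D : Type) (e : D -> V) (I : Type).

Lemma DX (F : V -> R) d k : (forall v, derivable F v d) ->
  (forall v, derivable (fun v => F v ^+ k) v d) /\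
  'D_d (fun v => F v ^+ k.+1) = fun v => k.+1%:R * (F v ^+ k * 'D_d F v).
Proof.
move=> dF; have dk j : forall v, derivable (fun v => F v ^+ j) v d.
  elim: j => [|j IH] v; first by under eq_fun do rewrite expr0; exact: dC.
  by under eq_fun do rewrite exprS; exact: dM.
split; first exact: dk.
elim: k => [|k IH].
  by apply/funext => v; rewrite expr0 !mul1r; congr ('D_d _ v); apply/funext => u; rewrite expr1.
have -> : (fun v => F v ^+ k.+2) = fun v => F v * F v ^+ k.+1 by apply/funext => v; rewrite exprS.
rewrite (DM dF (dk k.+1)); apply/funext => v; rewrite (congr1 (@^~ v) IH : 'D_d _ v = _).
by rewrite (exprS _ k) -[k.+2]addn1 natrD; ring.
Qed.

(** A derivative replaces one factor [F] by [F'], of size [1 + F]. Of [K + M] factors, [M] are still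
    present after [K] derivatives, which preserves the vanishing at [F = 0]. *)
Lemma cls_pow K M (F : I -> V -> R) : (forall i v, 0 <= F i v) -> (forall k, cls e k F (fun i v => 1 + F i v)) ->
  cls e K (fun i v => F i v ^+ (K + M)) (fun i v => F i v ^+ M * (1 + F i v) ^+ K).
Proof.
move=> F0 hF; have F1 i v : 0 <= 1 + F i v by rewrite addr_ge0.
have bd K' : exists2 C, 0 <= C & forall i v, `|F i v ^+ (K' + M)| <= C * (F i v ^+ M * (1 + F i v) ^+ K').
  exists 1 => // i v; rewrite mul1r ger0_norm ?exprn_ge0// addnC exprD ler_wpM2l ?exprn_ge0//.
  by apply: lerXn2r; rewrite ?nnegrE ?lerDr.
have cn K' i : continuous (fun v => F i v ^+ (K' + M)) by apply: contX; exact: (cls_cont (hF 0%N)).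
elim: K => [|K IH]; first by split => //; exact: (bd 0%N).
split=> [i||d]; [exact: (cn K.+1)|exact: bd|].
have dF i v : derivable (F i) v (e d) by exact: (cls_d (hF 1%N)).
split => [i v|]; first exact: (DX _ (dF i)).1.
rewrite (_ : (fun i => 'D_(e d) _) = fun i v => (K + M).+1%:R * (F i v ^+ (K + M) * 'D_(e d) (F i) v)); last first.
  by apply/funext => i; rewrite addSn (DX _ (dF i)).2.
have w0 i v : 0 <= F i v ^+ M * (1 + F i v) ^+ K by rewrite mulr_ge0 ?exprn_ge0.
have h := clsZ (fun=> (K + M).+1%:R) (clsM w0 IH (cls_D d (hF K.+1))).
apply: (cls_le (A := (K + M).+1%:R) _ _ h) => // i v.
by rewrite ger0_norm// exprSr mulrA.
Qed.

(** The difference of two rational cut-offs over a common denominator. If [c0 = 0], it and its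
    derivatives vanish to order [M] at [F = 0], and they decay at infinity: a smooth substitute for
    an annulus. *)
Lemma cls_annulus K M (F : I -> V -> R) (c0 c1 : I -> R) B q : (forall i v, 0 < F i v) ->
  (forall k, cls e k F (fun i v => 1 + F i v)) -> 1 <= q -> 0 <= B ->
  (forall i v, `|c0 i| <= F i v ^+ M * (1 + F i v) ^+ K) -> (forall i, `|c1 i| <= B) ->
  cls e K (fun i v => (c0 i + c1 i * F i v ^+ (K + M)) * ((1 + F i v ^+ (K + M))^-1 * (1 + q * F i v ^+ (K + M))^-1))
    (fun i v => F i v ^+ M * (1 + F i v) ^+ K * (((1 + F i v) ^+ (K + M))^-1 * ((1 + F i v) ^+ (K + M))^-1)).
Proof.
move=> Fp hF q1 B0 h0 h1; have F0 i v := ltW (Fp i v); set N := (K + M)%N.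
have F1 i v : 0 < 1 + F i v by rewrite addr_gt0.
have F2 i v := ltW (F1 i v).
have w0 i v : 0 <= F i v ^+ M * (1 + F i v) ^+ K by rewrite mulr_ge0 ?exprn_ge0.
have FF i v k : F i v ^+ k <= (1 + F i v) ^+ k by apply: lerXn2r; rewrite ?nnegrE ?lerDr.
have hN := cls_pow K M F0 hF.
have den p : 1 <= p -> cls e K (fun i v => (1 + p * F i v ^+ N)^-1) (fun i v => ((1 + F i v) ^+ N)^-1).
  move=> p1; apply: clsV => [i v||]; first by rewrite exprn_gt0.
    apply: clsD; first by apply: cls_cst => i v; rewrite normr1 exprn_ege1// lerDl.
    have := clsZ (fun=> p) hN; apply: (cls_le (A := p)) => [|i v]; first exact: le_trans p1.
    rewrite ger0_norm ?(le_trans _ p1)// ler_wpM2l ?(le_trans _ p1)// /N addnC exprD.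
    by apply: ler_wpM2r => //; exact: exprn_ge0.
  (* [(1 + F) ^+ N <= 2 ^+ N * (1 + F ^+ N)], by comparing [F] with 1. *)
  exists (2 ^- N); first by rewrite invr_gt0 exprn_gt0.
  move=> i v; rewrite ger0_norm; last by rewrite addr_ge0// mulr_ge0 ?exprn_ge0// (le_trans _ p1).
  rewrite mulrC ler_pdivrMr ?exprn_gt0//.
  apply: (@le_trans _ _ ((1 + F i v ^+ N) * 2 ^+ N)); last first.
    by rewrite ler_wpM2r ?exprn_ge0// lerD2l ler_peMl ?exprn_ge0.
  have [f1|f1] := leP (F i v) 1.
    apply: (@le_trans _ _ (1 * 2 ^+ N)); last by rewrite ler_wpM2r ?exprn_ge0// lerDl exprn_ge0.
    rewrite mul1r; apply: lerXn2r; rewrite ?nnegrE//; lra.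
  apply: (@le_trans _ _ (F i v ^+ N * 2 ^+ N)); last by rewrite ler_wpM2r ?exprn_ge0// lerDr.
  rewrite -exprMn; apply: lerXn2r; rewrite ?nnegrE ?mulr_ge0//; lra.
apply: clsM => //.
  apply: clsD; first exact: cls_cst.
  have := clsZ c1 hN; apply: (cls_le (A := B)) => // i v.
  by rewrite ler_wpM2r.
apply: clsM => [i v||]; first by rewrite invr_ge0 exprn_ge0.
  by have := den 1 (lexx _); under eq_fun do under eq_fun do rewrite mul1r.
exact: den.
Qed.
End Powers.

Variable n : nat.
Notation V := ('rV[R]_n).
Notation V3 := ('rV[R]_n * 'rV[R]_n * 'rV[R]_n)%type.
Variable rho : R.
Hypotheses (rho0 : 0 < rho) (rho1 : rho <= 1).

Definition lam (j : nat) : R := powR (2 ^+ j) rho.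
Definition mu (j : nat) : R := powR (2 ^+ j) (1 - rho).
Definition crd (d : bool * 'I_n) (v : V3) : R := (if d.1 then v.2 else v.1.2) 0 d.2.
(* With [xi = lam j * xi'] etc., [P j = (1 + |xi|^2 + |eta|^2) / 4 ^ j]. *)
Definition P (j : nat) (v : V3) : R := (4^-1) ^+ j + \sum_(d : bool * 'I_n) ((mu j)^-1 * crd d v) ^+ 2.

Lemma pow2_ge1 j : 1 <= 2 ^+ j :> R. Proof. by rewrite exprn_ege1// ler1n. Qed.
Lemma lam_gt0 j : 0 < lam j. Proof. by apply: powR_gt0; rewrite exprn_gt0. Qed.
Lemma mu_ge1 j : 1 <= mu j.
Proof. by rewrite -[leLHS](powRr0 (2 ^+ j)); apply: ler_powR; [exact: pow2_ge1|rewrite subr_ge0]. Qed.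
Lemma mu_pos j : 0 < mu j. Proof. exact: lt_le_trans (mu_ge1 j). Qed.
Lemma lam_mu j : lam j * mu j = 2 ^+ j.
Proof.
rewrite -powRD; last by rewrite subrKC oner_eq0.
by rewrite subrKC powRr1// exprn_ge0.
Qed.
Lemma P_gt0 j v : 0 < P j v.
Proof. by rewrite ltr_pwDl ?exprn_gt0 ?invr_gt0// sumr_ge0// => d _; exact: sqr_ge0. Qed.
Lemma P0_ge1 v : 1 <= P 0%N v.
Proof. by rewrite /P expr0 lerDl sumr_ge0// => d _; exact: sqr_ge0. Qed.

Lemma affine_crd d : affine (@e3 R n) (fun j d' => (mu j)^-1 * crd d (e3 R d')) (fun j v => (mu j)^-1 * crd d v).
Proof.
have m1 j : `|(mu j)^-1| <= 1.
  have h : 0 < (mu j)^-1 by rewrite invr_gt0 mu_pos.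
  by rewrite (gtr0_norm h) (invf_le1 (mu_pos j)) mu_ge1.
split.
- move=> j; apply: contM; first exact: contC.
  have c1 : continuous (fun v : V3 => v.1.2).
    by apply: (cont_compT (f := fst) (g := snd)) => v; [exact: cvg_fst|exact: cvg_snd].
  have c2 : continuous (fun v : V3 => v.2) by move=> v; exact: cvg_snd.
  rewrite /crd; case: d => [[] k] /=.
    by apply: (cont_comp (f := fun v : V3 => v.2) (g := fun u : V => u 0 k)); last exact: coord_cont.
  by apply: (cont_comp (f := fun v : V3 => v.1.2) (g := fun u : V => u 0 k)); last exact: coord_cont.
- move=> j d'; rewrite normrM mulr_ile1//.
  by rewrite /crd /e3; case: d => [[] k] /=; case: ifP => _ /=; rewrite ?mxE ?normr0//; case: ifP => _ /=;
    rewrite ?mxE ?normr0// eqxx; case: eqP => _; rewrite ?normr1 ?normr0.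
- move=> j d' h v; rewrite /crd scale3E.
  case: d => [[] k] /=; rewrite !mxE; ring.
Qed.

Lemma cls_P K : cls (@e3 R n) K P (fun j v => 1 + P j v).
Proof.
have h := @cls_quad R _ _ (@e3 R n) nat K _ (index_enum _) _ _ (fun j => (4^-1) ^+ j) (fun j v => 1 + P j v) affine_crd.
apply: h.
- by move=> j; rewrite exprn_ge0// invr_ge0.
- by move=> j v; rewrite lerDl; exact: ltW (P_gt0 j v).
- by move=> j v; rewrite -/(P j v) lerDr.
Qed.

Lemma sum_crd (f : bool * 'I_n -> R) : \sum_d f d = \sum_k f (false, k) + \sum_k f (true, k).
Proof.
transitivity (\sum_(d : bool * 'I_n) f (d.1, d.2)); first by apply: eq_bigr => -[].
by rewrite -(pair_bigA _ (fun b k => f (b, k))) /= big_bool addrC.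
Qed.

(** [wt (xi / mu)] is a product of [n] factors, each at least [(1 + P)^-1], and [W2] consists of
    four such products; hence [4 * n]. *)
Lemma W2_low j v K : (4 * n <= K)%N -> (1 + P j v) ^- K <= W2 (mu j) (v.1.2, v.2).
Proof.
move=> hK; have P0 := P_gt0 j v; have P1 : 1 <= 1 + P j v by rewrite lerDl ltW.
have h (b : bool) : (1 + P j v) ^- n <= wt ((mu j)^-1 *: (if b then v.2 else v.1.2)).
  have -> : (1 + P j v) ^- n = \prod_(k < n) (1 + P j v)^-1 by rewrite prodr_const card_ord exprVn.
  apply: ler_prod => k _; rewrite invr_ge0 (le_trans _ P1)//= /w1 lef_pV2 ?posrE ?w1_den ?(lt_le_trans _ P1)//.
  rewrite lerD2l mxE /P (bigD1 (b, k)) //= -[leLHS]add0r lerD ?exprn_ge0 ?invr_ge0//.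
  by rewrite /crd /= lerDl sumr_ge0// => d _; exact: sqr_ge0.
apply: (@le_trans _ _ ((1 + P j v) ^- n ^+ 2 * (1 + P j v) ^- n ^+ 2)).
  rewrite -!exprVn -!exprM -exprD; apply: ler_wiXn2l; rewrite ?invr_ge0 ?invf_le1 ?(le_trans _ P1) ?(lt_le_trans _ P1)//.
  by lia.
have n0 : 0 <= (1 + P j v) ^- n by rewrite invr_ge0 exprn_ge0// (le_trans _ P1).
apply: ler_pM; rewrite ?exprn_ge0//; apply: lerXn2r; rewrite ?nnegrE ?wt_ge0//; [exact: (h false)|exact: (h true)].
Qed.
End FrequencyPieces.

(** * Dilated symbols and their pieces *)

Section DilatedSymbols.
Local Open Scope classical_set_scope.
Local Open Scope ring_scope.
Variables (R : realType) (n : nat).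
Notation V := ('rV[R]_n).
Notation V3 := ('rV[R]_n * 'rV[R]_n * 'rV[R]_n)%type.
Notation dir := ('I_3 * 'I_n)%type.
Variables (m rho delta : R).
Hypotheses (rho0 : 0 < rho) (rho1 : rho <= 1) (delta0 : 0 <= delta) (delta1 : delta <= rho).

Definition Dsv (f : V3 -> R) (ds : seq dir) : V3 -> R := foldr (fun d G => 'D_(e3 R d) G) f ds.
Definition ordr (ds : seq dir) : R := m - rho * (ord_in R 1 ds + ord_in R 2 ds) + delta * ord_in R 0 ds.
Definition sym (f : V3 -> R) := forall ds, [/\ continuous (Dsv f ds), forall d v, derivable (Dsv f ds) v (e3 R d) &
  exists C, forall v, `|Dsv f ds v| <= C * powR (1 + enorm v.1.2 + enorm v.2) (ordr ds)].

Lemma symN f : sym f -> sym (fun v => - f v).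
Proof.
move=> hf; have E ds : Dsv (fun v => - f v) ds = fun v => - Dsv f ds v.
  elim: ds => [//|d ds IH]; rewrite [LHS]/= -/(Dsv _ ds) IH DN//.
  by move=> v; have [_ h _] := hf ds; exact: h.
move=> ds; have [h1 h2 [C hC]] := hf ds; rewrite E; split => [|d v|]; [exact: contN|exact: dN|].
by exists C => v; rewrite normrN.
Qed.

Definition sc (j : nat) (d : dir) : R := if val d.1 == 0%N then (lam rho j)^-1 else lam rho j.
Definition Sd (j : nat) (v : V3) : V3 := ((lam rho j)^-1 *: v.1.1, lam rho j *: v.1.2, lam rho j *: v.2).

Lemma Sd_shift j d (h : R) v : Sd j (h *: e3 R d + v) = h *: (sc j d *: e3 R d) + Sd j v.
Proof.
rewrite /Sd /sc scalerA !scale3E /= /e3.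
by case: ifP => _ /=; [|case: ifP => _ /=]; rewrite ?scaler0 ?add0r ?scalerDr ?scalerA 1?[in RHS]mulrC.
Qed.

Lemma cont_Sd j : continuous (Sd j).
Proof.
have cs (c : R) (f : V3 -> V) : continuous f -> continuous (fun v => c *: f v).
  by move=> cf v; apply: cvgZr; exact: cf.
have c1 : continuous (fun v : V3 => v.1.1) by apply: (cont_compT (f := fst) (g := fst)) => v; exact: cvg_fst.
have c2 : continuous (fun v : V3 => v.1.2) by apply: (cont_compT (f := fst) (g := snd)) => v; [exact: cvg_fst|exact: cvg_snd].
have c3 : continuous (fun v : V3 => v.2) by move=> v; exact: cvg_snd.
exact: (cont_pair (cont_pair (cs _ _ c1) (cs _ _ c2)) (cs _ _ c3)).
Qed.

Lemma ord_in_cons k d (ds : seq dir) : ord_in R k (d :: ds) = (val d.1 == k)%:R + ord_in R k ds.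
Proof. by rewrite /ord_in /= natrD. Qed.

Lemma dir_cases (d : dir) : [|| val d.1 == 0%N, val d.1 == 1%N | val d.1 == 2%N].
Proof. by case: d => [[[|[|[|]]]]]. Qed.

Lemma ord_in_size (ds : seq dir) : ord_in R 0 ds + ord_in R 1 ds + ord_in R 2 ds = (size ds)%:R.
Proof.
elim: ds => [|d ds IH]; first by rewrite /ord_in /= !addr0.
rewrite !ord_in_cons /= -[(size ds).+1]addn1 natrD -IH.
by case/or3P: (dir_cases d) => /eqP ->; rewrite ?eqxx /=; ring.
Qed.

Lemma prod_sc j (ds : seq dir) : \prod_(d <- ds) sc j d = powR (lam rho j) (ord_in R 1 ds + ord_in R 2 ds - ord_in R 0 ds).
Proof.
have l0 := lam_gt0 rho j; elim: ds => [|d ds IH]; first by rewrite big_nil /ord_in /= !addr0 subr0 powRr0.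
rewrite big_cons IH !ord_in_cons /sc.
have P x y : lam rho j `^ (x + y) = lam rho j `^ x * lam rho j `^ y by rewrite powRD// (gt_eqF l0) implybT.
case/or3P: (dir_cases d) => /eqP -> /=.
- rewrite -(powR_inv1 (ltW l0)) -P; congr powR; ring.
- rewrite -{1}(powRr1 (ltW l0)) -P; congr powR; ring.
- rewrite -{1}(powRr1 (ltW l0)) -P; congr powR; ring.
Qed.

(** [P] is comparable with [T ^+ 2], where [T = (1 + |xi| + |eta|) / 2 ^ j] in the original
    frequencies. Up to a constant this weight dominates every power of [T] with exponent between
    [- 2 M] and [2 M], and so absorbs the change of order under differentiation. *)
Definition omP M (j : nat) (v : V3) : R := powR (2 ^+ j) m * ((P rho j v) ^- M * (1 + P rho j v) ^+ (2 * M)).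

Lemma enormZ c (x : V) : 0 <= c -> enorm (c *: x) = c * enorm x.
Proof.
move=> c0; rewrite /enorm (_ : dot (c *: x) (c *: x) = c ^+ 2 * dot x x); last first.
  by rewrite /dot big_distrr /=; apply: eq_bigr => i _; rewrite !mxE; ring.
by rewrite sqrtrM ?sqr_ge0// sqrtr_sqr ger0_norm.
Qed.
Lemma enorm_ge0 (x : V) : 0 <= enorm x. Proof. exact: sqrtr_ge0. Qed.
Lemma enorm2 (x : V) : enorm x ^+ 2 = \sum_k x 0 k ^+ 2.
Proof. by rewrite sqr_sqrtr ?sumr_ge0// => k _; rewrite -expr2 sqr_ge0. Qed.

Lemma base_P j v : let T := (1 + enorm (Sd j v).1.2 + enorm (Sd j v).2) / 2 ^+ j in
  P rho j v <= T ^+ 2 /\ T ^+ 2 <= 3 * P rho j v.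
Proof.
have l0 := ltW (lam_gt0 rho j); have m0 := mu_pos rho1 j; have lm := lam_mu rho j.
move=> T; pose a := lam rho j * enorm v.1.2; pose b := lam rho j * enorm v.2.
have TE : T = (1 + a + b) / 2 ^+ j by rewrite /T /Sd !enormZ.
have a0 : 0 <= a by rewrite mulr_ge0 ?enorm_ge0.
have b0 : 0 <= b by rewrite mulr_ge0 ?enorm_ge0.
have X0 : 0 < 2 ^+ j :> R by rewrite exprn_gt0.
have PE : P rho j v = (1 + a ^+ 2 + b ^+ 2) / (2 ^+ j) ^+ 2.
  rewrite /P sum_crd /crd /= /a /b !exprMn !enorm2.
  have s c (x : V) : \sum_k (c * x 0 k) ^+ 2 = c ^+ 2 * \sum_k x 0 k ^+ 2.
    by rewrite big_distrr /=; apply: eq_bigr => k _; rewrite exprMn.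
  rewrite !s -lm; have e4 : (4^-1 : R) ^+ j = ((lam rho j * mu rho j) ^+ 2)^-1.
    by rewrite lm -exprM mulnC exprM exprVn; congr (_ ^+ _)^-1; ring.
  rewrite e4; field; rewrite gt_eqF// gt_eqF// lam_gt0//.
have X20 : 0 < (2 ^+ j) ^+ 2 :> R by rewrite exprn_gt0.
rewrite PE TE expr_div_n; clearbody a b; split.
  by apply: ler_wpM2r; rewrite ?invr_ge0 ?(ltW X20)//; nra.
by rewrite mulrA; apply: ler_wpM2r; rewrite ?invr_ge0 ?(ltW X20)//; have := sqr_ge0 (a - b); have := sqr_ge0 (1 - a); have := sqr_ge0 (1 - b); nra.
Qed.

Lemma T_pow (T Q s : R) (M : nat) : 0 < T -> 0 < Q -> Q <= T ^+ 2 -> T ^+ 2 <= 3 * Q -> `|s| <= (2 * M)%:R ->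
  powR T s <= 3 ^+ M * (Q ^- M * (1 + Q) ^+ (2 * M)).
Proof.
move=> T0 Q0 h1 h2; rewrite ler_norml => /andP[s1 s2].
have QM : 0 < Q ^+ M by rewrite exprn_gt0.
have t31 : 1 <= 3 ^+ M :> R by rewrite exprn_ege1// ler1n.
have q1 : 1 <= (1 + Q) ^+ (2 * M) by rewrite exprn_ege1// lerDl ltW.
have [t1|t1] := leP 1 T.
  apply: (@le_trans _ _ (T ^+ (2 * M))).
    by rewrite -powR_mulrn ?(ltW T0)//; exact: ler_powR.
  rewrite exprM; apply: (@le_trans _ _ ((3 * Q) ^+ M)).
    by apply: lerXn2r => //; rewrite nnegrE ?sqr_ge0// mulr_ge0 ?(ltW Q0).
  rewrite exprMn ler_wpM2l ?exprn_ge0// mulrC ler_pdivlMr// -expr2 -exprM mulnC.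
  by apply: lerXn2r; rewrite ?nnegrE ?addr_ge0 ?(ltW Q0)// lerDr.
apply: (@le_trans _ _ (powR T (- (2 * M)%:R))).
  by apply: ger_powR => //; rewrite T0 ltW.
rewrite powRN powR_mulrn ?(ltW T0)// exprM.
apply: (@le_trans _ _ (Q ^- M)).
  rewrite lef_pV2 ?posrE ?exprn_gt0//.
  by apply: lerXn2r => //; rewrite nnegrE ?sqr_ge0// ltW.
have i0 : 0 <= Q ^- M by rewrite invr_ge0 ltW.
rewrite mulrCA ler_peMr//; exact: (mulr_ege1 t31 q1).
Qed.

(** The dilation contributes [lam] to the number of frequency derivatives minus that of space
    derivatives. Against the orders [rho] and [delta], frequency derivatives cancel and each space
    derivative leaves [2 ^ (- j (rho - delta))], at most 1 because [delta <= rho]. *)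
Lemma sym_bnd f M ds : sym f -> `|m| + (size ds)%:R <= (2 * M)%:R -> exists2 C, 0 <= C & forall j v,
  `|\prod_(d <- ds) sc j d * Dsv f ds (Sd j v)| <= C * omP M j v.
Proof.
move=> hf hM; have [_ _ [C hC]] := hf ds.
exists (`|C| * 3 ^+ M); first by rewrite mulr_ge0 ?exprn_ge0.
move=> j v; have [] := base_P j v; set B := 1 + _ + _ => /=; set T := B / _ => h1 h2.
have X1 := pow2_ge1 R j; have X0 : 0 < 2 ^+ j :> R by rewrite exprn_gt0.
have B0 : 0 < B by rewrite /B -addrA ltr_pwDl// addr_ge0// enorm_ge0.
have T0 : 0 < T by rewrite divr_gt0.
have BE : B = 2 ^+ j * T by rewrite /T mulrC divfK// gt_eqF.
have o00 : 0 <= ord_in R 0 ds by exact: ler0n.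
have o10 : 0 <= ord_in R 1 ds by exact: ler0n.
have o20 : 0 <= ord_in R 2 ds by exact: ler0n.
have os := ord_in_size ds.
rewrite normrM prod_sc ger0_norm ?powR_ge0//.
apply: (@le_trans _ _ (powR (lam rho j) (ord_in R 1 ds + ord_in R 2 ds - ord_in R 0 ds) * (`|C| * powR B (ordr ds)))).
  rewrite ler_wpM2l ?powR_ge0//; apply: (le_trans (hC _)); rewrite -/B.
  by rewrite ler_wpM2r ?powR_ge0// ler_norm.
rewrite mulrCA -mulrA ler_wpM2l// BE powRM ?(ltW X0) ?(ltW T0)// /lam -powRrM mulrA -powRD; last by rewrite (gt_eqF X0) implybT.
rewrite /omP mulrCA; apply: ler_pM; rewrite ?powR_ge0//.
  apply: ler_powR => //; rewrite /ordr.
  have : 0 <= (rho - delta) * ord_in R 0 ds by rewrite mulr_ge0// subr_ge0.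
  move: (ord_in _ _ _) (ord_in _ _ _) (ord_in _ _ _) => x y z; lra.
apply: T_pow => //; first exact: P_gt0.
apply: le_trans hM; rewrite /ordr -os.
have d1 : delta <= 1 by exact: le_trans rho1.
move: (ord_in R 0 ds) (ord_in R 1 ds) (ord_in R 2 ds) o00 o10 o20 => x y z x0 y0 z0.
have hx : rho * (y + z) <= y + z by rewrite ler_piMl ?addr_ge0.
have hx0 : 0 <= rho * (y + z) by rewrite mulr_ge0 ?addr_ge0// ltW.
have hz : delta * x <= x by rewrite ler_piMl.
have hz0 : 0 <= delta * x by rewrite mulr_ge0.
have := ler_norm m; have : - m <= `|m| by rewrite -normrN ler_norm.
by rewrite ler_norml; move=> ? ?; apply/andP; split; lra.
Qed.

Lemma cls_dil f M K ds : sym f -> `|m| + (size ds + K)%:R <= (2 * M)%:R ->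
  cls (@e3 R n) K (fun j v => \prod_(d <- ds) sc j d * Dsv f ds (Sd j v)) (omP M).
Proof.
move=> hf; elim: K ds => [|K IH] ds hM; have [c1 d1 _] := hf ds.
  split => // [j|]; last by apply: sym_bnd => //; rewrite addn0 in hM.
  apply: contM; first exact: contC. exact: (cont_compT (@cont_Sd j) c1).
split => [j||d].
- apply: contM; first exact: contC. exact: (cont_compT (@cont_Sd j) c1).
- by apply: sym_bnd => //; apply: le_trans hM; rewrite lerD2l ler_nat leq_addr.
have dS j v : derivable (fun v => Dsv f ds (Sd j v)) v (e3 R d) /\
    'D_(e3 R d) (fun v => Dsv f ds (Sd j v)) v = sc j d * Dsv f (d :: ds) (Sd j v).
  have [s1 s2] := derive_scale (sc j d) (d1 d (Sd j v)).
  split; first by apply: (derivable_shift (L := Sd j) (e := sc j d *: e3 R d)) => // h x; exact: Sd_shift.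
  by rewrite (derive_shift (L := Sd j) (e := sc j d *: e3 R d)) ?s2// => h x; exact: Sd_shift.
split => [j v|]; first by apply: dZ; exact: (dS j v).1.
rewrite (_ : (fun j => 'D_(e3 R d) _) = fun j v => \prod_(d' <- d :: ds) sc j d' * Dsv f (d :: ds) (Sd j v)).
  by apply: IH; rewrite /= addSnnS.
apply/funext => j; rewrite DZ; last by move=> v; exact: (dS j v).1.
by apply/funext => v; rewrite (dS j v).2 big_cons; ring.
Qed.

(** Switches off the subtracted term at [j = 0], so that the first piece contains the low
    frequencies. *)
Definition kp (j : nat) : R := (j != 0%N)%:R.
(** Concentrates on [P] of order 1: the quantity [4 ^+ N * P ^+ N] is [P ^+ N] taken at the
    preceding scale. *)
Definition psi N (j : nat) (v : V3) : R := (1 + P rho j v ^+ N)^-1 - kp j * (1 + 4 ^+ N * P rho j v ^+ N)^-1.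

(** The factor [P ^+ M] of the cut-off cancels [P ^- M], and the powers of [1 + P] combine to
    [(1 + P) ^- (6 n)], which is below [W2]. The condition on [M] lets [omP] absorb the order [m]
    together with [6 n] derivatives. *)
Lemma cls_piece f M : sym f -> `|m| + (6 * n)%:R <= (2 * M)%:R ->
  cls (@e3 R n) (6 * n) (fun j v => psi (6 * n + M) j v * f (Sd j v))
    (fun j v => powR (2 ^+ j) m * W2 (mu rho j) (v.1.2, v.2)).
Proof.
move=> hf hM; set K := (6 * n)%N; set N := (K + M)%N.
have hP := @P_gt0 R n rho.
have P1 j (v : V3) : 0 < 1 + P rho j v by exact: (addr_gt0 ltr01 (hP j v)).
have k01 j : 0 <= kp j /\ kp j <= 1 by rewrite /kp; case: (j != 0%N); rewrite ?lexx ?ler01.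
have q1 : 1 <= 4 ^+ N :> R by rewrite exprn_ege1// ler1n.
have h1 : cls (@e3 R n) K (psi N) (fun j v => P rho j v ^+ M * (1 + P rho j v) ^+ K *
   (((1 + P rho j v) ^+ (K + M))^-1 * ((1 + P rho j v) ^+ (K + M))^-1)).
  have := @cls_annulus R _ _ (@e3 R n) nat K M (P rho) (fun j => 1 - kp j) (fun j => 4 ^+ N - kp j) (4 ^+ N) (4 ^+ N) hP
    (cls_P n rho1) q1 (le_trans ler01 q1).
  rewrite (_ : (fun i v => _ * _) = psi N); last first.
    apply/funext => j; apply/funext => v; rewrite /psi -/N; have := exprn_gt0 N (hP j v).
    move: (P rho j v ^+ N) (4 ^+ N : R) q1 => p q q1' p0; field.
    by rewrite !gt_eqF// ?addr_gt0// mulr_gt0// (lt_le_trans _ q1').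
  apply => [j v|j]; last by have [] := k01 j => ? ?; rewrite ger0_norm; lra.
  rewrite /kp; case: j => [|j] /=; last by rewrite subrr normr0 mulr_ge0 ?exprn_ge0 ?(ltW (hP _ _)) ?(ltW (P1 _ _)).
  (* At [j = 0] the numerator does not vanish at the origin of [P], but there [1 <= P]. *)
  rewrite subr0 normr1 mulr_ege1// exprn_ege1//; first exact: P0_ge1.
  by rewrite lerDl ltW.
have h2 : cls (@e3 R n) K (fun j v => f (Sd j v)) (omP M).
  have := @cls_dil f M K [::] hf hM; rewrite (_ : (fun j v => \prod_(d <- [::]) sc j d * Dsv f [::] (Sd j v)) = fun j v => f (Sd j v))//.
  by apply/funext => j; apply/funext => v; rewrite big_nil mul1r.
have w0 j (v : V3) : 0 <= P rho j v ^+ M * (1 + P rho j v) ^+ K *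
   (((1 + P rho j v) ^+ (K + M))^-1 * ((1 + P rho j v) ^+ (K + M))^-1).
  by have p0 := ltW (hP j v); have p1 := ltW (P1 j v); rewrite !mulr_ge0 ?invr_ge0 ?exprn_ge0.
apply: (cls_le (A := 1) _ _ (clsM w0 h1 h2)) => // j v; rewrite mul1r /omP.
have -> : P rho j v ^+ M * (1 + P rho j v) ^+ K * (((1 + P rho j v) ^+ (K + M))^-1 * ((1 + P rho j v) ^+ (K + M))^-1) *
    (powR (2 ^+ j) m * (P rho j v ^- M * (1 + P rho j v) ^+ (2 * M))) = powR (2 ^+ j) m * (1 + P rho j v) ^- K.
  have alg (x y z t : R) : 0 < x -> 0 < y -> 0 < z -> x * y * ((y * z)^-1 * (y * z)^-1) * (t * (x^-1 * (z * z))) = t * y^-1.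
    by move=> x0 y0 z0; field; rewrite !lt0r_neq0.
  by rewrite mul2n -addnn (exprD _ K M) (exprD _ M M); apply: (alg _ _ _ _ (exprn_gt0 M (hP j v)) (exprn_gt0 K (P1 j v)) (exprn_gt0 M (P1 j v))).
by rewrite ler_wpM2l ?powR_ge0//; apply: W2_low => //; rewrite /K; lia.
Qed.
End DilatedSymbols.

(** * Behaviour of transforms and norms under dilation *)

Section Rescaling.
Local Open Scope classical_set_scope.
Local Open Scope ring_scope.
Variables (R : realType) (n : nat).
Notation V := ('rV[R]_n).
Notation V3 := ('rV[R]_n * 'rV[R]_n * 'rV[R]_n)%type.
Notation X1 := (Vw R n).
Notation X2 := (prodw (Vw R n) (Vw R n)).

(** Every vector is a value of [ws_phi], so slices of tame functions can be taken at every point. *)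
Lemma Vw_surj k (v : 'rV[R]_k) : exists t, @ws_phi _ _ (Vw R k) t = v.
Proof.
elim: k v => [|k IH] v; first by exists tt; apply/rowP => -[].
have [t ht] := IH (\row_i v 0 (lift ord0 i)).
exists (v 0 ord0, t); rewrite /= (_ : (_, _) = (v 0 ord0, \row_i v 0 (lift ord0 i))) ?ht//.
by apply/rowP => i; case: (unliftP ord0 i) => [i'|] ->; rewrite ?rowmS ?rowm0 ?mxE.
Qed.

Lemma tame_slice (F : V * V -> R) x : tame X2 F -> tame X1 (fun y => F (x, y)).
Proof. by move=> tF; have [t <-] := Vw_surj x; exact: (tame_slice1 tF). Qed.

Lemma tame_Int1 V1 V2 (X : wspace R V1) (Y : wspace R V2) (F : V1 * V2 -> R) :
  tame (prodw X Y) F -> tame Y (ws_w Y) -> (forall x, meas Y (fun y => F (x, y))) -> tame X (fun x => Int Y (fun y => F (x, y))).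
Proof.
move=> [mF [C hC]] tY mx; split; first exact: meas_Int1.
exists (C * Int Y (ws_w Y)) => x.
have -> : C * Int Y (ws_w Y) * ws_w X x = Int Y (fun y => C * ws_w X x * ws_w Y y) by rewrite IntZ//; ring.
apply: norm_Int => //; first exact: tameZ.
by move=> y; rewrite -mulrA; exact: hC.
Qed.

Lemma meas_scale (l : R) (F : V -> R) : 0 < l -> meas X1 F -> meas X1 (fun v => F (l *: v)).
Proof.
move=> l0 mF; have h : meas X1 (fun v => F (aff l 0 v)).
  by apply/measurable_EFinP; exact: (@meas_aff R n l 0 (fun v => (F v)%:E) l0 (measE mF)).
by move: h; under eq_fun do rewrite /aff addr0.
Qed.

Lemma Int_scale2 (l : R) (F : V * V -> R) : 0 < l -> tame X2 F -> tame X2 (fun z => F (l *: z.1, l *: z.2)) ->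
  Int X2 (fun z => F (l *: z.1, l *: z.2)) = l ^- n * (l ^- n * Int X2 F).
Proof.
move=> l0 tF tF'; rewrite (Int_prod12 tF') (Int_prod12 tF) /=.
have tw : tame X1 (ws_w X1).
  by rewrite (_ : ws_w X1 = @wt R n); [exact: tame_wt1|apply/funext => v; exact: Vw_w].
have tH : tame X1 (fun x => Int X1 (fun y => F (x, y))).
  by apply: tame_Int1 => // x; exact: (tame_slice x tF).1.
rewrite -(Int_scale l0 tH) -IntZ; last exact: (tame_scale l0 tH).
by congr Int; apply/funext => x; rewrite (Int_scale l0 (tame_slice (l *: x) tF)).
Qed.

Definition dil (l : R) (F : V -> R) (y : V) := F (l^-1 *: y).

Lemma dotZ_comm (l : R) (x y : V) : dot (l *: x) y = dot x (l *: y).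
Proof. by rewrite dotZl dotZr. Qed.

Lemma Ft_dil l F th xi : 0 < l -> tame X1 F -> Ft (dil l F) th xi = l ^+ n * Ft F th (l *: xi).
Proof.
move=> l0 tF; have li : 0 < l^-1 by rewrite invr_gt0.
have t1 : tame X1 (fun y => F y * cos (dot y (l *: xi) + th)) by exact: tame_Fcos.
have := Int_scale li t1; rewrite exprVn invrK => <-; congr Int; apply/funext => y.
by rewrite /dil -dotZ_comm scalerA mulfV ?scale1r// gt_eqF.
Qed.

Lemma hh_dil l F G z : 0 < l -> tame X1 F -> tame X1 G ->
  hh0 (dil l F) (dil l G) z = l ^+ n * l ^+ n * hh0 F G (l *: z.1, l *: z.2) /\
  hh1 (dil l F) (dil l G) z = l ^+ n * l ^+ n * hh1 F G (l *: z.1, l *: z.2).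
Proof.
move=> l0 tF tG; rewrite /hh0 /hh1 !Ft_dil//=; move: (Ft _ _ _) (Ft _ _ _) (Ft _ _ _) (Ft _ _ _) => a b c d.
by split; ring.
Qed.

Lemma cont_scale (l : R) : continuous (fun y : V => l *: y).
Proof.
apply: cont_rV => j; under eq_fun do rewrite mxE.
by apply: contM; [exact: contC|exact: coord_cont].
Qed.

Lemma nice_dil l F : 1 <= l -> nice F -> nice (dil l F).
Proof.
move=> l1 [cF [C hC]]; have l0 : 0 < l by exact: lt_le_trans l1.
split; first exact: (cont_compT (@cont_scale l^-1) cF).
exists (`|C| * (l ^+ (4 * n))) => y; apply: (le_trans (hC _)).
apply: (@le_trans _ _ (`|C| * wt (l^-1 *: y) ^+ 2)); first by rewrite ler_wpM2r ?exprn_ge0 ?wt_ge0 ?ler_norm.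
rewrite -mulrA ler_wpM2l//.
have h : wt (l^-1 *: y) <= l ^+ (2 * n) * wt y.
  have -> : l ^+ (2 * n) = \prod_(i < n) l ^+ 2 by rewrite prodr_const card_ord -exprM.
  rewrite /wt -big_split /=; apply: ler_prod => i _; rewrite ltW ?w1_gt0//= mxE /w1.
  rewrite (ler_pdivlMr _ _ (w1_den _)) mulrC (ler_pdivrMr _ _ (w1_den _)) mulrDr mulr1 exprMn exprVn mulrA.
  by rewrite mulfV ?mul1r ?lerD2r ?exprn_ege1// gt_eqF// exprn_gt0.
rewrite (_ : l ^+ (4 * n) = (l ^+ (2 * n)) ^+ 2); last by rewrite -exprM; congr (_ ^+ _); lia.
by rewrite -exprMn; apply: lerXn2r; rewrite ?nnegrE ?wt_ge0// mulr_ge0 ?exprn_ge0 ?wt_ge0// ltW.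
Qed.

Lemma nrm_dil q l F v : (1%:E <= q)%E -> 1 <= l -> nice F -> 0 <= v -> nrm q F v ->
  nrm q (dil l F) (powR l (n%:R * inv_exp q) * v).
Proof.
case: q => [p|//|//] p1 l1 nF v0 hv /=; last by move=> x; rewrite mulr0 powRr0 mul1r; exact: hv.
rewrite lee_fin in p1; have p0 : 0 < p by exact: lt_le_trans p1.
have l0 : 0 < l by exact: lt_le_trans l1.
have li : 0 < l^-1 by rewrite invr_gt0.
have := Int_scale li (tame_Np p1 nF); rewrite exprVn invrK => ->.
rewrite powRM ?powR_ge0// -powRrM -mulrA mulVf ?gt_eqF// mulr1 powR_mulrn ?(ltW l0)//.
by rewrite ler_wpM2l ?exprn_ge0 ?(ltW l0).
Qed.
End Rescaling.

(** * The estimate of one dyadic piece *)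

Section Pieces.
Local Open Scope classical_set_scope.
Local Open Scope ring_scope.
Variables (R : realType) (n : nat).
Notation V := ('rV[R]_n).
Notation V3 := ('rV[R]_n * 'rV[R]_n * 'rV[R]_n)%type.
Notation X1 := (Vw R n).
Notation X2 := (prodw (Vw R n) (Vw R n)).

Definition Z (v : V3) : R := 1 + enorm v.1.2 ^+ 2 + enorm v.2 ^+ 2.
(* A smooth frequency cut-off to [Z v] comparable with [4 ^ j]; the sum over [j < k + 1] telescopes. *)
Definition cf (N j : nat) (v : V3) : R :=
  (1 + Z v ^+ N / (4 ^+ N) ^+ j)^-1 - kp R j * (1 + 4 ^+ N * (Z v ^+ N / (4 ^+ N) ^+ j))^-1.

Lemma Z_ge1 v : 1 <= Z v. Proof. by rewrite /Z -addrA lerDl addr_ge0// sqr_ge0. Qed.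

Lemma cf_sum N k v : \sum_(j < k.+1) cf N j v = (1 + Z v ^+ N / (4 ^+ N) ^+ k)^-1.
Proof.
elim: k => [|k IH]; first by rewrite big_ord_recr big_ord0 /cf /kp /= mul0r subr0 add0r.
rewrite big_ord_recr /= IH /cf /kp /= mul1r (_ : 4 ^+ N * (Z v ^+ N / (4 ^+ N) ^+ k.+1) = Z v ^+ N / (4 ^+ N) ^+ k); first by ring.
rewrite exprS; have : (0 : R) < 4 ^+ N by rewrite exprn_gt0.
move: (4 ^+ N : R) => q q0; have : 0 < q ^+ k by rewrite exprn_gt0.
by move: (q ^+ k) => y y0; field; rewrite !gt_eqF.
Qed.

(** The telescoped sum is [1 / (1 + y)], and [1 - 1 / (1 + y) <= y]. *)
Lemma cf_tail N k v : `|1 - \sum_(j < k.+1) cf N j v| <= Z v ^+ N / (4 ^+ N) ^+ k.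
Proof.
rewrite cf_sum; have : 0 <= Z v ^+ N / (4 ^+ N) ^+ k.
  by rewrite divr_ge0 ?exprn_ge0// (le_trans _ (Z_ge1 v)).
move: (_ / _) => y y0; have y1 : 0 < 1 + y by rewrite ltr_pwDl.
have -> : 1 - (1 + y)^-1 = y / (1 + y) by field; rewrite gt_eqF.
rewrite ger0_norm ?divr_ge0// ?(ltW y1)// ler_pdivrMr// ler_peMr// lerDl//.
Qed.

Variables (m rho delta : R).
Hypotheses (rho0 : 0 < rho) (rho1 : rho <= 1) (delta0 : 0 <= delta) (delta1 : delta <= rho).
Variables (q1 q2 : \bar R) (r : R).
Hypotheses (q11 : (1%:E <= q1)%E) (q21 : (1%:E <= q2)%E) (r0 : 0 < r) (hr : r^-1 = inv_exp q1 + inv_exp q2).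
Variables (f : bool -> V3 -> R) (M : nat).
Hypotheses (hf : forall u, sym m rho delta (f u)) (hM : `|m| + (6 * n)%:R <= (2 * M)%:R).
Let N := (6 * n + M)%N.
Let A (j : nat) : R := powR (2 ^+ j) m.
Let b (u : bool) j v := psi rho N j v * f u (Sd rho j v).

Lemma cls_b' u : cls (@e3 R n) (6 * n) (b u) (fun j v => A j * W2 (mu rho j) (v.1.2, v.2)).
Proof. exact: (cls_piece rho0 rho1 delta0 delta1 (hf u) hM). Qed.

Lemma A_ge0 j : 0 <= A j. Proof. exact: powR_ge0. Qed.

Definition piece j (u : bool) v := cf N j v * f u v.

Lemma P_Z j (v : V3) : P rho j v = Z (Sd rho j v) / 4 ^+ j.
Proof.
have l0 := ltW (lam_gt0 rho j); have lm := lam_mu rho j; have m0 := mu_pos rho1 j.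
have s c (x : V) : \sum_k (c * x 0 k) ^+ 2 = c ^+ 2 * \sum_k x 0 k ^+ 2.
  by rewrite big_distrr /=; apply: eq_bigr => k _; rewrite exprMn.
rewrite /P sum_crd /crd /Z /Sd /= !enormZ// !exprMn !enorm2 !s.
have e4 : (4 : R) ^+ j = (lam rho j * mu rho j) ^+ 2.
  by rewrite lm -exprM mulnC exprM; congr (_ ^+ _); ring.
rewrite exprVn e4; move: (\sum_k _) (\sum_k _) => x y; field.
by rewrite gt_eqF// gt_eqF// lam_gt0.
Qed.

Lemma piece_b j u v : piece j u (Sd rho j v) = b u j v.
Proof.
rewrite /piece /b; congr (_ * _); rewrite /cf /psi P_Z exprMn exprVn.
by rewrite (_ : (4 ^+ j) ^+ N = (4 ^+ N : R) ^+ j)// -!exprM mulnC.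
Qed.

Definition Sdi j (v : V3) : V3 := (lam rho j *: v.1.1, (lam rho j)^-1 *: v.1.2, (lam rho j)^-1 *: v.2).
Lemma SdK j v : Sd rho j (Sdi j v) = v.
Proof.
have l0 : lam rho j != 0 by rewrite gt_eqF// lam_gt0.
by case: v => [[x y] z]; rewrite /Sd /Sdi /= !scalerA mulVf// mulfV// !scale1r.
Qed.

Lemma f_cont u : continuous (f u). Proof. by have [] := hf u [::]. Qed.

Lemma cont_enorm2 (g : V3 -> V) : continuous g -> continuous (fun v => enorm (g v) ^+ 2).
Proof.
move=> cg; under eq_fun do rewrite enorm2; apply: cont_sum => k; apply: contX.
by apply: (cont_comp (f := g) (g := fun u : V => u 0 k)) => //; exact: coord_cont.
Qed.

Lemma cont_Z : continuous Z.
Proof.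
apply: contD; first apply: contD; first exact: contC.
  by apply: cont_enorm2; apply: (cont_compT (f := fst) (g := snd)) => v; [exact: cvg_fst|exact: cvg_snd].
by apply: cont_enorm2 => v; exact: cvg_snd.
Qed.

Lemma cf_cont N' j : continuous (cf N' j).
Proof.
have y0 v : 0 <= Z v ^+ N' / (4 ^+ N') ^+ j by rewrite divr_ge0 ?exprn_ge0// (le_trans _ (Z_ge1 v)).
have cy : continuous (fun v => Z v ^+ N' / (4 ^+ N') ^+ j).
  by apply: contM; [apply: contX; exact: cont_Z|exact: contC].
apply: contB.
  apply: contV => [|v]; first by apply: contD => //; exact: contC.
  by rewrite gt_eqF// ltr_pwDl.
apply: contM; first exact: contC.
apply: contV => [|v]; first by apply: contD; [exact: contC|apply: contM => //; exact: contC].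
by rewrite gt_eqF// ltr_pwDl// mulr_ge0 ?exprn_ge0.
Qed.

Lemma piece_cont j u : continuous (piece j u).
Proof. by apply: contM; [exact: cf_cont|exact: f_cont]. Qed.

(** Undoing the dilation turns the frequency size [mu j] into [2 ^ j], since
    [lam j * mu j = 2 ^ j]. *)
Lemma piece_bnd : exists2 C, 0 <= C & forall u j x z, `|piece j u (Lz z x)| <= C * A j * W2 (2 ^+ j) z.
Proof.
have [C C0 hC] := @a_bnd R n nat A (mu rho) A_ge0 b cls_b'.
exists C => // u j x z; rewrite -{1}(SdK j (Lz z x)) piece_b; apply: (le_trans (hC u j _)).
rewrite mulrA ler_wpM2l ?mulr_ge0 ?A_ge0// le_eqVlt; apply/orP; left; apply/eqP.
rewrite /W2 /wm /Sdi /Lz /= !scalerA -(lam_mu rho j) invfM; by rewrite [(mu rho j)^-1 * _]mulrC.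
Qed.

Lemma tame_piece j u x th h H : meas X2 h -> (forall z, `|h z| <= H) ->
  tame X2 (fun z => piece j u (Lz z x) * cos (dot x (tau z) + th) * h z).
Proof.
have [C C0 hC] := piece_bnd => mh hH.
have X0 : 0 < 2 ^+ j :> R by rewrite exprn_gt0.
have cp u' : continuous (piece j u') by exact: (@piece_cont j u').
exact: (@tame_Th R n nat (fun u j => piece j u) j x (C * A j) (2 ^+ j) cp (fun u z => hC u j x z) X0 u th h H mh hH).
Qed.

Lemma tame_pieceb j u x th h H : meas X2 h -> (forall z, `|h z| <= H) ->
  tame X2 (fun z => b u j (Lz z x) * cos (dot x (tau z) + th) * h z).
Proof.
have [C C0 hC] := @a_bnd R n nat A (mu rho) A_ge0 b cls_b' => mh hH.
have := @tame_Th R n nat b j x (C * A j) (mu rho j) _ _ (mu_pos rho1 j) u th h H mh hH.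
apply; first by move=> u'; exact: (cls_cont (cls_b' u') j).
by move=> u' z; apply: (le_trans (hC _ _ _)); rewrite mulrA /Lz /=; case: z.
Qed.

(** Substitution in both frequency variables: the Jacobian [lam ^- (2 n)] cancels the factor
    [lam ^+ (2 n)] that the transforms of the dilated inputs carry. *)
Lemma Th_dil j u th (h h' : V * V -> R) H H' x : meas X2 h -> (forall z, `|h z| <= H) ->
  meas X2 h' -> (forall z, `|h' z| <= H') ->
  (forall z, h' z = lam rho j ^+ n * lam rho j ^+ n * h (lam rho j *: z.1, lam rho j *: z.2)) ->
  Th (b u j) th h' (lam rho j *: x) = Th (piece j u) th h x.
Proof.
set l := lam rho j => mh hH mh' hH' hh; have l0 : 0 < l by exact: lam_gt0.
have l1 : l ^+ n != 0 by rewrite expf_neq0// gt_eqF.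
pose F z := piece j u (Lz z x) * cos (dot x (tau z) + th) * h z.
have tF : tame X2 F by exact: (tame_piece j u x th mh hH).
have E z : b u j (Lz z (l *: x)) * cos (dot (l *: x) (tau z) + th) * h' z = l ^+ n * l ^+ n * F (l *: z.1, l *: z.2).
  rewrite hh -piece_b /F -/l (_ : Sd rho j (Lz z (l *: x)) = Lz (l *: z.1, l *: z.2) x); last first.
    by rewrite /Sd /Lz /= -/l scalerA mulVf ?scale1r// gt_eqF.
  rewrite (_ : dot (l *: x) (tau z) = dot x (tau (l *: z.1, l *: z.2))); first by ring.
  by rewrite dotZ_comm /tau /= scalerDr.
have tF' : tame X2 (fun z => F (l *: z.1, l *: z.2)).
  have := tameZ ((l ^+ n * l ^+ n)^-1) (tame_pieceb j u (l *: x) th mh' hH').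
  rewrite (_ : (fun z => _) = fun z => F (l *: z.1, l *: z.2))//.
  by apply/funext => z; rewrite E mulrA mulVf ?mul1r// mulf_neq0.
rewrite /Th (_ : (fun z => _) = fun z => l ^+ n * l ^+ n * F (l *: z.1, l *: z.2)); last by apply/funext => z; exact: E.
rewrite IntZ// Int_scale2// /F; move: (Int X2 _) => I; field => //; exact: l1.
Qed.

Lemma lam_ge1 j : 1 <= lam rho j.
Proof. by rewrite -[leLHS](powRr0 (2 ^+ j)); apply: ler_powR; [exact: pow2_ge1|exact: ltW]. Qed.

Lemma Hf_dil j F G x : nice F -> nice G ->
  Hf (b ^~ j) (dil (lam rho j) F) (dil (lam rho j) G) (lam rho j *: x) = Hf (piece j) F G x.
Proof.
move=> nF nG; have l1 := lam_ge1 j; have l0 := lam_gt0 rho j.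
have tF := nice_tame nF; have tG := nice_tame nG.
have tF' := nice_tame (nice_dil l1 nF); have tG' := nice_tame (nice_dil l1 nG).
have [m0 m1] := meas_hh tF tG; have [H hH] := hh_bnd tF tG.
have [m0' m1'] := meas_hh tF' tG'; have [H' hH'] := hh_bnd tF' tG'.
have s0 z := (hh_dil z l0 tF tG).1; have s1 z := (hh_dil z l0 tF tG).2.
have b0 z := (hH z).1; have b1 z := (hH z).2; have b0' z := (hH' z).1; have b1' z := (hH' z).2.
have E0 u th := Th_dil u th x m0 b0 m0' b0' s0.
have E1 u th := Th_dil u th x m1 b1 m1' b1' s1.
by rewrite /Hf -(E0 false 0) -(E0 true (pi / 2)) -(E1 false (- (pi / 2))) -(E1 true 0).
Qed.

(** The power of [mu ^+ n] lost by one piece: [sg q1 + sg q2 - 1/2] through the estimate in [L^2]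
    and the inputs, the maximum through the output when [r > 2]. *)
Definition ee : R := sg q1 + sg q2 - 2^-1 + Num.max 0 (2^-1 - r^-1).

Lemma meas_piece j F G : nice F -> nice G -> meas X1 (Hf (piece j) F G).
Proof.
move=> nF nG; have l1 := lam_ge1 j; have l0 := lam_gt0 rho j.
have mH := @meas_Hf R n nat A (mu rho) A_ge0 (mu_ge1 rho1) b cls_b' q1 q11 j _ _ (nice_dil l1 nF) (nice_dil l1 nG).
have -> : Hf (piece j) F G = fun x => Hf (b ^~ j) (dil (lam rho j) F) (dil (lam rho j) G) (lam rho j *: x).
  by apply/funext => x; rewrite Hf_dil.
exact: (meas_scale l0 mH).
Qed.

(** Dilation multiplies the input norms by [lam ^ (n / q1)] and [lam ^ (n / q2)] and the output norm
    by [lam ^ (n / r)]. These cancel by the relation between the exponents, and [2 ^ (j m)] times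
    the loss [mu ^ (n ee)] remains. *)
Lemma piece_est : exists2 C, 0 <= C & forall j F G v1 v2, nice F -> nice G -> 0 <= v1 -> 0 <= v2 -> nrm q1 F v1 -> nrm q2 G v2 ->
  (Eint X1 (fun x => (powR `|Hf (piece j) F G x| r)%:E) <= (powR (C * powR (2 ^+ j) (m + n%:R * (1 - rho) * ee) * (v1 * v2)) r)%:E)%E.
Proof.
have [C C0 hC] := @global R n nat A (mu rho) A_ge0 (mu_ge1 rho1) b cls_b' q1 q2 r q11 q21 r0 hr.
exists C => // j F G v1 v2 nF nG v10 v20 n1 n2.
have l1 := lam_ge1 j; have l0 := lam_gt0 rho j; set l := lam rho j in l1 l0 *.
have nF' := nice_dil l1 nF; have nG' := nice_dil l1 nG.
have := hC j _ _ _ _ nF' nG' (mulr_ge0 (powR_ge0 _ _) v10) (mulr_ge0 (powR_ge0 _ _) v20) (nrm_dil q11 l1 nF v10 n1) (nrm_dil q21 l1 nG v20 n2).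
set H := Hf (b ^~ j) _ _ => hE.
have mH : meas X1 (fun x => powR `|H x| r).
  by apply: meas_powR; apply: meas_norm; exact: (@meas_Hf R n nat A (mu rho) A_ge0 (mu_ge1 rho1) b cls_b' q1 q11 j _ _ nF' nG').
have := @Eint_aff R n l 0 (fun x => (powR `|H x| r)%:E) l0 (measE mH) (fun x => _).
rewrite (_ : (fun x => _) \o aff l 0 = fun x => (powR `|Hf (piece j) F G x| r)%:E); last first.
  by apply/funext => x /=; rewrite /aff addr0 /H Hf_dil.
move=> /(_ (fun x => _)) hS.
have ln : 0 < l ^+ n by rewrite exprn_gt0.
rewrite -(@lee_pmul2l _ (l ^+ n)%:E) ?lte_fin// hS; last by move=> x; rewrite lee_fin powR_ge0.
apply: (le_trans hE); rewrite -EFinM lee_fin.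
have Pl x y : powR l (x + y) = powR l x * powR l y by rewrite powRD// (gt_eqF l0) implybT.
have -> : l ^+ n = powR (powR l (n%:R * inv_exp q1) * powR l (n%:R * inv_exp q2)) r.
  rewrite -Pl -powRrM -mulrDr -hr -mulrA mulVf ?gt_eqF// mulr1 powR_mulrn// ltW//.
have X0 : 0 < 2 ^+ j :> R by rewrite exprn_gt0.
have -> : A j * powR (mu rho j ^+ n) (sg q1 + sg q2 - 2^-1 + Num.max 0 (2^-1 - r^-1)) = powR (2 ^+ j) (m + n%:R * (1 - rho) * ee).
  rewrite -/ee /A -(powR_mulrn n (powR_ge0 (2 ^+ j) (1 - rho))) -!powRrM -powRD; last by rewrite (gt_eqF X0) implybT.
  by congr powR; ring.
set a := powR l _; set a' := powR l (_ * inv_exp q2).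
have a0 : 0 <= a by exact: powR_ge0.
have a0' : 0 <= a' by exact: powR_ge0.
set D := powR (2 ^+ j) _; have D0 : 0 <= D by exact: powR_ge0.
have h1 : 0 <= a * a' by exact: mulr_ge0.
have h2 : 0 <= C * D * (v1 * v2) by exact: (mulr_ge0 (mulr_ge0 C0 D0) (mulr_ge0 v10 v20)).
rewrite -(powRM r h1 h2) le_eqVlt; apply/orP; left; apply/eqP; congr powR.
move: a a' D {a0 a0' D0 h1 h2} => a a' D; ring.
Qed.
End Pieces.

(** * Summation of a geometrically decaying series in [L^r] for every [r > 0] *)

Section SeriesInLr.
Local Open Scope classical_set_scope.
Local Open Scope ring_scope.
Variable R : realType.

Lemma geo_sum (y : R) k : 0 <= y -> y < 1 -> \sum_(j < k) y ^+ j <= (1 - y)^-1.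
Proof.
move=> y0 y1; have d : 0 < 1 - y by rewrite subr_gt0.
rewrite -[leRHS]mul1r ler_pdivlMr// mulrC.
have -> : (1 - y) * \sum_(j < k) y ^+ j = 1 - y ^+ k.
  by have := subrX1 y k => e; rewrite -[LHS]opprK -mulNr opprB -e opprB.
by rewrite gerBl exprn_ge0.
Qed.

Lemma small_pow (D q e : R) : 1 < q -> 0 < e -> exists k, D / q ^+ k <= e.
Proof.
move=> q1 e0; have d : 0 < q - 1 by rewrite subr_gt0.
have bern k : k%:R * (q - 1) <= q ^+ k.
  elim: k => [|k IH]; first by rewrite mul0r exprn_ge0// ltW// (lt_trans ltr01).
  have : 1 <= q ^+ k by rewrite exprn_ege1// ltW.
  by rewrite exprS -[k.+1]addn1 natrD; nra.
pose k := (Num.truncn (D / (e * (q - 1)))).+1; exists k.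
have qk : 0 < q ^+ k by rewrite exprn_gt0// (lt_trans ltr01).
rewrite ler_pdivrMr//; apply: (@le_trans _ _ (e * (k%:R * (q - 1)))); last by rewrite ler_wpM2l// ltW.
rewrite mulrCA -ler_pdivrMr ?mulr_gt0//; exact/ltW/truncnS_gt.
Qed.

(** If [U ^ r] is the sum on the right, then [|t j| <= U * B ^- j], and a geometric series is summed
    pointwise. This covers [r < 1] and [r >= 1] at once. *)
Lemma series_r (a : R) (t : nat -> R) (D q B r : R) : 1 < q -> 1 < B -> 0 < r ->
  (forall k, `|a - \sum_(j < k.+1) t j| <= D / q ^+ k) ->
  ((powR `|a| r)%:E <= (powR (1 - B^-1)^-1 r)%:E * \sum_(0 <= j <oo) (powR (B ^+ j * `|t j|) r)%:E)%E.
Proof.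
move=> q1 B1 r0 ha; have B0 : 0 < B by exact: lt_trans ltr01 B1.
have b1 : B^-1 < 1 by rewrite invf_lt1.
have g0 : 0 < (1 - B^-1)^-1 by rewrite invr_gt0 subr_gt0.
have p0 j : (0 <= (powR (B ^+ j * `|t j|) r)%:E)%E by rewrite lee_fin powR_ge0.
have hj j : ((powR (B ^+ j * `|t j|) r)%:E <= \sum_(0 <= j <oo) (powR (B ^+ j * `|t j|) r)%:E)%E.
  apply: (le_trans _ (@nneseries_lim_ge R (fun j => (powR (B ^+ j * `|t j|) r)%:E) xpredT 0 j.+1 (fun i _ _ => p0 i))).
  by rewrite big_nat_recr//= leeDr// sume_ge0.
case: (\sum_(0 <= j <oo) _)%E hj => [s||] hj.
- set U := powR s r^-1.
  have s0 : 0 <= s by have := le_trans (p0 0%N) (hj 0%N); rewrite lee_fin.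
  have U0 : 0 <= U by exact: powR_ge0.
  have ht j : `|t j| <= U * B^-1 ^+ j.
    rewrite exprVn ler_pdivlMr ?exprn_gt0// mulrC.
    have := hj j; rewrite lee_fin => /(powR_le_mono (powR_ge0 _ _) (ltW (_ : 0 < r^-1))).
    rewrite invr_gt0 => /(_ r0); rewrite -powRrM mulfV ?gt_eqF// powRr1// mulr_ge0// exprn_ge0// ltW//.
  have hs k : `|\sum_(j < k) t j| <= U * (1 - B^-1)^-1.
    apply: (le_trans (ler_norm_sum _ _ _)).
    apply: (@le_trans _ _ (\sum_(j < k) U * B^-1 ^+ j)); first by apply: ler_sum => j _.
    by rewrite -big_distrr /= ler_wpM2l// geo_sum// invr_ge0 ltW.
  have aU : `|a| <= U * (1 - B^-1)^-1.
    apply/ler_addgt0Pr => e e0; have [k hk] := small_pow D q1 e0.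
    rewrite -(subrK (\sum_(j < k.+1) t j) a) addrC; apply: (le_trans (ler_normD _ _)).
    by apply: lerD; [exact: hs|exact: le_trans (ha k) hk].
  rewrite -EFinM lee_fin; apply: (le_trans (powR_le_mono (normr_ge0 _) (ltW r0) aU)).
  by rewrite powRM// ?(ltW g0)// /U -powRrM mulVf ?gt_eqF// powRr1// mulrC.
- by rewrite gt0_muley ?leey// lte_fin powR_gt0.
- by have := le_trans (p0 0%N) (hj 0%N).
Qed.

Lemma measE_powR (V : topologicalType) (X : wspace R V) (F : V -> R) r : meas X F ->
  measurable_fun setT (fun s => (powR `|F (@ws_phi _ _ X s)| r)%:E).
Proof.
move=> mF; have h : meas X (fun x => powR `|F x| r) by apply: meas_powR; exact: meas_norm.
exact: (measE h).
Qed.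

(** Of the decay [B ^- (2 j)] one half pays for the weights [B ^+ j] of [series_r], the other makes
    the sum of the integrals converge. *)
Lemma Eint_series_r (V : topologicalType) (X : wspace R V) (a : V -> R) (t : nat -> V -> R) (D : V -> R) (q B r K : R) :
  1 < q -> 1 < B -> 0 < r -> 0 <= K -> meas X a -> (forall j, meas X (t j)) ->
  (forall x k, `|a x - \sum_(j < k.+1) t j x| <= D x / q ^+ k) ->
  (forall j, Eint X (fun x => (powR `|t j x| r)%:E) <= (powR (K * B^-1 ^+ (2 * j)) r)%:E)%E ->
  (Eint X (fun x => (powR `|a x| r)%:E) <= (powR (1 - B^-1)^-1 r * (powR K r * (1 - powR B^-1 r)^-1))%:E)%E.
Proof.
move=> q1 B1 r0 K0 ma mt ha hE; have B0 : 0 < B by exact: lt_trans ltr01 B1.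
have i0 : 0 < B^-1 by rewrite invr_gt0.
have b1 : B^-1 < 1 by rewrite invf_lt1.
have p0 j x : (0 <= (powR (B ^+ j * `|t j x|) r)%:E)%E by rewrite lee_fin powR_ge0.
have mp j : measurable_fun setT (fun s => (powR (B ^+ j * `|t j (@ws_phi _ _ X s)|) r)%:E).
  apply/measurable_EFinP; have h : meas X (fun x => powR (B ^+ j * `|t j x|) r); last exact: h.
  by apply: meas_powR; apply: measM; [exact: measC|exact: meas_norm].
have mS : measurable_fun setT (fun s => \sum_(0 <= j <oo) (powR (B ^+ j * `|t j (@ws_phi _ _ X s)|) r)%:E)%E.
  by apply: ge0_emeasurable_sum => // j s _ _; exact: p0.
set g := powR (1 - B^-1)^-1 r; have g0 : 0 <= g by exact: powR_ge0.
apply: (@le_trans _ _ (\int[ws_mu X]_s (g%:E * \sum_(0 <= j <oo) (powR (B ^+ j * `|t j (ws_phi s)|) r)%:E))%E).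
  apply: ge0_le_integral; first exact: measurableT.
  - by move=> s _; rewrite lee_fin powR_ge0.
  - exact: measE_powR.
  - exact: measurable_funeM.
  - by move=> s _; exact: (series_r q1 B1 r0 (ha (ws_phi s))).
rewrite (ge0_integralZl (ws_mu X) measurableT mS (k := g%:E) (fun s _ => nneseries_ge0 (fun j _ _ => p0 j (ws_phi s)))) ?lee_fin//.
rewrite EFinM lee_wpmul2l ?lee_fin// integral_nneseries//.
have Br : 0 <= powR B^-1 r < 1.
  rewrite powR_ge0 /=; have e11 : powR (1 : R) r = 1 by rewrite powR1.
  by rewrite -[ltRHS]e11; apply: gt0_ltr_powR; rewrite ?nnegrE ?(ltW i0).
have hI j : (\int[ws_mu X]_s (powR (B ^+ j * `|t j (ws_phi s)|) r)%:E <= (powR K r * powR B^-1 r ^+ j)%:E)%E.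
  have Bj : 0 <= B ^+ j by rewrite exprn_ge0// ltW.
  under eq_integral do rewrite powRM// EFinM.
  have n0 s : setT s -> (0 <= (powR `|t j (@ws_phi _ _ X s)| r)%:E)%E by move=> _; rewrite lee_fin powR_ge0.
  rewrite (ge0_integralZl (ws_mu X) measurableT (measE_powR r (mt j)) n0) ?lee_fin ?powR_ge0//.
  apply: (@le_trans _ _ ((powR (B ^+ j) r)%:E * (powR (K * B^-1 ^+ (2 * j)) r)%:E)%E).
    by rewrite lee_wpmul2l ?lee_fin ?powR_ge0//; exact: hE.
  have h2 : 0 <= K * B^-1 ^+ (2 * j) by rewrite mulr_ge0// exprn_ge0// ltW.
  rewrite -EFinM lee_fin -powRM// (_ : B ^+ j * _ = K * B^-1 ^+ j); last first.
    by rewrite mul2n -addnn exprD exprVn; field; rewrite expf_neq0// gt_eqF.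
  rewrite powRM ?exprn_ge0 ?(ltW i0)// ler_wpM2l ?powR_ge0// le_eqVlt; apply/orP; left; apply/eqP.
  by rewrite -(powR_mulrn j (ltW i0)) -powRrM mulrC powRrM powR_mulrn ?powR_ge0.
apply: lime_le; first by apply: is_cvg_nneseries => j _ _; apply: integral_ge0.
apply: nearW => k; apply: (@le_trans _ _ (\sum_(0 <= j < k) (powR K r * powR B^-1 r ^+ j)%:E)%E); first by apply: lee_sum.
rewrite sumEFin lee_fin big_mkord -big_distrr /= ler_wpM2l ?powR_ge0//.
by have /andP[h1 h2] := Br; exact: geo_sum.
Qed.
End SeriesInLr.

(** * The full symbol applied to rapidly decreasing functions *)

Section FullSymbol.
Local Open Scope classical_set_scope.
Local Open Scope ring_scope.
Variables (R : realType) (n : nat).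
Notation V := ('rV[R]_n).
Notation V3 := ('rV[R]_n * 'rV[R]_n * 'rV[R]_n)%type.
Notation X1 := (Vw R n).
Notation X2 := (prodw (Vw R n) (Vw R n)).

(** Rapid decrease of all derivatives, phrased with [cls] so that [osc_decay] applies directly; a
    single function is a family over [unit]. *)
Definition fast (F : V -> R) := forall K p, cls (@e1 R n) K (fun _ : unit => F) (fun _ v => wt v ^+ p).

Lemma fast_nice F : fast F -> nice F.
Proof.
move=> hF; have h := hF 0%N 2%N; split; first exact: (cls_cont h tt).
by have [C _ hC] := cls_bnd h; exists C => v; exact: hC.
Qed.

Lemma Ft_decay F L th : fast F -> exists2 C, 0 <= C & forall xi, `|Ft F th xi| <= C * wt xi ^+ L.
Proof.
(* Every direction is repeated [L] times, and each round through the directions gains one power of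
   [wt xi]. *)
move=> hF; pose ds := flatten (nseq L (index_enum 'I_n)).
have [C C0 hC] := @osc_decay R V _ (@e1 R n) X1 unit (fun _ v => wt v ^+ 1) (@ibp_Vw R n)
  (fun _ => tame_wt R n 0) _ ds (hF (2 * size ds)%N 1%N).
exists (C * Int X1 (fun v => wt v ^+ 1)).
  by rewrite mulr_ge0//; apply: Int_ge0 => v; rewrite exprn_ge0// wt_ge0.
move=> xi; have -> : wt xi ^+ L = \prod_(d <- ds) (1 + xi 0 d ^+ 2)^-1.
  by rewrite big_flatten big_nseq iter_mulr_1.
apply: (hC tt (fun y => dot y xi + th) (fun d => xi 0 d)); first exact: cont_phase.
by move=> d h v; rewrite dot_shift addrA.
Qed.

Lemma hh_decay F G L : fast F -> fast G -> exists2 C, 0 <= C & forall z : V * V, `|hh0 F G z| <= C * (wt z.1 * wt z.2) ^+ L /\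
  `|hh1 F G z| <= C * (wt z.1 * wt z.2) ^+ L.
Proof.
move=> hF hG; have [C1 c1 h1] := Ft_decay L 0 hF; have [C2 c2 h2] := Ft_decay L (- (pi / 2)) hF.
have [D1 d1 k1] := Ft_decay L 0 hG; have [D2 d2 k2] := Ft_decay L (- (pi / 2)) hG.
exists ((C1 + C2) * (D1 + D2)); first by rewrite mulr_ge0 ?addr_ge0.
move=> z; set w := wt z.1 ^+ L; set w' := wt z.2 ^+ L.
have w0 : 0 <= w by rewrite exprn_ge0// wt_ge0. have w0' : 0 <= w' by rewrite exprn_ge0// wt_ge0.
rewrite exprMn -/w -/w'.
have b (x y A B : R) : `|x| <= A * w -> `|y| <= B * w' -> `|x * y| <= A * B * (w * w').
  by move=> hx hy; rewrite normrM mulrACA ler_pM.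
have b11 := b _ _ _ _ (h1 z.1) (k1 z.2); have b22 := b _ _ _ _ (h2 z.1) (k2 z.2).
have b12 := b _ _ _ _ (h1 z.1) (k2 z.2); have b21 := b _ _ _ _ (h2 z.1) (k1 z.2).
have ww : 0 <= w * w' by exact: mulr_ge0.
have e0 : (C1 + C2) * (D1 + D2) * (w * w') = C1 * D1 * (w * w') + C2 * D2 * (w * w') + (C1 * D2 * (w * w') + C2 * D1 * (w * w')) by ring.
have n1 : 0 <= C1 * D1 * (w * w') by rewrite !mulr_ge0. have n2 : 0 <= C2 * D2 * (w * w') by rewrite !mulr_ge0.
have n3 : 0 <= C1 * D2 * (w * w') by rewrite !mulr_ge0. have n4 : 0 <= C2 * D1 * (w * w') by rewrite !mulr_ge0.
rewrite e0; split.
  apply: (le_trans (ler_normB _ _)); apply: (le_trans (lerD b11 b22)); rewrite lerDl; exact: addr_ge0.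
apply: (le_trans (ler_normD _ _)); apply: (le_trans (lerD b21 b12)); rewrite addrC lerDr; exact: addr_ge0.
Qed.

(** Expanding the product of all [1 + xi_k ^+ 2] and [1 + eta_k ^+ 2] gives at least
    [1 + |xi|^2 + |eta|^2]. Growth in frequency can thus be paid for by powers of [wt]. *)
Lemma Z_wt (x : V) (z : V * V) : Z (Lz z x) * (wt z.1 * wt z.2) <= 1.
Proof.
have p1 (v : V) : 1 + \sum_k v 0 k ^+ 2 <= (wt v)^-1.
  have -> : (wt v)^-1 = \prod_k (1 + v 0 k ^+ 2) by rewrite /wt -prodfV; apply: eq_bigr => k _; rewrite invrK.
  elim: (index_enum _) => [|k s IH]; first by rewrite !big_nil addr0.
  have : 0 <= \sum_(k <- s) v 0 k ^+ 2 by rewrite sumr_ge0// => j _; exact: sqr_ge0.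
  have := sqr_ge0 (v 0 k); move: IH; rewrite !big_cons.
  move: (v 0 k ^+ 2) (\sum_(_ <- _) _) (\prod_(_ <- _) _) => a b c; nra.
have w1 := wt_gt0 z.1; have w2 := wt_gt0 z.2.
rewrite -ler_pdivlMr ?mulr_gt0// mul1r invfM /Z /Lz /= !enorm2.
apply: (@le_trans _ _ ((1 + \sum_k z.1 0 k ^+ 2) * (1 + \sum_k z.2 0 k ^+ 2))).
  have a0 : 0 <= \sum_k z.1 0 k ^+ 2 by rewrite sumr_ge0// => k _; exact: sqr_ge0.
  have b0 : 0 <= \sum_k z.2 0 k ^+ 2 by rewrite sumr_ge0// => k _; exact: sqr_ge0.
  move: (\sum_k _) (\sum_k _) a0 b0 => a b a0 b0; nra.
by apply: ler_pM; rewrite ?addr_ge0 ?sumr_ge0// => k _; exact: sqr_ge0.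
Qed.

Variables (m rho delta : R).
Hypotheses (rho0 : 0 < rho) (rho1 : rho <= 1) (delta0 : 0 <= delta) (delta1 : delta <= rho).
Variables (q1 q2 : \bar R) (r : R).
Hypotheses (q11 : (1%:E <= q1)%E) (q21 : (1%:E <= q2)%E) (r0 : 0 < r) (hr : r^-1 = inv_exp q1 + inv_exp q2).
Variables (f : bool -> V3 -> R) (M : nat).
Hypotheses (hf : forall u, sym m rho delta (f u)) (hM : `|m| + (6 * n)%:R <= (2 * M)%:R) (M0 : (0 < M)%N).
Let N := (6 * n + M)%N.

Lemma f_bnd : exists2 C, 0 <= C & forall u v, `|f u v| <= C * Z v ^+ M.
Proof.
have h u : exists2 C, 0 <= C & forall v, `|f u v| <= C * Z v ^+ M.
  have [_ _ [C hC]] := hf u [::]; exists (`|C| * 3 ^+ M); first by rewrite mulr_ge0 ?exprn_ge0.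
  move=> v; have := hC v; rewrite /Dsv /= /ordr /ord_in /= !addr0 !mulr0 subr0 addr0 => h.
  set a := enorm v.1.2 in h; set b := enorm v.2 in h.
  have a0 : 0 <= a by exact: enorm_ge0. have b0 : 0 <= b by exact: enorm_ge0.
  have B1 : 1 <= 1 + a + b by rewrite -addrA lerDl addr_ge0.
  have B0 : 0 <= 1 + a + b by exact: le_trans B1.
  apply: (le_trans h); apply: (@le_trans _ _ (`|C| * powR (1 + a + b) (2 * M)%:R)).
    apply: (@le_trans _ _ (`|C| * powR (1 + a + b) m)); first by rewrite ler_wpM2r ?powR_ge0 ?ler_norm.
    rewrite ler_wpM2l//; apply: ler_powR => //; apply: le_trans hM; apply: le_trans (ler_norm m) _.
    by rewrite lerDl.
  rewrite -mulrA ler_wpM2l// powR_mulrn// exprM -exprMn; apply: lerXn2r; rewrite ?nnegrE ?sqr_ge0//.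
    by rewrite mulr_ge0// (le_trans _ (Z_ge1 v)).
  rewrite /Z -/a -/b; have := sqr_ge0 (a - b); have := sqr_ge0 (1 - a); have := sqr_ge0 (1 - b); nra.
have [C C0 hC] := h false; have [D D0 hD] := h true.
exists (C + D); first exact: addr_ge0.
have z0 (v : V3) : 0 <= Z v ^+ M by rewrite exprn_ge0// (le_trans _ (Z_ge1 v)).
case=> v; [apply: (le_trans (hD v))|apply: (le_trans (hC v))]; apply: ler_wpM2r; try exact: z0.
  by rewrite lerDr.
by rewrite lerDl.
Qed.

Section Tail.
Variables (h : V * V -> R) (Ch : R).
Hypotheses (mh : meas X2 h) (Ch0 : 0 <= Ch) (hh : forall z, `|h z| <= Ch * (wt z.1 * wt z.2) ^+ (M + N + 2)).

Lemma w01 (z : V * V) : 0 <= wt z.1 * wt z.2 /\ wt z.1 * wt z.2 <= 1.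
Proof. by rewrite mulr_ge0 ?wt_ge0// mulr_ile1 ?wt_ge0 ?wt_le1. Qed.

Lemma tame_ww : tame X2 (fun z : V * V => (wt z.1 * wt z.2) ^+ 2).
Proof.
by under eq_fun do rewrite exprMn; exact: (tame_prod (tame_wt R n 1) (tame_wt R n 1)).
Qed.

(** Of the decay of [h], [M] powers absorb the growth of the symbol, [N] powers a factor [Z ^+ k]
    with [k <= N], and the last 2 leave an integrable bound. *)
Lemma integrand_bnd : exists2 C, 0 <= C & forall u (x : V) (z : V * V) k, (k <= N)%N ->
  `|f u (Lz z x)| * Z (Lz z x) ^+ k * `|h z| <= C * (wt z.1 * wt z.2) ^+ 2.
Proof.
have [C C0 hC] := f_bnd; exists (C * Ch); first exact: mulr_ge0.
move=> u x z k kN; have [w0 w1] := w01 z; have zw := Z_wt x z; have z1 := Z_ge1 (Lz z x).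
have hf' := hC u (Lz z x); have hh' := hh z.
move: (`|f u (Lz z x)|) (`|h z|) (normr_ge0 (f u (Lz z x))) (normr_ge0 (h z)) hf' hh' => fz hz fz0 hz0.
move: (wt z.1 * wt z.2) w0 w1 zw => w w0 w1; move: (Z (Lz z x)) z1 => y z1 zw hf' hh'.
have y0 : 0 <= y by exact: le_trans z1.
apply: (@le_trans _ _ (C * y ^+ M * y ^+ N * (Ch * w ^+ (M + N + 2)))).
  have yk : y ^+ k <= y ^+ N by exact: ler_weXn2l.
  have p1 := exprn_ge0 k y0.
  exact: (ler_pM (mulr_ge0 fz0 p1) hz0 (ler_pM fz0 p1 hf' yk) hh').
have -> : C * y ^+ M * y ^+ N * (Ch * w ^+ (M + N + 2)) = C * Ch * w ^+ 2 * (y * w) ^+ (M + N).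
  by rewrite exprMn (exprD w (M + N) 2) (exprD y M N); ring.
rewrite ler_piMr ?mulr_ge0 ?sqr_ge0//; apply: exprn_ile1 => //; exact: mulr_ge0.
Qed.

Lemma cont_int u x th : continuous (fun z => f u (Lz z x) * cos (dot x (tau z) + th)).
Proof.
apply: contM; first exact: (cont_comp (@cont_Lx R n x) (@f_cont R n m rho delta f hf u)).
apply: cont_cos; apply: contD; last exact: contC.
apply: cont_dot => k; first exact: contC.
by apply: (cont_comp (f := @tau R n) (g := fun u : V => u 0 k)); [exact: cont_tau|exact: coord_cont].
Qed.

Lemma tame_full u x th : tame X2 (fun z => f u (Lz z x) * cos (dot x (tau z) + th) * h z).
Proof.
have [C C0 hC] := integrand_bnd; apply: (tame_le (C := C) _ tame_ww) => [|z].
  by apply: measM => //; apply: cont_meas; exact: cont_int.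
apply: le_trans (hC u x z 0%N isT); rewrite expr0 mulr1 !normrM ler_wpM2r//.
by rewrite ler_piMr// cos_le1.
Qed.

Lemma meas_Thf u th : meas X1 (Th (f u) th h).
Proof.
apply: (@meas_Int1 _ _ _ X1 X2 (fun q => f u (Lz q.2 q.1) * cos (dot q.1 (tau q.2) + th) * h q.2)).
apply: measM; last exact: (@meas_snd _ _ _ X1 X2 h mh).
apply: cont_meas; apply: contM; first exact: (cont_comp (@cont_Lxz R n) (@f_cont R n m rho delta f hf u)).
apply: cont_cos; apply: contD; last exact: contC.
apply: cont_dot => k.
  by apply: (cont_comp (f := fst) (g := fun u : V => u 0 k)); [move=> v; exact: cvg_fst|exact: coord_cont].
apply: (cont_comp (f := fun p : V * (V * V) => tau p.2) (g := fun u : V => u 0 k)); last exact: coord_cont.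
by apply: (cont_compT (f := snd) (g := @tau R n)); [by move=> v; exact: cvg_snd|exact: cont_tau].
Qed.

(** The first cut-offs sum to 1 up to [Z ^+ N / 4 ^ (N k)]. This error is not small uniformly in
    frequency, but the decay of [h] absorbs [Z ^+ N]. *)
Lemma Th_tail : exists2 D, 0 <= D & forall u x th k,
  `|Th (f u) th h x - \sum_(j < k.+1) Th (piece f M j u) th h x| <= D / (4 ^+ N) ^+ k.
Proof.
have [C C0 hC] := integrand_bnd; have I0 : 0 <= Int X2 (fun z : V * V => (wt z.1 * wt z.2) ^+ 2).
  by apply: Int_ge0 => z; exact: sqr_ge0.
exists (C * Int X2 (fun z : V * V => (wt z.1 * wt z.2) ^+ 2)); first exact: mulr_ge0.
move=> u x th k; have hb z : `|h z| <= Ch.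
  by apply: (le_trans (hh z)); have [w0 w1] := w01 z; rewrite ler_piMr// exprn_ile1.
have tp j := @tame_piece R n m rho delta rho0 rho1 delta0 delta1 f M hf hM j u x th h Ch mh hb.
have tf := tame_full u x th.
rewrite /Th -(Int_sum (index_enum _) (fun j : 'I_k.+1 => tp j)) -IntB//; last exact: tame_sum.
set q := (4 ^+ N) ^+ k; have q0 : 0 < q by rewrite !exprn_gt0.
rewrite [leRHS](_ : _ = Int X2 (fun z => C / q * (wt z.1 * wt z.2) ^+ 2)); last first.
  by rewrite (IntZ _ tame_ww) mulrAC.
apply: norm_Int; [by apply: measB; [exact: tf.1|exact: (tame_sum _ (fun j : 'I_k.+1 => tp j)).1]|exact: (tameZ _ tame_ww)|] => z.
have -> : f u (Lz z x) * cos (dot x (tau z) + th) * h z -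
    \sum_(j < k.+1) piece f M j u (Lz z x) * cos (dot x (tau z) + th) * h z =
    (1 - \sum_(j < k.+1) cf N j (Lz z x)) * (f u (Lz z x) * cos (dot x (tau z) + th) * h z).
  rewrite mulrBl mul1r big_distrl /=; congr (_ - _); apply: eq_bigr => j _.
  by rewrite /piece -/N; ring.
rewrite normrM; have ct := cf_tail N k (Lz z x); rewrite -/q in ct.
apply: (@le_trans _ _ (Z (Lz z x) ^+ N / q * (`|f u (Lz z x)| * `|h z|))).
  apply: ler_pM => //; rewrite !normrM ler_wpM2r// ler_piMr// cos_le1//.
have -> : Z (Lz z x) ^+ N / q * (`|f u (Lz z x)| * `|h z|) = `|f u (Lz z x)| * Z (Lz z x) ^+ N * `|h z| / q by ring.
rewrite [leRHS]mulrAC; apply: ler_wpM2r; [by rewrite invr_ge0 (ltW q0)|exact: hC].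
Qed.
End Tail.

Lemma Hf_tail F G : fast F -> fast G -> meas X1 (Hf f F G) /\ exists D, forall x k,
  `|Hf f F G x - \sum_(j < k.+1) Hf (piece f M j) F G x| <= D / (4 ^+ N) ^+ k.
Proof.
move=> hF hG; have nF := fast_nice hF; have nG := fast_nice hG.
have [C C0 hC] := hh_decay (M + N + 2) hF hG.
have [m0 m1] := meas_hh (nice_tame nF) (nice_tame nG).
have b0 z := (hC z).1; have b1 z := (hC z).2.
split; first by apply: measD; [apply: measD; [apply: measD|]|]; apply: meas_Thf.
have [D0 _ t0] := Th_tail m0 C0 b0; have [D1 _ t1] := Th_tail m1 C0 b1.
exists (D0 + D0 + D1 + D1) => x k; rewrite /Hf !big_split /=.
have s1 := t0 false x 0 k; have s2 := t0 true x (pi / 2) k; have s3 := t1 false x (- (pi / 2)) k; have s4 := t1 true x 0 k.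
have tri (a1 a2 a3 a4 c1 c2 c3 c4 e1 e2 e3 e4 : R) : `|a1 - c1| <= e1 -> `|a2 - c2| <= e2 -> `|a3 - c3| <= e3 -> `|a4 - c4| <= e4 ->
    `|a1 + a2 + a3 + a4 - (c1 + c2 + c3 + c4)| <= e1 + e2 + e3 + e4.
  move=> u1 u2 u3 u4.
  have -> : a1 + a2 + a3 + a4 - (c1 + c2 + c3 + c4) = (a1 - c1) + (a2 - c2) + (a3 - c3) + (a4 - c4) by ring.
  apply: (le_trans (ler_normD _ _)); apply: lerD => //; apply: (le_trans (ler_normD _ _)); apply: lerD => //.
  by apply: (le_trans (ler_normD _ _)); apply: lerD.
have qE (q : R) : (D0 + D0 + D1 + D1) / q = D0 / q + D0 / q + D1 / q + D1 / q by ring.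
rewrite qE; exact: (tri _ _ _ _ _ _ _ _ _ _ _ _ s1 s2 s3 s4).
Qed.

Lemma Hf_est : m + n%:R * (1 - rho) * ee q1 q2 r < 0 -> exists2 C, 0 <= C & forall F G v1 v2, fast F -> fast G ->
  0 <= v1 -> 0 <= v2 -> nrm q1 F v1 -> nrm q2 G v2 ->
  meas X1 (Hf f F G) /\ (Eint X1 (fun x => (powR `|Hf f F G x| r)%:E) <= (powR (C * (v1 * v2)) r)%:E)%E.
Proof.
(* Chosen so that the decay [2 ^ (j s)] of the pieces is [B ^- (2 j)]. *)
set s := m + _ => s0; pose B := powR 2 (- s / 2) : R.
have [C C0 hC] := piece_est rho0 rho1 delta0 delta1 q11 q21 r0 hr hf hM.
have B1 : 1 < B.
  have e11 : powR (1 : R) (- s / 2) = 1 by rewrite powR1.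
  by rewrite /B -[ltLHS]e11; apply: gt0_ltr_powR; rewrite ?nnegrE ?ltr1n//; rewrite divr_gt0// oppr_gt0.
have B0 : 0 < B by exact: lt_trans ltr01 B1.
(* Positivity of [M] matters in dimension 0, where [N = M]. *)
have q4 : 1 < 4 ^+ N :> R by rewrite exprn_egt1 ?ltr1n// -lt0n /N addn_gt0 M0 orbT.
pose k0 := powR (1 - B^-1)^-1 r * (1 - powR B^-1 r)^-1.
have k00 : 0 <= k0.
  rewrite mulr_ge0 ?powR_ge0// invr_ge0 subr_ge0; have e11 : powR (1 : R) r = 1 by rewrite powR1.
  by rewrite -[leRHS]e11; apply: powR_le_mono; rewrite ?invr_ge0 ?(ltW B0) ?(ltW r0)// invf_le1// ltW.
exists (powR k0 r^-1 * C); first by rewrite mulr_ge0 ?powR_ge0.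
move=> F G v1 v2 hF hG v10 v20 n1 n2; have nF := fast_nice hF; have nG := fast_nice hG.
have [mH [D hD]] := Hf_tail hF hG; split => //.
have K0 : 0 <= C * (v1 * v2) by rewrite mulr_ge0// mulr_ge0.
have mt j := meas_piece rho0 rho1 delta0 delta1 q11 hf hM j nF nG.
have BE j : powR (2 ^+ j) s = B^-1 ^+ (2 * j).
  rewrite -powR_mulrn// -powRrM exprVn -powR_mulrn ?(ltW B0)// /B -powRrM -powRN; congr powR.
  by rewrite natrM; field.
have hI j : (Eint X1 (fun x => (powR `|Hf (piece f M j) F G x| r)%:E) <= (powR (C * (v1 * v2) * B^-1 ^+ (2 * j)) r)%:E)%E.
  by rewrite -BE mulrAC; exact: (hC j F G v1 v2 nF nG v10 v20 n1 n2).
apply: (le_trans (Eint_series_r q4 B1 r0 K0 mH mt hD hI)); rewrite lee_fin -(mulrA (powR k0 r^-1)).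
rewrite (powRM _ (powR_ge0 _ _) K0) -powRrM mulVf ?gt_eqF// powRr1// /k0 le_eqVlt; apply/orP; left; apply/eqP.
by move: (powR _ _) (powR _ _) (_^-1) => x y z; ring.
Qed.
End FullSymbol.

(** * From the complex operator of the statement to real operators *)

Section ComplexOperator.
Local Open Scope classical_set_scope.
Local Open Scope ring_scope.
Variables (R : realType) (n : nat).
Notation V := ('rV[R]_n).
Notation V3 := ('rV[R]_n * 'rV[R]_n * 'rV[R]_n)%type.
Notation X1 := (Vw R n).
Notation X2 := (prodw (Vw R n) (Vw R n)).

Lemma derivable_unshift (V U : normedModType R) (L : V -> U) (d : V) (e : U) (F : U -> R) x :
  (forall (h : R) x, L (h *: d + x) = h *: e + L x) -> derivable (fun v => F (L v)) x d -> derivable F (L x) e.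
Proof.
move=> hL; rewrite /derivable (_ : (fun h : R => h^-1 *: (((fun v => F (L v)) \o shift x) (h *: d) - F (L x))) =
  fun h : R => h^-1 *: ((F \o shift (L x)) (h *: e) - F (L x)))//.
by apply/funext => h /=; rewrite hL.
Qed.

Lemma line1_shift (x : V) i (h t : R) : x + (h *: (1 : R) + t) *: delta_mx 0 i = h *: e1 R i + (x + t *: delta_mx 0 i).
Proof. 
have -> : h *: (1 : R) = h by exact: mulr1.
by rewrite /e1 scalerDl addrCA.
 Qed.

Lemma pd1E (F : V -> R) i : pd1 F i = 'D_(e1 R i) F.
Proof.
apply/funext => x; rewrite /pd1 (derive_shift (L := fun t : R => x + t *: delta_mx 0 i) F 0 (line1_shift x i)).
by rewrite scale0r addr0.
Qed.

Lemma pd1ableE (F : V -> R) i x : pd1able F i x -> derivable F x (e1 R i).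
Proof.
move=> h; have := derivable_unshift (L := fun t : R => x + t *: delta_mx 0 i) (line1_shift x i) h.
by rewrite scale0r addr0.
Qed.

Lemma wt_enorm (x : V) : 1 <= (1 + enorm x) ^+ (2 * n) * wt x.
Proof.
have w0 := wt_gt0 x; have e0 := enorm_ge0 x.
rewrite -ler_pdivrMr// mul1r /wt -prodfV.
have -> : (1 + enorm x) ^+ (2 * n) = \prod_(k < n) (1 + enorm x) ^+ 2 by rewrite prodr_const card_ord -exprM.
apply: ler_prod => k _; rewrite invrK addr_ge0 ?sqr_ge0//=.
have h : x 0 k ^+ 2 <= enorm x ^+ 2.
  by rewrite enorm2 (bigD1 k)//= lerDl sumr_ge0// => j _; exact: sqr_ge0.
by move: h; move: (x 0 k) (enorm x) e0 => a b b0; nra.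
Qed.

Lemma schwartz_fast (F : V -> R) : smooth1 F ->
  (forall ds N, exists C, forall x, (1 + enorm x) ^+ N * `|Dseq1 ds F x| <= C) -> fast F.
Proof.
move=> sF dF K p.
suff H ds : cls (@e1 R n) K (fun _ : unit => Dseq1 ds F) (fun _ v => wt v ^+ p) by exact: (H [::]).
have bd ds' : exists2 C, 0 <= C & forall (i : unit) v, `|Dseq1 ds' F v| <= C * wt v ^+ p.
  (* By [wt_enorm], [2 * n * p] powers of [1 + enorm v] dominate [wt v ^- p]. *)
  have [C hC] := dF ds' (2 * n * p)%N; exists `|C| => // _ v.
  have w0 := wt_ge0 v; have W := wt_enorm v.
  have W1 : 1 <= ((1 + enorm v) ^+ (2 * n) * wt v) ^+ p by exact: exprn_ege1.
  apply: (@le_trans _ _ (`|Dseq1 ds' F v| * ((1 + enorm v) ^+ (2 * n) * wt v) ^+ p)); first by rewrite ler_peMr.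
  rewrite exprMn -exprM mulrCA mulrA ler_wpM2r ?exprn_ge0//.
  exact: le_trans (hC v) (ler_norm C).
elim: K ds => [|K IH] ds; have [c1 d1] := sF ds; first by split => //; exact: bd.
split => [||d]; [by []|exact: bd|].
split => [_ v|]; first exact: (pd1ableE (d1 d v)).
by have := IH (d :: ds); rewrite /= pd1E.
Qed.

Lemma cabs_ge (z : cplx R) : `|z.1| <= cabs z /\ `|z.2| <= cabs z.
Proof.
by split; rewrite -sqrtr_sqr; apply: ler_wsqrtr; rewrite ?lerDl ?lerDr sqr_ge0.
Qed.

Lemma schwartz_fast2 (f : V -> cplx R) : schwartz f -> fast (fun x => (f x).1) /\ fast (fun x => (f x).2).
Proof.
move=> [s1 [s2 hd]]; split; apply: schwartz_fast => // ds N; have [C hC] := hd ds N; exists C => x;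
  apply: le_trans (hC x); apply: ler_wpM2l; rewrite ?exprn_ge0 ?addr_ge0 ?enorm_ge0//.
  exact: (cabs_ge (_, _)).1.
exact: (cabs_ge (_, _)).2.
Qed.

Lemma shift3_shift (x y z : V) d (h t : R) :
  shift3 d.1 d.2 (h *: (1 : R) + t) x y z = h *: e3 R d + shift3 d.1 d.2 t x y z.
Proof.
have -> : h *: (1 : R) = h by exact: mulr1.
rewrite /shift3 /e3 scale3E.
by case: ifP => _ /=; [|case: ifP => _ /=]; rewrite ?scaler0 ?add0r // /e1 scalerDl addrCA.
Qed.

Lemma shift30 (x y z : V) (d : 'I_3 * 'I_n) : shift3 d.1 d.2 (0 : R) x y z = (x, y, z).
Proof. by rewrite /shift3; case: ifP => _; [|case: ifP => _]; rewrite scale0r addr0. Qed.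

Lemma pd3E (F : V -> V -> V -> R) d : uncurry3 (pd3 F d) = 'D_(e3 R d) (uncurry3 F).
Proof.
apply/funext => -[[x y] z]; rewrite {1}/uncurry3 /pd3 /=.
by rewrite (derive_shift (L := fun t : R => shift3 d.1 d.2 t x y z) (uncurry3 F) 0 (shift3_shift x y z d)) shift30.
Qed.

Lemma Dseq3E (F : V -> V -> V -> R) ds : uncurry3 (Dseq3 ds F) = Dsv (uncurry3 F) ds.
Proof. by elim: ds => [//|d ds IH]; rewrite /= pd3E IH. Qed.

Lemma symbol_sym m rho delta (a : V -> V -> V -> cplx R) : symbol_class m rho delta a ->
  sym m rho delta (uncurry3 (fun x y z => (a x y z).1)) /\ sym m rho delta (uncurry3 (fun x y z => (a x y z).2)).
Proof.
move=> [s1 [s2 hb]].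
have H (F : V -> V -> V -> R) : smooth3 F -> (forall ds, exists C, forall v : V3, `|uncurry3 (Dseq3 ds F) v| <=
    C * powR (1 + enorm v.1.2 + enorm v.2) (ordr m rho delta ds)) -> sym m rho delta (uncurry3 F).
  move=> sF hF ds; have e := Dseq3E F ds; have [c1 d1] := sF ds; have [C hC] := hF ds.
  split; [rewrite -e; exact: c1| |by exists C => v; rewrite -e; exact: hC] => d [[x y] z]; rewrite -e.
  have := derivable_unshift (L := fun t : R => shift3 d.1 d.2 t x y z) (shift3_shift x y z d) (d1 d x y z).
  by rewrite shift30.
split; apply: H => // ds; have [C hC] := hb ds; exists C => -[[x y] z]; apply: le_trans (hC x y z).
  exact: (cabs_ge (_, _)).1.
exact: (cabs_ge (_, _)).2.
Qed.

Lemma tame_X1w : tame X1 (ws_w X1).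
Proof. by rewrite (_ : ws_w X1 = @wt R n); [exact: tame_wt1|apply/funext => v; exact: Vw_w]. Qed.

Lemma Rint2 (F : V * V -> R) : tame X2 F -> RintRn (fun xi => RintRn (fun eta => F (xi, eta))) = Int X2 F.
Proof.
move=> tF; have E : (fun xi => RintRn (fun eta => F (xi, eta))) = fun xi => Int X1 (fun eta => F (xi, eta)).
  by apply/funext => xi; rewrite RintRnE//; exact: tame_slice.
rewrite E RintRnE ?Int_prod12//; apply: tame_Int1 => //; first exact: tame_X1w.
by move=> xi; exact: (tame_slice xi tF).1.
Qed.

Lemma fourierE (f : V -> cplx R) xi : tame X1 (fun x => (f x).1) -> tame X1 (fun x => (f x).2) ->
  fourier f xi = (Ft (fun x => (f x).1) 0 xi + Ft (fun x => (f x).2) (- (pi / 2)) xi,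
                  Ft (fun x => (f x).2) 0 xi - Ft (fun x => (f x).1) (- (pi / 2)) xi).
Proof.
move=> t1 t2; rewrite /fourier /CintRn /cmul /cexpi /=.
have c1 th := tame_Fcos th xi t1; have c2 th := tame_Fcos th xi t2.
have E1 : (fun v : V => (f v).1 * cos (- dot v xi) - (f v).2 * sin (- dot v xi)) =
    fun v => (f v).1 * cos (dot v xi + 0) + (f v).2 * cos (dot v xi + - (pi / 2)).
  by apply/funext => v; rewrite addr0 -sin_cos cosN sinN; ring.
have E2 : (fun v : V => (f v).1 * sin (- dot v xi) + (f v).2 * cos (- dot v xi)) =
    fun v => (f v).2 * cos (dot v xi + 0) - (f v).1 * cos (dot v xi + - (pi / 2)).
  by apply/funext => v; rewrite addr0 -sin_cos cosN sinN; ring.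
rewrite E1 E2 !RintRnE; [|exact: tameB|exact: tameD].
by rewrite IntD// IntB.
Qed.

Variables (m rho delta : R).
Hypotheses (rho0 : 0 < rho) (rho1 : rho <= 1) (delta0 : 0 <= delta) (delta1 : delta <= rho).
Variable M : nat.
Hypotheses (hM : `|m| + (6 * n)%:R <= (2 * M)%:R).

(** The integrand of [Hf] gathered under one integral, for pointwise comparison with that of
    [Tbil]. *)
Definition HfI (f : bool -> V3 -> R) (F G : V -> R) (x : V) (z : V * V) : R :=
  f false (Lz z x) * cos (dot x (tau z) + 0) * hh0 F G z + f true (Lz z x) * cos (dot x (tau z) + pi / 2) * hh0 F G z +
  f false (Lz z x) * cos (dot x (tau z) + - (pi / 2)) * hh1 F G z + f true (Lz z x) * cos (dot x (tau z) + 0) * hh1 F G z.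

Lemma HfE (f : bool -> V3 -> R) F G x : (forall u, sym m rho delta (f u)) -> fast F -> fast G ->
  tame X2 (HfI f F G x) /\ Hf f F G x = Int X2 (HfI f F G x).
Proof.
move=> hf hF hG; have [C C0 hC] := hh_decay (M + (6 * n + M) + 2) hF hG.
have [m0 m1] := meas_hh (nice_tame (fast_nice hF)) (nice_tame (fast_nice hG)).
have b0 z := (hC z).1; have b1 z := (hC z).2.
have t0 u th := @tame_full R n m rho delta f M hf hM _ _ m0 C0 b0 u x th.
have t1 u th := @tame_full R n m rho delta f M hf hM _ _ m1 C0 b1 u x th.
have ta := tameD (t0 false 0) (t0 true (pi / 2)); have tb := tameD ta (t1 false (- (pi / 2))).
split; first exact: (tameD tb (t1 true 0)).
by rewrite /HfI (IntD tb (t1 true 0)) (IntD ta (t1 false (- (pi / 2)))) (IntD (t0 false 0) (t0 true (pi / 2))).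
Qed.

(** [fa] stands for the symbol [a] and [fb] for [- i a], whose operator has as real part the
    imaginary part of the original one. Splitting [f] and [g] into real and imaginary parts leaves
    eight real operators, with signs from [i ^ 2 = -1]. *)
Lemma Tbil_Hf (a : V -> V -> V -> cplx R) (f g : V -> cplx R) x : symbol_class m rho delta a -> schwartz f -> schwartz g ->
  let a1 := uncurry3 (fun x y z => (a x y z).1) in let a2 := uncurry3 (fun x y z => (a x y z).2) in
  let fa (u : bool) v := if u then a2 v else a1 v in let fb (u : bool) v := if u then - a1 v else a2 v in
  let f1 x := (f x).1 in let f2 x := (f x).2 in let g1 x := (g x).1 in let g2 x := (g x).2 in
  Tbil a f g x = (Hf fa f1 g1 x - Hf fb f1 g2 x - Hf fb f2 g1 x - Hf fa f2 g2 x,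
                  Hf fb f1 g1 x + Hf fa f1 g2 x + Hf fa f2 g1 x - Hf fb f2 g2 x).
Proof.
move=> ha sf sg a1 a2 fa fb f1 f2 g1 g2.
have [y1 y2] := symbol_sym ha; have [f1f f2f] := schwartz_fast2 sf; have [g1f g2f] := schwartz_fast2 sg.
have hfa u : sym m rho delta (fa u) by case: u.
have hfb u : sym m rho delta (fb u) by case: u => //; exact: symN.
have [ta11 ea11] := HfE x hfa f1f g1f; have [ta12 ea12] := HfE x hfa f1f g2f.
have [ta21 ea21] := HfE x hfa f2f g1f; have [ta22 ea22] := HfE x hfa f2f g2f.
have [tb11 eb11] := HfE x hfb f1f g1f; have [tb12 eb12] := HfE x hfb f1f g2f.
have [tb21 eb21] := HfE x hfb f2f g1f; have [tb22 eb22] := HfE x hfb f2f g2f.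
pose Phi1 z := HfI fa f1 g1 x z - HfI fb f1 g2 x z - HfI fb f2 g1 x z - HfI fa f2 g2 x z.
pose Phi2 z := HfI fb f1 g1 x z + HfI fa f1 g2 x z + HfI fa f2 g1 x z - HfI fb f2 g2 x z.
have u1 := tameB ta11 tb12; have u2 := tameB u1 tb21; have u3 := tameB u2 ta22.
have v1 := tameD tb11 ta12; have v2 := tameD v1 ta21; have v3 := tameB v2 tb22.
have i1 : Int X2 Phi1 = Hf fa f1 g1 x - Hf fb f1 g2 x - Hf fb f2 g1 x - Hf fa f2 g2 x.
  by rewrite /Phi1 (IntB u2 ta22) (IntB u1 tb21) (IntB ta11 tb12) -ea11 -eb12 -eb21 -ea22.
have i2 : Int X2 Phi2 = Hf fb f1 g1 x + Hf fa f1 g2 x + Hf fa f2 g1 x - Hf fb f2 g2 x.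
  by rewrite /Phi2 (IntB v2 tb22) (IntD v1 ta21) (IntD tb11 ta12) -eb11 -ea12 -ea21 -eb22.
have alg xi eta : cmul (cmul (a x xi eta) (cexpi (dot x (xi + eta)))) (cmul (fourier f xi) (fourier g eta)) =
    (Phi1 (xi, eta), Phi2 (xi, eta)).
  rewrite !fourierE; try exact: nice_tame (fast_nice _).
  rewrite /Phi1 /Phi2 /HfI /fa /fb /a1 /a2 /uncurry3 /Lz /tau /hh0 /hh1 /cexpi /cmul /= -/f1 -/f2 -/g1 -/g2.
  rewrite !addr0 -!sin_cos cosD cos_pihalf sin_pihalf mulr0 mulr1 sub0r.
  move: (cos _) (sin _) (a x xi eta) => c s [p q] /=.
  move: (Ft f1 0 xi) (Ft f1 (- (pi / 2)) xi) (Ft f2 0 xi) (Ft f2 (- (pi / 2)) xi) => A B C D.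
  move: (Ft g1 0 eta) (Ft g1 (- (pi / 2)) eta) (Ft g2 0 eta) (Ft g2 (- (pi / 2)) eta) => A' B' C' D'.
  by congr pair; ring.
rewrite /Tbil /CintRn /= -i1 -i2 -(Rint2 u3) -(Rint2 v3).
congr pair; congr RintRn; apply/funext => xi; congr RintRn; apply/funext => eta.
  exact: (congr1 fst (alg xi eta)).
exact: (congr1 snd (alg xi eta)).
Qed.
End ComplexOperator.

(** * Norms of complex functions, comparison of exponents and the final estimate *)

Section FinalEstimate.
Local Open Scope classical_set_scope.
Local Open Scope ring_scope.
Variables (R : realType) (n : nat).
Notation V := ('rV[R]_n).
Notation X1 := (Vw R n).

Lemma cabs_sum_le (z : cplx R) : cabs z <= `|z.1| + `|z.2|.
Proof.
rewrite -[leRHS]ger0_norm ?addr_ge0// -sqrtr_sqr; apply: ler_wsqrtr.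
have := normr_ge0 z.1; have := normr_ge0 z.2; rewrite -(real_normK (num_real z.1)) -(real_normK (num_real z.2)).
by move: `|z.1| `|z.2| => a b; nra.
Qed.

Lemma cabs_le8 (t : bool * bool * bool -> R) (z : cplx R) :
  z = (t (false, false, false) - t (true, false, true) - t (true, true, false) - t (false, true, true),
       t (true, false, false) + t (false, false, true) + t (false, true, false) - t (true, true, true)) ->
  cabs z <= \sum_i `|t i|.
Proof.
move=> ->; apply: (le_trans (cabs_sum_le _)) => /=.
have -> : \sum_i `|t i| = \sum_(s : bool) \sum_(b : bool) \sum_(c : bool) `|t (s, b, c)|.
  by rewrite pair_bigA /= pair_bigA /=; apply: eq_bigr => -[[s b] c] _.
rewrite !big_bool /=.
have tri (x1 x2 x3 x4 : R) : `|x1 - x2 - x3 - x4| <= `|x1| + `|x2| + `|x3| + `|x4|.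
  apply: (le_trans (ler_normB _ _)); rewrite lerD2r; apply: (le_trans (ler_normB _ _)); rewrite lerD2r; exact: ler_normB.
have tri' (x1 x2 x3 x4 : R) : `|x1 + x2 + x3 - x4| <= `|x1| + `|x2| + `|x3| + `|x4|.
  apply: (le_trans (ler_normB _ _)); rewrite lerD2r; apply: (le_trans (ler_normD _ _)); rewrite lerD2r; exact: ler_normD.
apply: (le_trans (lerD (tri _ _ _ _) (tri' _ _ _ _))).
by rewrite le_eqVlt; apply/orP; left; apply/eqP; ring.
Qed.

(** Each term is at most [S ^ (1 / r)], a bound that holds for all [r > 0]. *)
Lemma powR_sum (I : finType) (t : I -> R) r : 0 < r -> (forall i, 0 <= t i) ->
  powR (\sum_i t i) r <= powR #|I|%:R r * \sum_i powR (t i) r.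
Proof.
move=> r0 t0; set S := \sum_i powR (t i) r.
have S0 : 0 <= S by rewrite sumr_ge0// => i _; exact: powR_ge0.
have ht i : t i <= powR S r^-1.
  rewrite -[leLHS](powRr1 (t0 i)) -(@mulfV _ r) ?gt_eqF// powRrM.
  apply: powR_le_mono; rewrite ?powR_ge0 ?invr_ge0 ?(ltW r0)//.
  by rewrite /S (bigD1 i)//= lerDl sumr_ge0// => j _; exact: powR_ge0.
apply: (@le_trans _ _ (powR (#|I|%:R * powR S r^-1) r)).
  apply: powR_le_mono; [by apply: sumr_ge0|exact: ltW|].
  apply: (@le_trans _ _ (\sum_(i : I) powR S r^-1)); first by apply: ler_sum.
  by rewrite sumr_const mulr_natl.
by rewrite powRM ?powR_ge0// -powRrM mulVf ?gt_eqF// powRr1.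
Qed.

Lemma cabs_powR (z : cplx R) : cabs z = powR (z.1 ^+ 2 + z.2 ^+ 2) 2^-1.
Proof. by rewrite powR12_sqrt// addr_ge0 ?sqr_ge0. Qed.

Lemma meas_cabs (F : V -> cplx R) : meas X1 (fun x => (F x).1) -> meas X1 (fun x => (F x).2) -> meas X1 (fun x => cabs (F x)).
Proof.
move=> m1 m2; under eq_fun do rewrite cabs_powR.
by apply: meas_powR; apply: measD; exact: measX.
Qed.

(** Schwartz functions have finite norms, so the estimates can be run with a real number [v] that
    bounds the real and the imaginary part alike. *)
Lemma Lp_nrm q (f : V -> cplx R) : (1%:E <= q)%E -> schwartz f -> exists v, [/\ 0 <= v, Lpnorm q f = v%:E,
  nrm q (fun x => (f x).1) v & nrm q (fun x => (f x).2) v].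
Proof.
move=> q1 sf; have [h1 h2] := schwartz_fast2 sf.
have n1 := fast_nice h1; have n2 := fast_nice h2.
have n12 : nice (fun x => cabs (f x)).
  split.
    have : continuous (fun x => Num.sqrt ((f x).1 ^+ 2 + (f x).2 ^+ 2)); last by [].
    apply: (cont_comp (f := fun x => (f x).1 ^+ 2 + (f x).2 ^+ 2) (g := Num.sqrt)); last exact: sqrt_continuous.
    by apply: contD; apply: contX; [exact: n1.1|exact: n2.1].
  have [_ [C hC]] := n1; have [_ [D hD]] := n2; exists (C + D) => v.
  rewrite ger0_norm ?sqrtr_ge0//; apply: (le_trans (cabs_sum_le _)); rewrite mulrDl; exact: lerD.
have c0 x : 0 <= cabs (f x) by exact: sqrtr_ge0.
case: q q1 => [p||] p1; last by [].
  rewrite lee_fin in p1; have p0 : 0 < p by exact: lt_le_trans p1.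
  have tp := tame_Np p1 n12; set N := fun y => powR `|cabs (f y)| p in tp.
  have NE : (fun x => (powR (cabs (f x)) p)%:E) = fun x => (N x)%:E.
    by apply/funext => x; rewrite /N ger0_norm.
  have I0 : 0 <= Int X1 N by apply: Int_ge0 => x; exact: powR_ge0.
  exists (powR (Int X1 N) p^-1); split; first exact: powR_ge0.
  - rewrite /Lpnorm NE EintRnE; last 2 first.
    + exact: (measE tp.1).
    + by move=> x; rewrite lee_fin powR_ge0.
    by rewrite (EintE tp) poweR_EFin.
  - rewrite /nrm -powRrM mulVf ?gt_eqF// powRr1//; apply: (le_trans (ler_norm _)).
    apply: (norm_Int (tame_Np p1 n1).1 tp) => x; rewrite (ger0_norm (powR_ge0 _ _)).
    by apply: powR_le_mono; rewrite ?(ltW p0)// (ger0_norm (c0 x)); exact: (cabs_ge (f x)).1.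
  - rewrite /nrm -powRrM mulVf ?gt_eqF// powRr1//; apply: (le_trans (ler_norm _)).
    apply: (norm_Int (tame_Np p1 n2).1 tp) => x; rewrite (ger0_norm (powR_ge0 _ _)).
    by apply: powR_le_mono; rewrite ?(ltW p0)// (ger0_norm (c0 x)); exact: (cabs_ge (f x)).2.
set S := [set (cabs (f x))%:E | x in [set: V]].
have ub x : ((cabs (f x))%:E <= ereal_sup S)%E by apply: ereal_sup_ubound; exists x.
have [_ [C hC]] := n12.
have le : (ereal_sup S <= (`|C|)%:E)%E.
  apply: ge_ereal_sup => _ [x _ <-]; rewrite lee_fin -[leLHS](ger0_norm (c0 x)); apply: (le_trans (hC x)).
  apply: (@le_trans _ _ (`|C| * wt x ^+ 2)); first by rewrite ler_wpM2r ?exprn_ge0 ?wt_ge0 ?ler_norm.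
  by rewrite ler_piMr// exprn_ile1 ?wt_ge0 ?wt_le1.
have fS : ereal_sup S \is a fin_num.
  by rewrite ge0_fin_numE; [exact: le_lt_trans le (ltry _)|apply: le_trans (ub 0); rewrite lee_fin].
exists (fine (ereal_sup S)); split.
- by rewrite fine_ge0//; apply: le_trans (ub 0); rewrite lee_fin.
- by rewrite fineK.
- by move=> x; apply: (le_trans (cabs_ge (f x)).1); rewrite -lee_fin fineK.
- by move=> x; apply: (le_trans (cabs_ge (f x)).2); rewrite -lee_fin fineK.
Qed.

(** Here [x = 1/q1], [y = 1/q2] and [x + y = 1/r]. If both are at most [1/2], the left side is
    [max (1/2) (1 - 1/r)]. If only one exceeds [1/2], it is that one. If both do, it is
    [x + y - 1/2], the mean of [x] and [y] plus [(1/r - 1) / 2]. *)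
Lemma exponent_le (x y : R) : 0 <= x -> 0 <= y ->
  Num.max 2^-1 x + Num.max 2^-1 y - 2^-1 + Num.max 0 (2^-1 - (x + y)) <=
  Num.max (Num.max 2^-1 x) (Num.max y (1 - (x + y))) + 2^-1 * Num.max (x + y - 1) 0.
Proof.
move=> x0 y0.
set a := Num.max (Num.max 2^-1 x) _; set b := Num.max (x + y - 1) 0.
have a1 : 2^-1 <= a by rewrite !le_max lexx.
have a2 : x <= a by rewrite !le_max lexx !orbT.
have a3 : y <= a by rewrite !le_max lexx !orbT.
have a4 : 1 - (x + y) <= a by rewrite !le_max lexx !orbT.
have b1 : x + y - 1 <= b by rewrite le_max lexx.
have b2 : 0 <= b by rewrite le_max lexx orbT.
have h : (2^-1 : R) * 2 = 1 by rewrite mulVf.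
have [h1|h1] := leP 2^-1 x; have [h2|h2] := leP 2^-1 y; have [h3|h3] := leP 0 (2^-1 - (x + y)); lra.
Qed.

Lemma main_estimate (q1 q2 : \bar R) (r m rho delta : R) (a : V -> V -> V -> cplx R) :
  (1%:E <= q1)%E -> (1%:E <= q2)%E -> 0 < r -> r^-1 = inv_exp q1 + inv_exp q2 ->
  0 < rho -> rho <= 1 -> 0 <= delta -> delta <= rho -> symbol_class m rho delta a ->
  m + n%:R * (1 - rho) * ee q1 q2 r < 0 ->
  exists2 C, 0 <= C & forall f g, schwartz f -> schwartz g -> forall v1 v2, 0 <= v1 -> 0 <= v2 ->
    nrm q1 (fun x => (f x).1) v1 -> nrm q1 (fun x => (f x).2) v1 ->
    nrm q2 (fun x => (g x).1) v2 -> nrm q2 (fun x => (g x).2) v2 ->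
    (Lpnorm r%:E (Tbil a f g) <= (C * (v1 * v2))%:E)%E.
Proof.
move=> q11 q21 r0 hr rho0 rho1 d0 d1 ha hs.
(* Large enough to absorb the order [m] and [6 * n] derivatives in every piece. *)
pose M := (Num.truncn (`|m| + (6 * n)%:R)).+1.
have hM : `|m| + (6 * n)%:R <= (2 * M)%:R.
  apply: (@le_trans _ _ M%:R); first exact/ltW/truncnS_gt.
  by rewrite ler_nat leq_pmull.
have M0 : (0 < M)%N by [].
have [y1 y2] := symbol_sym ha.
(* [fs false] stands for the symbol [a] and [fs true] for [- i a]. *)
pose fs (s u : bool) v := if s then (if u then - uncurry3 (fun x y z => (a x y z).1) v else uncurry3 (fun x y z => (a x y z).2) v)
  else (if u then uncurry3 (fun x y z => (a x y z).2) v else uncurry3 (fun x y z => (a x y z).1) v).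
have hfs s u : sym m rho delta (fs s u) by case: s; case: u => //; exact: symN.
have [Ca Ca0 hCa] := @Hf_est R n m rho delta rho0 rho1 d0 d1 q1 q2 r q11 q21 r0 hr (fs false) M (hfs false) hM M0 hs.
have [Cb Cb0 hCb] := @Hf_est R n m rho delta rho0 rho1 d0 d1 q1 q2 r q11 q21 r0 hr (fs true) M (hfs true) hM M0 hs.
pose I := (bool * bool * bool)%type.
(* The first factor comes from [powR_sum] over the eight operators, the second from adding their
   eight bounds. *)
pose k0 : R := powR #|{: I}|%:R r * #|{: I}|%:R.
have k00 : 0 <= k0 by rewrite mulr_ge0 ?powR_ge0.
exists (powR k0 r^-1 * (Ca + Cb)); first by rewrite mulr_ge0 ?powR_ge0 ?addr_ge0.
move=> f g sf sg v1 v2 v10 v20 f1n f2n g1n g2n.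
have [f1f f2f] := schwartz_fast2 sf; have [g1f g2f] := schwartz_fast2 sg.
pose ff (b : bool) (x : V) := if b then (f x).2 else (f x).1.
pose gg (b : bool) (x : V) := if b then (g x).2 else (g x).1.
pose H (i : I) := Hf (fs i.1.1) (ff i.1.2) (gg i.2).
have vv : 0 <= v1 * v2 by exact: mulr_ge0.
have K0 : 0 <= (Ca + Cb) * (v1 * v2) by rewrite mulr_ge0 ?addr_ge0.
have hH i : meas X1 (H i) /\ (Eint X1 (fun x => (powR `|H i x| r)%:E) <= (powR ((Ca + Cb) * (v1 * v2)) r)%:E)%E.
  case: i => [[s b] c]; have fb : fast (ff b) by case: b.
  have gc : fast (gg c) by case: c.
  have nb : nrm q1 (ff b) v1 by case: b {fb}.
  have nc : nrm q2 (gg c) v2 by case: c {gc}.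
  case: s.
    have [mH hE] := hCb _ _ _ _ fb gc v10 v20 nb nc; split; first exact: mH.
    apply: (le_trans hE); rewrite lee_fin; apply: powR_le_mono; rewrite ?mulr_ge0 ?(ltW r0)//.
    by rewrite ler_wpM2r// lerDr.
  have [mH hE] := hCa _ _ _ _ fb gc v10 v20 nb nc; split; first exact: mH.
  apply: (le_trans hE); rewrite lee_fin; apply: powR_le_mono; rewrite ?mulr_ge0 ?(ltW r0)//.
  by rewrite ler_wpM2r// lerDl.
pose T := Tbil a f g.
have TE x : T x = (H (false, false, false) x - H (true, false, true) x - H (true, true, false) x - H (false, true, true) x,
    H (true, false, false) x + H (false, false, true) x + H (false, true, false) x - H (true, true, true) x).
  exact: (Tbil_Hf hM x ha sf sg).
have mH i := (hH i).1.
have meas_eq (A B : V -> R) : meas X1 B -> A =1 B -> meas X1 A by move=> mB /funext ->.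
have m1 : meas X1 (fun x => (T x).1).
  have mB := measB (measB (measB (mH (false, false, false)) (mH (true, false, true))) (mH (true, true, false))) (mH (false, true, true)).
  by apply: (meas_eq _ _ mB) => x; rewrite TE.
have m2 : meas X1 (fun x => (T x).2).
  have mB := measB (measD (measD (mH (true, false, false)) (mH (false, false, true))) (mH (false, true, false))) (mH (true, true, true)).
  by apply: (meas_eq _ _ mB) => x; rewrite TE.
have mT := meas_cabs m1 m2.
have mP : meas X1 (fun x => powR (cabs (T x)) r) by exact: meas_powR.
have cT x : cabs (T x) <= \sum_i `|H i x| by apply: (@cabs_le8 (fun i => H i x) (T x)); rewrite TE.
have n0 x : 0 <= powR (cabs (T x)) r by exact: powR_ge0.
have hE : (Eint X1 (fun x => (powR (cabs (T x)) r)%:E) <= (k0 * powR ((Ca + Cb) * (v1 * v2)) r)%:E)%E.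
  have mpi i := measE_powR r (hH i).1.
  have np i s : setT s -> (0 <= (powR `|H i (@ws_phi _ _ X1 s)| r)%:E)%E by move=> _; rewrite lee_fin powR_ge0.
  set c := powR #|{: I}|%:R r : R.
  apply: (@le_trans _ _ (\int[ws_mu X1]_s (c%:E * \sum_(i <- index_enum {: I}) (powR `|H i (ws_phi s)| r)%:E))%E).
    apply: ge0_le_integral; first exact: measurableT.
    - by move=> s _; rewrite lee_fin.
    - exact: (measE mP).
    - by apply: measurable_funeM; exact: emeasurable_sum.
    - move=> s _; rewrite sumEFin -EFinM lee_fin.
      apply: (@le_trans _ _ (powR (\sum_i `|H i (ws_phi s)|) r)).
        by apply: powR_le_mono; [exact: sqrtr_ge0|exact: ltW|exact: cT].
      by apply: powR_sum => // i.
  have c0 : (0 <= c%:E)%E by rewrite lee_fin powR_ge0.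
  have ns s : setT s -> (0 <= \sum_(i <- index_enum {: I}) (powR `|H i (@ws_phi _ _ X1 s)| r)%:E)%E.
    by move=> Ts; apply: sume_ge0 => i _; exact: np.
  rewrite (ge0_integralZl (ws_mu X1) measurableT (emeasurable_sum (index_enum {: I}) mpi) ns c0).
  rewrite (ge0_integral_sum (ws_mu X1) measurableT mpi np) /k0 -mulrA EFinM; apply: lee_wpmul2l => //.
  apply: (@le_trans _ _ (\sum_(i <- index_enum {: I}) (powR ((Ca + Cb) * (v1 * v2)) r)%:E)%E).
    by apply: lee_sum => i _; exact: (hH i).2.
  by rewrite sumEFin lee_fin sumr_const mulr_natl.
rewrite /Lpnorm EintRnE; last 2 first.
- exact: (measE mP).
- by move=> x; rewrite lee_fin.
have E0 : (0 <= Eint X1 (fun x => (powR (cabs (T x)) r)%:E))%E by apply: integral_ge0 => s _; rewrite lee_fin.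
have ri : 0 <= r^-1 by rewrite invr_ge0 ltW.
have h0 : 0 <= k0 * powR ((Ca + Cb) * (v1 * v2)) r by rewrite mulr_ge0 ?powR_ge0.
have b1 : Eint X1 (fun x => (powR (cabs (T x)) r)%:E) \in `[0%E, +oo%E] by rewrite in_itv /= E0 leey.
have b2 : (k0 * powR ((Ca + Cb) * (v1 * v2)) r)%:E \in `[0%E, +oo%E] by rewrite in_itv /= lee_fin h0 leey.
apply: (le_trans (gt0_ler_poweR ri b1 b2 hE)).
by rewrite poweR_EFin lee_fin (powRM _ k00 (powR_ge0 _ _)) -(powRrM _ r) mulfV ?gt_eqF// (powRr1 K0) -(mulrA _ (Ca + Cb)).
Qed.
End FinalEstimate.

Local Open Scope ring_scope.

Theorem theorem5p19 (R : realType) (n : nat) (q1 q2 : \bar R) (r : R)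
  (m rho delta : R) (a : 'rV[R]_n -> 'rV[R]_n -> 'rV[R]_n -> cplx R) :
  (1%:E <= q1)%E -> (1%:E <= q2)%E -> 0 < r ->
  r^-1 = inv_exp q1 + inv_exp q2 ->
  0 < rho -> rho <= 1 -> 0 <= delta -> delta <= rho -> delta < 1 ->
  symbol_class m rho delta a ->
  m < n%:R * (rho - 1) *
        (Num.max (Num.max (2^-1) (inv_exp q1)) (Num.max (inv_exp q2) (1 - r^-1))
         + 2^-1 * Num.max (r^-1 - 1) 0) ->
  exists C : R, 0 < C /\
    forall f g : 'rV[R]_n -> cplx R, schwartz f -> schwartz g ->
      (Lpnorm r%:E (Tbil a f g) <= C%:E * Lpnorm q1 f * Lpnorm q2 g)%E.
Proof.
move=> q11 q21 r0 hr rho0 rho1 d0 d1 _ ha hm.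
have [i10 _] := inv_exp01 q11; have [i20 _] := inv_exp01 q21.
(* The bound on [m] and [exponent_le] make the exponent of [2 ^ j] in the pieces negative. *)
have hs : m + n%:R * (1 - rho) * ee q1 q2 r < 0.
  have p0 : 0 <= n%:R * (1 - rho) by rewrite mulr_ge0 ?subr_ge0.
  have h := ler_wpM2l p0 (exponent_le i10 i20); rewrite -hr in h.
  rewrite /ee /sg; apply: (le_lt_trans (lerD (lexx m) h)); rewrite -ltrBrDr sub0r.
  by apply: (lt_le_trans hm); rewrite le_eqVlt; apply/orP; left; apply/eqP; ring.
have [C C0 hC] := main_estimate q11 q21 r0 hr rho0 rho1 d0 d1 ha hs.
(* [C] may be 0, while a positive constant is required. *)
exists (C + 1); split; first by rewrite ltr_wpDl.
move=> f g sf sg.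
have [v1 [v10 e1 a1 a2]] := Lp_nrm q11 sf; have [v2 [v20 e2 b1 b2]] := Lp_nrm q21 sg.
rewrite e1 e2 -!EFinM; apply: (le_trans (hC f g sf sg v1 v2 v10 v20 a1 a2 b1 b2)).
by rewrite lee_fin -mulrA ler_wpM2r ?mulr_ge0// lerDl.
Qed.
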